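(* Let $\nu>0$ and $\lambda_+,\lambda_-,\lambda_0>0$, and let $m\in\mathbb{Z}$. For every $\rho\in(0,(4C_{\mathrm{GN}})^{-1})$ there exists $(\varphi_{+,m},\varphi_{-,m+1})\in\mathcal{H}_m$ such that $$E_m(\varphi_{+,m},\varphi_{-,m+1})=\mathcal{E}_m(\rho)\quad\text{and}\quad M_m(\varphi_{+,m},\varphi_{-,m+1})=\rho .$$
   Context: Functions are complex valued; $z=(x,y)\in\mathbb{R}^2$, $(r,\theta)$ are polar coordinates of $(x,y)$, and $D^{\pm}=\partial_x\pm i\partial_y$. For $(u_+,u_-)\in H^1(\mathbb{R}^2)\times H^1(\mathbb{R}^2)$ define $$E(u_+,u_-)=\frac14\int_{\mathbb{R}^2}\left(|D^+u_+|^2+|D^-u_-|^2\right)dz+\frac{\nu}{2}\operatorname{Re}\int_{\mathbb{R}^2}\left(\overline{u_+}D^-u_--\overline{u_-}D^+u_+\right)dz-N(u_+,u_-),$$ $$N(u_+,u_-)=\frac14\int_{\mathbb{R}^2}\left(\lambda_+|u_+|^4+\lambda_-|u_-|^4+2\lambda_0|u_+|^2|u_-|^2\right)dz,\qquad M(u_+,u_-)=\|u_+\|_{L^2}^2+\|u_-\|_{L^2}^2 .$$ $C_{\mathrm{GN}}$ is the best (smallest) constant in the Gagliardo--Nirenberg inequality $N(u_+,u_-)\le C_{\mathrm{GN}}\,M(u_+,u_-)\,\|(u_+,u_-)\|_{\dot H^1\times\dot H^1}^2$ for all $(u_+,u_-)\in H^1(\mathbb{R}^2)\times H^1(\mathbb{R}^2)$,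 where $\|(u_+,u_-)\|_{\dot H^1\times\dot H^1}^2=\|\nabla u_+\|_{L^2}^2+\|\nabla u_-\|_{L^2}^2$. For $l\in\mathbb{Z}$, $H_l$ is the Hilbert space of measurable $f:[0,\infty)\to\mathbb{C}$ such that $f$, $f'$ and $\frac{l}{r}f$ belong to $L^2((0,\infty);r\,dr)$, with inner product $\operatorname{Re}\int_0^\infty(f'\overline{g'}+\frac{l^2}{r^2}f\overline g+f\overline g)\,r\,dr$. Set $\mathcal{H}_m=H_m\times H_{m+1}$; thus $(v_+,v_-)\in\mathcal{H}_m$ means that $(e^{im\theta}v_+(r),e^{i(m+1)\theta}v_-(r))\in H^1(\mathbb{R}^2)\times H^1(\mathbb{R}^2)$. For $(v_+,v_-)\in\mathcal{H}_m$ put $$E_m(v_+,v_-)=E(e^{im\theta}v_+(r),e^{i(m+1)\theta}v_-(r)),\qquad M_m(v_+,v_-)=M(e^{im\theta}v_+(r),e^{i(m+1)\theta}v_-(r)),$$ and for $\rho>0$ $$\mathcal{E}_m(\rho)=\inf\{E_m(v_+,v_-) : (v_+,v_-)\in\mathcal{H}_m,\ M_m(v_+,v_-)=\rho\}.$$ *)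

(* Defs.v *)
From HB Require Import structures.
From mathcomp Require Import all_boot all_order all_algebra.
From mathcomp Require Import complex.
From mathcomp Require Import all_classical all_reals all_analysis.

Set Implicit Arguments.
Unset Strict Implicit.
Unset Printing Implicit Defensive.

Import Order.TTheory GRing.Theory Num.Theory.
Import numFieldNormedType.Exports.
Import ComplexField.Normc.

Local Open Scope classical_set_scope.
Local Open Scope complex_scope.
Local Open Scope ring_scope.

(* Complex-valued functions on the plane are functions R * R -> R[i]; all
   integrals are extended-real integrals of real-valued expressions, so that a
   divergent nonnegative integral is +oo.  Functions are representatives, not
   classes modulo equality almost everywhere; measurable means Borel. *)

Local Notation leb2 R := (@lebesgue_measure R \x @lebesgue_measure R)%E.

Definition cmeasurable d (T : measurableType d) (R : realType) (D : set T)
    (f : T -> R[i]) : Prop :=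
  measurable_fun D (fun z => complex.Re (f z) : measurableTypeR R) /\
  measurable_fun D (fun z => complex.Im (f z) : measurableTypeR R).

Definition L2plane (R : realType) (f : R * R -> R[i]) : Prop :=
  @cmeasurable _ (measurableTypeR R * measurableTypeR R)%type R setT f /\
  (\int[leb2 R]_z (normc (f z) ^+ 2)%:E < +oo)%E.

Definition axis (R : realType) (b : bool) : R * R :=
  if b then (0, 1) else (1, 0).

Definition partials (R : realType) (s : seq bool) (phi : R * R -> R) :
    R * R -> R :=
  foldr (fun b g z => 'D_(axis R b) g z) phi s.

(* phi \in C_c^oo(R^2) *)
Definition test_plane (R : realType) (phi : R * R -> R) : Prop :=
  (forall s : seq bool, continuous (partials s phi) /\
     forall z b, derivable (partials s phi) z (axis R b)) /\
  compact (closure [set z | phi z != 0]).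

(* g is the distributional partial derivative of f; real-valued test functions
   suffice by linearity. *)
Definition weak_partial (R : realType) (b : bool) (f g : R * R -> R[i]) :
    Prop :=
  forall phi : R * R -> R, test_plane phi ->
    (\int[leb2 R]_z (complex.Re (f z) * 'D_(axis R b) phi z)%:E =
       - \int[leb2 R]_z (complex.Re (g z) * phi z)%:E)%E /\
    (\int[leb2 R]_z (complex.Im (f z) * 'D_(axis R b) phi z)%:E =
       - \int[leb2 R]_z (complex.Im (g z) * phi z)%:E)%E.

Definition H1 (R : realType) (f : R * R -> R[i]) : Prop :=
  L2plane f /\
  forall b, exists g : R * R -> R[i], L2plane g /\ weak_partial b f g.

(* A representative of the weak partial derivative, unique up to null sets
   when f belongs to H1 (false: in x, true: in y). *)
Definition wD (R : realType) (b : bool) (f : R * R -> R[i]) :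
    R * R -> R[i] :=
  xget (fun=> 0) [set g | L2plane g /\ weak_partial b f g].

Definition Dplus (R : realType) (f : R * R -> R[i]) (z : R * R) : R[i] :=
  wD false f z + 'i%C * wD true f z.

Definition Dminus (R : realType) (f : R * R -> R[i]) (z : R * R) : R[i] :=
  wD false f z - 'i%C * wD true f z.

Definition mass (R : realType) (up um : R * R -> R[i]) : \bar R :=
  (\int[leb2 R]_z (normc (up z) ^+ 2)%:E +
   \int[leb2 R]_z (normc (um z) ^+ 2)%:E)%E.

Definition grad2 (R : realType) (f : R * R -> R[i]) : \bar R :=
  (\int[leb2 R]_z
     (normc (wD false f z) ^+ 2 + normc (wD true f z) ^+ 2)%:E)%E.

Definition nonlin (R : realType) (lp lm l0 : R) (up um : R * R -> R[i]) :
    \bar R :=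
  ((4^-1)%:E * \int[leb2 R]_z
     (lp * normc (up z) ^+ 4 + lm * normc (um z) ^+ 4 +
      2 * l0 * normc (up z) ^+ 2 * normc (um z) ^+ 2)%:E)%E.

Definition energy (R : realType) (nu lp lm l0 : R) (up um : R * R -> R[i]) :
    \bar R :=
  ((4^-1)%:E * \int[leb2 R]_z
      (normc (Dplus up z) ^+ 2 + normc (Dminus um z) ^+ 2)%:E +
   (nu / 2)%:E * \int[leb2 R]_z
      (complex.Re ((up z)^*%C * Dminus um z - (um z)^*%C * Dplus up z))%:E -
   nonlin lp lm l0 up um)%E.

Definition C_GN (R : realType) (lp lm l0 : R) : R :=
  inf [set C : R | forall up um : R * R -> R[i], H1 up -> H1 um ->
    (nonlin lp lm l0 up um <=
       C%:E * mass up um * (grad2 up + grad2 um))%E].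

Definition L2radial (R : realType) (f : R -> R[i]) : Prop :=
  @cmeasurable _ (measurableTypeR R) R `]0, +oo[ f /\
  (\int[@lebesgue_measure R]_(r in `]0%R, +oo[)
     (normc (f r) ^+ 2 * r)%:E < +oo)%E.

(* phi \in C_c^oo((0, +oo)), extended by 0 *)
Definition test_halfline (R : realType) (phi : R -> R) : Prop :=
  [/\ forall n x, derivable (derive1n n phi) x 1,
      compact (closure [set x | phi x != 0]) &
      closure [set x | phi x != 0] `<=` `]0, +oo[].

Definition weak_deriv (R : realType) (f g : R -> R[i]) : Prop :=
  forall phi : R -> R, test_halfline phi ->
    (\int[@lebesgue_measure R]_(r in `]0%R, +oo[) (complex.Re (f r) * derive1 phi r)%:E =
       - \int[@lebesgue_measure R]_(r in `]0%R, +oo[)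
           (complex.Re (g r) * phi r)%:E)%E /\
    (\int[@lebesgue_measure R]_(r in `]0%R, +oo[) (complex.Im (f r) * derive1 phi r)%:E =
       - \int[@lebesgue_measure R]_(r in `]0%R, +oo[)
           (complex.Im (g r) * phi r)%:E)%E.

(* The space H_l; only the values of f on [0, +oo) matter. *)
Definition Hrad (R : realType) (l : int) (f : R -> R[i]) : Prop :=
  [/\ L2radial f,
      L2radial (fun r => (l%:~R / r)%:C * f r) &
      exists g : R -> R[i], L2radial g /\ weak_deriv f g].

Definition Hpair (R : realType) (m : int) (vp vm : R -> R[i]) : Prop :=
  Hrad m vp /\ Hrad (m + 1) vm.

Definition radius (R : realType) (z : R * R) : R :=
  Num.sqrt (z.1 ^+ 2 + z.2 ^+ 2).

(* e^{i l theta} v(r), using e^{i theta} = (x + i y) / r off the origin *)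
Definition angular_lift (R : realType) (l : int) (v : R -> R[i]) (z : R * R) :
    R[i] :=
  ((z.1 +i* z.2) / (radius z)%:C) ^ l * v (radius z).

Definition energy_m (R : realType) (nu lp lm l0 : R) (m : int)
    (vp vm : R -> R[i]) : \bar R :=
  energy nu lp lm l0 (angular_lift m vp) (angular_lift (m + 1) vm).

Definition mass_m (R : realType) (m : int) (vp vm : R -> R[i]) : \bar R :=
  mass (angular_lift m vp) (angular_lift (m + 1) vm).

Definition min_energy_m (R : realType) (nu lp lm l0 : R) (m : int) (rho : R) :
    \bar R :=
  ereal_inf [set energy_m nu lp lm l0 m v.1 v.2 | v in
    [set v : (R -> R[i]) * (R -> R[i]) |
      Hpair m v.1 v.2 /\ mass_m m v.1 v.2 = rho%:E]].

(* Main.v *)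
Require Import Defs.
From HB Require Import structures.
From mathcomp Require Import all_boot all_order all_algebra.
From mathcomp Require Import complex.
From mathcomp Require Import all_classical all_reals all_analysis.
From mathcomp Require Import measurable_realfun.
From mathcomp Require Import ring lra.

Set Implicit Arguments.
Unset Strict Implicit.
Unset Printing Implicit Defensive.

Import Order.TTheory GRing.Theory Num.Theory.
Import numFieldNormedType.Exports.
Import ComplexField.Normc.

Local Open Scope classical_set_scope.
Local Open Scope complex_scope.
Local Open Scope ring_scope.
Local Notation radius := Defs.radius.

(** Completing the square gives E = Q / 4 - nu^2 / 4 * M - N, where Q is the squared
    L^2 norm of (D^- u_- + nu u_+, D^+ u_+ - nu u_-), so at fixed mass it suffices to
    minimize the reduced energy J = Q / 4 - N.  On a fixed angular mode every quantity is
    a one-dimensional integral against r dr.  There the cross terms of |D^+- u|^2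
    integrate to zero, and the Gagliardo-Nirenberg inequality with 4 C rho < 1 makes J
    coercive in the gradient norm.  The one-dimensional estimate r |f|^2 <= C makes N
    continuous along minimizing sequences, and Q is weakly lower semicontinuous, so a
    weak limit phi satisfies J(phi) <= inf J and M(phi) <= rho.  It remains to recover
    the mass.  The functions (J_m(nu r), J_(m+1)(nu r)) annihilate Q and decay like
    r^(-1/2); cutting them off at radius L shows inf J < 0.  Hence phi is nonzero, and
    for t^2 = rho / M(phi) >= 1 one gets J(t phi) <= t^2 J(phi) <= J(phi) <= inf J. *)

(** The definitions shape the proof: derivatives are distributional and chosen by [xget], and
    profiles are measurable representatives. Each profile is therefore first replaced by its locally
    absolutely continuous representative, whose lift is absolutely continuous on almost every line,
    so that weak derivatives can be read off in polar form. From then on a competitor is four real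
    functions on the half-line with their derivatives.

    The threshold: Young's inequality bounds Q below by (1 - e) times the squared gradient norm, up
    to a multiple of the mass, while N is at most C rho times that norm; a positive multiple
    survives for small e exactly when 4 C rho < 1.

    Strict negativity of inf J is delicate because the mass is prescribed, so the quartic term
    cannot be made dominant by a large amplitude. After normalizing the mass to rho, J < 0 amounts
    to Q M < 4 rho N for the unnormalized mode. Decay like r^(-1/2) keeps Q M bounded in L, while
    |u|^4 r behaves like 1 / r; a logarithm thus decides, however small rho is. *)

Lemma ae_imp d (T : measurableType d) (R : realType)
    (m : {measure set T -> \bar R}) (P Q : T -> Prop) :
  (forall x, P x -> Q x) -> {ae m, forall x, P x} -> {ae m, forall x, Q x}.
Proof. by move=> PQ; exact: filterS. Qed.

(** * Measure-theoretic preliminaries *)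

Section density.
Context d (T : measurableType d) (R : realType).
Variable mu : {measure set T -> \bar R}.
Local Open Scope ereal_scope.

(** The two proofs are arguments so that the measure structure can be attached to the term
    [density mh h0]. *)
Definition density (h : T -> R) (mh : measurable_fun [set: T] h)
  (h0 : forall x, (0 <= h x)%R) (A : set T) := \int[mu]_(x in A) (h x)%:E.

Variables (h : T -> R) (mh : measurable_fun [set: T] h).
Variable h0 : forall x, (0 <= h x)%R.

Let density0 : density mh h0 set0 = 0.
Proof. by rewrite /density integral_set0. Qed.

Let density_ge0 A : 0 <= density mh h0 A.
Proof. by apply: integral_ge0 => x _; rewrite lee_fin. Qed.

Let density_sadd : semi_sigma_additive (density mh h0).
Proof.
apply: semi_sigma_additive_nng_induced; first exact/measurable_EFinP.
by move=> x; rewrite lee_fin.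
Qed.

HB.instance Definition _ :=
  isMeasure.Build _ _ _ (density mh h0) density0 density_ge0 density_sadd.

Import HBNNSimple.

Let integral_density_nnsfun D (g : {nnsfun T >-> R}) : measurable D ->
  \int[density mh h0]_(x in D) (g x)%:E = \int[mu]_(x in D) ((g x)%:E * (h x)%:E).
Proof.
move=> mD.
have mhD : measurable_fun D h by exact: measurable_funTS.
under [LHS]eq_integral do rewrite fimfunE -fsumEFin//.
rewrite [LHS]ge0_integral_fsum//; last 2 first.
- by move=> r; exact/measurable_EFinP/measurableT_comp.
- by move=> n x _; rewrite EFinM nnfun_muleindic_ge0.
transitivity (\sum_(k \in range g)
    \int[mu]_(x in D) ((k * \1_(g @^-1` [set k]) x)%:E * (h x)%:E)).
  apply: eq_fsbigr => r _; rewrite integralZl_indic_nnsfun// integral_indic//=.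
  have [r0|r0] := ltP r 0%R.
    rewrite preimage_nnfun0//= set0I measure0 mule0 integral0_eq// => x _.
    by rewrite indic0 mulr0 mul0e.
  under [RHS]eq_integral do rewrite EFinM -muleA.
  rewrite ge0_integralZl//; first last.
  - by move=> x _; rewrite -EFinM lee_fin mulr_ge0.
  - apply: emeasurable_funM; first exact/measurable_EFinP.
    exact/measurable_EFinP.
  congr (_ * _); rewrite /density/= setIC integral_mkcondr.
  apply: eq_integral => x _; rewrite patchE indicE.
  by case: ifPn => xg; rewrite ?mul1e ?mul0e.
rewrite -ge0_integral_fsum//.
- apply: eq_integral => x _; rewrite -ge0_mule_fsuml.
    by rewrite fsumEFin// -fimfunE.
  by move=> r; rewrite EFinM nnfun_muleindic_ge0.
- move=> r; apply: emeasurable_funM; last exact/measurable_EFinP.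
  by apply/measurable_EFinP/measurable_funM.
- move=> r x _; apply: mule_ge0; last by rewrite lee_fin.
  by rewrite EFinM nnfun_muleindic_ge0.
Qed.

(** Monotone convergence from simple functions, for which the identity is the definition of
    [density] extended by linearity. *)
Lemma ge0_integral_density D (f : T -> \bar R) :
  measurable D -> measurable_fun D f -> (forall x, D x -> 0 <= f x) ->
  \int[density mh h0]_(x in D) f x = \int[mu]_(x in D) (f x * (h x)%:E).
Proof.
move=> mD mf f0.
have mhD : measurable_fun D h by exact: measurable_funTS.
pose f_ := nnsfun_approx mD mf.
transitivity (limn (fun n => \int[density mh h0]_(x in D) (f_ n x)%:E)).
  rewrite -monotone_convergence//.
  - apply: eq_integral => y /[!inE] yD; apply/esym/cvg_lim => //.
    exact: cvg_nnsfun_approx.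
  - by move=> n; exact/measurable_EFinP/measurable_funTS.
  - by move=> n y _; rewrite lee_fin.
  - by move=> y _ m n mn; rewrite lee_fin; exact/lefP/nd_nnsfun_approx.
rewrite [X in limn X](_ : _ =
    (fun n => \int[mu]_(x in D) ((f_ n x)%:E * (h x)%:E))); last first.
  by apply/funext => n; exact: integral_density_nnsfun.
rewrite -monotone_convergence//; last 3 first.
- move=> n; apply: emeasurable_funM; last exact/measurable_EFinP.
  exact/measurable_EFinP/measurable_funTS.
- by move=> n y _; apply: mule_ge0; rewrite lee_fin.
- move=> y _ m n mn; apply: lee_wpmul2r; first by rewrite lee_fin.
  by rewrite lee_fin; exact/lefP/nd_nnsfun_approx.
apply: eq_integral => y /[!inE] yD; apply/cvg_lim => //.
by apply: cvgeZr => //; exact: cvg_nnsfun_approx.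
Qed.

End density.

(* A signed function whose integral vanishes on a generating pi-system is null:
   its positive and negative parts are the densities of the same measure. *)
Lemma ae_eq0_pi_system d (T : measurableType d) (R : realType)
    (mu : {measure set T -> \bar R}) (G : set (set T)) (g : (set T)^nat)
    (f : T -> R) :
  @measurable _ T = <<s G >> -> setI_closed G ->
  (forall i, G (g i)) -> \bigcup_k g k = setT ->
  measurable_fun [set: T] f ->
  (forall i, mu.-integrable (g i) (EFin \o f)) ->
  (forall A, G A -> mu.-integrable A (EFin \o f)) ->
  (forall A, G A -> (\int[mu]_(x in A) (f x)%:E = 0)%E) ->
  {ae mu, forall x, f x = 0}.
Proof.
move=> mG GI Gg gT mf intg intG f0.
have mp : measurable_fun [set: T] (f ^\+)%R by exact: measurable_funrpos.
have mn : measurable_fun [set: T] (f ^\-)%R by exact: measurable_funrneg.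
have p0 x : 0 <= (f ^\+)%R x by exact: funrpos_ge0.
have n0 x : 0 <= (f ^\-)%R x by exact: funrneg_ge0.
have mgE A : G A -> measurable A by move=> GA; rewrite mG; exact: sub_gen_smallest.
have pn A : measurable A -> density mu mp p0 A = density mu mn n0 A.
  move=> mA; apply: (measure_unique G g) => //.
  - move=> B GB; rewrite /= /density.
    have iB := intG _ GB; have mB := mgE _ GB.
    have := f0 _ GB; rewrite integralE => /eqP.
    rewrite funerpos funerneg sube_eq ?add0e//.
    + by move=> /eqP.
    + by have := integrable_pos_fin_num mB iB; rewrite funerpos.
  - move=> k; have := integral_funepos_lt_pinfty (mgE _ (Gg k)) (intg k).
    by rewrite funerpos.
have main (A : set T) (h : T -> R) (mh : measurable_fun setT h)
    (h0 : forall x, 0 <= h x) : measurable A -> density mu mh h0 A = 0%E ->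
    {ae mu, forall x, A x -> h x = 0}.
  move=> mA; rewrite /density => hA.
  have /(ae_eq_integral_abs mu mA) : measurable_fun A (EFin \o h).
    by apply/measurable_EFinP; exact: measurable_funTS.
  move=> [+ _]; have -> : (\int[mu]_(x in A) `|(EFin \o h) x| = 0)%E.
    by rewrite -hA; apply: eq_integral => x _; rewrite /= ger0_norm.
  by move=> /(_ erefl); apply: filterS => x /= + Ax => /(_ Ax) [].
(* The negative part vanishes on [P], so both densities give [P] measure zero and the positive part
   vanishes almost everywhere on [P]; symmetrically for the negative part off [P]. *)
pose P := [set x | 0 < f x].
have mP : measurable P.
  by rewrite -[P]setTI; apply: measurable_fun_ltr => //; exact: measurable_cst.
have nP : density mu mn n0 P = 0%E.
  apply: integral0_eq => x /= fx; congr EFin.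
  by rewrite /funrneg; apply/max_idPr; rewrite oppr_le0 ltW.
have pN : density mu mp p0 (~` P) = 0%E.
  apply: integral0_eq => x /= /negP; rewrite -leNgt => fx; congr EFin.
  by rewrite /funrpos; apply/max_idPr.
have pP := main _ _ mp p0 mP (etrans (pn _ mP) nP).
have mN : measurable (~` P) by exact: measurableC.
have nN := main _ _ mn n0 mN (etrans (esym (pn _ mN)) pN).
apply: filterS2 pP nN => x px nx.
have [fx|fx] := ltP 0 (f x).
  by have := px fx; rewrite /funrpos; move/max_idPl: (ltW fx) => ->.
have : (~` P) x by rewrite /P /= => /lt_geF; rewrite fx.
move=> /nx; rewrite /funrneg; move: (fx); rewrite -oppr_ge0 => /max_idPl ->.
by move=> /eqP; rewrite oppr_eq0 => /eqP.
Qed.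

(** * Half-open boxes as generators of the Borel sets *)

Section real_boxes.
Variable R : realType.
Local Notation mu := (@lebesgue_measure R).
Local Notation mR := (measurableTypeR R).

(** Half-open, so that every box is itself a member of the generating family [ocitv]. *)
Definition box (n : nat) : set R := `](- n%:R), n%:R].

Lemma box_cover : \bigcup_n box n = [set: R].
Proof.
apply/seteqP; split => // x _; exists (Num.trunc `|x|).+1 => //=.
rewrite /box /= in_itv/=.
by have := Num.Theory.truncnS_gt `|x|; rewrite ltr_norml => /andP[-> /ltW ->].
Qed.

Definition boxes : set (set (R * R)) := [set A `*` B | A in @ocitv R & B in @ocitv R].

(** The sets whose strip over the other axis lies in the generated sigma-algebra form a
    sigma-algebra themselves, and it contains the half-open intervals because the other axis is a
    countable union of them. A rectangle is the intersection of two strips. *)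
Lemma measurable_prod_boxes : @measurable _ (mR * mR)%type = <<s boxes >>.
Proof.
rewrite measurable_prod_measurableType; apply/seteqP; split; last first.
  apply: smallest_sub; first exact: smallest_sigma_algebra.
  move=> _ [A oA] [B oB] <-; apply: sub_gen_smallest.
  by exists A; [exact: sub_sigma_algebra|exists B => //; exact: sub_sigma_algebra].
have saB : sigma_algebra setT <<s boxes >> by exact: smallest_sigma_algebra.
have mI (A B : set (R * R)) : <<s boxes >> A -> <<s boxes >> B -> <<s boxes >> (A `&` B).
  move=> mA mB.
  have := @measurableI _ (g_sigma_algebraType boxes) A B.
  exact.
have mU (F : nat -> set (R * R)) : (forall n, <<s boxes >> (F n)) -> <<s boxes >> (\bigcup_n F n).
  by move=> mF; exact: (@bigcupT_measurable _ (g_sigma_algebraType boxes)).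
have mC (A : set (R * R)) : <<s boxes >> A -> <<s boxes >> (~` A).
  by move=> mA; exact: (@measurableC _ (g_sigma_algebraType boxes)).
have H1 (A : set mR) : measurable A -> <<s boxes >> (A `*` setT).
  apply: (@smallest_sub _ _ _ [set A | <<s boxes >> (A `*` [set: R])]) => //=.
    split => /=.
    - by rewrite set0X; case: saB.
    - by move=> B; rewrite setTD !setXT preimage_setC; exact: mC.
    - move=> F mF; rewrite setXT preimage_bigcup; apply: mU => n.
      by rewrite -setXT.
  move=> B oB /=.
  rewrite -box_cover setX_bigcupr; apply: mU => n; apply: sub_gen_smallest.
  by exists B => //; exists (box n) => //; exact: is_ocitv.
have H2 (A : set mR) : measurable A -> <<s boxes >> (setT `*` A).
  apply: (@smallest_sub _ _ _ [set A | <<s boxes >> ([set: R] `*` A)]) => //=.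
    split => /=.
    - by rewrite setX0; case: saB.
    - by move=> B; rewrite setTD !setTX preimage_setC; exact: mC.
    - move=> F mF; rewrite setTX preimage_bigcup; apply: mU => n.
      by rewrite -setTX.
  move=> B oB /=.
  rewrite -box_cover setX_bigcupl; apply: mU => n; apply: sub_gen_smallest.
  by exists (box n); [exact: is_ocitv|exists B].
apply: smallest_sub => //.
move=> _ [A mA [B mB <-]].
by rewrite -(setIT A) -(setTI B) setXI; apply: mI; [exact: H1|exact: H2].
Qed.
End real_boxes.

(** * Polar integration and substitution along lines *)

Section radial.
Variable R : realType.
Local Notation mu := (@lebesgue_measure R).
Local Notation mR := (measurableTypeR R).
Local Notation leb2 := (mu \x mu)%E.

(** The push-forward of [m] and the measure with density [h] agree on open half-lines, a pi-system
    exhausted by members of finite measure, hence everywhere. This serves both polar coordinates,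
    with [Phi] the radius, and the substitution [s = hypot y x] along a line. *)
Lemma ge0_integral_distribution d (X : measurableType d)
    (m : {measure set X -> \bar R}) (Phi : X -> R) (h : R -> R) (f : R -> \bar R) :
  measurable_fun [set: X] Phi -> measurable_fun [set: R] h ->
  (forall x, 0 <= h x) ->
  (forall t, m (Phi @^-1` `]-oo, t[) = \int[mu]_(y in `]-oo, t[) (h y)%:E)%E ->
  (forall t, m (Phi @^-1` `]-oo, t[) < +oo)%E ->
  measurable_fun [set: R] f -> (forall y, 0 <= f y)%E ->
  (\int[m]_x f (Phi x) = \int[mu]_y (f y * (h y)%:E))%E.
Proof.
move=> mPhi mh h0 mE mfin mf f0.
transitivity (\int[pushforward m (Phi : X -> mR)]_y f y)%E.
  by rewrite (@ge0_integral_pushforward _ _ _ mR).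
rewrite -(ge0_integral_density mu mh h0)//.
apply: eq_measure_integral => A mA _.
apply: (@measure_unique _ R mR (@RGenInftyO.G R) (fun n : nat => `]-oo, n%:R[%classic)
  _ _ _ _ (pushforward m (Phi : X -> mR)) (density mu mh h0)) => //.
- exact: (@RGenInftyO.measurableE R).
- move=> _ _ [x ->] [y ->]; exists (Num.min x y).
  by apply/seteqP; split => z /=; rewrite !in_itv/= lt_min => /andP.
- by move=> n; exists n%:R.
- apply/seteqP; split => // x _; exists (Num.trunc `|x|).+1 => //=.
  by rewrite in_itv/= (le_lt_trans (ler_norm x))// truncnS_gt.
- by move=> _ [t ->]; exact: mE.
- by move=> n; exact: mfin.
Qed.

Lemma FTC2 (F f : R -> R) (a b : R) : a <= b ->
  (forall x, a <= x <= b -> is_derive x (1 : R) F (f x)) ->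
  (forall x, a <= x <= b -> {for x, continuous f}) ->
  (\int[mu]_(x in `[a, b]) (f x)%:E = (F b - F a)%:E)%E.
Proof.
rewrite le_eqVlt => /predU1P[-> _ _|ab dF cf].
  by rewrite set_itv1 integral_set1 subrr.
have cF x : a <= x <= b -> {for x, continuous F}.
  by move=> /dF[+ _] => /derivable1_diffP/differentiable_continuous.
rewrite EFinB; apply: continuous_FTC2 => //.
- apply: continuous_in_subspaceT => x; rewrite inE/= in_itv/=; exact: cf.
- split.
  + by move=> x; rewrite in_itv/= => /andP[ax xb]; have [] := dF x; rewrite ?ltW.
  + by apply: cvg_at_right_filter; apply: cF; rewrite lexx ltW.
  + by apply: cvg_at_left_filter; apply: cF; rewrite lexx ltW.
- move=> x; rewrite in_itv/= => /andP[ax xb]; rewrite derive1E.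
  by have [] := dF x; rewrite ?ltW.
Qed.

(** Uniqueness of Lebesgue measure: the rescaled push-forward gives half-open intervals their
    length. The planar version [leb2_scale] uses uniqueness of the product measure in the same
    way. *)
Lemma lebesgue_measure_scale (c : R) (A : set R) : 0 < c -> measurable A ->
  mu ((fun x => c^-1 * x) @^-1` A) = (c%:E * mu A)%E.
Proof.
move=> c0 mA.
have ci : 0 <= c^-1 by rewrite invr_ge0 ltW.
have mc : measurable_fun [set: mR] (fun x : mR => c^-1 * x : mR).
  by apply: measurable_funM => //; exact: measurable_cst.
rewrite [in RHS](@lebesgue_measure_unique R (mscale (NngNum ci)
    (measure_function_pushforward__canonical__measure_function_Measure mu mc)) _ A mA).
  by rewrite /mscale /= muleA -EFinM divff ?gt_eqF// mul1e.
move=> _ [[a b] _ <-] /=; rewrite /mscale /pushforward /=.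
rewrite [X in (_ * X)%E](_ : _ = mu `]c * a, c * b]%classic); last first.
  congr (mu _); apply/seteqP; split => x /=;
    by rewrite !in_itv/= ltr_pdivlMl// ler_pdivrMl.
rewrite !lebesgue_measure_itv/= !lte_fin ltr_pM2l//; case: ifPn => _; last by rewrite mule0.
by rewrite -!EFinB -EFinM -mulrBr mulKf// gt_eqF.
Qed.

Lemma measurable_radius : measurable_fun [set: mR * mR] (@radius R).
Proof.
apply: (@measurableT_comp _ _ _ _ _ _ (@Num.sqrt R) _
  (fun z : mR * mR => z.1 ^+ 2 + z.2 ^+ 2)).
  by apply: continuous_measurable_fun; exact: sqrt_continuous.
by apply: measurable_funD; apply: measurable_funX;
  [exact: measurable_fst|exact: measurable_snd].
Qed.

Lemma radius_ge0 (z : R * R) : 0 <= radius z.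
Proof. exact: sqrtr_ge0. Qed.

Lemma sqr_radius (z : R * R) : radius z ^+ 2 = z.1 ^+ 2 + z.2 ^+ 2.
Proof. by rewrite sqr_sqrtr// addr_ge0// sqr_ge0. Qed.

Lemma radiusZ (c : R) (z : R * R) : 0 <= c ->
  radius (c * z.1, c * z.2) = c * radius z.
Proof.
move=> c0; rewrite /radius /= !exprMn -mulrDr sqrtrM ?sqr_ge0//.
by rewrite sqrtr_sqr ger0_norm.
Qed.

Definition disc (t : R) : set (R * R) := (@radius R) @^-1` `]-oo, t[.

Lemma measurable_disc t : measurable (disc t : set (mR * mR)).
Proof.
by rewrite /disc -[_ @^-1` _]setTI; apply: measurable_radius.
Qed.

Lemma leb2_scale (c : R) (A : set (mR * mR)) : 0 < c -> measurable A ->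
  leb2 ((fun z => (c^-1 * z.1, c^-1 * z.2)) @^-1` A) = ((c ^+ 2)%:E * leb2 A)%E.
Proof.
move=> c0 mA.
have ci : 0 <= (c ^+ 2)^-1 by rewrite invr_ge0 sqr_ge0.
have mc : measurable_fun [set: mR * mR]
    (fun z : mR * mR => (c^-1 * z.1, c^-1 * z.2) : (mR * mR)%type).
  apply: measurable_fun_pair; apply: measurable_funM => //;
    by [exact: measurable_cst|exact: measurable_fst|exact: measurable_snd].
rewrite [in RHS](@product_measure_unique _ _ _ _ _ mu mu (mscale (NngNum ci)
    (measure_function_pushforward__canonical__measure_function_Measure leb2 mc)) _ A mA).
  by rewrite /mscale /= muleA -EFinM divff ?expf_neq0 ?gt_eqF// mul1e.
move=> B C mB mC; rewrite /mscale /=.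
have mp (D : set mR) : measurable D -> measurable ((fun x : mR => c^-1 * x) @^-1` D).
  move=> mD; rewrite -[_ @^-1` _]setTI.
  by apply: measurable_funM => //; exact: measurable_cst.
transitivity (((c ^+ 2)^-1)%:E * (mu ((fun x : R => (c^-1 * x)%R) @^-1` B) *
    mu ((fun x : R => (c^-1 * x)%R) @^-1` C)))%E.
  by rewrite -product_measure1E//; exact: mp.
rewrite !lebesgue_measure_scale// [X in (_ * X)%E]muleACA -EFinM -expr2.
rewrite [LHS]muleA -EFinM mulVf ?mul1e//.
by rewrite expf_neq0// gt_eqF.
Qed.

Lemma leb2_rect (A B : set mR) : measurable A -> measurable B ->
  leb2 (A `*` B) = (mu A * mu B)%E.
Proof. exact: product_measure1E. Qed.

Lemma preimage_disc (t : R) : 0 < t ->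
  (fun z : R * R => (t^-1 * z.1, t^-1 * z.2)) @^-1` disc 1 = disc t.
Proof.
move=> t0; apply/seteqP; split => z; rewrite /disc /= !in_itv/=;
  by rewrite radiusZ ?invr_ge0 ?ltW// ltr_pdivrMl// mulr1.
Qed.

Lemma disc_scale (t : R) : 0 < t -> leb2 (disc t) = ((t ^+ 2)%:E * leb2 (disc 1))%E.
Proof.
move=> t0; have := leb2_scale t0 (measurable_disc 1).
by rewrite (preimage_disc t0).
Qed.

Lemma disc1_sub : disc 1 `<=` (`[-1, 1]%classic `*` `[-1, 1]%classic : set (R * R)).
Proof.
move=> [x y]; rewrite /disc /= !in_itv/= => xy.
have h : x ^+ 2 + y ^+ 2 < 1.
  rewrite -(sqr_radius (x, y)) -(expr1n _ 2).
  by rewrite ltrXn2r// ?radius_ge0// nnegrE// radius_ge0.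
split; apply/andP; split; nra.
Qed.

Lemma sub_disc1 : (`]0, 2^-1]%classic `*` `]0, 2^-1]%classic : set (R * R)) `<=` disc 1.
Proof.
move=> [x y] /= []; rewrite /disc /= !in_itv/= => /andP[x0 x1] /andP[y0 y1].
have : (radius (x, y)) ^+ 2 < 1 by rewrite sqr_radius /=; nra.
by have := radius_ge0 (x, y); nra.
Qed.

Lemma leb2_disc1_lty : (leb2 (disc 1) < +oo)%E.
Proof.
apply: (@le_lt_trans _ _ (leb2 (`[-1, 1]%classic `*` `[-1, 1]%classic))).
  apply: le_measure; rewrite ?inE; [exact: measurable_disc|exact: measurableX|].
  exact: disc1_sub.
rewrite leb2_rect// lebesgue_measure_itv/=.
by case: ifPn => _; rewrite -?EFinB -?EFinM ?ltry// mul0e ltry.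
Qed.

Lemma leb2_disc1_gt0 : (0 < leb2 (disc 1))%E.
Proof.
apply: (@lt_le_trans _ _ (leb2 (`]0, 2^-1]%classic `*` `]0, 2^-1]%classic))).
  rewrite leb2_rect// lebesgue_measure_itv/= lte_fin.
  by rewrite ifT ?invr_gt0// -EFinB -EFinM lte_fin; lra.
apply: le_measure; rewrite ?inE; [exact: measurableX|exact: measurable_disc|].
exact: sub_disc1.
Qed.

(** By scaling, the distribution function of the radius is [kappa * t ^+ 2], with density
    [2 * kappa * t]; thus [2 * kappa] stands for the length of the unit circle. *)
Definition kappa : R := fine (leb2 (disc 1)).

Lemma kappaE : leb2 (disc 1) = kappa%:E.
Proof.
by rewrite fineK// ge0_fin_numE// leb2_disc1_lty.
Qed.

Lemma kappa_gt0 : 0 < kappa.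
Proof. by have := leb2_disc1_gt0; rewrite kappaE. Qed.

(* kappa is the area of the unit disc. *)
Lemma ge0_integral_radial (f : R -> \bar R) :
  measurable_fun [set: R] f -> (forall y, 0 <= f y)%E ->
  (\int[leb2]_z f (radius z) =
   (2 * kappa)%:E * \int[mu]_(r in `]0%R, +oo[) (f r * r%:E))%E.
Proof.
move=> mf f0.
pose h (r : R) := 2 * kappa * Num.max 0 r.
have mh : measurable_fun [set: R] h.
  apply: measurable_funM; first exact: measurable_cst.
  by apply: measurable_maxr => //; exact: measurable_cst.
have h0 r : 0 <= h r by rewrite /h mulr_ge0 ?le_max ?lexx// mulr_ge0 // ltW// kappa_gt0.
have hE t : leb2 (disc t) = (\int[mu]_(y in `]-oo, t[) (h y)%:E)%E.
  have [t0|t0] := leP t 0.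
    rewrite (_ : disc t = set0) ?measure0; last first.
      apply/seteqP; split => z //; rewrite /disc /= in_itv/= => rt.
      by have := lt_le_trans rt t0; rewrite ltNge radius_ge0.
    rewrite integral0_eq// => x /=; rewrite in_itv/= => xt.
    by rewrite /h (max_idPl _) ?mulr0// (le_trans (ltW xt)).
  rewrite disc_scale// kappaE -EFinM.
  have -> : `]-oo, t[%classic = `]-oo, 0[ `|` `[0, t[ :> set R.
    by rewrite -itv_bndbnd_setU// bnd_simp ltW.
  rewrite ge0_integral_setU//=; last 3 first.
  - exact/measurable_EFinP/measurable_funTS.
  - by move=> x _; rewrite lee_fin.
  - apply/disj_setPLR => x /=; rewrite !in_itv/= => x0 /andP[].
    by rewrite leNgt x0.
  rewrite [X in (X + _)%E]integral0_eq ?add0e; last first.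
    by move=> x /=; rewrite in_itv/= => xt; rewrite /h (max_idPl _) ?mulr0// ltW.
  rewrite integral_itv_bndo_bndc; last first.
    exact/measurable_EFinP/measurable_funTS.
  have -> : (\int[mu]_(x in `[0%R, t]) (h x)%:E =
      \int[mu]_(x in `[0%R, t]) (2 * kappa * x)%:E)%E.
    apply: eq_integral => x; rewrite inE/= in_itv/= => /andP[x0 _].
    by rewrite /h (max_idPr x0).
  have dF (x : R) : 0 <= x <= t ->
      is_derive x (1 : R) (fun x => kappa * x ^+ 2) (2 * kappa * x).
    move=> _; have H := is_deriveZ kappa (is_deriveX 2 (is_derive_id x (1 : R))).
    apply: (is_derive_eq H); rewrite expr1 /GRing.scale/=; ring.
  rewrite (FTC2 (ltW t0) dF); last first.
    by move=> x _; apply: cvgM; [exact: cvg_cst|exact: cvg_id].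
  by rewrite expr0n/= mulr0 subr0 mulrC.
have hfin t : (leb2 (disc t) < +oo)%E.
  have [t0|t0] := leP t 0.
    by rewrite hE integral0_eq ?ltry// => x /=; rewrite in_itv/= => xt;
      rewrite /h (max_idPl _) ?mulr0// (le_trans (ltW xt)).
  by rewrite disc_scale// kappaE -EFinM ltry.
rewrite (ge0_integral_distribution measurable_radius mh h0 hE hfin mf f0).
rewrite -ge0_integralZl//; last 3 first.
- apply: emeasurable_funM; first exact: measurable_funTS.
  exact/measurable_EFinP.
- by move=> r; rewrite /= in_itv/= andbT => r0; rewrite mule_ge0 ?lee_fin// ltW.
- by rewrite lee_fin mulr_ge0// ltW// kappa_gt0.
rewrite [RHS]integral_mkcond; apply: eq_integral => r _.
rewrite patchE mem_setE in_itv/= andbT /h; case: ltP => r0.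
  by rewrite muleCA -EFinM.
by rewrite mulr0 mule0.
Qed.

Lemma ae_eq0_plane (f : R * R -> R) :
  measurable_fun [set: mR * mR] f ->
  (forall A, boxes A -> leb2.-integrable A (EFin \o f)) ->
  (forall A, boxes A -> (\int[leb2]_(x in A) (f x)%:E = 0)%E) ->
  {ae leb2, forall x, f x = 0}.
Proof.
move=> mf intf f0.
have bb i : boxes (@box R i `*` @box R i).
  by exists (@box R i); [exact: is_ocitv|exists (@box R i) => //; exact: is_ocitv].
apply: (@ae_eq0_pi_system _ (mR * mR)%type R leb2 (@boxes R)
  (fun n => @box R n `*` @box R n)) => //.
- exact: measurable_prod_boxes.
- move=> _ _ [A oA [B oB <-]] [C oC [D oD <-]]; rewrite -setXI.
  by exists (A `&` C); [exact: ocitvI|exists (B `&` D) => //; exact: ocitvI].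
- apply/seteqP; split => // -[x y] _.
  have [n _ xn] : (\bigcup_n @box R n) x by rewrite box_cover.
  have [k _ yk] : (\bigcup_n @box R n) y by rewrite box_cover.
  have mono i j : (i <= j)%N -> @box R i `<=` @box R j.
    move=> ij z; rewrite /box/= !in_itv/= => /andP[iz zi].
    by rewrite (le_lt_trans _ iz) ?(le_trans zi) ?lerN2 ?ler_nat.
  by exists (maxn n k) => //; split; [apply: mono xn|apply: mono yk];
    rewrite ?leq_maxl ?leq_maxr.
- by move=> i; apply: intf.
Qed.

(** [f] may fail to be integrable near 0, so the pi-system argument is run on the truncations to
    []1/(n+1), +oo[], which together cover the open half-line. *)
Lemma ae_eq0_halfline (f : R -> R) :
  measurable_fun (`]0, +oo[ : set R) f ->
  (forall a b : R, 0 < a -> mu.-integrable `]a, b] (EFin \o f)) ->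
  (forall a b : R, 0 < a -> (\int[mu]_(x in `]a, b]) (f x)%:E = 0)%E) ->
  {ae mu, forall x, 0 < x -> f x = 0}.
Proof.
move=> mf intf f0.
have H (n : nat) : {ae mu, forall x, n.+1%:R^-1 < x -> f x = 0}.
  have d0 : 0 < n.+1%:R^-1 :> R by [].
  set d := n.+1%:R^-1 : R.
  have md : measurable `]d, +oo[%classic by exact: measurable_itv.
  pose g := f \_ `]d, +oo[.
  have mg : measurable_fun [set: R] g.
    apply/(measurable_restrictT f) => //.
    apply: measurable_funS mf => // x /=; rewrite !in_itv/= !andbT.
    exact: lt_trans.
  have Egf : EFin \o g = (EFin \o f) \_ `]d, +oo[.
    by apply/funext => x; rewrite /g /= !patchE; case: ifP.
  have capE a b : `]a, b] `&` `]d, +oo[ = `](Num.max a d), b]%classic.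
    apply/seteqP; split => x /=; rewrite !in_itv/= gt_max.
      by move=> [/andP[-> ->]]; rewrite andbT => ->.
    by move=> /andP[/andP[-> ->] ->].
  have dmax a : 0 < Num.max a d by rewrite lt_max d0 orbT.
  have G0 A : @ocitv R A -> mu.-integrable A (EFin \o g).
    move=> [[a b] _ <-] /=; rewrite Egf; apply/integrable_restrict => //=.
    by rewrite capE; exact: intf.
  have : {ae mu, forall x, g x = 0}.
    apply: (@ae_eq0_pi_system _ mR R mu (@ocitv R) (@box R)) => //.
    - exact: ocitvI.
    - by move=> i; exact: is_ocitv.
    - exact: box_cover.
    - by move=> i; apply: G0; exact: is_ocitv.
    - move=> A oA; rewrite -[RHS](f0 (Num.max (0 : R) d) 0 (dmax 0)).
      move: oA => [[a b] _ <-] /=.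
      rewrite (_ : (fun x => (g x)%:E) = (EFin \o f) \_ `]d, +oo[)//.
      by rewrite -integral_mkcondr capE !f0.
  apply: ae_imp => x; rewrite /g patchE => + dx.
  by rewrite mem_set//= in_itv/= andbT.
have : {ae mu, forall x, forall n : nat, n.+1%:R^-1 < x -> f x = 0}.
  exact: ae_foralln.
apply: ae_imp => x h x0.
have [n nx] : exists n : nat, n.+1%:R^-1 < x.
  exists (Num.trunc x^-1); rewrite invf_plt ?posrE//.
  exact: truncnS_gt.
exact: h nx.
Qed.

(** The radius along the line at height [y]. For [y != 0] it is smooth and stays away from 0, so
    that profiles controlled only on the open half-line can be composed with it; the excluded line
    is null. *)
Definition hypot (y x : R) : R := radius (x, y).

Lemma hypot_gt0 (y x : R) : y != 0 -> 0 < hypot y x.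
Proof.
move=> y0; rewrite /hypot /radius sqrtr_gt0/=.
by rewrite ltr_wpDl ?sqr_ge0// exprn_even_gt0.
Qed.

Lemma is_derive_hypot (y x : R) : y != 0 ->
  is_derive x (1 : R) (hypot y) (x / hypot y x).
Proof.
move=> y0.
have p0 : 0 < x ^+ 2 + y ^+ 2 by rewrite ltr_wpDl ?sqr_ge0// exprn_even_gt0.
have H : is_derive x (1 : R) (fun x : R => x ^+ 2 + y ^+ 2) (2 * x).
  have := is_deriveD (is_deriveX 2 (is_derive_id x (1 : R))) (is_derive_cst (y ^+ 2) x (1 : R)).
  move=> H; apply: (is_derive_eq H); rewrite /GRing.scale/=; ring.
have H2 := @is_derive1_comp _ Num.sqrt (fun x : R => x ^+ 2 + y ^+ 2) x _ _ (is_derive1_sqrt p0) H.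
apply: (is_derive_eq H2); rewrite /hypot /radius/=.
have s0 : Num.sqrt (x ^+ 2 + y ^+ 2) != 0 by rewrite gt_eqF// sqrtr_gt0.
by field.
Qed.

Lemma continuous_hypot (y : R) : y != 0 -> continuous (hypot y).
Proof.
move=> y0 x; have [+ _] := is_derive_hypot x y0.
by move=> /derivable1_diffP/differentiable_continuous.
Qed.

Lemma hypot_lt (y x t : R) : 0 < t -> (hypot y x < t) = (x ^+ 2 + y ^+ 2 < t ^+ 2).
Proof.
move=> t0; rewrite -(sqr_radius (x, y)) /hypot.
by rewrite ltr_pXn2r// nnegrE ?radius_ge0 // ltW.
Qed.

(** The weight [x / hypot y x] is the derivative of [hypot y], so its image measure under [hypot y]
    has distribution function [t - |y|], that of Lebesgue measure beyond [|y|]. *)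
Lemma ge0_integral_hypot (y : R) (f : R -> \bar R) : y != 0 ->
  measurable_fun [set: R] f -> (forall s, 0 <= f s)%E ->
  (\int[mu]_(x in `]0%R, +oo[) (f (hypot y x) * (x / hypot y x)%:E) =
   \int[mu]_(s in `]`|y|%R, +oo[) f s)%E.
Proof.
move=> y0 mf f0.
have ch := continuous_hypot y0.
have mhyp : measurable_fun [set: R] (hypot y) by exact: continuous_measurable_fun.
have hgt (x : R) := hypot_gt0 x y0.
have y2 : 0 < y ^+ 2 by rewrite exprn_even_gt0.
pose k (x : R) := Num.max 0 x / hypot y x.
have ck : continuous (fun x : R => x / hypot y x).
  by move=> x; apply: cvgM; [exact: cvg_id|apply: cvgV; [rewrite gt_eqF|exact: ch]].
have mk : measurable_fun [set: R] k.
  apply: measurable_funM; first by apply: measurable_maxr => //; exact: measurable_cst.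
  apply: continuous_measurable_fun => x.
  by apply: cvgV; [rewrite gt_eqF|exact: ch].
have k0 x : 0 <= k x by rewrite /k divr_ge0 ?le_max ?lexx// ltW.
pose h : R -> R := \1_(`]`|y|, +oo[%classic : set R).
have mh : measurable_fun [set: R] h by apply: measurable_indic; exact: measurable_itv.
have h0 x : 0 <= h x by rewrite /h indicE.
have hE (t : R) : (\int[mu]_(s in `]-oo, t[) (h s)%:E)%E = (Num.max 0 (t - `|y|))%:E.
  rewrite integral_indic//=.
  have -> : `]`|y|, +oo[ `&` `]-oo, t[ = `]`|y|, t[%classic :> set R.
    by apply/seteqP; split => x /=; rewrite !in_itv/= andbT => /andP.
  rewrite lebesgue_measure_itv/= lte_fin -EFinB.
  have [|] := ltP `|y| t => yt; first by rewrite (max_idPr _)// subr_ge0 ltW.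
  by rewrite (max_idPl _)// subr_le0.
have mE (t : R) : (density mu mk k0 (hypot y @^-1` `]-oo, t[) =
    \int[mu]_(s in `]-oo, t[) (h s)%:E)%E.
  rewrite hE; have [ty|ty] := leP t `|y|.
    rewrite (max_idPl _) ?subr_le0//.
    rewrite (_ : _ @^-1` _ = set0) ?measure0//.
    apply/seteqP; split => x //=; rewrite in_itv/= => xt.
    have t0 : 0 < t by exact: lt_trans xt.
    have := xt; rewrite hypot_lt//.
    have : t ^+ 2 <= y ^+ 2.
      by rewrite -[leRHS]real_normK ?num_real// ler_pXn2r// nnegrE ?ltW.
    by have := sqr_ge0 x; lra.
  have t0 : 0 < t by rewrite (le_lt_trans _ ty).
  rewrite (max_idPr _) ?subr_ge0; last exact: ltW.
  have ty2 : y ^+ 2 < t ^+ 2.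
    by rewrite -[ltLHS]real_normK ?num_real// ltr_pXn2r// nnegrE ltW.
  (* On the nonnegative half-line, [hypot y x < t] means [x < X], and [hypot y X = t]. *)
  pose X := Num.sqrt (t ^+ 2 - y ^+ 2).
  have X0 : 0 < X by rewrite sqrtr_gt0 subr_gt0.
  have X2 : X ^+ 2 = t ^+ 2 - y ^+ 2 by rewrite sqr_sqrtr// subr_ge0 ltW.
  have -> : hypot y @^-1` `]-oo, t[ = `]-oo, 0[ `&` (hypot y @^-1` `]-oo, t[) `|` `[0, X[ :> set R.
    apply/seteqP; split => x /=; rewrite !in_itv/= ?hypot_lt//.
      move=> xt; case: (ltP x 0) => x0; [by left|right => /=].
      have : x ^+ 2 < X ^+ 2 by rewrite X2; lra.
      by rewrite ltr_pXn2r// nnegrE// ltW.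
    move=> [[]//|/andP[x0 xX]].
    have : x ^+ 2 < X ^+ 2 by rewrite ltr_pXn2r// nnegrE// ltW.
    by rewrite X2; lra.
  have mA : measurable (`]-oo, 0[ `&` (hypot y @^-1` `]-oo, t[) : set mR).
    apply: measurableI => //; rewrite -[_ @^-1` _]setTI; exact: mhyp.
  rewrite measureU//; last first.
    apply/seteqP; split => x //= []; rewrite !in_itv/= => -[x0 _] /andP[].
    by rewrite leNgt x0.
  rewrite [X in (X + _)%E](_ : _ = 0%E) ?add0e; last first.
    apply: integral0_eq => x /=; rewrite in_itv/= => -[x0 _].
    by rewrite /k (max_idPl (ltW x0)) mul0r.
  rewrite /= /density integral_itv_bndo_bndc; last first.
    exact/measurable_EFinP/measurable_funTS.
  have -> : (\int[mu]_(x in `[0%R, X]) (k x)%:E =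
      \int[mu]_(x in `[0%R, X]) (x / hypot y x)%:E)%E.
    apply: eq_integral => x; rewrite inE/= in_itv/= => /andP[x0 _].
    by rewrite /k (max_idPr x0).
  rewrite (FTC2 (ltW X0) (fun x _ => is_derive_hypot x y0)); last by move=> x _; exact: ck.
  rewrite /hypot /radius /= X2 subrK expr0n/= add0r !sqrtr_sqr.
  by rewrite (gtr0_norm t0).
have mfin (t : R) : (density mu mk k0 (hypot y @^-1` `]-oo, t[) < +oo)%E.
  by rewrite mE hE ltry.
have := @ge0_integral_distribution _ mR (density mu mk k0) (hypot y) h f mhyp mh h0 mE mfin mf f0.
rewrite ge0_integral_density//; last exact: measurableT_comp.
rewrite [X in X = _ -> _](_ : _ =
    \int[mu]_(x in `]0%R, +oo[) (f (hypot y x) * (x / hypot y x)%:E))%E; last first.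
  rewrite [RHS]integral_mkcond; apply: eq_integral => x _.
  rewrite patchE mem_setE in_itv/= andbT /k; case: ltP => // x0.
  by rewrite mul0r mule0.
move=> ->; rewrite [RHS]integral_mkcond; apply: eq_integral => x _.
by rewrite patchE mem_setE /h indicE mem_setE; case: ifP; rewrite ?mule1 ?mule0.
Qed.

End radial.

(** * Integrability criteria *)

Section integral_tools.
Context d (T : measurableType d) (R : realType).
Variable m : {measure set T -> \bar R}.

Lemma EFin_Rintegral D (f : T -> R) : measurable D ->
  m.-integrable D (EFin \o f) ->
  (\int[m]_(x in D) (f x)%:E)%E = (\int[m]_(x in D) f x)%:E.
Proof. by move=> mD fi; rewrite /Rintegral fineK//; exact: integrable_fin_num. Qed.

Lemma integrable_addr D (f g : T -> R) : measurable D ->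
  m.-integrable D (EFin \o f) -> m.-integrable D (EFin \o g) ->
  m.-integrable D (EFin \o (fun x => f x + g x)).
Proof. by move=> mD fi gi; have := integrableD mD fi gi; apply: eq_integrable. Qed.

Lemma integrable_subr D (f g : T -> R) : measurable D ->
  m.-integrable D (EFin \o f) -> m.-integrable D (EFin \o g) ->
  m.-integrable D (EFin \o (fun x => f x - g x)).
Proof. by move=> mD fi gi; have := integrableB mD fi gi; apply: eq_integrable. Qed.

Lemma integrable_mulr D c (f : T -> R) : measurable D ->
  m.-integrable D (EFin \o f) -> m.-integrable D (EFin \o (fun x => c * f x)).
Proof. by move=> mD fi; have := integrableZl mD c fi; apply: eq_integrable. Qed.

Lemma integrable_mul_L2 D (f g : T -> R) : measurable D ->
  measurable_fun D f -> measurable_fun D g ->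
  (\int[m]_(x in D) (f x ^+ 2)%:E < +oo)%E ->
  (\int[m]_(x in D) (g x ^+ 2)%:E < +oo)%E ->
  m.-integrable D (EFin \o (fun x => f x * g x)).
Proof.
move=> mD mf mg fi gi.
have sq (h : T -> R) : measurable_fun D h ->
    (\int[m]_(x in D) (h x ^+ 2)%:E < +oo)%E ->
    m.-integrable D (EFin \o (fun x => h x ^+ 2)).
  move=> mh hi; apply/integrableP; split.
    by apply/measurable_EFinP; exact: measurable_funX.
  apply: le_lt_trans hi; rewrite le_eqVlt; apply/orP; left; apply/eqP.
  by apply: eq_integral => x _ /=; rewrite ger0_norm// sqr_ge0.
apply: (le_integrable mD _ _ (integrableD mD (sq f mf fi) (sq g mg gi))).
  by apply/measurable_EFinP; exact: measurable_funM.
move=> x Dx /=; rewrite lee_fin normrM.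
rewrite [leRHS]ger0_norm ?addr_ge0 ?sqr_ge0//.
have := sqr_ge0 (`|f x| - `|g x|); rewrite sqrrB !real_normK ?num_real//.
have := mulr_ge0 (normr_ge0 (f x)) (normr_ge0 (g x)).
set a := _ * _; rewrite -mulr_natl; lra.
Qed.

End integral_tools.

Section product_integrable.
Context d1 d2 (T1 : measurableType d1) (T2 : measurableType d2) (R : realType).
Variables (m1 : {sigma_finite_measure set T1 -> \bar R})
          (m2 : {sigma_finite_measure set T2 -> \bar R}).

Lemma integrable_tensor (f : T1 -> R) (g : T2 -> R) :
  m1.-integrable [set: T1] (EFin \o f) -> m2.-integrable [set: T2] (EFin \o g) ->
  (m1 \x m2)%E.-integrable [set: T1 * T2] (EFin \o (fun z => f z.1 * g z.2)).
Proof.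
move=> fi gi.
have mf : measurable_fun [set: T1] f by apply/measurable_EFinP; exact: measurable_int fi.
have mg : measurable_fun [set: T2] g by apply/measurable_EFinP; exact: measurable_int gi.
apply/integrable12ltyP.
  apply/measurable_EFinP; apply: measurable_funM; exact: measurableT_comp.
have -> : (\int[m1]_x \int[m2]_y `|(EFin \o (fun z : T1 * T2 => (f z.1 * g z.2)%R)) (x, y)| =
   \int[m1]_x (`|f x|%:E * \int[m2]_y `|g y|%:E))%E.
  apply: eq_integral => x _; rewrite -ge0_integralZl//=.
  - by apply: eq_integral => y _; rewrite normrM EFinM.
  - by apply/measurable_EFinP; exact: measurableT_comp.
have gfin : (\int[m2]_y `|g y|%:E < +oo)%E by have /integrableP[_] := gi.
have ffin : (\int[m1]_y `|f y|%:E < +oo)%E by have /integrableP[_] := fi.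
rewrite ge0_integralZr//.
- by rewrite lte_mul_pinfty// ?integral_ge0// ge0_fin_numE// integral_ge0.
- by apply/measurable_EFinP; exact: measurableT_comp.
- exact: integral_ge0.
Qed.
End product_integrable.

(** * Absolutely continuous functions and test functions *)

Section primitives.
Variable R : realType.
Local Notation mu := (@lebesgue_measure R).
Local Notation mR := (measurableTypeR R).

(** Fubini for [g t * k r] on the triangle [t <= r]. It yields the product rule for functions whose
    derivatives are merely integrable. *)
Lemma ibp_fubini (a b : R) (g k : R -> R) :
  mu.-integrable `[a, b] (EFin \o g) -> mu.-integrable `[a, b] (EFin \o k) ->
  (\int[mu]_(r in `[a, b]) ((\int[mu]_(t in `[a, r]) g t) * k r)%:E =
   \int[mu]_(t in `[a, b]) (g t * (\int[mu]_(r in `[t, b]) k r))%:E)%E.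
Proof.
move=> ig ik.
have ext (h : R -> R) : mu.-integrable `[a, b] (EFin \o h) ->
    mu.-integrable [set: R] (EFin \o (h \_ `[a, b])).
  by move=> hi; rewrite -restrict_EFin; apply/integrable_restrict => //=; rewrite setTI.
pose g' := g \_ `[a, b]; pose k' := k \_ `[a, b].
pose S := [set z : mR * mR | z.1 <= z.2].
have mS : measurable S.
  by rewrite -[S]setTI; apply: measurable_fun_ler.
pose F (z : R * R) := g' z.1 * k' z.2 * (z.1 <= z.2)%R%:R.
have mchi : measurable_fun [set: mR * mR] (fun z : mR * mR => (z.1 <= z.2)%R%:R : R).
  rewrite (_ : (fun z : mR * mR => _) = \1_S); first exact: measurable_indic.
  by apply/funext => z; rewrite indicE mem_setE.
have pt0 : (point : R) = 0 by [].
have ept0 : (point : \bar R) = 0%E by [].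
have iF : (mu \x mu)%E.-integrable [set: mR * mR] (EFin \o F).
  apply: (le_integrable _ _ _ (integrable_tensor (ext _ ig) (ext _ ik))) => //.
    apply/measurable_EFinP; apply: measurable_funM => //.
    apply: measurable_funM.
      apply: (@measurableT_comp _ _ _ _ _ _ g') => //.
      by apply/measurable_EFinP; exact: measurable_int (ext _ ig).
    apply: (@measurableT_comp _ _ _ _ _ _ k') => //.
    by apply/measurable_EFinP; exact: measurable_int (ext _ ik).
  move=> z _ /=; rewrite lee_fin normrM ler_piMr//.
  by rewrite normr_nat lern1 leq_b1.
have := Fubini iF.
have -> : (\int[mu]_x \int[mu]_y (EFin \o F) (x, y) =
   \int[mu]_(t in `[a, b]) (g t * (\int[mu]_(r in `[t, b]) k r))%:E)%E.
  rewrite [RHS]integral_mkcond; apply: eq_integral => x _.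
  rewrite patchE mem_setE; case: ifPn => xab; last first.
    apply: integral0_eq => y _; rewrite /F /= /g' patchE mem_setE (negbTE xab) pt0.
    by rewrite !mul0r.
  move: xab; rewrite in_itv/= => /andP[ax xb].
  have sub : `[x, b] `<=` `[a, b] by move=> y /=; rewrite !in_itv/= => /andP[xy ->];
    rewrite (le_trans ax xy).
  have ikx : mu.-integrable `[x, b] (EFin \o k) by apply: integrableS ik.
  rewrite EFinM -EFin_Rintegral// -integralZl//.
  rewrite [RHS]integral_mkcond; apply: eq_integral => y _ /=.
  rewrite /F patchE /= /g' /k' !patchE !mem_setE !in_itv/= ax xb ?pt0 ?ept0/=.
  case: (leP x y) => xy /=; rewrite ?mulr0// mulr1 (le_trans ax xy)/=.
  by case: ifP; rewrite ?mulr0.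
have -> : (\int[mu]_y \int[mu]_x (EFin \o F) (x, y) =
   \int[mu]_(r in `[a, b]) ((\int[mu]_(t in `[a, r]) g t) * k r)%:E)%E.
  rewrite [RHS]integral_mkcond; apply: eq_integral => y _.
  rewrite patchE mem_setE; case: ifPn => yab; last first.
    apply: integral0_eq => x _; rewrite /F /= /k' patchE mem_setE (negbTE yab) pt0.
    by rewrite mulr0 mul0r.
  move: yab; rewrite in_itv/= => /andP[ay yb].
  have sub : `[a, y] `<=` `[a, b] by move=> x /=; rewrite !in_itv/= => /andP[-> xy];
    rewrite (le_trans xy yb).
  have igy : mu.-integrable `[a, y] (EFin \o g) by apply: integrableS ig.
  rewrite EFinM -EFin_Rintegral// -integralZr//.
  rewrite [RHS]integral_mkcond; apply: eq_integral => x _ /=.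
  rewrite /F patchE /= /g' /k' !patchE !mem_setE !in_itv/= ay yb ?pt0 ?ept0/=.
  case: (leP x y) => xy /=; rewrite ?mulr0 ?andbF// mulr1 (le_trans xy yb) !andbT.
  by case: ifP; rewrite ?mul0r.
by move=> ->.
Qed.

(** Absolute continuity in integrated form: [h] is integrable and matters only up to null sets, and
    nothing is said about pointwise differentiability of [V]. *)
Definition primitive_on (a b : R) (V h : R -> R) : Prop :=
  mu.-integrable `[a, b] (EFin \o h) /\
  forall x y, a <= x -> x <= y -> y <= b -> V y - V x = \int[mu]_(t in `[x, y]) h t.

Lemma primitive_on_sub (a b c e : R) V h : a <= c -> e <= b ->
  primitive_on a b V h -> primitive_on c e V h.
Proof.
move=> ac eb [ih Vh]; split.
  apply: integrableS ih => // x /=; rewrite !in_itv/= => /andP[cx xe].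
  by rewrite (le_trans ac cx) (le_trans xe eb).
by move=> x y cx xy ye; apply: Vh => //; [exact: le_trans cx|exact: le_trans eb].
Qed.

Lemma primitive_on_continuous (a b : R) V h : a <= b ->
  primitive_on a b V h -> {within `[a, b], continuous V}.
Proof.
move=> ab [ih Vh].
have := parameterized_integral_continuous ab ih.
pose P := parameterized_integral mu a ^~ h; move=> cP.
have : {within `[a, b], continuous (fun x => V a + P x)}.
  by move=> x; apply: cvgD; [exact: cvg_cst|exact: cP].
apply: subspace_eq_continuous => x; rewrite inE/= in_itv/= => /andP[ax xb].
by rewrite /from_subspace /P /parameterized_integral -Vh// addrC subrK.
Qed.

Lemma primitive_on_bounded (a b : R) V h : a <= b -> primitive_on a b V h ->
  forall x, a <= x <= b -> `|V x| <= `|V a| + \int[mu]_(t in `[a, b]) `|h t|.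
Proof.
move=> ab [ih Vh] x /andP[ax xb].
have -> : V x = V a + (V x - V a) by rewrite addrC subrK.
apply: (le_trans (ler_normD _ _)); rewrite lerD2l Vh//.
have sub : `[a, x] `<=` `[a, b].
  by move=> y /=; rewrite !in_itv/= => /andP[-> yx]; rewrite (le_trans yx xb).
have ihx : mu.-integrable `[a, x] (EFin \o h) by apply: integrableS ih.
apply: (le_trans (le_normr_Rintegral _ ihx)) => //.
rewrite -lee_fin -!EFin_Rintegral//; last 2 first.
- by have := integrable_abse ih.
- by have := integrable_abse ihx.
apply: ge0_subset_integral => //.
by apply/measurable_EFinP/measurableT_comp => //; apply/measurable_EFinP; exact: measurable_int ih.
Qed.

Lemma primitive_on_integrableM (a b : R) V h k : a <= b -> primitive_on a b V h ->
  mu.-integrable `[a, b] (EFin \o k) ->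
  mu.-integrable `[a, b] (EFin \o (fun x => V x * k x)).
Proof.
move=> ab pV ik.
have := @integrableMr _ _ R mu `[a, b] (measurable_itv _) V (EFin \o k) _ _ ik.
apply.
- apply: subspace_continuous_measurable_fun => //.
  exact: primitive_on_continuous pV.
- exists (`|V a| + \int[mu]_(t in `[a, b]) `|h t|); split; first exact: num_real.
  move=> M hM x /=; rewrite in_itv/= => xab.
  by apply: le_trans (ltW hM); exact: (primitive_on_bounded ab pV).
Qed.

(** The inner integrals of [ibp_fubini] are [V r - V a] and [W b - W t]; inserting them leaves
    exactly the boundary terms. *)
Lemma primitive_on_mul (a b : R) V h W k : a <= b ->
  primitive_on a b V h -> primitive_on a b W k ->
  \int[mu]_(x in `[a, b]) (V x * k x + h x * W x) = V b * W b - V a * W a.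
Proof.
move=> ab pV pW; have [ih Vh] := pV; have [ik Wk] := pW.
have iVk := primitive_on_integrableM ab pV ik.
have iWh := primitive_on_integrableM ab pW ih.
have iab (f : R -> R) : mu.-integrable `[a, b] (EFin \o f) ->
   (\int[mu]_(x in `[a, b]) (f x)%:E)%E = (\int[mu]_(x in `[a, b]) f x)%:E.
  by move=> fi; exact: EFin_Rintegral.
have ihW : mu.-integrable `[a, b] (EFin \o (fun x => h x * W x)).
  by apply: eq_integrable iWh => // x _; rewrite /= mulrC.
rewrite RintegralD//.
have Ik : \int[mu]_(x in `[a, b]) k x = W b - W a by rewrite Wk.
have Ih : \int[mu]_(x in `[a, b]) h x = V b - V a by rewrite Vh.
have := ibp_fubini ih ik.
rewrite (_ : (\int[mu]_(r in `[a, b]) _)%E =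
   (\int[mu]_(r in `[a, b]) (V r * k r - V a * k r)%:E)%E); last first.
  apply: eq_integral => r; rewrite inE/= in_itv/= => /andP[ar rb].
  by rewrite -Vh// mulrBl.
rewrite (_ : (\int[mu]_(t in `[a, b]) (h t * _)%:E)%E =
   (\int[mu]_(r in `[a, b]) (W b * h r - h r * W r)%:E)%E); last first.
  apply: eq_integral => r; rewrite inE/= in_itv/= => /andP[ar rb].
  by rewrite -Wk// mulrBr (mulrC (h r) (W b)).
have iZ c (f : R -> R) : mu.-integrable `[a, b] (EFin \o f) ->
    mu.-integrable `[a, b] (EFin \o (fun x => c * f x)).
  exact: integrable_mulr.
rewrite !iab; last 2 first.
- by apply: integrable_subr => //; exact: iZ.
- by apply: integrable_subr => //; exact: iZ.
rewrite !RintegralB//; [|exact: iZ..].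
rewrite !RintegralZl// Ik Ih => -[]; lra.
Qed.

Lemma C1_primitive_on (a b : R) (F f : R -> R) : a <= b ->
  (forall x, a <= x <= b -> is_derive x (1 : R) F (f x)) ->
  (forall x, a <= x <= b -> {for x, continuous f}) ->
  primitive_on a b F f.
Proof.
move=> ab dF cf; split.
  apply: continuous_compact_integrable; first exact: segment_compact.
  by apply: continuous_in_subspaceT => x; rewrite inE/= in_itv/=; exact: cf.
move=> x y ax xy yb.
have sub z : x <= z <= y -> a <= z <= b.
  by move=> /andP[xz zy]; rewrite (le_trans ax xz) (le_trans zy yb).
by rewrite /Rintegral (FTC2 xy (fun z h => dF z (sub z h)) (fun z h => cf z (sub z h))).
Qed.

Lemma ibp_test (a b : R) V h (phi dphi : R -> R) : a <= b ->
  primitive_on a b V h ->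
  (forall x, a <= x <= b -> is_derive x (1 : R) phi (dphi x)) ->
  (forall x, a <= x <= b -> {for x, continuous dphi}) ->
  phi a = 0 -> phi b = 0 ->
  \int[mu]_(x in `[a, b]) (V x * dphi x) = - \int[mu]_(x in `[a, b]) (h x * phi x).
Proof.
move=> ab pV dphiE cdphi pa pb.
have pP := C1_primitive_on ab dphiE cdphi.
have := primitive_on_mul ab pV pP; rewrite pa pb !mulr0 subrr RintegralD//.
- by move=> /eqP; rewrite addr_eq0 => /eqP.
- by apply: primitive_on_integrableM pV _ => //; case: pP.
- have : mu.-integrable `[a, b] (EFin \o (fun x => phi x * h x)).
    by apply: primitive_on_integrableM pP _ => //; case: pV.
  by apply: eq_integrable => // x _; rewrite /= mulrC.
Qed.

End primitives.

(** * Smooth bumps built from exp(-1/t) *)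

Section flat_functions.
Variable R : realType.
Implicit Types (p q : {poly R}) (t x : R).

(** A polynomial in 1/t times exp(-1/t): the smallest shape closed under differentiation, which acts
    on the polynomial as p -> X^2 (p - p'). *)
Definition flat p t : R := if 0 < t then p.[t^-1] * expR (- t^-1) else 0.

Lemma poly_bound p : exists C n, 0 <= C /\ forall s, 1 <= s -> `|p.[s]| <= C * s ^+ n.
Proof.
elim/poly_ind: p => [|p c [C [n [C0 IH]]]].
  by exists 0, 0%N; split => // s _; rewrite horner0 normr0 mul0r.
exists (C + `|c|), n.+1; split; first by rewrite addr_ge0.
move=> s s1; rewrite hornerMXaddC (le_trans (ler_normD _ _))// mulrDl.
apply: lerD; last by rewrite ler_peMr// exprn_ege1.
rewrite normrM (@ger0_norm _ s) ?(le_trans ler01)// exprSr mulrA.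
by rewrite ler_wpM2r ?IH// (le_trans ler01).
Qed.

(** The exponential beats every power of 1/t. The second power of t is what makes the difference
    quotient at 0 vanish in [is_derive_flat]. *)
Lemma flat_small p : exists C, 0 <= C /\ forall t, `|t| <= 1 -> `|flat p t| <= C * t ^+ 2.
Proof.
have [C [n [C0 pC]]] := poly_bound p.
exists (C * n.+2`!%:R); split; first by rewrite mulr_ge0.
move=> t t1; rewrite /flat; case: ifPn => t0; last by rewrite normr0 mulr_ge0 ?sqr_ge0 ?mulr_ge0.
rewrite gtr0_norm// in t1.
have s1 : 1 <= t^-1 by rewrite invf_ge1.
have s0 : 0 < t^-1 by rewrite invr_gt0.
have := expR_ge1Dxn n.+1 (ltW s0); set s := t^-1 in s1 s0 *.
move=> es; have {}es : s ^+ n.+2 <= n.+2`!%:R * expR s.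
  rewrite -ler_pdivrMl ?ltr0n ?fact_gt0// mulrC; apply: le_trans es.
  by rewrite lerDr.
rewrite normrM (ger0_norm (expR_ge0 _)) expRN.
have -> : t ^+ 2 = (s ^+ 2)^-1 by rewrite /s exprVn invrK.
rewrite ler_pdivrMr ?expR_gt0// mulrAC ler_pdivlMr ?exprn_gt0//.
apply: (@le_trans _ _ (C * s ^+ n * s ^+ 2)); first by rewrite ler_wpM2r ?sqr_ge0 ?pC.
by rewrite -mulrA -exprD addn2 -mulrA ler_wpM2l.
Qed.

Lemma flat_le0 p t : t <= 0 -> flat p t = 0.
Proof. by rewrite /flat leNgt => /negbTE ->. Qed.

Lemma is_derive_flat p t :
  is_derive t (1 : R) (flat p) (flat ('X^2 * (p - p^`())) t).
Proof.
have [t0|t0|->] := ltgtP t 0.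
- rewrite flat_le0 ?ltW//; apply: (@near_eq_is_derive _ _ _ (cst 0)).
    near=> z; rewrite flat_le0//; apply: ltW; near: z; exact: lt_nbhsl.
- have H : is_derive t (1 : R) (fun t => p.[t^-1] * expR (- t^-1))
      (flat ('X^2 * (p - p^`())) t).
    have t0' : t != 0 by rewrite gt_eqF.
    have dV : is_derive t (1 : R) (fun t => t^-1) (- t ^- 2).
      have := is_deriveV t0' (is_derive_id t (1 : R)) => H.
      by apply: (is_derive_eq H); rewrite /GRing.scale/= mulr1.
    have d1 := @is_derive1_comp _ (horner p) (fun t => t^-1) t _ _ (is_derive_poly p _) dV.
    have d2 := @is_derive1_comp _ expR (fun t => - t^-1) t _ _ (is_derive_expR _) (is_deriveN dV).
    have d3 := is_deriveM d1 d2.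
    apply: (is_derive_eq d3); rewrite /flat t0 !hornerE/= /GRing.scale/=.
    by field.
  apply: (@near_eq_is_derive _ _ _ (fun t => p.[t^-1] * expR (- t^-1))) => //.
  near=> z; rewrite /flat ifT//; near: z; exact: lt_nbhsr.
- rewrite [flat (_ * _) _]flat_le0//.
  have [C [C0 HC]] := flat_small p.
  suff H : h^-1 *: (flat p (h + 0) - flat p 0) @[h --> 0^'] --> (0 : R).
    split; last by apply/cvg_lim => //; rewrite /GRing.scale/= in H *; under eq_fun do rewrite mulr1.
    apply/cvg_ex; exists 0; rewrite /=; under eq_fun do rewrite [_ *: 1]mulr1; exact: H.
  apply/cvgrPdist_le => e e0; near=> h.
  rewrite sub0r normrN addr0 (flat_le0 _ (lexx 0)) subr0 /GRing.scale/= normrM normfV.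
  have h0 : h != 0 by near: h; exact: nbhs_dnbhs_neq.
  have h1 : `|h| <= 1 by near: h; apply: dnbhs0_le.
  have h2 : `|h| <= e / (C + 1) by near: h; apply: dnbhs0_le; rewrite divr_gt0// ltr_wpDl.
  rewrite ler_pdivrMl ?normr_gt0//.
  apply: (le_trans (HC h h1)).
  rewrite -real_normK ?num_real// expr2 mulrCA ler_wpM2l//.
  move: h2; rewrite ler_pdivlMr ?ltr_wpDl// => h2; apply: le_trans h2.
  by rewrite mulrC ler_wpM2l// lerDl.
Unshelve. all: by end_near. Qed.

(** A class that contains the bumps and is stable under differentiation, so that one derivative
    computation settles smoothness of every order. *)
Inductive bump_span : (R -> R) -> Prop :=
| bump_span_base p q (a b c d : R) :
    bump_span (fun x => flat p (a * x + b) * flat q (c * x + d))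
| bump_span_add f g : bump_span f -> bump_span g -> bump_span (fun x => f x + g x)
| bump_span_scale (k : R) f : bump_span f -> bump_span (fun x => k * f x).

Lemma bump_span_deriv f : bump_span f ->
  exists2 f', bump_span f' & forall x, is_derive x (1 : R) f (f' x).
Proof.
elim => {f} [p q a b c d|f g _ [f' Bf df] _ [g' Bg dg]|k f _ [f' Bf df]].
- have aff (u v : R) x : is_derive x (1 : R) (fun x => u * x + v) u.
    have H := is_deriveD (is_deriveZ u (is_derive_id x (1 : R))) (is_derive_cst v x (1 : R)).
    by apply: (is_derive_eq H); rewrite addr0 /GRing.scale/= mulr1.
  pose D r := 'X^2 * (r - r^`()) : {poly R}.
  exists (fun x => a * (flat (D p) (a * x + b) * flat q (c * x + d)) +
     c * (flat p (a * x + b) * flat (D q) (c * x + d))).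
    by apply: bump_span_add; apply: bump_span_scale; exact: bump_span_base.
  move=> x.
  have d1 := @is_derive1_comp _ (flat p) (fun x => a * x + b) x _ _ (is_derive_flat p _) (aff a b x).
  have d2 := @is_derive1_comp _ (flat q) (fun x => c * x + d) x _ _ (is_derive_flat q _) (aff c d x).
  apply: (is_derive_eq (is_deriveM d1 d2)); rewrite /GRing.scale/= -/(D p) -/(D q); ring.
- exists (fun x => f' x + g' x); first exact: bump_span_add.
  by move=> x; exact: is_deriveD.
- exists (fun x => k * f' x); first exact: bump_span_scale.
  by move=> x; exact: is_deriveZ.
Qed.

Lemma bump_span_derive1 f : bump_span f -> bump_span (derive1 f) /\
  forall x, is_derive x (1 : R) f (derive1 f x).
Proof.
move=> /bump_span_deriv[f' Bf' df].
have <- : f' = derive1 f by apply/funext => x; rewrite derive1E derive_val.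
by split.
Qed.

Lemma bump_span_continuous f : bump_span f -> continuous f.
Proof.
move=> /bump_span_derive1[_ df] x; have [+ _] := df x.
by move=> /derivable1_diffP/differentiable_continuous.
Qed.

Lemma bump_span_derive1n f n : bump_span f -> bump_span (derive1n n f).
Proof.
by move=> Bf; elim: n => [//|n IH]; rewrite derive1nS; have [] := bump_span_derive1 IH.
Qed.

(** A smooth approximation of the indicator of []a, b]]. With N = n + 1 the second factor lives on x
    < b + 1/N, and the slope N^2 keeps its argument at least N for all x <= b; hence the limit is
    right at both endpoints, and all supports lie in [[a, b + 1]]. *)
Definition sbump (n : nat) (a b x : R) : R :=
  flat 1 (n.+1%:R * x + - (n.+1%:R * a)) *
  flat 1 (- n.+1%:R ^+ 2 * x + (n.+1%:R ^+ 2 * b + n.+1%:R)).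

Lemma sbump_spanP n a b : bump_span (sbump n a b).
Proof. exact: bump_span_base. Qed.

Lemma flat1_ge0 t : 0 <= flat 1 t.
Proof. by rewrite /flat; case: ifP => // _; rewrite hornerC mul1r expR_ge0. Qed.

Lemma flat1_le1 t : flat 1 t <= 1.
Proof.
rewrite /flat; case: ifP => // t0; rewrite hornerC mul1r -expR0 ler_expR.
by rewrite oppr_le0 invr_ge0 ltW.
Qed.

Lemma sbump_ge0 n a b x : 0 <= sbump n a b x.
Proof. by rewrite mulr_ge0 ?flat1_ge0. Qed.

Lemma sbump_le1 n a b x : sbump n a b x <= 1.
Proof. by rewrite mulr_ile1 ?flat1_ge0 ?flat1_le1. Qed.

Lemma sbump_eq0 n a b x : ~~ (a < x < b + 1) -> sbump n a b x = 0.
Proof.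
have n1 : 1 <= n.+1%:R :> R by rewrite ler1n.
rewrite negb_and -!leNgt => /orP[xa|bx]; rewrite /sbump.
  by rewrite flat_le0 ?mul0r//; nra.
by rewrite [X in _ * X]flat_le0 ?mulr0//; nra.
Qed.

Lemma cvg_flat1 (u : R^nat) : u n @[n --> \oo] --> +oo -> flat 1 (u n) @[n --> \oo] --> (1 : R).
Proof.
move=> uoo.
have pos : \forall n \near \oo, 0 < u n by exact: (cvgry_gt uoo).
have ui : (u n)^-1 @[n --> \oo] --> (0 : R) by exact: (gtr0_cvgV0 pos).2.
have : expR (- (u n)^-1) @[n --> \oo] --> expR (- 0).
  by apply: continuous_cvg; [exact: continuous_expR|exact: cvgN].
rewrite oppr0 expR0; apply: cvg_trans; apply: near_eq_cvg; near=> n.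
rewrite /flat ifT ?hornerC ?mul1r//; near: n; exact: (cvgry_gt uoo).
Unshelve. all: by end_near. Qed.

Lemma cvg_sbump a b x :
  sbump n a b x @[n --> \oo] --> ((a < x <= b)%R%:R : R).
Proof.
have [xa|ax] := leP x a.
  rewrite /= ; under eq_fun do rewrite sbump_eq0 ?ltNge ?xa//; exact: cvg_cst.
have noo : (n.+1%:R : R) @[n --> \oo] --> +oo.
  by apply/cvgryPge => A; near=> n; rewrite (@le_trans _ _ n%:R)// ?ler_nat//;
    near: n; exact: nbhs_infty_ger.
have f1 : flat 1 (n.+1%:R * x + - (n.+1%:R * a)) @[n --> \oo] --> (1 : R).
  have xa0 : 0 < x - a by rewrite subr_gt0.
  have := @cvg_flat1 (fun n => (x - a) * n.+1%:R); rewrite /=.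
  rewrite (_ : (fun n : nat => flat 1 ((x - a) * _)) =
      (fun n => flat 1 (n.+1%:R * x + - (n.+1%:R * a)))); last first.
    by apply/funext => n; congr flat; ring.
  apply; apply/cvgryPge => A; near=> n; rewrite -ler_pdivrMl// mulrC.
  by near: n; exact: (cvgry_ge noo).
have [xb|bx] /= := leP x b.
  rewrite -[X in _ --> X]mulr1; apply: cvgM => //; apply: cvg_flat1.
  apply/cvgryPge => A; near=> n.
  apply: (@le_trans _ _ n.+1%:R); first by near: n; exact: (cvgry_ge noo).
  have : 0 <= n.+1%:R ^+ 2 * (b - x) by rewrite mulr_ge0 ?sqr_ge0 ?subr_ge0.
  by rewrite mulrBr; lra.
have xb0 : 0 < x - b by rewrite subr_gt0.
have c0 : \forall n \near \oo, sbump n a b x = 0.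
  near=> n; rewrite /sbump [X in _ * X]flat_le0 ?mulr0//.
  have : (x - b)^-1 <= n.+1%:R by near: n; exact: (cvgry_ge noo).
  rewrite -(ler_pM2r xb0) mulVf ?gt_eqF// => h.
  have := ler_wpM2l (ler0n R n.+1) h; rewrite mulr1 mulrA -expr2; nra.
by apply: cvg_near_cst.
Unshelve. all: by end_near. Qed.

End flat_functions.

(** * Tensor products of bumps as test functions on the plane *)

Section test_functions.
Variable R : realType.
Local Notation mu := (@lebesgue_measure R).
Local Notation mR := (measurableTypeR R).
Local Notation leb2 := (mu \x mu)%E.

Lemma closure_support_sub (f : R -> R) (a b : R) :
  (forall x, ~~ (a < x < b) -> f x = 0) ->
  closure [set x | f x != 0] `<=` `[a, b].
Proof.
move=> f0; apply: (@subset_trans _ (closure `[a, b]%classic)).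
  apply: closure_subset => x /= fx; rewrite in_itv/=.
  by apply: contraNT fx => h; rewrite f0//; apply: contraNN h => /andP[/ltW -> /ltW ->].
have cl : closed (`[a, b]%classic : set R).
  by apply: compact_closed; [exact: norm_hausdorff|exact: segment_compact].
by rewrite -((closure_id _).1 cl).
Qed.

(** [derivable] and ['D] are both defined from this quotient, so one identity transfers existence
    and value of a partial derivative to the slice. *)
Lemma slice1_quotient (F : R * R -> R) (x y : R) :
  (fun h : R => h^-1 *: ((F \o shift (x, y)) (h *: ((1, 0) : R * R)) - F (x, y))) =
  (fun h : R => h^-1 *: (((fun t => F (t, y)) \o shift x) (h *: (1 : R)) - F (x, y))).
Proof.
apply/funext => h /=; congr (_ *: (F _ - _)).
by rewrite /GRing.add/= /add_pair/= /GRing.scale/= mulr0 add0r.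
Qed.

Lemma slice2_quotient (F : R * R -> R) (x y : R) :
  (fun h : R => h^-1 *: ((F \o shift (x, y)) (h *: ((0, 1) : R * R)) - F (x, y))) =
  (fun h : R => h^-1 *: (((fun t => F (x, t)) \o shift y) (h *: (1 : R)) - F (x, y))).
Proof.
apply/funext => h /=; congr (_ *: (F _ - _)).
by rewrite /GRing.add/= /add_pair/= /GRing.scale/= mulr0 add0r.
Qed.

Lemma slice1_derivable (F : R * R -> R) (x y : R) :
  derivable F (x, y) (1, 0) = derivable (fun t => F (t, y)) x (1 : R).
Proof. by rewrite /derivable slice1_quotient. Qed.

Lemma slice2_derivable (F : R * R -> R) (x y : R) :
  derivable F (x, y) (0, 1) = derivable (fun t => F (x, t)) y (1 : R).
Proof. by rewrite /derivable slice2_quotient. Qed.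

Lemma slice1_derive (F : R * R -> R) (x y : R) :
  'D_(1, 0) F (x, y) = 'D_(1 : R) (fun t => F (t, y)) x.
Proof. by rewrite /derive slice1_quotient. Qed.

Lemma slice2_derive (F : R * R -> R) (x y : R) :
  'D_(0, 1) F (x, y) = 'D_(1 : R) (fun t => F (x, t)) y.
Proof. by rewrite /derive slice2_quotient. Qed.

Lemma partials_tensor (s : seq bool) (f g : R -> R) : bump_span f -> bump_span g ->
  exists f' g', [/\ bump_span f', bump_span g' &
    partials s (fun z => f z.1 * g z.2) = (fun z => f' z.1 * g' z.2)].
Proof.
move=> Bf Bg; elim: s => [|b s [f' [g' [Bf' Bg' E]]]]; first by exists f, g.
have [Bf1 df] := bump_span_derive1 Bf'; have [Bg1 dg] := bump_span_derive1 Bg'.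
case: b => /=; rewrite -/(partials s _) E.
  exists f', (derive1 g'); split => //; apply/funext => -[x y] /=.
  rewrite slice2_derive.
  by have [_] := is_deriveZ (f' x) (dg y).
exists (derive1 f'), g'; split => //; apply/funext => -[x y] /=.
rewrite slice1_derive mulrC (_ : (fun t => _) = (fun t => g' y *: f' t)).
  by have [_] := is_deriveZ (g' y) (df x).
by apply/funext => t; rewrite mulrC.
Qed.

Lemma tensor_derivable (b : bool) (f g : R -> R) (z : R * R) :
  bump_span f -> bump_span g ->
  derivable (fun z : R * R => f z.1 * g z.2) z (axis R b).
Proof.
move=> Bf Bg; case: z => x y.
have [_ df] := bump_span_derive1 Bf; have [_ dg] := bump_span_derive1 Bg.
case: b.
  by rewrite slice2_derivable; have [] := is_deriveZ (f x) (dg y).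
rewrite slice1_derivable (_ : (fun t => _) = (fun t => g y *: f t)).
  by have [] := is_deriveZ (g y) (df x).
by apply/funext => t; rewrite mulrC.
Qed.

Lemma tensor_continuous (f g : R -> R) : continuous f -> continuous g ->
  continuous (fun z : R * R => f z.1 * g z.2).
Proof.
move=> cf cg z; apply: cvgM.
  by apply: (cvg_comp fst f); [exact: cvg_fst|exact: cf].
by apply: (cvg_comp snd g); [exact: cvg_snd|exact: cg].
Qed.

Lemma bump_span_test_plane (f g : R -> R) (a b c d : R) :
  bump_span f -> bump_span g ->
  (forall x, ~~ (a < x < b) -> f x = 0) -> (forall x, ~~ (c < x < d) -> g x = 0) ->
  test_plane (fun z : R * R => f z.1 * g z.2).
Proof.
move=> Bf Bg f0 g0; split.
  move=> s; have [f' [g' [Bf' Bg' ->]]] := partials_tensor s Bf Bg; split.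
    by apply: tensor_continuous; exact: bump_span_continuous.
  by move=> z b'; exact: tensor_derivable.
apply: (subclosed_compact (@closed_closure _ _)
  (compact_setX (@segment_compact _ a b) (@segment_compact _ c d))).
rewrite [X in _ `<=` X](closure_id _).1; last first.
  exact: compact_closed (compact_setX (@segment_compact _ a b) (@segment_compact _ c d)).
apply: closure_subset => -[x y] /= h; split => /=; rewrite in_itv/=.
  apply: contraNT h => h; rewrite f0 ?mul0r//.
  by apply: contraNN h => /andP[/ltW -> /ltW ->].
apply: contraNT h => h; rewrite g0 ?mulr0//.
by apply: contraNN h => /andP[/ltW -> /ltW ->].
Qed.

Definition bump2 n (a b c d : R) (z : R * R) : R := sbump n a b z.1 * sbump n c d z.2.

Lemma test_plane_bump2 n a b c d : test_plane (bump2 n a b c d).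
Proof.
by apply: (bump_span_test_plane (sbump_spanP n a b) (sbump_spanP n c d)) => x;
  exact: sbump_eq0.
Qed.

End test_functions.

(** * Fundamental lemmas of the calculus of variations *)

Lemma integrable_support d (T : measurableType d) (R : realType)
    (m : {measure set T -> \bar R}) (A D : set T) (f : T -> R) :
  measurable A -> measurable D -> (forall x, ~ A x -> f x = 0) ->
  m.-integrable A (EFin \o f) -> m.-integrable D (EFin \o f).
Proof.
move=> mA mD f0 /(integrable_mkcond _ mA).
move=> /(integrableS measurableT mD (@subsetT _ _)).
apply: eq_integrable => // x _; rewrite patchE.
by case: ifPn => //; rewrite notin_setE => /f0 /= ->.
Qed.

(** Dominated convergence with majorant [|h|] on [K] carries orthogonality to the bumps over to the
    set they approximate. *)
Lemma integral_eq0_bumps d (T : measurableType d) (R : realType)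
    (m : {measure set T -> \bar R}) (h : T -> R) (phi : nat -> T -> R) (K A : set T) :
  measurable K -> measurable A -> measurable_fun [set: T] h ->
  m.-integrable K (EFin \o h) ->
  (forall n, measurable_fun [set: T] (phi n)) ->
  (forall n x, `|phi n x| <= \1_K x) ->
  (forall x, phi n x @[n --> \oo] --> (\1_A x : R)) ->
  (forall n, (\int[m]_x (h x * phi n x)%:E = 0)%E) ->
  (\int[m]_(x in A) (h x)%:E = 0)%E.
Proof.
move=> mK mA mh hK mphi phiK phiA h0.
have ihK : m.-integrable [set: T] (fun x => (`|h x| * \1_K x)%:E).
  have : m.-integrable [set: T] ((EFin \o (fun x => `|h x|)) \_ K).
    apply/integrable_restrict => //; rewrite setTI.
    by have := integrable_abse hK; apply: eq_integrable.
  apply: eq_integrable => // x _; rewrite patchE indicE.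
  by case: ifP => _; rewrite ?mulr1 ?mulr0.
have := @dominated_convergence _ T R m setT measurableT
  (fun n x => (h x * phi n x)%:E) (fun x => (h x * \1_A x)%:E)
  (fun x => (`|h x| * \1_K x)%:E).
case => //.
- by move=> n; apply/measurable_EFinP; exact: measurable_funM.
- by apply/measurable_EFinP; apply: measurable_funM => //; exact: measurable_indic.
- apply: aeW => x _; apply: cvg_EFin; first exact: nearW.
  by apply: cvgM; [exact: cvg_cst|exact: phiA].
- apply: aeW => x n _; rewrite lee_fin normrM ler_wpM2l//.
move=> _ _; rewrite (_ : [sequence _]_n = fun=> 0%E); last first.
  by apply/funext => n /=; exact: h0.
move=> /(cvg_unique _ (cvg_cst _)) => /(_ (@ereal_hausdorff _)) ->.
rewrite integral_mkcond; apply: eq_integral => x _.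
by rewrite patchE indicE; case: ifP => _; rewrite ?mulr1 ?mulr0.
Qed.

Section fundamental_lemmas.
Variable R : realType.
Local Notation mu := (@lebesgue_measure R).
Local Notation mR := (measurableTypeR R).
Local Notation leb2 := (mu \x mu)%E.

Lemma integral_cst_itv (c a b : R) : a <= b ->
  (\int[mu]_(x in `[a, b]) c%:E = (c * (b - a))%:E)%E.
Proof.
move=> ab; transitivity (c%:E * mu `[a, b])%E; first exact: integral_cst.
rewrite lebesgue_measure_itv/= lte_fin; case: ltP => ba; first by rewrite -EFinB -EFinM.
by rewrite (@le_anti _ _ a b) ?ab// subrr mulr0 mule0.
Qed.

Lemma sbump_continuous n (a b : R) : continuous (sbump n a b).
Proof. exact: bump_span_continuous (sbump_spanP n a b). Qed.

Lemma sbump_indic n (a b x : R) : sbump n a b x <= \1_(`[a, (b + 1)]%classic : set R) x.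
Proof.
rewrite indicE mem_setE in_itv/=; case: (boolP (a <= x <= b + 1)) => h /=.
  exact: sbump_le1.
by rewrite sbump_eq0//; apply: contraNN h => /andP[/ltW -> /ltW ->].
Qed.

(** Square integrability makes [h] integrable on bounded boxes; product bumps then give vanishing
    integrals over all half-open boxes, which form a generating pi-system. *)
Lemma plane_test_eq0 (h : R * R -> R) : measurable_fun [set: mR * mR] h ->
  (\int[leb2]_z (h z ^+ 2)%:E < +oo)%E ->
  (forall phi, test_plane phi -> (\int[leb2]_z (h z * phi z)%:E = 0)%E) ->
  {ae leb2, forall z, h z = 0}.
Proof.
move=> mh h2 h0.
have fin (I J : interval R) : mu [set` I] \is a fin_num -> mu [set` J] \is a fin_num ->
    leb2.-integrable ([set` I] `*` [set` J]) (EFin \o h).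
  move=> fI fJ; set K := (X in leb2.-integrable X).
  have mK : measurable (K : set (mR * mR)) by exact: measurableX.
  have := @integrable_mul_L2 _ _ _ leb2 K h (cst 1) mK _ _ _ _.
  rewrite (_ : (fun x => h x * cst 1 x) = h); last by apply/funext => z; rewrite /= mulr1.
  apply.
  - exact: measurable_funTS.
  - exact: measurable_cst.
  - apply: le_lt_trans h2; apply: ge0_subset_integral => //.
      by apply/measurable_EFinP; exact: measurable_funX.
    by move=> z _; rewrite lee_fin sqr_ge0.
  - under eq_integral do rewrite /= expr1n.
    have LK : leb2 K = (mu [set` I] * mu [set` J])%E by exact: leb2_rect.
    have -> : (\int[leb2]_(_ in K) 1 = mu [set` I] * mu [set` J])%E.
      by rewrite -LK -[RHS]mul1e; exact: integral_cst.
    by rewrite ltey_eq fin_numM.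
have itvfin (x y : bool) (a b : R) : mu [set` Interval (BSide x a) (BSide y b)] \is a fin_num.
  by rewrite lebesgue_measure_itv/=; case: ifP.
apply: ae_eq0_plane => //.
  by move=> _ [_ [[a b] _ <-] [_ [[c e] _ <-] <-]]; apply: fin; exact: itvfin.
move=> _ [_ [[a b] _ <-] [_ [[c e] _ <-] <-]] /=.
pose K := (`[a, (b + 1)]%classic `*` `[c, (e + 1)]%classic : set (mR * mR)).
apply: (@integral_eq0_bumps _ _ _ leb2 h (fun n => bump2 n a b c e) K) => //.
- exact: measurableX.
- exact: measurableX.
- by apply: fin; exact: itvfin.
- move=> n; apply: measurable_funM; apply: measurableT_comp => //;
    by apply: continuous_measurable_fun; exact: sbump_continuous.
- move=> n [x y]; rewrite /bump2 /= (ger0_norm (mulr_ge0 (sbump_ge0 n a b x) (sbump_ge0 n c e y))).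
  rewrite /K indicE in_setX /=.
  have := sbump_indic n a b x; have := sbump_indic n c e y.
  rewrite !indicE => h1 h2'.
  rewrite (_ : (_ && _)%:R = (x \in (`[a, (b + 1)]%classic : set R))%:R *
    (y \in (`[c, (e + 1)]%classic : set R))%:R :> R).
    by apply: ler_pM => //; exact: sbump_ge0.
  by rewrite -natrM mulnb.
- move=> [x y]; rewrite indicE in_setX /= !mem_setE !in_itv/=.
  rewrite -mulnb natrM; apply: cvgM; exact: cvg_sbump.
- by move=> n; apply: h0; exact: test_plane_bump2.
Qed.

(** Subtracting from a bump the multiple of one fixed bump [eta] with the same integral leaves the
    derivative of a test function. Pairing [h] with any bump is therefore a fixed constant times the
    integral of the bump, and that constant is [c]. *)
Lemma du_bois_reymond (h : R -> R) : measurable_fun (`]0, +oo[%classic : set R) h ->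
  (forall a b : R, 0 < a -> mu.-integrable `[a, b] (EFin \o h)) ->
  (forall phi, test_halfline phi ->
     (\int[mu]_(r in `]0%R, +oo[) (h r * derive1 phi r)%:E = 0)%E) ->
  exists c, {ae mu, forall x, 0 < x -> h x = c}.
Proof.
move=> mh ih h0.
have D1 : measurable (`]0, +oo[%classic : set mR) by exact: measurable_itv.
have cbi n (a b u v : R) : mu.-integrable `[u, v] (EFin \o sbump n a b).
  apply: continuous_compact_integrable; first exact: segment_compact.
  by apply: continuous_subspaceT; exact: sbump_continuous.
pose I (f : R -> R) u v := \int[mu]_(x in `[u, v]) f x.
have Itot n (a b u v w : R) : u <= a -> b + 1 <= v -> v <= w ->
    I (sbump n a b) u w = I (sbump n a b) u v.
  move=> ua bv vw; rewrite /I /Rintegral; congr fine.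
  rewrite integral_mkcond [RHS]integral_mkcond; apply: eq_integral => x _.
  rewrite !patchE !mem_setE !in_itv/=; case: (leP u x) => //= ux.
  case: (leP x v) => xv; first by rewrite (le_trans xv vw).
  by case: ifP => // _; rewrite sbump_eq0// negb_and -!leNgt (le_trans bv (ltW xv)) orbT.
have msb n (a b : R) : measurable_fun [set: R] (sbump n a b).
  by apply: continuous_measurable_fun; exact: sbump_continuous.
pose eta := sbump 0 1 2 : R -> R.
have eta_gt0 : 0 < I eta 0 3.
  (* On this interval the arguments [x - 1] and [3 - x] of the two flat factors are at least 1/2 and
     1. *)
  have low x : 3 / 2 <= x <= 2 -> expR (- 2) * expR (- 1) <= eta x.
    move=> /andP[x1 x2]; rewrite /eta /sbump /flat !hornerC !mul1r expr1n.
    rewrite !ifT ?mulN1r; [|lra|lra].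
    apply: ler_pM; rewrite ?expR_ge0// ler_expR lerN2.
      by rewrite -[leRHS]invrK lef_pV2 ?posrE; lra.
    by rewrite -[leRHS]invr1 lef_pV2 ?posrE; lra.
  have e0 : 0 < expR (- 2) * expR (- 1) :> R by rewrite mulr_gt0 ?expR_gt0.
  apply: (@lt_le_trans _ _ (expR (- 2) * expR (- 1) / 2)); first by rewrite divr_gt0.
  rewrite -lee_fin /I -EFin_Rintegral//; last exact: cbi.
  apply: (@le_trans _ _ (\int[mu]_(x in `[(3 / 2)%R, 2%R]) (expR (- 2) * expR (- 1))%:E)%E).
    rewrite integral_cst_itv; last by lra.
    by rewrite lee_fin (_ : 2 - 3 / 2 = 2^-1); last by lra.
  apply: (@le_trans _ _ (\int[mu]_(x in `[(3 / 2)%R, 2%R]) (eta x)%:E)%E).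
    apply: ge0_le_integral => //.
    by apply/measurable_EFinP; exact: measurable_funTS (msb _ _ _).
  apply: ge0_subset_integral => //.
  - by apply/measurable_EFinP; exact: measurable_funTS (msb _ _ _).
  - by move=> x _; rewrite lee_fin sbump_ge0.
  - by move=> x /=; rewrite !in_itv/=; lra.
have ihb m (u v : R) : 0 < u ->
    mu.-integrable `]0, +oo[ (EFin \o (fun r => h r * sbump m u v r)).
  move=> u0.
  have : mu.-integrable `[u, v + 1] (EFin \o (fun r => h r * sbump m u v r)).
    apply: (le_integrable _ _ _ (ih u (v + 1) u0)) => //.
      apply/measurable_EFinP; apply: measurable_funM.
        apply: measurable_funS mh => // x /=; rewrite !in_itv/= andbT.
        by move=> /andP[/(lt_le_trans u0)].
      exact: measurable_funTS (msb _ _ _).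
    move=> x _; rewrite lee_fin normrM ler_piMr// ger0_norm ?sbump_ge0//.
    exact: sbump_le1.
  apply: integrable_support => // x /= hx; rewrite sbump_eq0 ?mulr0//.
  by apply/negP => hx'; apply: hx; rewrite in_itv/=; move: hx' => /andP[/ltW -> /ltW ->].
have key n (a b : R) : 0 < a ->
    (\int[mu]_(r in `]0%R, +oo[) (h r * sbump n a b r)%:E =
     (I (sbump n a b) 0 (Num.max 3 (b + 1)) / I eta 0 3)%:E *
     \int[mu]_(r in `]0%R, +oo[) (h r * eta r)%:E)%E.
  move=> a0; set B := Num.max 3 (b + 1); set k := _ / _.
  have B3 : 3 <= B by rewrite le_max lexx.
  have Bb : b + 1 <= B by rewrite le_max lexx orbT.
  (* []al, B[] contains the supports of both bumps, the one of [eta] being []1, 3[], and [al > 0]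
     keeps the primitive a test function on the open half-line. *)
  pose al := Num.min a 1; have al0 : 0 < al by rewrite lt_min a0 ltr01.
  have ala : al <= a by rewrite ge_min lexx.
  have al1 : al <= 1 by rewrite ge_min lexx orbT.
  pose chi x := sbump n a b x + (- k) * eta x.
  have Bchi : bump_span chi.
    by apply: bump_span_add; [exact: sbump_spanP|apply: bump_span_scale; exact: sbump_spanP].
  have chi0 x : ~~ (al < x < B) -> chi x = 0.
    move=> hx; rewrite /chi /eta !sbump_eq0 ?mulr0 ?addr0//; apply: contraNN hx => /andP[x1 x2];
      by apply/andP; split; lra.
  have cchi := bump_span_continuous Bchi.
  have ichi u v : mu.-integrable `[u, v] (EFin \o chi).
    apply: continuous_compact_integrable; first exact: segment_compact.
    exact: continuous_subspaceT.
  have Ichi : I chi 0 B = 0.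
    rewrite /I /chi RintegralD//; last by apply: integrable_mulr => //; exact: cbi.
    rewrite RintegralZl//; last exact: cbi.
    have IE : I eta 0 B = I eta 0 3 by apply: Itot => //; lra.
    rewrite -/(I _ 0 B) -/(I eta 0 B) IE.
    by rewrite /k mulNr divfK ?subrr// gt_eqF.
  pose phi x := I chi 0 x.
  have dphi x : is_derive x (1 : R) phi (chi x).
    have [x0|x0] := ltP 0 x.
      have xl : x < x + 1 by rewrite ltrDl.
      have [d e] := continuous_FTC1_closed xl (ichi 0 (x + 1)) x0 (cchi x).
      by split; [exact: d|rewrite -derive1E; exact: e].
    rewrite chi0 ?negb_and -?leNgt ?(le_trans x0 (ltW al0))//.
    apply: (@near_eq_is_derive _ _ _ (cst 0)).
    near=> z; rewrite /phi /I /Rintegral integral0_eq// => y /=; rewrite in_itv/= => /andP[y0 yz].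
    rewrite chi0// negb_and -!leNgt (le_trans yz)//; apply: ltW.
    near: z; apply: lt_nbhsl; exact: le_lt_trans al0.
  have d1phi : derive1 phi = chi by apply/funext => x; rewrite derive1E derive_val.
  have phi0 x : ~~ (al < x < B) -> phi x = 0.
    rewrite negb_and -!leNgt => /orP[xal|Bx].
      rewrite /phi /I /Rintegral integral0_eq// => y /=; rewrite in_itv/= => /andP[y0 yz].
      by rewrite chi0// negb_and -!leNgt (le_trans yz).
    rewrite /phi -[RHS]Ichi /I /Rintegral; congr fine.
    rewrite integral_mkcond [RHS]integral_mkcond; apply: eq_integral => y _.
    rewrite !patchE !mem_setE !in_itv/=; case: (leP 0 y) => //= y0.
    case: (leP y B) => yB; first by rewrite (le_trans yB Bx).
    by case: ifP => // _; rewrite chi0// negb_and -!leNgt (ltW yB) orbT.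
  have tphi : test_halfline phi.
    split.
    - move=> [|m] x; first by have [] := dphi x.
      rewrite /derive1n iterSr d1phi.
      by have [_ /(_ x)[]] := bump_span_derive1 (bump_span_derive1n m Bchi).
    - apply: (subclosed_compact _ (@segment_compact _ al B)); first exact: closed_closure.
      exact: closure_support_sub.
    - apply: (subset_trans (closure_support_sub phi0)) => x /=; rewrite !in_itv/= andbT.
      by move=> /andP[/(lt_le_trans al0)].
  have := h0 phi tphi; rewrite d1phi.
  rewrite (_ : (fun r => _) = (fun r => (h r * sbump n a b r + (- k) * (h r * eta r))%:E)); last first.
    by apply/funext => r; congr EFin; rewrite /chi; ring.
  rewrite EFin_Rintegral//; last first.
    by apply: integrable_addr => //; [exact: ihb|apply: integrable_mulr => //; exact: ihb].
  rewrite RintegralD//; [|exact: ihb|by apply: integrable_mulr => //; exact: ihb].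
  rewrite RintegralZl//; last exact: ihb.
  move=> [] /eqP; rewrite mulNr subr_eq0 => /eqP E.
  by rewrite !EFin_Rintegral// ?E//; exact: ihb.
pose c := fine (\int[mu]_(r in `]0%R, +oo[) (h r * eta r)%:E)%E / I eta 0 3.
exists c.
have cst_int (a b : R) : mu.-integrable `[a, b] (EFin \o (cst c)).
  apply: continuous_compact_integrable; first exact: segment_compact.
  by apply: continuous_subspaceT => x; exact: cvg_cst.
have ihc (a b : R) : 0 < a -> mu.-integrable `[a, b] (EFin \o (fun x => h x - c)).
  by move=> a0; apply: integrable_subr => //; exact: ih.
suff : {ae mu, forall x, 0 < x -> h x - c = 0}.
  by apply: ae_imp => x hx x0; apply/eqP; rewrite -subr_eq0; apply/eqP; exact: hx.
apply: ae_eq0_halfline.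
- by apply: measurable_funB => //; exact: measurable_cst.
- move=> a b a0; apply: integrableS (ihc a b a0) => // x /=.
  by rewrite !in_itv/= => /andP[/ltW -> ->].
move=> a b a0.
pose h' := (fun x => h x - c) \_ (`]0, +oo[%classic : set R).
rewrite (_ : (\int[mu]_(x in `]a, b]) _)%E = (\int[mu]_(x in `]a, b]) (h' x)%:E)%E); last first.
  apply: eq_integral => x; rewrite inE/= in_itv/= => /andP[ax _].
  by rewrite /h' patchE mem_setE in_itv/= (lt_trans a0 ax).
apply: (@integral_eq0_bumps _ mR _ mu h' (fun n => sbump n a b) `[a, (b + 1)]%classic) => //.
- apply/(measurable_restrictT (fun x => h x - c)) => //.
  by apply: measurable_funB => //; exact: measurable_cst.
- apply: eq_integrable (ihc a (b + 1) a0) => // x; rewrite inE/= in_itv/= => /andP[ax _].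
  by rewrite /h' patchE mem_setE in_itv/= (lt_le_trans a0 ax).
- by move=> n; exact: msb.
- by move=> n x; rewrite ger0_norm ?sbump_ge0//; exact: sbump_indic.
- move=> x; rewrite indicE mem_setE in_itv/=; exact: cvg_sbump.
move=> n; set B := Num.max 3 (b + 1).
have isb : mu.-integrable `]0, +oo[ (EFin \o (fun r => sbump n a b r)).
  have := cbi n a b a (b + 1).
  apply: integrable_support => // x /= hx; rewrite sbump_eq0//.
  by apply/negP => hx'; apply: hx; rewrite in_itv/=; move: hx' => /andP[/ltW -> /ltW ->].
have Isb : \int[mu]_(r in `]0%R, +oo[) sbump n a b r = I (sbump n a b) 0 B.
  rewrite /I /Rintegral; congr fine; rewrite -integral_itv_obnd_cbnd; last first.
    by apply/measurable_EFinP; exact: measurable_funTS (msb _ _ _).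
  rewrite integral_mkcond [RHS]integral_mkcond; apply: eq_integral => x _.
  rewrite !patchE !mem_setE !in_itv/= andbT; case: (ltP 0 x) => //= x0.
  case: ifPn => //; rewrite -ltNge => xB.
  rewrite sbump_eq0// negb_and -!leNgt orbC (le_trans _ (ltW xB))//.
  by rewrite /B le_max lexx orbT.
rewrite (_ : (\int[mu]_x _)%E = (\int[mu]_(x in `]0%R, +oo[)
    (h x * sbump n a b x + (- c) * sbump n a b x)%:E)%E); last first.
  rewrite [RHS]integral_mkcond; apply: eq_integral => x _.
  rewrite /h' !patchE; case: ifP => _; last by rewrite mul0r.
  by rewrite mulrBl mulNr.
rewrite EFin_Rintegral//; last first.
  by apply: integrable_addr => //; [exact: ihb|exact: integrable_mulr].
rewrite RintegralD//; [|exact: ihb|exact: integrable_mulr].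
rewrite RintegralZl// Isb; congr EFin.
have := key n a b a0; rewrite -/B !EFin_Rintegral//; [|exact: ihb..].
move=> [] ->; rewrite /c -/(Rintegral _ _ _); ring.
Unshelve. all: by end_near. Qed.

End fundamental_lemmas.

Lemma ae_imp2 d (T : measurableType d) (R : realType)
    (m : {measure set T -> \bar R}) (P Q S : T -> Prop) :
  (forall x, P x -> Q x -> S x) -> {ae m, forall x, P x} -> {ae m, forall x, Q x} ->
  {ae m, forall x, S x}.
Proof. by move=> PQS; exact: filterS2. Qed.

Lemma integral_support d (T : measurableType d) (R : realType)
    (m : {measure set T -> \bar R}) (A D : set T) (f : T -> R) :
  A `<=` D -> (forall x, D x -> ~ A x -> f x = 0) ->
  (\int[m]_(x in D) (f x)%:E = \int[m]_(x in A) (f x)%:E)%E.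
Proof.
move=> AD f0; rewrite integral_mkcond [RHS]integral_mkcond.
apply: eq_integral => x _; rewrite !patchE.
have [Dx|Dx] := pselect (D x).
  rewrite (mem_set Dx); have [Ax|Ax] := pselect (A x); first by rewrite (mem_set Ax).
  by rewrite (memNset Ax) f0.
by rewrite (memNset Dx) memNset// => /AD.
Qed.

(** * Radial profiles and their lifts to the plane *)

Section radial_pairs.
Variable R : realType.
Local Notation mu := (@lebesgue_measure R).
Local Notation mR := (measurableTypeR R).
Local Notation Rpos := (`]0, +oo[%classic : set R).

Lemma measurable_Rpos : measurable (Rpos : set mR).
Proof. exact: measurable_itv. Qed.

Definition L2w (f : R -> R) : Prop := measurable_fun Rpos f /\
  (\int[mu]_(r in `]0%R, +oo[) (f r ^+ 2 * r)%:E < +oo)%E.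

Lemma L2w_integrable f (a b : R) : L2w f -> 0 < a ->
  mu.-integrable `[a, b] (EFin \o f) /\
  (\int[mu]_(r in `[a, b]) (f r ^+ 2)%:E < +oo)%E.
Proof.
move=> [mf f2] a0.
have sub : `[a, b] `<=` Rpos.
  by move=> x /=; rewrite !in_itv/= andbT => /andP[/(lt_le_trans a0)].
have mfab : measurable_fun (`[a, b]%classic : set R) f by exact: measurable_funS mf.
have fab : (\int[mu]_(r in `[a, b]) (f r ^+ 2)%:E < +oo)%E.
  apply: (@le_lt_trans _ _ ((a^-1)%:E * \int[mu]_(r in `]0%R, +oo[) (f r ^+ 2 * r)%:E)%E).
    rewrite -ge0_integralZl//.
    - apply: (@le_trans _ _ (\int[mu]_(r in `[a, b]) ((a^-1)%:E * (f r ^+ 2 * r)%:E))%E).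
        apply: ge0_le_integral => //.
        - by move=> x _; rewrite lee_fin sqr_ge0.
        - by apply/measurable_EFinP; exact: measurable_funX.
        - apply/measurable_EFinP; apply: measurable_funM; first exact: measurable_cst.
          by apply: measurable_funM => //; exact: measurable_funX.
        - move=> x /=; rewrite in_itv/= lee_fin => /andP[ax _].
          by rewrite mulrCA ler_peMr ?sqr_ge0// ler_pdivlMl// mulr1.
      apply: ge0_subset_integral => //.
      - apply/measurable_EFinP; apply: measurable_funM; first exact: measurable_cst.
        by apply: measurable_funM => //; exact: measurable_funX.
      - move=> x /=; rewrite in_itv/= andbT lee_fin => x0.
        by apply: mulr_ge0; [rewrite invr_ge0 ltW|apply: mulr_ge0; [exact: sqr_ge0|exact: ltW]].
    - apply/measurable_EFinP.
      by apply: measurable_funM => //; exact: measurable_funX.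
    - move=> x /=; rewrite in_itv/= andbT lee_fin => x0.
      by rewrite mulr_ge0 ?sqr_ge0// ltW.
    - by rewrite lee_fin invr_ge0 ltW.
  rewrite lte_mul_pinfty// ?lee_fin ?invr_ge0 ?ltW//.
split => //.
have := @integrable_mul_L2 _ _ _ mu `[a, b]%classic f (cst 1).
rewrite (_ : (fun x => f x * cst 1 x) = f); last by apply/funext => z; rewrite /= mulr1.
apply => //.
have [ba|ab] := ltP b a; first by rewrite set_itv_ge ?integral_set0 ?ltry// bnd_simp -ltNge.
by under eq_integral do rewrite /= expr1n; rewrite integral_cst_itv ?ltry.
Qed.

Lemma Rintegral_itv_add (g : R -> R) (x y z : R) : x <= y -> y <= z ->
  mu.-integrable `[x, z] (EFin \o g) ->
  \int[mu]_(t in `[x, z]) g t =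
  \int[mu]_(t in `[x, y]) g t + \int[mu]_(t in `[y, z]) g t.
Proof.
move=> xy yz ig.
have := Rintegral_itvB ig; move=> /(_ y); rewrite !bnd_simp => /(_ xy yz).
have iyz : mu.-integrable `[y, z] (EFin \o g).
  apply: integrableS ig => // t /=; rewrite !in_itv/= => /andP[yt ->].
  by rewrite (le_trans xy yt).
rewrite Rintegral_itv_obnd_cbnd; last first.
  by apply: integrableS iyz => // t /=; rewrite !in_itv/= => /andP[/ltW -> ->].
by move=> <-; rewrite addrC subrK.
Qed.

Definition primitive0 (f g : R -> R) : Prop :=
  forall a b, 0 < a -> a <= b -> primitive_on a b f g.

Lemma primitive_exists (g : R -> R) :
  (forall a b : R, 0 < a -> mu.-integrable `[a, b] (EFin \o g)) ->
  exists V, primitive0 V g.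
Proof.
move=> ig.
(* The signed integral from 1 to [r]: one of the two intervals is always empty or a point. *)
exists (fun r => \int[mu]_(t in `[1, r]) g t - \int[mu]_(t in `[r, 1]) g t).
move=> a b a0 ab; split; first exact: ig.
move=> x y ax xy yb; have x0 : 0 < x by exact: lt_le_trans ax.
have y0 : 0 < y by exact: lt_le_trans xy.
have e (u v : R) : v < u \/ u = v -> \int[mu]_(t in `[u, v]) g t = 0.
  case=> [vu|->]; first by rewrite set_itv_ge ?Rintegral_set0// bnd_simp -ltNge.
  by rewrite set_itv1 Rintegral_set1.
have e1 (u v : R) : v <= u -> \int[mu]_(t in `[u, v]) g t = 0.
  by rewrite le_eqVlt => /predU1P[->|vu]; apply: e; [right|left].
have [x1|x1] := leP 1 x.
  rewrite (e1 x 1)// (e1 y 1) ?(le_trans x1 xy)// !subr0.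
  by rewrite (@Rintegral_itv_add g 1 x y)//; [rewrite addrC addKr|exact: ig].
have [y1|y1] := leP 1 y.
  rewrite (e1 1 x) ?(ltW x1)// (e1 y 1)// (@Rintegral_itv_add g x 1 y) ?(ltW x1)//.
    by rewrite subr0 sub0r opprK addrC.
  exact: ig.
rewrite (e1 1 x) ?(ltW x1)// (e1 1 y) ?(ltW y1)// !sub0r opprK.
by rewrite (@Rintegral_itv_add g x y 1) ?(ltW y1)//; [rewrite addrC addrK|exact: ig].
Qed.

Lemma primitive0_continuous (f g : R -> R) : primitive0 f g -> {in Rpos, continuous f}.
Proof.
move=> pf x; rewrite inE/= in_itv/= andbT => x0.
have x2 : 0 < x / 2 by rewrite divr_gt0.
have ab : x / 2 < x + 1 by lra.
have /(continuous_within_itvP _ ab)[+ _ _] :=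
  primitive_on_continuous (ltW ab) (pf _ _ x2 (ltW ab)).
by apply; rewrite in_itv/=; apply/andP; split; lra.
Qed.

Lemma primitive0_measurable (f g : R -> R) : primitive0 f g -> measurable_fun Rpos f.
Proof.
move=> pf; apply: open_continuous_measurable_fun; first exact: interval_open.
exact: primitive0_continuous pf.
Qed.

Lemma test_halfline_support (phi : R -> R) : test_halfline phi ->
  exists a b, [/\ 0 < a, a <= b & forall x, ~~ (a < x < b) -> phi x = 0 /\ derive1 phi x = 0].
Proof.
move=> [dphi cK sub]; set K := closure _ in cK sub.
have [M [_ HM]] := compact_bounded cK.
(* The support stays away from 0 because its image under inversion is compact, hence bounded. *)
have cinv : {within K, continuous (fun x : R => x^-1)}.
  apply: continuous_in_subspaceT => x; rewrite inE => /sub/=; rewrite in_itv/= andbT => x0.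
  by apply: cvgV; [rewrite gt_eqF|exact: cvg_id].
have [M' [_ HM']] := compact_bounded (continuous_compact cinv cK).
pose b := `|M| + 1; pose m := `|M'| + 1.
have b0 : 0 < b by rewrite ltr_wpDl.
have m0 : 0 < m by rewrite ltr_wpDl.
have Kb x : K x -> 0 < x /\ m^-1 <= x <= b.
  move=> Kx; have := sub _ Kx; rewrite /= in_itv/= andbT => x0; split => //.
  have Mb : M < b by rewrite (le_lt_trans (ler_norm M))// ltrDl.
  have Mm : M' < m by rewrite (le_lt_trans (ler_norm M'))// ltrDl.
  have := HM _ Mb _ Kx; rewrite /= gtr0_norm// => ->; rewrite andbT.
  have /= := HM' _ Mm x^-1 (ex_intro2 _ _ x Kx erefl).
  by rewrite gtr0_norm ?invr_gt0// => h; rewrite invf_ple ?posrE.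
have z x : ~ K x -> phi x = 0.
  move=> Kx; apply/eqP; apply: contra_notT Kx => h; exact: subset_closure.
(* The interval is strictly larger than the support, so [phi] vanishes near every outside point, the
   endpoints included, and its derivative with it. The maximum keeps the endpoints in order even for
   an empty support. *)
exists (m^-1 / 2), (Num.max (b + 1) (m^-1)); split.
- by rewrite divr_gt0// invr_gt0.
- have mi0 : 0 < m^-1 by rewrite invr_gt0.
  by rewrite le_max; apply/orP; right; lra.
move=> x hx.
have nearz : \forall y \near x, phi y = 0.
  have [xm|xm] := leP x (m^-1 / 2).
    near=> y; apply: z => /Kb[_ /andP[my _]].
    have : y < m^-1 by near: y; apply: lt_nbhsl; rewrite (le_lt_trans xm)//
      ltr_pdivrMr// ltr_pMr ?invr_gt0// ltr1n.
    by rewrite ltNge my.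
  have xb : b < x.
    move: hx; rewrite xm/= -leNgt ge_max => /andP[h _].
    by rewrite (lt_le_trans _ h)// ltrDl.
  near=> y; apply: z => /Kb[_ /andP[_ yb]].
  have : b < y by near: y; exact: lt_nbhsr.
  by rewrite ltNge yb.
split; first exact: nbhs_singleton nearz.
by rewrite derive1E (near_eq_derive _ nearz); exact: derive_cst.
Unshelve. all: by end_near. Qed.

Lemma test_halfline_is_derive (phi : R -> R) : test_halfline phi ->
  (forall x, is_derive x (1 : R) phi (derive1 phi x)) /\ continuous (derive1 phi).
Proof.
move=> [dphi _ _]; split => x.
  by split; [exact: (dphi 0%N x)|rewrite derive1E].
by have := dphi 1%N x; rewrite derive1n1 => /derivable1_diffP/differentiable_continuous.
Qed.

Lemma primitive0_weak (f g : R -> R) : primitive0 f g ->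
  forall phi, test_halfline phi ->
    (\int[mu]_(r in `]0%R, +oo[) (f r * derive1 phi r)%:E =
     - \int[mu]_(r in `]0%R, +oo[) (g r * phi r)%:E)%E.
Proof.
move=> pf phi tphi.
have [a [b [a0 ab z]]] := test_halfline_support tphi.
have [dphi cphi] := test_halfline_is_derive tphi.
have cphi0 : continuous phi.
  by move=> x; have [+ _] := dphi x; move=> /derivable1_diffP/differentiable_continuous.
have sub : `[a, b] `<=` Rpos.
  by move=> x /=; rewrite !in_itv/= andbT => /andP[/(lt_le_trans a0)].
have nab x : ~ (`[a, b]%classic x) -> ~~ (a < x < b).
  by move=> h; apply/negP => /andP[ax xb]; apply: h; rewrite /= in_itv/= !ltW.
rewrite (@integral_support _ _ _ mu `[a, b]%classic)//; last first.
  by move=> x _ /nab /z[_ ->]; rewrite mulr0.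
rewrite [in RHS](@integral_support _ _ _ mu `[a, b]%classic)//; last first.
  by move=> x _ /nab /z[-> _]; rewrite mulr0.
have pab := pf a b a0 ab.
have ic (h : R -> R) : continuous h -> mu.-integrable `[a, b] (EFin \o h).
  by move=> ch; apply: continuous_compact_integrable;
    [exact: segment_compact|exact: continuous_subspaceT].
have i1 : mu.-integrable `[a, b] (EFin \o (fun x => f x * derive1 phi x)).
  by apply: primitive_on_integrableM pab _ => //; exact: ic.
have pphi := C1_primitive_on ab (fun x _ => dphi x) (fun x _ => cphi x).
have i2 : mu.-integrable `[a, b] (EFin \o (fun x => g x * phi x)).
  have : mu.-integrable `[a, b] (EFin \o (fun x => phi x * g x)).
    by apply: primitive_on_integrableM pphi _ => //; case: pab.
  by apply: eq_integrable => // x _; rewrite /= mulrC.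
rewrite !EFin_Rintegral// -EFinN; congr EFin.
apply: ibp_test pab _ _ _ _ => //.
- by move=> x _; exact: cphi.
- by have [] := z a _; rewrite ?ltxx.
- by have [] := z b _; rewrite ?ltxx ?andbF.
Qed.

(** [f] minus a primitive of its weak derivative has zero weak derivative, hence is constant almost
    everywhere by [du_bois_reymond]. *)
Lemma weak_primitive (f g : R -> R) : L2w f -> L2w g ->
  (forall phi, test_halfline phi ->
    (\int[mu]_(r in `]0%R, +oo[) (f r * derive1 phi r)%:E =
     - \int[mu]_(r in `]0%R, +oo[) (g r * phi r)%:E)%E) ->
  exists V, primitive0 V g /\ {ae mu, forall x, 0 < x -> f x = V x}.
Proof.
move=> Lf Lg fg.
have [V0 pV0] := primitive_exists (fun a b a0 => (L2w_integrable b Lg a0).1).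
have iV0 (a b : R) : 0 < a -> mu.-integrable `[a, b] (EFin \o V0).
  move=> a0; have [ab|ba] := leP a b; last first.
    by rewrite set_itv_ge ?bnd_simp -?ltNge//; exact: integrable_set0.
  apply: continuous_compact_integrable; first exact: segment_compact.
  exact: primitive_on_continuous (pV0 a b a0 ab).
have [||phi tphi|c hc] := @du_bois_reymond R (fun x => f x - V0 x).
- by apply: measurable_funB; [case: Lf|exact: primitive0_measurable pV0].
- by move=> a b a0; apply: integrable_subr => //; [case: (L2w_integrable b Lf a0)|exact: iV0].
- have E1 := fg phi tphi; have E2 := primitive0_weak pV0 tphi.
  have [a [b [a0 ab z]]] := test_halfline_support tphi.
  have [dphi cphi] := test_halfline_is_derive tphi.
  have pphi := C1_primitive_on ab (fun x _ => dphi x) (fun x _ => cphi x).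
  have ext (h k : R -> R) : (forall x, ~~ (a < x < b) -> k x = 0) ->
      continuous k -> mu.-integrable `[a, b] (EFin \o h) ->
      mu.-integrable `]0, +oo[ (EFin \o (fun x => h x * k x)).
    move=> k0 ck ih; apply: (@integrable_support _ _ _ mu `[a, b]%classic) => //.
      move=> x hx; rewrite k0 ?mulr0//; apply/negP => /andP[ax xb]; apply: hx.
      by rewrite /= in_itv/= !ltW.
    have H := @integrableMr _ _ R mu `[a, b] (measurable_itv _) k (EFin \o h) _ _ ih.
    apply: eq_integrable (H _ _) => //.
    - by move=> x _ /=; rewrite mulrC.
    - by apply: measurable_funTS; exact: continuous_measurable_fun.
    - have := continuous_compact (continuous_subspaceT ck) (@segment_compact _ a b).
      move=> /compact_bounded[M [Mr HM]]; exists M; split => // t Mt x xab.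
      by apply: HM Mt _ _; exists x.
  have cphi0 : continuous phi.
    by move=> x; have [+ _] := dphi x; move=> /derivable1_diffP/differentiable_continuous.
  have i1 : mu.-integrable `]0, +oo[ (EFin \o (fun x => f x * derive1 phi x)).
    by apply: ext => //; [move=> x /z[]|case: (L2w_integrable b Lf a0)].
  have i2 : mu.-integrable `]0, +oo[ (EFin \o (fun x => V0 x * derive1 phi x)).
    by apply: ext => //; [move=> x /z[]|exact: iV0].
  rewrite (_ : (fun r => _) = (fun r => (f r * derive1 phi r - V0 r * derive1 phi r)%:E)); last first.
    by apply/funext => r; rewrite mulrBl.
  rewrite EFin_Rintegral//; last exact: integrable_subr.
  rewrite RintegralB// EFinB -!EFin_Rintegral// E1 E2 subee//.
  by rewrite -E2 EFin_Rintegral.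
exists (fun x => V0 x + c); split.
  move=> a b a0 ab; have [ig h] := pV0 a b a0 ab; split => // x y ax xy yb.
  by rewrite -h//; ring.
by move: hc; apply: ae_imp => x h x0; rewrite -(h x0) addrC subrK.
Qed.

Lemma L2w_ae (f V : R -> R) : measurable_fun Rpos V ->
  {ae mu, forall x, 0 < x -> f x = V x} -> L2w f -> L2w V.
Proof.
move=> mV fV [mf f2]; split => //; apply: le_lt_trans f2.
rewrite le_eqVlt; apply/orP; left; apply/eqP.
apply: ge0_ae_eq_integral => //.
- by apply/measurable_EFinP; apply: measurable_funM => //; exact: measurable_funX.
- by apply/measurable_EFinP; apply: measurable_funM => //; exact: measurable_funX.
- by move=> x /=; rewrite in_itv/= andbT lee_fin => x0; rewrite mulr_ge0 ?sqr_ge0// ltW.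
- by move=> x /=; rewrite in_itv/= andbT lee_fin => x0; rewrite mulr_ge0 ?sqr_ge0// ltW.
- by move: fV; apply: ae_imp => x h /=; rewrite in_itv/= andbT => x0; rewrite h.
Qed.

(* The real or imaginary part of an element of H_l: f is its locally absolutely
   continuous representative and g an almost everywhere derivative. *)
Definition radial_pair (l : R) (f g : R -> R) : Prop :=
  [/\ L2w f, L2w (fun r => l / r * f r), L2w g & primitive0 f g].

Lemma sqr_normc (z : R[i]) : normc z ^+ 2 = complex.Re z ^+ 2 + complex.Im z ^+ 2.
Proof. by case: z => a b; rewrite /normc sqr_sqrtr// addr_ge0// sqr_ge0. Qed.

Lemma L2radial_components (f : R -> R[i]) : L2radial f ->
  L2w (fun r => complex.Re (f r)) /\ L2w (fun r => complex.Im (f r)).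
Proof.
move=> [[mr mi] f2].
have mr' : measurable_fun Rpos (fun r => complex.Re (f r)) by [].
have mi' : measurable_fun Rpos (fun r => complex.Im (f r)) by [].
have mf2 : measurable_fun Rpos (fun r => normc (f r) ^+ 2 * r).
  rewrite (_ : (fun r => _) =
    (fun r => (complex.Re (f r) ^+ 2 + complex.Im (f r) ^+ 2) * r)); last first.
    by apply/funext => r; rewrite sqr_normc.
  by apply: measurable_funM => //; apply: measurable_funD; exact: measurable_funX.
have le (h : R -> R) : measurable_fun Rpos h ->
    (forall r, h r ^+ 2 <= normc (f r) ^+ 2) -> L2w h.
  move=> mh hle; split => //; apply: le_lt_trans f2; apply: ge0_le_integral => //.
  - by move=> x /=; rewrite in_itv/= andbT lee_fin => x0; rewrite mulr_ge0 ?sqr_ge0// ltW.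
  - by apply/measurable_EFinP; apply: measurable_funM => //; exact: measurable_funX.
  - exact/measurable_EFinP.
  - by move=> x /=; rewrite in_itv/= andbT lee_fin => x0; rewrite ler_wpM2r// ltW.
by split; apply: le => // r; rewrite sqr_normc ?lerDl ?lerDr sqr_ge0.
Qed.

Lemma Hrad_radial_pair (l : int) (v : R -> R[i]) : Hrad l v ->
  exists f1 g1 f2 g2, [/\ radial_pair l%:~R f1 g1, radial_pair l%:~R f2 g2 &
    {ae mu, forall r, 0 < r -> v r = f1 r +i* f2 r}].
Proof.
move=> [Lv Llv [g [Lg wg]]].
have [Lr Li] := L2radial_components Lv; have [Lgr Lgi] := L2radial_components Lg.
have [Llr Lli] := L2radial_components Llv.
have [f1 [p1 e1]] := weak_primitive Lr Lgr (fun phi tphi => (wg phi tphi).1).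
have [f2 [p2 e2]] := weak_primitive Li Lgi (fun phi tphi => (wg phi tphi).2).
have m1 := primitive0_measurable p1; have m2 := primitive0_measurable p2.
have ml (f : R -> R) : measurable_fun Rpos f -> measurable_fun Rpos (fun r => l%:~R / r * f r).
  move=> mf; apply: measurable_funM => //; apply: measurable_funM; first exact: measurable_cst.
  apply: open_continuous_measurable_fun; first exact: interval_open.
  move=> x; rewrite inE/= in_itv/= andbT => x0.
  by apply: cvgV; [rewrite gt_eqF|exact: cvg_id].
exists f1, (fun r => complex.Re (g r)), f2, (fun r => complex.Im (g r)); split.
- split => //; first exact: L2w_ae e1 Lr.
  apply: L2w_ae (ml _ m1) _ Llr; move: e1; apply: ae_imp => x h x0.
  by rewrite -(h x0); case: (v x) => a b /=; rewrite mul0r subr0.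
- split => //; first exact: L2w_ae e2 Li.
  apply: L2w_ae (ml _ m2) _ Lli; move: e2; apply: ae_imp => x h x0.
  by rewrite -(h x0); case: (v x) => a b /=; rewrite mul0r addr0.
- move: e1 e2; apply: ae_imp2 => x h1 h2 x0; rewrite -(h1 x0) -(h2 x0).
  by case: (v x).
Qed.

Lemma L2radialC (f1 f2 : R -> R) : L2w f1 -> L2w f2 ->
  L2radial (fun r => f1 r +i* f2 r).
Proof.
move=> [m1 i1] [m2 i2]; split; first by split.
have mm (h : R -> R) : measurable_fun Rpos h ->
    measurable_fun Rpos (fun r => (h r ^+ 2 * r)%:E).
  move=> mh; apply/measurable_EFinP; apply: measurable_funM => //.
  exact: measurable_funX.
rewrite (_ : (\int[mu]_(r in _) _ = \int[mu]_(r in `]0%R, +oo[) ((f1 r ^+ 2 * r)%:E + (f2 r ^+ 2 * r)%:E))%E).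
  rewrite ge0_integralD//; first exact: lte_add_pinfty.
  - by move=> x /=; rewrite in_itv/= andbT lee_fin => x0; rewrite mulr_ge0 ?sqr_ge0// ltW.
  - exact: mm.
  - by move=> x /=; rewrite in_itv/= andbT lee_fin => x0; rewrite mulr_ge0 ?sqr_ge0// ltW.
  - exact: mm.
by apply: eq_integral => x _; rewrite sqr_normc /= mulrDl.
Qed.

Lemma radial_pair_Hrad (l : int) (f1 g1 f2 g2 : R -> R) :
  radial_pair l%:~R f1 g1 -> radial_pair l%:~R f2 g2 ->
  Hrad l (fun r => f1 r +i* f2 r).
Proof.
move=> [L1 Ll1 Lg1 p1] [L2 Ll2 Lg2 p2]; split.
- exact: L2radialC.
- rewrite (_ : (fun r => _) = (fun r => (l%:~R / r * f1 r) +i* (l%:~R / r * f2 r))).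
    exact: L2radialC.
  by apply/funext => r; apply/eqP; rewrite eq_complex /= !mul0r subr0 addr0 !eqxx.
- exists (fun r => g1 r +i* g2 r); split; first exact: L2radialC.
  by move=> phi tphi; split; exact: primitive0_weak.
Qed.

End radial_pairs.

(** * Absolutely continuous profiles composed with the radius along a line *)

Section primitive_algebra.
Variable R : realType.
Local Notation mu := (@lebesgue_measure R).
Local Notation mR := (measurableTypeR R).
Local Notation Rpos := (`]0, +oo[%classic : set R).

Lemma primitive_onD (a b : R) V h W k : a <= b ->
  primitive_on a b V h -> primitive_on a b W k ->
  primitive_on a b (fun x => V x + W x) (fun x => h x + k x).
Proof.
move=> ab [ih Vh] [ik Wk]; split; first exact: integrable_addr.
move=> x y ax xy yb.
have sub : `[x, y] `<=` `[a, b].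
  move=> t /=; rewrite !in_itv/= => /andP[xt ty].
  by rewrite (le_trans ax xt) (le_trans ty yb).
rewrite RintegralD//; [|exact: integrableS ih|exact: integrableS ik].
by rewrite -Vh// -Wk//; ring.
Qed.

Lemma primitive_onZ (a b : R) c V h : a <= b ->
  primitive_on a b V h -> primitive_on a b (fun x => c * V x) (fun x => c * h x).
Proof.
move=> ab [ih Vh]; split; first exact: integrable_mulr.
move=> x y ax xy yb.
have sub : `[x, y] `<=` `[a, b].
  move=> t /=; rewrite !in_itv/= => /andP[xt ty].
  by rewrite (le_trans ax xt) (le_trans ty yb).
by rewrite RintegralZl//; [rewrite -Vh// mulrBr|exact: integrableS ih].
Qed.

Lemma primitive_onM (a b : R) V h W k : a <= b ->
  primitive_on a b V h -> primitive_on a b W k ->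
  primitive_on a b (fun x => V x * W x) (fun x => V x * k x + h x * W x).
Proof.
move=> ab pV pW; split.
  apply: integrable_addr => //.
    by apply: primitive_on_integrableM pV _ => //; case: pW.
  have : mu.-integrable `[a, b] (EFin \o (fun x => W x * h x)).
    by apply: primitive_on_integrableM pW _ => //; case: pV.
  by apply: eq_integrable => // x _; rewrite /= mulrC.
move=> x y ax xy yb.
by rewrite (primitive_on_mul xy (primitive_on_sub ax yb pV) (primitive_on_sub ax yb pW)).
Qed.

Lemma ge0_integral_reflect (k : R -> \bar R) (a b : R) :
  measurable_fun (`[(- b), (- a)]%classic : set R) k ->
  (forall x : R, (- b <= x <= - a)%R -> (0 <= k x)%E) ->
  (\int[mu]_(x in `[a, b]) k (- x)%R = \int[mu]_(x in `[(- b)%R, (- a)%R]) k x)%E.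
Proof.
move=> mk k0.
have mN : measurable_fun [set: mR] (-%R : mR -> mR) by exact: oppr_measurable.
transitivity (\int[pushforward mu (-%R : mR -> mR)]_(x in `[(- b)%R, (- a)%R]) k x)%E.
  rewrite ge0_integral_pushforward//.
    by rewrite opp_preimage_itvbndbnd/= !opprK.
  by move=> x; rewrite inE/= in_itv/=; exact: k0.
by apply: eq_measure_integral => A mA _; exact: lebesgue_measureN.
Qed.

Lemma integral_reflect (k : R -> \bar R) (a b : R) :
  measurable_fun (`[(- b), (- a)]%classic : set R) k ->
  (\int[mu]_(x in `[a, b]) k (- x)%R = \int[mu]_(x in `[(- b)%R, (- a)%R]) k x)%E.
Proof.
move=> mk; rewrite integralE [RHS]integralE; congr (_ - _)%E.
  rewrite -(ge0_integral_reflect (measurable_funepos mk))//.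
  by apply: eq_integral => x _; rewrite !funeposE.
rewrite -(ge0_integral_reflect (measurable_funeneg mk))//.
by apply: eq_integral => x _; rewrite !funenegE.
Qed.

Lemma hypotN (y x : R) : hypot y (- x) = hypot y x.
Proof. by rewrite /hypot /radius /= sqrrN. Qed.

Lemma hypot_le (y x1 x2 : R) : 0 <= x1 -> 0 <= x2 ->
  (hypot y x1 <= hypot y x2) = (x1 <= x2).
Proof.
move=> h1 h2; rewrite /hypot.
rewrite -(@ler_pXn2r _ 2)// ?nnegrE ?radius_ge0// !sqr_radius/= lerD2r.
by rewrite ler_pXn2r// nnegrE.
Qed.

Lemma hypot_ge (y x : R) : `|y| <= hypot y x.
Proof.
rewrite -(@ler_pXn2r _ 2)// ?nnegrE ?radius_ge0// sqr_radius/=.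
by rewrite real_normK ?num_real// lerDr sqr_ge0.
Qed.

Lemma measurable_hypot_ratio (y : R) (D : set mR) : y != 0 -> measurable D ->
  measurable_fun D (fun x : R => x / hypot y x).
Proof.
move=> y0 mD; apply: (@measurable_funS _ _ _ _ setT) => //.
apply: continuous_measurable_fun => x; apply: cvgM; first exact: cvg_id.
by apply: cvgV; [rewrite gt_eqF// hypot_gt0|exact: continuous_hypot].
Qed.

Lemma measurable_hypot_itv d (T : measurableType d) (y : R) (k : R -> T) (x1 x2 : R) :
  y != 0 -> 0 <= x1 -> x1 <= x2 ->
  measurable_fun (`[hypot y x1, hypot y x2]%classic : set mR) k ->
  measurable_fun (`[x1, x2]%classic : set mR) (fun x => k (hypot y x)).
Proof.
move=> y0 x10 x12 mk.
apply: (@measurable_comp _ _ _ _ _ _ (`[hypot y x1, hypot y x2]%classic : set mR)) => //.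
  move=> _ [x /= + <-]; rewrite !in_itv/= => /andP[xx1 xx2].
  by rewrite !hypot_le// ?xx1// ?xx2// ?(le_trans x10).
apply: (@measurable_funS _ _ _ _ setT) => //.
by apply: continuous_measurable_fun; exact: continuous_hypot.
Qed.

Lemma ge0_integral_hypot_itv (y : R) (k : R -> \bar R) (x1 x2 : R) : y != 0 ->
  0 <= x1 -> x1 <= x2 ->
  measurable_fun (`[hypot y x1, hypot y x2]%classic : set mR) k ->
  (forall s, 0 <= k s)%E ->
  (\int[mu]_(x in `[x1, x2]) (k (hypot y x) * (x / hypot y x)%:E) =
   \int[mu]_(s in `[hypot y x1, hypot y x2]) k s)%E.
Proof.
move=> y0 x10 x12 mk k0.
have mk0 : measurable_fun (`]hypot y x1, hypot y x2]%classic : set mR) k.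
  by apply: measurable_funS mk => //; exact: subset_itv_oc_cc.
have mkh : measurable_fun (`[x1, x2]%classic : set mR)
    (fun x => k (hypot y x) * (x / hypot y x)%:E)%E.
  apply: emeasurable_funM; first exact: measurable_hypot_itv.
  by apply/measurable_EFinP; exact: measurable_hypot_ratio.
rewrite -integral_itv_obnd_cbnd//; last first.
  by apply: measurable_funS mkh => //; exact: subset_itv_oc_cc.
rewrite -[RHS]integral_itv_obnd_cbnd//.
pose k' := k \_ `]hypot y x1, hypot y x2].
have mk' : measurable_fun [set: R] k' by apply/(measurable_restrictT k).
have k'0 s : (0 <= k' s)%E by rewrite /k' patchE; case: ifP => // _; exact: k0.
have hlt u v : 0 <= u -> 0 <= v -> (hypot y u < hypot y v) = (u < v).
  by move=> hu hv; rewrite !ltNge hypot_le.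
transitivity (\int[mu]_(x in `]0%R, +oo[) (k' (hypot y x) * (x / hypot y x)%:E))%E.
  rewrite integral_mkcond [RHS]integral_mkcond; apply: eq_integral => x _.
  rewrite !patchE !mem_setE !in_itv/= andbT.
  have [xp|x0] := ltP 0 x.
    have x0 := ltW xp; have x20 := le_trans x10 x12.
    rewrite /k' patchE mem_setE in_itv/= (hypot_le _ x0 x20) (hlt _ _ x10 x0).
    by case: ifP => // _; rewrite mul0e.
  by case: ifP => // /andP[xx1 _]; move: (le_lt_trans x10 xx1); rewrite ltNge x0.
rewrite (ge0_integral_hypot y0 mk' k'0).
rewrite integral_mkcond [RHS]integral_mkcond; apply: eq_integral => s _.
rewrite !patchE !mem_setE !in_itv/= andbT.
have [ys|ys] := ltP `|y| s; first by rewrite /k' patchE mem_setE in_itv.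
case: ifP => // /andP[h1 h2].
by move: (le_lt_trans (hypot_ge y x1) h1); rewrite ltNge ys.
Qed.

Lemma integral_hypot_itv (y : R) (k : R -> R) (x1 x2 : R) : y != 0 ->
  0 <= x1 -> x1 <= x2 ->
  measurable_fun (`[hypot y x1, hypot y x2]%classic : set mR) k ->
  (\int[mu]_(x in `[x1, x2]) (k (hypot y x) * (x / hypot y x))%:E =
   \int[mu]_(s in `[hypot y x1, hypot y x2]) (k s)%:E)%E.
Proof.
move=> y0 x10 x12 mk; have mk' : measurable_fun (`[hypot y x1, hypot y x2]%classic : set mR)
  (EFin \o k) by apply/measurable_EFinP.
have nn x : x \in (`[x1, x2]%classic : set R) -> 0 <= x / hypot y x.
  rewrite inE/= in_itv/= => /andP[xx1 _]; rewrite divr_ge0 ?(le_trans x10 xx1)//.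
  exact: radius_ge0.
rewrite integralE [RHS]integralE; congr (_ - _)%E.
  rewrite -(ge0_integral_hypot_itv y0 x10 x12 (measurable_funepos mk'))//.
  apply: eq_integral => x /nn hx.
  by rewrite !funeposE -!EFin_max -EFinM maxr_pMl// mul0r.
rewrite -(ge0_integral_hypot_itv y0 x10 x12 (measurable_funeneg mk'))//.
apply: eq_integral => x /nn hx.
by rewrite !funenegE /= -!EFin_max -EFinM maxr_pMl// mul0r mulNr.
Qed.

Lemma primitive_on_cat (a b c : R) V h : a <= b -> b <= c ->
  primitive_on a b V h -> primitive_on b c V h -> primitive_on a c V h.
Proof.
move=> ab bc [i1 V1] [i2 V2].
have iac : mu.-integrable `[a, c] (EFin \o h).
  have i2' : mu.-integrable `]b, c] (EFin \o h).
    by apply: integrableS i2 => //; exact: subset_itv_oc_cc.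
  have /integrable_mkcond j1 := i1; have /integrable_mkcond j2 := i2'.
  apply/integrable_mkcond => //.
  apply: eq_integrable (integrableD _ (j1 _) (j2 _)) => // x _.
  rewrite /= !patchE !mem_setE !in_itv/=.
  have [xb|bx] := leP x b; first by rewrite (le_trans xb bc) adde0.
  by rewrite andbF add0e (le_trans ab (ltW bx)).
split=> // x y ax xy yc.
have [yb|/ltW yb] := leP y b; first exact: V1.
have [bx|/ltW xb] := leP b x; first exact: V2.
rewrite (@Rintegral_itv_add _ h x b y)//; last first.
  apply: integrableS iac => // t /=; rewrite !in_itv/= => /andP[xt ty].
  by rewrite (le_trans ax xt) (le_trans ty yc).
by rewrite -V1// -V2//; ring.
Qed.

(** Chain rule for a profile that is only absolutely continuous. [hypot y] is increasing for
    nonnegative arguments, where the substitution formula applies; it is even, so reflection handles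
    the other side, and the two are glued at 0. *)
Lemma primitive_on_hypot (y : R) f g (a b : R) : y != 0 -> primitive0 f g -> a <= b ->
  primitive_on a b (fun x => f (hypot y x)) (fun x => g (hypot y x) * (x / hypot y x)).
Proof.
move=> y0 pf.
pose V x := f (hypot y x); pose h x := g (hypot y x) * (x / hypot y x).
have pos x1 x2 : 0 <= x1 -> x1 <= x2 -> primitive_on x1 x2 V h.
  move=> x10 x12.
  have hh : hypot y x1 <= hypot y x2 by rewrite hypot_le// (le_trans x10).
  have [ig Vg] := pf _ _ (hypot_gt0 x1 y0) hh.
  have /measurable_EFinP mg : measurable_fun (`[hypot y x1, hypot y x2]%classic : set mR)
    (EFin \o g) := measurable_int _ ig.
  have mh : measurable_fun (`[x1, x2]%classic : set mR) h.
    apply: measurable_funM; first exact: measurable_hypot_itv.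
    exact: measurable_hypot_ratio.
  split.
    apply/integrableP; split; first exact/measurable_EFinP.
    have mag : measurable_fun (`[hypot y x1, hypot y x2]%classic : set mR) (fun x => `|g x|).
      exact: measurableT_comp.
    have /integrableP[_] := ig; rewrite -(integral_hypot_itv y0 x10 x12 mag).
    congr (_ < _)%E; apply: eq_integral => x; rewrite inE/= in_itv/= => /andP[xx1 _].
    rewrite /h normrM (ger0_norm (_ : 0 <= x / _))// divr_ge0 ?(le_trans x10 xx1)//.
    exact: radius_ge0.
  move=> u v xu uv vx; have u0 := le_trans x10 xu.
  have huv : hypot y u <= hypot y v by rewrite hypot_le// (le_trans u0).
  have v0 := le_trans u0 uv; have x20 := le_trans x10 x12.
  rewrite /V (Vg (hypot y u) (hypot y v)) ?hypot_le//.
  rewrite /Rintegral integral_hypot_itv//.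
  apply: measurable_funS mg => // t /=; rewrite !in_itv/= => /andP[ut tv].
  by rewrite (le_trans _ ut) ?hypot_le// (le_trans tv)// hypot_le.
have neg x1 x2 : x1 <= x2 -> x2 <= 0 -> primitive_on x1 x2 V h.
  move=> x12 x20.
  have [ih Vh] := pos (- x2) (- x1) ltac:(by rewrite oppr_ge0) ltac:(by rewrite lerN2).
  have /measurable_EFinP mh : measurable_fun (`[(- x2), (- x1)]%classic : set mR)
    (EFin \o h) := measurable_int _ ih.
  have hN x : h (- x) = - h x by rewrite /h hypotN !mulNr mulrN.
  have mhN : measurable_fun (`[(- x2), (- x1)]%classic : set mR) (fun x => (-1 * h x)%:E).
    by apply/measurable_EFinP; apply: measurable_funM.
  have hE x : h x = - h (- x) by rewrite hN opprK.
  have mh12 : measurable_fun (`[x1, x2]%classic : set mR) h.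
    rewrite (_ : h = fun x => - h (- x)); last exact/funext.
    apply: measurable_funN.
    apply: (@measurable_comp _ _ _ mR mR mR (`[(- x2), (- x1)]%classic) h
      `[x1, x2]%classic (fun x : mR => - x)) => //.
      by move=> _ [x /= + <-]; rewrite !in_itv/= !lerN2 andbC.
    by apply: (@measurable_funS _ _ mR mR setT) => //; exact: oppr_measurable.
  split.
    apply/integrableP; split; first exact/measurable_EFinP.
    have /integrableP[_] := ih.
    have mah : measurable_fun (`[(- x2), (- x1)]%classic : set mR) (fun x => `|(h x)%:E|%E).
      by apply: measurableT_comp => //; exact/measurable_EFinP.
    rewrite -(integral_reflect mah).
    by congr (_ < _)%E; apply: eq_integral => x _; rewrite /= hN normrN.
  move=> u v xu uv vx.
  have := Vh (- v) (- u) ltac:(by rewrite lerN2) ltac:(by rewrite lerN2) ltac:(by rewrite lerN2).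
  rewrite /V !hypotN => E; rewrite -[LHS]opprB E -mulN1r -RintegralZl//; last first.
    apply: integrableS ih => // t /=; rewrite !in_itv/= => /andP[h1 h2].
    by rewrite (le_trans _ h1) ?lerN2// (le_trans h2)// lerN2.
  rewrite /Rintegral -(@integral_reflect (fun x => (-1 * h x)%:E)).
    by congr fine; apply: eq_integral => x _; rewrite mulN1r -hE.
  apply: measurable_funS mhN => // t /=; rewrite !in_itv/= => /andP[h1 h2].
  by rewrite (le_trans _ h1) ?lerN2// (le_trans h2)// lerN2.
move=> ab; have [b0|b0] := leP b 0; first exact: neg.
have [a0|a0] := leP 0 a; first exact: pos.
have a0' := ltW a0; have b0' := ltW b0.
by apply: (@primitive_on_cat a 0 b) => //; [exact: neg|exact: pos].
Qed.

End primitive_algebra.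

(** * Weak derivatives from absolute continuity on lines *)

Section plane_ibp.
Variable R : realType.
Local Notation mu := (@lebesgue_measure R).
Local Notation mR := (measurableTypeR R).
Local Notation leb2 := (mu \x mu)%E.

Lemma test_plane_continuous (phi : R * R -> R) b : test_plane phi ->
  [/\ continuous phi, continuous (fun z => 'D_(axis R b) phi z) &
      forall z, derivable phi z (axis R b)].
Proof.
by move=> [h _]; split; [case: (h [::])|case: (h [:: b])|move=> z; case: (h [::]) => _; exact].
Qed.

Lemma test_plane_support (phi : R * R -> R) : test_plane phi ->
  exists2 M, 0 < M & forall b (x y : R), M <= `|x| \/ M <= `|y| ->
    phi (x, y) = 0 /\ 'D_(axis R b) phi (x, y) = 0.
Proof.
move=> tphi; have [_ cK] := tphi; set K := closure _ in cK.
have [M [_ HM]] := compact_bounded cK.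
pose b := `|M| + 1.
have b0 : 0 < b by rewrite ltr_wpDl.
have Kb (x y : R) : K (x, y) -> `|x| <= b /\ `|y| <= b.
  move=> Kx; have Mb : M < b by rewrite (le_lt_trans (ler_norm M))// ltrDl.
  have /= := HM _ Mb _ Kx; rewrite prod_normE/= ge_max => /andP[-> ->].
  by [].
have z (x y : R) : b < `|x| \/ b < `|y| -> phi (x, y) = 0.
  move=> h; apply/eqP; apply: contraPT h => h.
  have [hx hy] : `|x| <= b /\ `|y| <= b by apply: Kb; exact: subset_closure.
  by rewrite !ltNge hx hy => -[].
exists (b + 1); first by rewrite addr_gt0.
have near_far (t : R) : b + 1 <= `|t| -> \forall s \near t, b < `|s|.
  move=> bt; have ct : `|s| @[s --> t] --> `|t| by exact: norm_continuous.
  by apply: (cvgr_gt _ ct); rewrite (lt_le_trans _ bt)// ltrDl.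
move=> b' x y h.
have hb (t : R) : b + 1 <= `|t| -> b < `|t| by apply: lt_le_trans; rewrite ltrDl.
split; first by apply: z; case: h => /hb; [left|right].
case: b' => /=.
  rewrite slice2_derive.
  have nz : \forall t \near y, phi (x, t) = 0.
    case: h => h; first by exists 1 => //= t _; apply: z; left; exact: hb.
    by move: (near_far _ h); apply: filterS => t ht; apply: z; right.
  by rewrite (near_eq_derive _ nz); exact: derive_cst.
rewrite slice1_derive.
have nz : \forall t \near x, phi (t, y) = 0.
  case: h => h; last by exists 1 => //= t _; apply: z; right; exact: hb.
  by move: (near_far _ h); apply: filterS => t ht; apply: z; left.
by rewrite (near_eq_derive _ nz); exact: derive_cst.
Qed.

(** An open set is the countable union of the boxes with rational centre and half-side 1/(n+1) that
    it contains. *)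
Lemma open_measurable_plane (O : set (R * R)) : open O -> measurable (O : set (mR * mR)).
Proof.
move=> oO.
pose e n : R := n.+1%:R^-1.
pose bx n a b : set (R * R) :=
  (`](ratr a - e n), (ratr a + e n)[%classic : set R) `*`
  (`](ratr b - e n), (ratr b + e n)[%classic : set R).
rewrite (_ : O = \bigcup_n \bigcup_(a : rat) \bigcup_(b : rat)
    (if `[< bx n a b `<=` O >] then bx n a b else set0)).
  apply: bigcup_measurable => n _; apply: bigcupT_measurable_rat => a.
  apply: bigcupT_measurable_rat => b; case: ifP => // _.
  by apply: measurableX; exact: measurable_itv.
apply/seteqP; split => [[x y] Oxy|z [n _ [a _ [b _]]]]; last first.
  by case: ifP => // /asboolP; apply.
have /nbhs_ballP[d d0 dO] : nbhs (x, y) O by exact: open_nbhs_nbhs.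
have d2 : 0 < d / 2 by rewrite divr_gt0.
have [n nd] : exists n, e n < d / 2.
  by have [n] := @ltr_add_invr R 0 (d / 2) d2; rewrite add0r; exists n.
have en0 : 0 < e n by rewrite invr_gt0.
have rat_near (t : R) : exists a : rat, ratr a - e n < t < ratr a + e n.
  have /rat_in_itvoo[a] : t - e n < t + e n by lra.
  by rewrite in_itv/= => /andP[h1 h2]; exists a; apply/andP; split; lra.
have [a ha] := rat_near x; have [b hb] := rat_near y.
exists n => //; exists a => //; exists b => //.
have -> : `[< bx n a b `<=` O >].
  apply/asboolP => -[u v] []; rewrite /= !in_itv/= => hu hv; apply: dO.
  move: ha hb hu hv => /andP[? ?] /andP[? ?] /andP[? ?] /andP[? ?].
  by split; rewrite /ball/= ltr_norml; apply/andP; split; lra.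
by split; rewrite /= in_itv.
Qed.

Lemma continuous_measurable_plane (psi : R * R -> R) : continuous psi ->
  measurable_fun [set: mR * mR] psi.
Proof.
move=> cpsi; apply: (measurability _ (RGenOpens.measurableE R)).
move=> _ [_ [a [b ->]] <-]; rewrite setTI; apply: open_measurable_plane.
by apply: open_comp => // z _; exact: cpsi.
Qed.

Lemma continuous_support_L2 (psi : R * R -> R) (M : R) : 0 < M -> continuous psi ->
  (forall x y : R, M <= `|x| \/ M <= `|y| -> psi (x, y) = 0) ->
  measurable_fun [set: mR * mR] psi /\ (\int[leb2]_z (psi z ^+ 2)%:E < +oo)%E.
Proof.
move=> M0 cpsi z.
have mpsi := continuous_measurable_plane cpsi; split => //.
pose K : set (R * R) := (`[(- M), M]%classic : set R) `*` (`[(- M), M]%classic : set R).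
have cK : compact K by apply: compact_setX; exact: segment_compact.
have [B [_ HB]] := compact_bounded (continuous_compact (continuous_subspaceT cpsi) cK).
have B1 : B < `|B| + 1 by rewrite (le_lt_trans (ler_norm B))// ltrDl.
have Kin x y : K (x, y) <-> `|x| <= M /\ `|y| <= M.
  by rewrite /K /= !in_itv/= !ler_norml; split.
have bnd w : psi w ^+ 2 <= (`|B| + 1) ^+ 2 * \1_K w.
  case: w => x y; rewrite indicE.
  have [Kxy|Kxy] := pselect (K (x, y)).
    rewrite (mem_set Kxy) mulr1 -[X in X <= _]real_normK ?num_real//.
    rewrite ler_sqr ?nnegrE ?addr_ge0//.
    by apply: (HB _ B1 (psi (x, y))); exists (x, y).
  rewrite (memNset Kxy) mulr0 z ?expr0n//.
  have [xM|/ltW] := leP `|x| M; last by left.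
  have [yM|/ltW] := leP `|y| M; last by right.
  by exfalso; apply: Kxy; exact/Kin.
have mK : measurable (K : set (mR * mR)) by apply: measurableX; exact: measurable_itv.
apply: (@le_lt_trans _ _ (\int[leb2]_w ((`|B| + 1) ^+ 2 * \1_K w)%:E)%E).
  apply: ge0_le_integral => //.
  - by move=> w _; rewrite lee_fin sqr_ge0.
  - by apply/measurable_EFinP; exact: measurable_funX.
  - by apply/measurable_EFinP; apply: measurable_funM => //; exact: measurable_indic.
  - by move=> w _; rewrite lee_fin.
have -> : (\int[leb2]_w ((`|B| + 1) ^+ 2 * \1_K w)%:E =
    ((`|B| + 1) ^+ 2)%:E * \int[leb2]_w (\1_K w)%:E)%E.
  transitivity (\int[leb2]_w (((`|B| + 1) ^+ 2)%:E * (\1_K w)%:E))%E.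
    by apply: eq_integral => w _; rewrite EFinM.
  by rewrite ge0_integralZl//; apply/measurable_EFinP; exact: measurable_indic.
rewrite integral_indic// setIT.
have I1 : measurable (`[(- M), M]%classic : set mR) by exact: measurable_itv.
set X := (X in (_ * X < _)%E).
have -> : X = (mu `[(- M)%R, M] * mu `[(- M)%R, M])%E by exact: leb2_rect.
by rewrite lebesgue_measure_itv/=; case: ifP => _; rewrite ?mule0 ?mul0e ?mule0 ?ltry// -!EFinM ltry.
Qed.

Lemma line_ibp (M : R) V h (phi : R -> R) : 0 < M -> primitive_on (- M) M V h ->
  (forall x, derivable phi x 1) -> continuous (fun x => 'D_1 phi x) ->
  (forall x, M <= `|x| -> phi x = 0 /\ 'D_1 phi x = 0) ->
  (\int[mu]_x (V x * 'D_1 phi x)%:E = - \int[mu]_x (h x * phi x)%:E)%E.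
Proof.
move=> M0 pV dphi0 cphi z; have ab : - M <= M by lra.
have dphi x : is_derive x (1 : R) phi ('D_1 phi x) by apply/derivableP; exact: dphi0.
have cphi0 : continuous phi.
  by move=> x; move: (dphi0 x); move=> /derivable1_diffP/differentiable_continuous.
have nab x : ~ (`[(- M), M]%classic x) -> M <= `|x|.
  move=> h0; have [//|xM] := leP M `|x|; exfalso; apply: h0.
  by rewrite /= in_itv/= -ler_norml ltW.
rewrite (@integral_support _ _ _ mu `[(- M), M]%classic)//; last first.
  by move=> x _ /nab /z[_ ->]; rewrite mulr0.
rewrite [in RHS](@integral_support _ _ _ mu `[(- M), M]%classic)//; last first.
  by move=> x _ /nab /z[-> _]; rewrite mulr0.
have ic (k : R -> R) : continuous k -> mu.-integrable `[(- M), M] (EFin \o k).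
  by move=> ch; apply: continuous_compact_integrable;
    [exact: segment_compact|exact: continuous_subspaceT].
have i1 : mu.-integrable `[(- M), M] (EFin \o (fun x => V x * 'D_1 phi x)).
  by apply: primitive_on_integrableM pV _ => //; exact: ic.
have pphi := C1_primitive_on ab (fun x _ => dphi x) (fun x _ => cphi x).
have i2 : mu.-integrable `[(- M), M] (EFin \o (fun x => h x * phi x)).
  have : mu.-integrable `[(- M), M] (EFin \o (fun x => phi x * h x)).
    by apply: primitive_on_integrableM pphi _ => //; case: pV.
  by apply: eq_integrable => // x _; rewrite /= mulrC.
rewrite !EFin_Rintegral// -EFinN; congr EFin.
apply: ibp_test pV _ _ _ _ => //.
- by move=> x _; exact: cphi.
- by have [] := z (- M) _; rewrite ?normrN ?ler_norm.
- by have [] := z M _; rewrite ?ler_norm.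
Qed.

Lemma integral_oppE d (T : measurableType d) (m : {measure set T -> \bar R}) (D : set T)
    (f : T -> R) : measurable D -> m.-integrable D (EFin \o f) ->
  (\int[m]_(x in D) (- f x)%:E = - \int[m]_(x in D) (f x)%:E)%E.
Proof.
move=> mD If; rewrite -[RHS]mulN1e -integralZl//.
by apply: eq_integral => x _; rewrite /= mulN1e.
Qed.

Definition weak_partialR (b : bool) (f g : R * R -> R) : Prop :=
  forall phi, test_plane phi ->
  (\int[leb2]_z (f z * 'D_(axis R b) phi z)%:E = - \int[leb2]_z (g z * phi z)%:E)%E.

(** Fubini reduces the identity to integration by parts on each line. The line through the origin,
    where radial functions may be singular, is a null set of lines and is left out by [y != 0]. *)
Lemma weak_partialR_lines (b : bool) (f g : R * R -> R) :
  measurable_fun [set: mR * mR] f -> measurable_fun [set: mR * mR] g ->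
  (\int[leb2]_z (f z ^+ 2)%:E < +oo)%E -> (\int[leb2]_z (g z ^+ 2)%:E < +oo)%E ->
  (forall (y a c : R), y != 0 -> a <= c ->
    primitive_on a c (fun x => f (if b then (y, x) else (x, y)))
                     (fun x => g (if b then (y, x) else (x, y)))) ->
  weak_partialR b f g.
Proof.
move=> mf mg f2 g2 lin phi tphi.
have [M M0 z] := test_plane_support tphi.
have [cphi cdphi dphi] := test_plane_continuous b tphi.
have [mphi phi2] := continuous_support_L2 M0 cphi (fun x y h => (z b x y h).1).
have [mdphi dphi2] := continuous_support_L2 M0 cdphi (fun x y h => (z b x y h).2).
have i1 : leb2.-integrable [set: mR * mR] (EFin \o (fun w => f w * 'D_(axis R b) phi w)).
  exact: integrable_mul_L2.
have i2 : leb2.-integrable [set: mR * mR] (EFin \o (fun w => g w * phi w)).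
  exact: integrable_mul_L2.
have cpair1 (y : R) : continuous (fun x : R => (x, y)).
  move=> x; exact: (cvg_pair (@cvg_id _ (nbhs x)) (cvg_cst y)).
have cpair2 (y : R) : continuous (fun x : R => (y, x)).
  move=> x; exact: (cvg_pair (cvg_cst y) (@cvg_id _ (nbhs x))).
have ae0 : {ae mu, forall y : R, y != 0}.
  exists [set 0]; split => //; first exact: lebesgue_measure_set1.
  by move=> y /= /negP; rewrite negbK => /eqP.
have i2' : leb2.-integrable [set: mR * mR] (EFin \o (fun w => - (g w * phi w))).
  by have := integrable_mulr (-1) measurableT i2; apply: eq_integrable => // x _; rewrite /= mulN1r.
rewrite -integral_oppE//.
have line (V h phi' : R -> R) : primitive_on (- M) M V h ->
    (forall x, derivable phi' x 1) -> continuous (fun x => 'D_1 phi' x) ->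
    (forall x, M <= `|x| -> phi' x = 0 /\ 'D_1 phi' x = 0) ->
    mu.-integrable [set: mR] (EFin \o (fun x => h x * phi' x)) ->
    (\int[mu]_x (V x * 'D_1 phi' x)%:E = \int[mu]_x (- (h x * phi' x))%:E)%E.
  by move=> *; rewrite integral_oppE//; exact: (@line_ibp M).
case: b lin z cdphi dphi mdphi dphi2 i1 => lin z cdphi dphi mdphi dphi2 i1.
  rewrite -(integral12_prod_meas1 i1) -(integral12_prod_meas1 i2').
  apply: ae_eq_integral => //.
  - exact: (measurable_fubini_F i1).
  - exact: (measurable_fubini_F i2').
  - have := ae_integrable1 i2; move: ae0; apply: ae_imp2 => y y0 iy _.
    transitivity (\int[mu]_x (f (y, x) * 'D_1 (fun t => phi (y, t)) x)%:E)%E.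
      by apply: eq_integral => x _; rewrite /= slice2_derive.
    apply: (line (fun x => f (y, x)) (fun x => g (y, x)) (fun x => phi (y, x))) => //.
    + by apply: lin => //; lra.
    + by move=> x; rewrite -slice2_derivable; exact: dphi.
    + move=> x; rewrite (_ : (fun _ => _) = (fun x => 'D_(0, 1) phi (y, x))).
        exact: (continuous_comp (cpair2 y x) (cdphi (y, x))).
      by apply/funext => t; rewrite slice2_derive.
    + by move=> x xM; have := z true y x (or_intror xM); rewrite /axis slice2_derive.
rewrite -(integral21_prod_meas1 i1) -(integral21_prod_meas1 i2').
apply: ae_eq_integral => //.
- exact: (measurable_fubini_G i1).
- exact: (measurable_fubini_G i2').
- have := ae_integrable2 i2; move: ae0; apply: ae_imp2 => y y0 iy _.
  transitivity (\int[mu]_x (f (x, y) * 'D_1 (fun t => phi (t, y)) x)%:E)%E.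
    by apply: eq_integral => x _; rewrite /= slice1_derive.
  apply: (line (fun x => f (x, y)) (fun x => g (x, y)) (fun x => phi (x, y))) => //.
  + by apply: lin => //; lra.
  + by move=> x; rewrite -slice1_derivable; exact: dphi.
  + move=> x; rewrite (_ : (fun _ => _) = (fun x => 'D_(1, 0) phi (x, y))).
      exact: (continuous_comp (cpair1 y x) (cdphi (x, y))).
    by apply/funext => t; rewrite slice1_derive.
  + by move=> x xM; have := z false x y (or_introl xM); rewrite /axis slice1_derive.
Qed.

End plane_ibp.

(** * The angular factor and its derivatives along lines *)

Section angular.
Variable R : realType.
Local Notation mu := (@lebesgue_measure R).
Local Notation mR := (measurableTypeR R).
Local Notation leb2 := (mu \x mu)%E.
Local Notation Rpos := (`]0, +oo[%classic : set R).
Implicit Types (l : int) (z : R * R).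

Definition dir z : R[i] := (z.1 +i* z.2) / (radius z)%:C.

Lemma dirE z : dir z = (z.1 / radius z) +i* (z.2 / radius z).
Proof.
rewrite /dir -(fmorphV (real_complex R)); apply/eqP.
by rewrite eq_complex /= !mulr0 subr0 add0r !eqxx.
Qed.

Lemma angular_liftE l v z : angular_lift l v z = dir z ^ l * v (radius z).
Proof. by []. Qed.

Lemma dir_sqr z : radius z != 0 -> (z.1 / radius z) ^+ 2 + (z.2 / radius z) ^+ 2 = 1.
Proof.
by move=> r0; rewrite !exprMn -mulrDl -sqr_radius -exprMn mulfV// expr1n.
Qed.

(** At the origin both sides are 0 by the convention for inverses. The identity turns negative
    powers into powers of the conjugate. *)
Lemma dirV z : (dir z)^-1 = (dir z)^*%C.
Proof.
case: (eqVneq (radius z) 0) => [r0|r0].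
  by rewrite /dir r0 invr0 mulr0 invr0 conjc0.
have d0 := dir_sqr r0; rewrite dirE; apply/eqP; rewrite eq_complex /=.
by rewrite d0 !divr1 !eqxx.
Qed.

Lemma normc_dir z : radius z != 0 -> normc (dir z) = 1.
Proof. by move=> r0; rewrite dirE /= dir_sqr// sqrtr1. Qed.

Lemma normcV1 (x : R[i]) : normc x = 1 -> normc x^-1 = 1.
Proof.
move=> x1; have x0 : x != 0 by apply: contra_eq_neq x1 => ->; rewrite normc0 eq_sym oner_eq0.
have : normc (x * x^-1) = 1 by rewrite mulfV// normc1.
by rewrite normcM x1 mul1r.
Qed.

Lemma normcX1 (x : R[i]) l : normc x = 1 -> normc (x ^ l) = 1.
Proof.
have X (y : R[i]) n : normc y = 1 -> normc (y ^+ n) = 1.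
  by move=> y1; elim: n => [|n IH]; rewrite ?expr0 ?normc1// exprS normcM y1 IH mulr1.
by move=> x1; case: l => n; [exact: X|rewrite /exprz; apply: normcV1; exact: X].
Qed.

(** The hypotheses say E' = -i k E, so (E^l)' = -i l k E^l. For negative [l] the rule is applied to
    the conjugate of [E], which satisfies the same equation with [-k]. *)
Lemma angular_derive (E : R -> R[i]) (k x : R) l :
  (forall t, (E t)^-1 = (E t)^*%C) ->
  is_derive x (1 : R) (fun t => complex.Re (E t)) (k * complex.Im (E x)) ->
  is_derive x (1 : R) (fun t => complex.Im (E t)) (- (k * complex.Re (E x))) ->
  is_derive x (1 : R) (fun t => complex.Re (E t ^ l)) (l%:~R * k * complex.Im (E x ^ l)) /\
  is_derive x (1 : R) (fun t => complex.Im (E t ^ l)) (- (l%:~R * k * complex.Re (E x ^ l))).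
Proof.
have ReM (a b : R[i]) : complex.Re (a * b) =
    complex.Re a * complex.Re b - complex.Im a * complex.Im b by case: a b => ? ? [].
have ImM (a b : R[i]) : complex.Im (a * b) =
    complex.Re a * complex.Im b + complex.Im a * complex.Re b.
  by case: a b => a1 a2 [b1 b2] /=; ring.
have pos (F : R -> R[i]) (c : R) n :
  is_derive x (1 : R) (fun t => complex.Re (F t)) (c * complex.Im (F x)) ->
  is_derive x (1 : R) (fun t => complex.Im (F t)) (- (c * complex.Re (F x))) ->
  is_derive x (1 : R) (fun t => complex.Re (F t ^+ n)) (n%:R * c * complex.Im (F x ^+ n)) /\
  is_derive x (1 : R) (fun t => complex.Im (F t ^+ n)) (- (n%:R * c * complex.Re (F x ^+ n))).
  move=> dR dI; elim: n => [|n [IR II]].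
    rewrite !mul0r oppr0; split.
      by rewrite (_ : (fun _ => _) = cst 1); [exact: is_derive_cst|apply/funext => t].
    by rewrite (_ : (fun _ => _) = cst 0); [exact: is_derive_cst|apply/funext => t].
  split.
    rewrite (_ : (fun _ => _) = ((fun t => complex.Re (F t)) * (fun t => complex.Re (F t ^+ n)) -
        (fun t => complex.Im (F t)) * (fun t => complex.Im (F t ^+ n)))); last first.
      by apply/funext => t; rewrite exprS ReM.
    have D := is_deriveB (is_deriveM dR IR) (is_deriveM dI II); apply: is_derive_eq D _.
    by rewrite /GRing.scale/= exprS ImM -natr1; ring.
  rewrite (_ : (fun _ => _) = ((fun t => complex.Re (F t)) * (fun t => complex.Im (F t ^+ n)) +
      (fun t => complex.Im (F t)) * (fun t => complex.Re (F t ^+ n)))); last first.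
    by apply/funext => t; rewrite exprS ImM.
  have D := is_deriveD (is_deriveM dR II) (is_deriveM dI IR); apply: is_derive_eq D _.
  by rewrite /GRing.scale/= exprS ReM -natr1; ring.
move=> EV dR dI; case: l => n.
  by have := pos E k n dR dI; rewrite -pmulrn.
have powN t : E t ^ Negz n = (E t)^*%C ^+ n.+1 by rewrite /exprz -exprVn EV.
have ReC (a : R[i]) : complex.Re a^*%C = complex.Re a by case: a.
have ImC (a : R[i]) : complex.Im a^*%C = - complex.Im a by case: a.
have [] := pos (fun t => (E t)^*%C) (- k) n.+1.
- by under eq_fun do rewrite ReC; rewrite ImC mulrNN.
- under eq_fun do rewrite ImC; rewrite ReC mulNr.
  by have := is_deriveN dI.
- have cN : (Negz n)%:~R = - n.+1%:R :> R by rewrite NegzE mulrNz -pmulrn.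
  have e (p : R[i] -> R) : (fun t => p ((E t)^*%C ^+ n.+1)) = (fun t => p (E t ^ Negz n)).
    by apply/funext => t; rewrite powN.
  by rewrite (e (@complex.Re R)) (e (@complex.Im R)) -powN cN !mulrN !mulNr => dR' dI'; split.
Qed.

Lemma radius_swap (x y : R) : radius (x, y) = radius (y, x).
Proof. by rewrite /radius /= addrC. Qed.

Definition line (b : bool) (y t : R) : R * R := if b then (y, t) else (t, y).

Lemma radius_line b y t : radius (line b y t) = hypot y t.
Proof. by case: b; rewrite /line /hypot// radius_swap. Qed.

Lemma is_derive_ratios (y x : R) : y != 0 ->
  is_derive x (1 : R) (fun t => t / hypot y t) (y / hypot y x ^+ 2 * (y / hypot y x)) /\
  is_derive x (1 : R) (fun t => y / hypot y t) (- (y / hypot y x ^+ 2 * (x / hypot y x))).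
Proof.
move=> y0; have h0 : hypot y x != 0 by rewrite gt_eqF// hypot_gt0.
have D := is_derive_hypot x y0.
have DV := is_deriveV h0 D.
have h2 : hypot y x ^+ 2 = x ^+ 2 + y ^+ 2 by rewrite sqr_radius.
split.
  have DM := is_deriveM (is_derive_id x (1 : R)) DV.
  apply: is_derive_eq DM _; rewrite /GRing.scale/= mulr1.
  have -> : y / hypot y x ^+ 2 * (y / hypot y x) = (hypot y x ^+ 2 - x ^+ 2) / hypot y x ^+ 3.
    have -> : hypot y x ^+ 2 - x ^+ 2 = y ^+ 2 by rewrite h2; ring.
    by field.
  by field.
have DM := is_deriveZ y DV.
by apply: is_derive_eq DM _; rewrite /GRing.scale/=; field.
Qed.

(** Minus the partial derivative of the polar angle; [dir_coord] is the partial derivative of the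
    radius. *)
Definition dir_slope (b : bool) z : R := (if b then - z.1 else z.2) / radius z ^+ 2.
Definition dir_coord (b : bool) z : R := (if b then z.2 else z.1) / radius z.

Lemma dir_line_derive b l (y x : R) : y != 0 ->
  is_derive x (1 : R) (fun t => complex.Re (dir (line b y t) ^ l))
    (l%:~R * dir_slope b (line b y x) * complex.Im (dir (line b y x) ^ l)) /\
  is_derive x (1 : R) (fun t => complex.Im (dir (line b y t) ^ l))
    (- (l%:~R * dir_slope b (line b y x) * complex.Re (dir (line b y x) ^ l))).
Proof.
move=> y0; have [D1 D2] := is_derive_ratios x y0.
apply: (@angular_derive (fun t => dir (line b y t))).
- by move=> t; exact: dirV.
- under eq_fun do rewrite dirE radius_line.
  rewrite /dir_slope dirE radius_line; case: b => /=.
    by apply: is_derive_eq D2 _; rewrite !mulNr.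
  by apply: is_derive_eq D1 _.
- under eq_fun do rewrite dirE radius_line.
  rewrite /dir_slope dirE radius_line; case: b => /=.
    by apply: is_derive_eq D1 _; rewrite !mulNr opprK.
  by apply: is_derive_eq D2 _.
Qed.

Lemma continuous_is_derive (f df : R -> R) :
  (forall x, is_derive x (1 : R) f (df x)) -> continuous f.
Proof. by move=> d x; have [+ _] := d x; move=> /derivable1_diffP/differentiable_continuous. Qed.

Lemma dir_line_primitive b l (y a c : R) : y != 0 -> a <= c ->
  primitive_on a c (fun t => complex.Re (dir (line b y t) ^ l))
    (fun t => l%:~R * dir_slope b (line b y t) * complex.Im (dir (line b y t) ^ l)) /\
  primitive_on a c (fun t => complex.Im (dir (line b y t) ^ l))
    (fun t => - (l%:~R * dir_slope b (line b y t) * complex.Re (dir (line b y t) ^ l))).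
Proof.
move=> y0 ac.
have cRe : continuous (fun t => complex.Re (dir (line b y t) ^ l)).
  by apply: continuous_is_derive => x; exact: (dir_line_derive b l x y0).1.
have cIm : continuous (fun t => complex.Im (dir (line b y t) ^ l)).
  by apply: continuous_is_derive => x; exact: (dir_line_derive b l x y0).2.
have cs : continuous (fun t : R => l%:~R * dir_slope b (line b y t)).
  rewrite (_ : (fun _ => _) =
      (fun t => l%:~R * ((if b then - y else y) / hypot y t ^+ 2))); last first.
    by apply/funext => t; rewrite /dir_slope radius_line; case: b {cRe cIm}.
  move=> t; apply: cvgM; first exact: cvg_cst.
  apply: cvgM; first exact: cvg_cst.
  apply: cvgV; first by rewrite expf_neq0// gt_eqF// hypot_gt0.
  apply: (@continuous_comp _ _ _ (hypot y) (fun u => u ^+ 2)).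
    exact: continuous_hypot.
  exact: exprn_continuous.
split.
  apply: C1_primitive_on => // x _; first exact: (dir_line_derive b l x y0).1.
  by apply: cvgM; [exact: cs|exact: cIm].
apply: C1_primitive_on => // x _; first exact: (dir_line_derive b l x y0).2.
by apply: cvgN; apply: cvgM; [exact: cs|exact: cRe].
Qed.

Definition cpart (b : bool) : R[i] -> R := if b then @complex.Im R else @complex.Re R.

(** Product rule in polar coordinates: e^{il theta} times (f' times the derivative of r, plus i l f
    times the derivative of theta), with [g] in the role of f'. *)
Definition lift_partial b l (f g : bool -> R -> R) z : R[i] :=
  dir z ^ l *
  ((g false (radius z) * dir_coord b z + l%:~R * dir_slope b z * f true (radius z)) +i*
   (g true (radius z) * dir_coord b z - l%:~R * dir_slope b z * f false (radius z))).

Definition cpair (f : bool -> R -> R) (r : R) : R[i] := f false r +i* f true r.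

Lemma lift_line_primitive b l j (f g : bool -> R -> R) (y a c : R) : y != 0 -> a <= c ->
  (forall j, primitive0 (f j) (g j)) ->
  primitive_on a c (fun t => cpart j (angular_lift l (cpair f) (line b y t)))
                   (fun t => cpart j (lift_partial b l f g (line b y t))).
Proof.
move=> y0 ac pf.
have pj i := primitive_on_hypot y0 (pf i) ac.
have [pR pI] := dir_line_primitive b l y0 ac.
have qE t : dir_coord b (line b y t) = t / hypot y t.
  by rewrite /dir_coord radius_line; case: b {pR pI}.
have lE t : angular_lift l (cpair f) (line b y t) =
    dir (line b y t) ^ l * (f false (hypot y t) +i* f true (hypot y t)).
  by rewrite angular_liftE radius_line.
have ReM (u v : R[i]) : complex.Re (u * v) =
    complex.Re u * complex.Re v - complex.Im u * complex.Im v by case: u v => ? ? [].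
have ImM (u v : R[i]) : complex.Im (u * v) =
    complex.Re u * complex.Im v + complex.Im u * complex.Re v.
  by case: u v => a1 a2 [b1 b2] /=; ring.
case: j.
  have := primitive_onD ac (primitive_onM ac pR (pj true)) (primitive_onM ac pI (pj false)).
  congr primitive_on; apply/funext => t.
    by rewrite lE /cpart ImM.
  rewrite /lift_partial /cpart ImM /= radius_line qE; ring.
have := primitive_onD ac (primitive_onM ac pR (pj false))
  (primitive_onZ (-1) ac (primitive_onM ac pI (pj true))).
congr primitive_on; apply/funext => t.
  by rewrite lE /cpart ReM /=; ring.
rewrite /lift_partial /cpart ReM /= radius_line qE; ring.
Qed.

End angular.

(** * Measurability, null sets and uniqueness of weak derivatives *)

Section lifts.
Variable R : realType.
Local Notation mu := (@lebesgue_measure R).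
Local Notation mR := (measurableTypeR R).
Local Notation leb2 := (mu \x mu)%E.
Local Notation Rpos := (`]0, +oo[%classic : set R).
Implicit Types (l : int) (z : R * R) (j b : bool).

Lemma cpartE j (u v : R[i]) : (forall j, cpart j u = cpart j v) -> u = v.
Proof.
by move=> h; apply/eqP; rewrite eq_complex; have := h false; have := h true => /= -> ->; rewrite !eqxx.
Qed.

Lemma cpartM j (u v : R[i]) : cpart j (u * v) =
  if j then cpart false u * cpart true v + cpart true u * cpart false v
  else cpart false u * cpart false v - cpart true u * cpart true v.
Proof. by case: j; case: u v => a1 a2 [b1 b2] //=; ring. Qed.

Definition cmeas (u : R * R -> R[i]) :=
  forall j, measurable_fun [set: mR * mR] (fun z => cpart j (u z)).

Lemma cmeasM u v : cmeas u -> cmeas v -> cmeas (fun z => u z * v z).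
Proof.
move=> mu_ mv j; under eq_fun do rewrite cpartM.
case: j; [apply: measurable_funD|apply: measurable_funB]; apply: measurable_funM;
  by [apply: mu_|apply: mv].
Qed.

Lemma measurable_comp_radius d (T : measurableType d) (f : R -> T) :
  measurable_fun [set: mR] f -> measurable_fun [set: mR * mR] (fun z => f (radius z)).
Proof.
by move=> mf; apply: (measurableT_comp mf); exact: measurable_radius.
Qed.

Lemma measurable_radial (f : R -> R) : measurable_fun Rpos f ->
  measurable_fun [set: mR * mR] (fun z => f (radius z)).
Proof.
move=> mf.
(* Measurability of [f] is known on the open half-line only, so the value at the origin is split
   off. *)
rewrite (_ : (fun z => _) = (fun z => (f \_ Rpos) (radius z) + f 0 * \1_([set 0] : set R) (radius z))).
  apply: measurable_funD; first apply: (@measurable_comp_radius _ _ (f \_ Rpos)).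
    exact/(measurable_restrictT f (@measurable_Rpos R)).
  apply: measurable_funM; first exact: measurable_cst.
  by apply: (@measurable_comp_radius _ mR (\1_([set 0] : set R))); exact: measurable_indic.
apply/funext => z; rewrite patchE mem_setE in_itv/= andbT indicE.
have [r0|] := ltP 0 (radius z); first by rewrite memNset ?mulr0 ?addr0// => /= h; rewrite h ltxx in r0.
move=> r0; have -> : radius z = 0 by apply/eqP; rewrite eq_le r0 radius_ge0.
by rewrite mem_set// mulr1 add0r.
Qed.

Lemma measurable_radius_inv : measurable_fun [set: mR * mR] (fun z => (radius z)^-1).
Proof.
apply: (@measurable_radial (fun r => r^-1)).
apply: open_continuous_measurable_fun; first exact: interval_open.
move=> x; rewrite inE/= in_itv/= andbT => x0.
by apply: cvgV; [rewrite gt_eqF|exact: cvg_id].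
Qed.

Lemma cmeas_dir : cmeas (@dir R).
Proof.
move=> j; under eq_fun do rewrite dirE.
case: j => /=; apply: measurable_funM; try exact: measurable_radius_inv.
  exact: measurable_snd.
exact: measurable_fst.
Qed.

Lemma cmeas_dirX l : cmeas (fun z => dir z ^ l).
Proof.
have X u n : cmeas u -> cmeas (fun z => u z ^+ n).
  move=> mu_; elim: n => [|n IH].
    by move=> j; under eq_fun do rewrite expr0; exact: measurable_cst.
  by rewrite (_ : (fun z => _) = (fun z => u z * u z ^+ n)); [exact: cmeasM|apply/funext => z; rewrite exprS].
case: l => n; first exact: (X _ n cmeas_dir).
rewrite (_ : (fun z => _) = (fun z => ((dir z)^*%C) ^+ n.+1)); last first.
  by apply/funext => z; rewrite /exprz -exprVn dirV.
apply: X => j; case: j.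
  rewrite (_ : (fun z => _) = (fun z => - cpart true (dir z))).
    by apply: measurable_funN; exact: cmeas_dir.
  by apply/funext => z; rewrite dirE.
rewrite (_ : (fun z => _) = (fun z => cpart false (dir z))); first exact: cmeas_dir.
by apply/funext => z; rewrite dirE.
Qed.

Lemma plane_pos : {ae leb2, forall z, 0 < radius z}.
Proof.
have m0 : measurable (`[0%R, 0%R]%classic : set mR) by exact: measurable_itv.
exists ((`[0%R, 0%R]%classic : set R) `*` (`[0%R, 0%R]%classic : set R)); split.
- exact: measurableX.
- have L : leb2 ((`[0%R, 0%R]%classic : set R) `*` (`[0%R, 0%R]%classic : set R)) =
    (mu `[0%R, 0%R] * mu `[0%R, 0%R])%E by exact: leb2_rect.
  by apply: etrans L _; rewrite set_itv1 lebesgue_measure_set1 mule0.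
- move=> [x y] /= /negP; rewrite -leNgt => r0.
  have : x ^+ 2 + y ^+ 2 = 0.
    have r00 : radius (x, y) = 0 by apply/eqP; rewrite eq_le r0 radius_ge0.
    by rewrite -[LHS](sqr_radius (x, y)) r00 expr0n.
  move/eqP; rewrite paddr_eq0 ?sqr_ge0// !sqrf_eq0 => /andP[/eqP-> /eqP->].
  by split; rewrite /= in_itv/= lexx.
Qed.

Lemma radial_integral (F : R * R -> R) (f : R -> R) :
  measurable_fun [set: mR * mR] F -> measurable_fun Rpos f ->
  (forall z, 0 <= F z) -> (forall z, 0 < radius z -> F z = f (radius z)) ->
  (\int[leb2]_z (F z)%:E = (2 * kappa R)%:E * \int[mu]_(r in `]0%R, +oo[) (f r * r)%:E)%E.
Proof.
move=> mF mf F0 Ff.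
have f0 r : 0 < r -> 0 <= f r.
  move=> r0; have rE : radius (r, 0) = r by rewrite /radius /= expr0n addr0 sqrtr_sqr gtr0_norm.
  by have := F0 (r, 0); rewrite Ff rE.
pose f' : R -> \bar R := EFin \o (f \_ Rpos).
have mf' : measurable_fun [set: R] f'.
  by apply/measurable_EFinP; exact/(measurable_restrictT f (@measurable_Rpos R)).
have f'0 y : (0 <= f' y)%E.
  rewrite /f' /= patchE mem_setE in_itv/= andbT lee_fin; case: ifP => //; exact: f0.
transitivity (\int[leb2]_z f' (radius z))%E.
  apply: ge0_ae_eq_integral => //.
  - exact/measurable_EFinP.
  - exact: measurable_comp_radius.
  - by move=> z _; rewrite lee_fin.
  - move: plane_pos; apply: ae_imp => z r0 _.
    by rewrite Ff// /f' /= patchE mem_setE in_itv/= r0.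
rewrite (ge0_integral_radial mf' f'0); congr (_ * _)%E.
apply: eq_integral => r; rewrite inE/= in_itv/= andbT => r0.
by rewrite /f' /= patchE mem_setE in_itv/= r0.
Qed.

(** By polar integration, the area of the set of points whose radius lies in a null set is zero. *)
Lemma ae_radial (P : R -> Prop) : {ae mu, forall r, 0 < r -> P r} ->
  {ae leb2, forall z, 0 < radius z -> P (radius z)}.
Proof.
move=> [N [mN N0 sub]].
exists [set z | N (radius z)]; split.
- by rewrite -[X in measurable X]setTI; exact: measurable_radius.
- have mN' : measurable ([set z | N (radius z)] : set (mR * mR)).
    by rewrite -[X in measurable X]setTI; exact: measurable_radius.
  have m1 : measurable_fun [set: R] (EFin \o \1_N : R -> \bar R).
    by apply/measurable_EFinP; exact: measurable_indic.
  have m10 y : (0 <= (EFin \o \1_N : R -> \bar R) y)%E by rewrite lee_fin.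
  transitivity (\int[leb2]_z (\1_N (radius z))%:E)%E.
    have := integral_indic leb2 measurableT mN'; rewrite setIT => <-.
    by apply: eq_integral => z _; rewrite !indicE.
  rewrite (ge0_integral_radial m1 m10).
  have -> : (\int[mu]_(r in `]0%R, +oo[) ((EFin \o \1_N : R -> \bar R) r * r%:E) =
      \int[mu]_(r in `]0%R, +oo[) 0)%E.
    apply: ge0_ae_eq_integral => //.
    + by apply: emeasurable_funM; [exact: measurable_funTS|apply/measurable_EFinP].
    + by move=> r /=; rewrite in_itv/= andbT => r0; rewrite mule_ge0// lee_fin ltW.
    + exists N; split => // r /not_implyP[_ h]; apply: contrapT => nN; apply: h.
      by rewrite /= indicE memNset// mul0e.
  by rewrite integral0 mule0.
- by move=> z /not_implyP[r0 nP]; apply: sub => /(_ r0).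
Qed.

Lemma normc_cpart (u : R[i]) : normc u ^+ 2 = cpart false u ^+ 2 + cpart true u ^+ 2.
Proof. by case: u => x y; rewrite /= sqr_sqrtr// addr_ge0// sqr_ge0. Qed.

Lemma measurable_normc u : cmeas u -> measurable_fun [set: mR * mR] (fun z => normc (u z) ^+ 2).
Proof.
move=> mu_; under eq_fun do rewrite normc_cpart.
by apply: measurable_funD; apply: measurable_funX; exact: mu_.
Qed.

Lemma cmeas_cmeasurable u : cmeas u <->
  @cmeasurable _ (mR * mR)%type R setT u.
Proof. by split=> [m|[m1 m2] []//]; split; [exact: (m false)|exact: (m true)]. Qed.

Lemma L2plane_cpart j u : L2plane u ->
  (\int[leb2]_z (cpart j (u z) ^+ 2)%:E < +oo)%E.
Proof.
move=> [/cmeas_cmeasurable m u2]; apply: le_lt_trans u2; apply: ge0_le_integral => //.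
- by move=> z _; rewrite lee_fin sqr_ge0.
- by apply/measurable_EFinP; apply: measurable_funX; exact: m.
- by apply/measurable_EFinP; exact: measurable_normc.
- by move=> z _; rewrite lee_fin normc_cpart; case: j; rewrite ?lerDl ?lerDr sqr_ge0.
Qed.

Lemma weak_partial_cpart b u v :
  weak_partial b u v <-> forall j, weak_partialR b (fun z => cpart j (u z)) (fun z => cpart j (v z)).
Proof.
split=> [h j phi /h[h1 h2]|h phi tphi]; first by case: j.
by split; [exact: (h false)|exact: (h true)].
Qed.

Lemma test_plane_L2 b (phi : R * R -> R) : test_plane phi ->
  [/\ measurable_fun [set: mR * mR] phi, (\int[leb2]_z (phi z ^+ 2)%:E < +oo)%E,
      measurable_fun [set: mR * mR] (fun z => 'D_(axis R b) phi z) &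
      (\int[leb2]_z ('D_(axis R b) phi z ^+ 2)%:E < +oo)%E].
Proof.
move=> tphi; have [M M0 z] := test_plane_support tphi.
have [cphi cdphi _] := test_plane_continuous b tphi.
have [? ?] := continuous_support_L2 M0 cphi (fun x y h => (z b x y h).1).
by have [? ?] := continuous_support_L2 M0 cdphi (fun x y h => (z b x y h).2).
Qed.

Lemma weak_partial_unique b u v w : L2plane v -> L2plane w ->
  weak_partial b u v -> weak_partial b u w -> {ae leb2, forall z, v z = w z}.
Proof.
move=> Lv Lw /weak_partial_cpart pv /weak_partial_cpart pw.
have [/cmeas_cmeasurable mv _] := Lv; have [/cmeas_cmeasurable mw _] := Lw.
have key j : {ae leb2, forall z, cpart j (v z) - cpart j (w z) = 0}.
  apply: plane_test_eq0.
  - by apply: measurable_funB; [exact: mv|exact: mw].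
  - apply: (@le_lt_trans _ _ (\int[leb2]_z ((2 * cpart j (v z) ^+ 2)%:E + (2 * cpart j (w z) ^+ 2)%:E))%E).
      apply: ge0_le_integral => //.
      + by move=> z _; rewrite lee_fin sqr_ge0.
      + by apply/measurable_EFinP; apply: measurable_funX; apply: measurable_funB; [exact: mv|exact: mw].
      + by apply: emeasurable_funD; apply/measurable_EFinP; apply: measurable_funM => //;
          apply: measurable_funX; [exact: mv|exact: mw].
      + move=> z _; rewrite lee_fin -subr_ge0.
        rewrite (_ : _ - _ = (cpart j (v z) + cpart j (w z)) ^+ 2) ?sqr_ge0//; ring.
    have two x : L2plane x -> (\int[leb2]_z (2 * cpart j (x z) ^+ 2)%:E < +oo)%E.
      move=> Lx; have [/cmeas_cmeasurable mx _] := Lx.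
      have -> : (\int[leb2]_z (2 * cpart j (x z) ^+ 2)%:E = 2%:E * \int[leb2]_z (cpart j (x z) ^+ 2)%:E)%E.
        rewrite -ge0_integralZl//.
        - by apply/measurable_EFinP; apply: measurable_funX; exact: mx.
        - by move=> z _; rewrite lee_fin sqr_ge0.
      by apply: lte_mul_pinfty => //; exact: L2plane_cpart.
    rewrite ge0_integralD//.
    + by apply: lte_add_pinfty; exact: two.
    + by move=> z _; rewrite lee_fin mulr_ge0// sqr_ge0.
    + by apply/measurable_EFinP; apply: measurable_funM => //; apply: measurable_funX; exact: mv.
    + by move=> z _; rewrite lee_fin mulr_ge0// sqr_ge0.
    + by apply/measurable_EFinP; apply: measurable_funM => //; apply: measurable_funX; exact: mw.
  - move=> phi tphi; have [mphi phi2 _ _] := test_plane_L2 b tphi.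
    have iv : leb2.-integrable [set: mR * mR] (EFin \o (fun z => cpart j (v z) * phi z)).
      by apply: integrable_mul_L2 => //; exact: L2plane_cpart.
    have iw : leb2.-integrable [set: mR * mR] (EFin \o (fun z => cpart j (w z) * phi z)).
      by apply: integrable_mul_L2 => //; exact: L2plane_cpart.
    have e := pv j phi tphi; rewrite (pw j phi tphi) in e.
    under eq_integral do rewrite mulrBl EFinB.
    rewrite integralB//.
    have {}e : (\int[leb2]_z (cpart j (w z) * phi z)%:E = \int[leb2]_z (cpart j (v z) * phi z)%:E)%E.
      by apply: oppe_inj.
    rewrite /comp e subee//; exact: integrable_fin_num.
move: (key false) (key true); apply: ae_imp2 => z /eqP h1 /eqP h2.
by apply: (@cpartE false) => -[]; apply/eqP; rewrite -subr_eq0.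
Qed.

Lemma weak_partial_ae b u u' v : cmeas u -> cmeas u' -> {ae leb2, forall z, u z = u' z} ->
  weak_partial b u v -> weak_partial b u' v.
Proof.
move=> m m' e /weak_partial_cpart p; apply/weak_partial_cpart => j phi tphi.
have [mphi phi2 mdphi dphi2] := test_plane_L2 b tphi.
rewrite -(p j phi tphi); apply: ae_eq_integral => //.
- by apply/measurable_EFinP; apply: measurable_funM => //; exact: m'.
- by apply/measurable_EFinP; apply: measurable_funM => //; exact: m.
- by move: e; apply: ae_imp => z -> _.
Qed.

(** [wD] is an arbitrary choice by [xget]; uniqueness lets any explicit weak derivative replace it
    under an integral. *)
Lemma wD_ae b u v : L2plane v -> weak_partial b u v -> {ae leb2, forall z, wD b u z = v z}.
Proof.
move=> Lv pv.
have [Lw pw] : [set g | L2plane g /\ weak_partial b u g] (wD b u).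
  by apply: (@xgetPex _ _ [set g | L2plane g /\ weak_partial b u g]); exists v.
exact: weak_partial_unique Lw Lv pw pv.
Qed.

End lifts.

(** * Gradient and D^+, D^- of an angular mode *)

Section radial_lifts.
Variable R : realType.
Local Notation mu := (@lebesgue_measure R).
Local Notation mR := (measurableTypeR R).
Local Notation leb2 := (mu \x mu)%E.
Local Notation Rpos := (`]0, +oo[%classic : set R).
Implicit Types (l : int) (z : R * R) (j b : bool).

Lemma normc_dirX l z w : 0 < radius z -> normc (dir z ^ l * w) = normc w.
Proof.
by move=> r0; rewrite normcM (normcX1 l (normc_dir _)) ?mul1r// gt_eqF.
Qed.

Lemma normc_sqrC (a b : R) : normc (a +i* b) ^+ 2 = a ^+ 2 + b ^+ 2.
Proof. by rewrite /= sqr_sqrtr// addr_ge0// sqr_ge0. Qed.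

Lemma cmeas_angular_lift l (v : R -> R[i]) : @cmeasurable _ mR R Rpos v -> cmeas (angular_lift l v).
Proof.
move=> [mr mi].
rewrite (_ : angular_lift l v = fun z => dir z ^ l * v (radius z)); last exact/funext.
apply: cmeasM; first exact: cmeas_dirX.
by case; [exact: (@measurable_radial _ (fun r => complex.Im (v r)))|
  exact: (@measurable_radial _ (fun r => complex.Re (v r)))].
Qed.

Lemma measurable_dir_coord b : measurable_fun [set: mR * mR] (@dir_coord R b).
Proof.
apply: measurable_funM; last exact: measurable_radius_inv.
by case: b; [exact: measurable_snd|exact: measurable_fst].
Qed.

Lemma measurable_dir_slope b : measurable_fun [set: mR * mR] (@dir_slope R b).
Proof.
rewrite (_ : dir_slope b = fun z => (if b then - z.1 else z.2) * (radius z)^-1 ^+ 2); last first.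
  by apply/funext => z; rewrite /dir_slope exprVn.
apply: measurable_funM; last by apply: measurable_funX; exact: measurable_radius_inv.
by case: b; [apply: measurable_funN; exact: measurable_fst|exact: measurable_snd].
Qed.

Lemma cmeas_lift_partial b l (f g : bool -> R -> R) :
  (forall j, measurable_fun Rpos (f j)) -> (forall j, measurable_fun Rpos (g j)) ->
  cmeas (lift_partial b l f g).
Proof.
move=> mf mg; apply: cmeasM; first exact: cmeas_dirX.
have mfr j := measurable_radial (mf j); have mgr j := measurable_radial (mg j).
have mc := measurable_dir_coord b; have ms := measurable_dir_slope b.
have msl : measurable_fun [set: mR * mR] (fun z => l%:~R * dir_slope b z).
  by apply: measurable_funM => //; exact: measurable_cst.
by case; [apply: measurable_funB|apply: measurable_funD]; apply: measurable_funM.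
Qed.

(** The gradients of the radius and of the angle are orthogonal, of lengths 1 and 1/r. *)
Lemma lift_partial_sqr l (f g : bool -> R -> R) z : 0 < radius z ->
  normc (lift_partial false l f g z) ^+ 2 + normc (lift_partial true l f g z) ^+ 2 =
  \sum_(j : bool) (g j (radius z) ^+ 2 + (l%:~R / radius z * f j (radius z)) ^+ 2).
Proof.
move=> r0; have rn : radius z != 0 by rewrite gt_eqF.
rewrite /lift_partial !normc_dirX// !normc_sqrC big_bool/= /dir_coord /dir_slope.
have := sqr_radius z; move: (radius z) rn => r rn r2; move: (l%:~R : R) => L.
case: z r0 r2 => x y /= _ r2.
(* Here [r] is a free variable; exposing the factors [r ^+ 2] lets the relation
   [r ^+ 2 = x ^+ 2 + y ^+ 2] be substituted before [field] is called. *)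
have -> : (g true r ^+ 2 + (L / r * f true r) ^+ 2 + (g false r ^+ 2 + (L / r * f false r) ^+ 2)) =
  (r ^+ 2 / r ^+ 2) * (g true r ^+ 2 + g false r ^+ 2) +
  (r ^+ 2 / r ^+ 4) * L ^+ 2 * (f true r ^+ 2 + f false r ^+ 2) by field.
have e t : r ^+ 2 * t = (x ^+ 2 + y ^+ 2) * t by rewrite r2.
by rewrite !e; field.
Qed.

Definition radial_pairs (l : R) (f g : bool -> R -> R) := forall j, radial_pair l (f j) (g j).

Lemma L2w_sqr (f : R -> R) : L2w f -> measurable_fun Rpos (fun r => f r ^+ 2) /\
  measurable_fun Rpos (fun r => f r ^+ 2 * r).
Proof.
move=> [mf _]; have mf2 : measurable_fun Rpos (fun r => f r ^+ 2) by exact: measurable_funX.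
by split => //; apply: measurable_funM.
Qed.

Lemma L2w_sum (I : finType) (h : I -> R -> R) : (forall i, L2w (h i)) ->
  (\int[mu]_(r in `]0%R, +oo[) ((\sum_i h i r ^+ 2) * r)%:E < +oo)%E /\
  measurable_fun Rpos (fun r => \sum_i h i r ^+ 2).
Proof.
move=> Lh; split; last first.
  apply: measurable_sum => i; exact: (L2w_sqr (Lh i)).1.
under eq_integral do rewrite mulr_suml -sumEFin.
rewrite ge0_integral_sum//.
- by apply: lte_sum_pinfty => i _; exact: (Lh i).2.
- by move=> i; apply/measurable_EFinP; exact: (L2w_sqr (Lh i)).2.
- by move=> i x; rewrite /= in_itv/= andbT lee_fin => x0; rewrite mulr_ge0 ?sqr_ge0// ltW.
Qed.

Lemma angular_lift_integral l (v : R -> R[i]) : @cmeasurable _ mR R Rpos v ->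
  (\int[leb2]_z (normc (angular_lift l v z) ^+ 2)%:E =
   (2 * kappa R)%:E * \int[mu]_(r in `]0%R, +oo[) (normc (v r) ^+ 2 * r)%:E)%E.
Proof.
move=> mv; apply: (radial_integral (f := fun r => normc (v r) ^+ 2)).
- by apply: measurable_normc; exact: cmeas_angular_lift.
- rewrite (_ : (fun r => _) = (fun r => cpart false (v r) ^+ 2 + cpart true (v r) ^+ 2)); last first.
    by apply/funext => r; rewrite normc_cpart.
  by apply: measurable_funD; apply: measurable_funX; case: mv.
- by move=> z; exact: sqr_ge0.
- by move=> z r0; rewrite angular_liftE normc_dirX.
Qed.

Lemma L2plane_angular_lift l (v : R -> R[i]) : L2radial v -> L2plane (angular_lift l v).
Proof.
move=> [mv v2]; split; first by apply/cmeas_cmeasurable; exact: cmeas_angular_lift.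
by rewrite angular_lift_integral// lte_mul_pinfty// lee_fin mulr_ge0// ltW// kappa_gt0.
Qed.

Lemma L2plane_lift_partial b l f g : radial_pairs l%:~R f g ->
  L2plane (lift_partial b l f g).
Proof.
move=> p.
have mf j : measurable_fun Rpos (f j) by have [[]] := p j.
have mg j : measurable_fun Rpos (g j) by have [_ _ []] := p j.
have m b' := cmeas_lift_partial b' l mf mg.
split; first exact/cmeas_cmeasurable.
have mn b' := measurable_normc (m b').
pose h (i : bool * bool) r := if i.1 then g i.2 r else l%:~R / r * f i.2 r.
have Lh i : L2w (h i) by case: i => [[] j]; have [_ ? ? _] := p j.
have hE r : \sum_i h i r ^+ 2 = \sum_j (g j r ^+ 2 + (l%:~R / r * f j r) ^+ 2).
  rewrite -(pair_bigA _ (fun i j => h (i, j) r ^+ 2)) /= exchange_big /=.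
  by apply: eq_bigr => j _; rewrite big_bool.
have [fin ms] := L2w_sum Lh.
apply: (@le_lt_trans _ _ (\int[leb2]_z (normc (lift_partial false l f g z) ^+ 2 +
    normc (lift_partial true l f g z) ^+ 2)%:E)%E).
  apply: ge0_le_integral => //.
  - by move=> z _; rewrite lee_fin sqr_ge0.
  - exact/measurable_EFinP.
  - by apply/measurable_EFinP; exact: measurable_funD.
  - by move=> z _; rewrite lee_fin; case: b; rewrite ?lerDl ?lerDr sqr_ge0.
rewrite (radial_integral (f := fun r => \sum_i h i r ^+ 2))//.
- by rewrite lte_mul_pinfty// lee_fin mulr_ge0// ltW// kappa_gt0.
- exact: measurable_funD.
- by move=> z; rewrite addr_ge0// sqr_ge0.
- by move=> z r0; rewrite hE lift_partial_sqr.
Qed.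

Lemma weak_partial_cpair b l f g : radial_pairs l%:~R f g ->
  weak_partial b (angular_lift l (cpair f)) (lift_partial b l f g).
Proof.
move=> p; apply/weak_partial_cpart => i.
have mf j : measurable_fun Rpos (f j) by have [[]] := p j.
have mg j : measurable_fun Rpos (g j) by have [_ _ []] := p j.
have Lc : L2radial (cpair f) by apply: L2radialC; [have [] := p false|have [] := p true].
apply: weak_partialR_lines.
- by apply: cmeas_angular_lift; split; [exact: (mf false)|exact: (mf true)].
- exact: cmeas_lift_partial.
- by apply: L2plane_cpart; exact: L2plane_angular_lift.
- by apply: L2plane_cpart; exact: L2plane_lift_partial.
- move=> y a c y0 ac; apply: lift_line_primitive => // j; by have [] := p j.
Qed.

Lemma lift_representative l v f g : radial_pairs l%:~R f g -> Hrad l v ->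
  {ae mu, forall r, 0 < r -> v r = cpair f r} ->
  [/\ H1 (angular_lift l v),
      {ae leb2, forall z, 0 < radius z /\ v (radius z) = cpair f (radius z)} &
      forall b, {ae leb2, forall z, wD b (angular_lift l v) z = lift_partial b l f g z}].
Proof.
move=> p [Lv _ _] e.
have Lc : L2radial (cpair f) by apply: L2radialC; [have [] := p false|have [] := p true].
have ez : {ae leb2, forall z, 0 < radius z /\ v (radius z) = cpair f (radius z)}.
  move: (ae_radial e) (plane_pos R); apply: ae_imp2 => z h r0; split=> //; exact: h.
have mv : cmeas (angular_lift l v) by apply: cmeas_angular_lift; case: Lv.
have mc : cmeas (angular_lift l (cpair f)) by apply: cmeas_angular_lift; case: Lc.
have w b : weak_partial b (angular_lift l v) (lift_partial b l f g).
  apply: weak_partial_ae mc mv _ (weak_partial_cpair b p).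
  by move: ez; apply: ae_imp => z [_ h]; rewrite !angular_liftE h.
have L b := L2plane_lift_partial b p.
split => //; last by move=> b; exact: wD_ae.
split; first exact: L2plane_angular_lift.
by move=> b; exists (lift_partial b l f g).
Qed.

(** D^+ is e^{i theta} times (d/dr + (i/r) d/dtheta): it raises the angular number by one, and D^-
    lowers it by one. This is why the modes m and m + 1 are coupled only to each other. *)
Lemma Dplus_lift l f g z : 0 < radius z ->
  lift_partial false l f g z + 'i%C * lift_partial true l f g z =
  dir z ^ (l + 1) * ((g false (radius z) - l%:~R / radius z * f false (radius z)) +i*
                     (g true (radius z) - l%:~R / radius z * f true (radius z))).
Proof.
move=> r0; have rn : radius z != 0 by rewrite gt_eqF.
have d0 : dir z != 0.
  by apply: contra_eq_neq (normc_dir rn) => ->; rewrite normc0 eq_sym oner_eq0.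
rewrite (expfzDr l 1 d0) expr1z /lift_partial (mulrCA 'i%C (dir z ^ l)) -mulrDr -[RHS]mulrA; congr (_ * _).
rewrite dirE /dir_coord /dir_slope; move: (radius z) rn => r rn.
by apply/eqP; rewrite eq_complex /=; apply/andP; split; apply/eqP; field.
Qed.

Lemma Dminus_lift l f g z : 0 < radius z ->
  lift_partial false (l + 1) f g z - 'i%C * lift_partial true (l + 1) f g z =
  dir z ^ l * ((g false (radius z) + (l + 1)%:~R / radius z * f false (radius z)) +i*
               (g true (radius z) + (l + 1)%:~R / radius z * f true (radius z))).
Proof.
move=> r0; have rn : radius z != 0 by rewrite gt_eqF.
have d0 : dir z != 0.
  by apply: contra_eq_neq (normc_dir rn) => ->; rewrite normc0 eq_sym oner_eq0.
rewrite /lift_partial (expfzDr l 1 d0) expr1z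
  -!(mulrA (dir z ^ l) (dir z)) (mulrCA 'i%C (dir z ^ l)) -mulrBr; congr (_ * _).
have d2 := dir_sqr rn.
rewrite dirE /dir_coord /dir_slope; move: (l + 1)%:~R => L.
have r2 := sqr_radius z; move: (radius z) rn r2 {d2} => r rn r2.
have e t : r ^+ 2 * t = (z.1 ^+ 2 + z.2 ^+ 2) * t by rewrite r2.
apply/eqP; rewrite eq_complex /=; apply/andP; split; apply/eqP.
  rewrite [RHS](_ : _ = r ^+ 2 * (g false r / r ^+ 2 + L / r ^+ 3 * f false r)); last by field.
  by rewrite e; field.
rewrite [RHS](_ : _ = r ^+ 2 * (g true r / r ^+ 2 + L / r ^+ 3 * f true r)); last by field.
by rewrite e; field.
Qed.

End radial_lifts.

(** * The energy of an angular mode *)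

Section energy_identity.
Variable R : realType.
Local Notation mu := (@lebesgue_measure R).
Local Notation mR := (measurableTypeR R).
Local Notation leb2 := (mu \x mu)%E.
Local Notation Rpos := (`]0, +oo[%classic : set R).
Implicit Types (l : int) (z : R * R) (j b : bool).

Lemma L2plane_wD b (u : R * R -> R[i]) : H1 u -> L2plane (wD b u).
Proof.
move=> [_ /(_ b)[g [Lg pg]]].
have [//] : [set g | L2plane g /\ weak_partial b u g] (wD b u).
by apply: (@xgetPex _ _ [set g | L2plane g /\ weak_partial b u g]); exists g.
Qed.

Lemma L2plane_lin (u v : R * R -> R[i]) (c : R[i]) : L2plane u -> L2plane v ->
  L2plane (fun z => u z + c * v z).
Proof.
move=> [/cmeas_cmeasurable mu_ u2] [/cmeas_cmeasurable mv v2].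
have m : cmeas (fun z => u z + c * v z).
  move=> j; rewrite (_ : (fun z => _) = (fun z => cpart j (u z) + cpart j (c * v z))); last first.
    by apply/funext => z; case: (u z) (c * v z) j => ? ? [? ?] [].
  apply: measurable_funD; first exact: mu_.
  by apply: cmeasM => // k; exact: measurable_cst.
split; first exact/cmeas_cmeasurable.
have K0 : 0 <= 2 * normc c ^+ 2 by rewrite mulr_ge0// sqr_ge0.
apply: (@le_lt_trans _ _ (\int[leb2]_z ((2 * normc (u z) ^+ 2)%:E +
    ((2 * normc c ^+ 2) * normc (v z) ^+ 2)%:E))%E).
  apply: ge0_le_integral => //.
  - by move=> z _; rewrite lee_fin sqr_ge0.
  - by apply/measurable_EFinP; exact: measurable_normc.
  - by apply: emeasurable_funD; apply/measurable_EFinP; apply: measurable_funM;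
      [exact: measurable_cst|exact: measurable_normc|exact: measurable_cst|exact: measurable_normc].
  - move=> z _; rewrite lee_fin -mulrA -exprMn -normcM.
    rewrite !normc_cpart; case: (u z) (c * v z) => a1 a2 [b1 b2] /=.
    rewrite -subr_ge0 (_ : _ - _ = (a1 - b1) ^+ 2 + (a2 - b2) ^+ 2); last by ring.
    by rewrite addr_ge0// sqr_ge0.
have fin (k : R) w : 0 <= k -> cmeas w -> (\int[leb2]_z (normc (w z) ^+ 2)%:E < +oo)%E ->
    (\int[leb2]_z (k * normc (w z) ^+ 2)%:E < +oo)%E.
  move=> k0 mw w2.
  have -> : (\int[leb2]_z (k * normc (w z) ^+ 2)%:E = k%:E * \int[leb2]_z (normc (w z) ^+ 2)%:E)%E.
    rewrite -ge0_integralZl//.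
    - by apply/measurable_EFinP; exact: measurable_normc.
    - by move=> z _; rewrite lee_fin sqr_ge0.
  by apply: lte_mul_pinfty.
rewrite ge0_integralD//.
- by apply: lte_add_pinfty; apply: fin.
- by move=> z _; rewrite lee_fin mulr_ge0// sqr_ge0.
- by apply/measurable_EFinP; apply: measurable_funM => //; exact: measurable_normc.
- by move=> z _; rewrite lee_fin mulr_ge0// sqr_ge0.
- by apply/measurable_EFinP; apply: measurable_funM => //; exact: measurable_normc.
Qed.

Lemma L2plane_Dplus (u : R * R -> R[i]) : H1 u -> L2plane (Dplus u).
Proof. by move=> Hu; apply: L2plane_lin; exact: L2plane_wD. Qed.

Lemma L2plane_Dminus (u : R * R -> R[i]) : H1 u -> L2plane (Dminus u).
Proof.
move=> Hu; rewrite (_ : Dminus u = fun z => wD false u z + (- 'i%C) * wD true u z).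
  by apply: L2plane_lin; exact: L2plane_wD.
by apply/funext => z; rewrite /Dminus mulNr.
Qed.

Lemma integrable_normc (u : R * R -> R[i]) : L2plane u ->
  leb2.-integrable [set: mR * mR] (EFin \o (fun z => normc (u z) ^+ 2)).
Proof.
move=> [/cmeas_cmeasurable m u2]; apply/integrableP; split.
  by apply/measurable_EFinP; exact: measurable_normc.
under eq_integral do rewrite gee0_abs ?lee_fin ?sqr_ge0//.
exact: u2.
Qed.

Lemma integrable_cprod (u v : R * R -> R[i]) : L2plane u -> L2plane v ->
  leb2.-integrable [set: mR * mR] (EFin \o (fun z => complex.Re ((u z)^*%C * v z))).
Proof.
move=> Lu Lv; have [/cmeas_cmeasurable m1 _] := Lu; have [/cmeas_cmeasurable m2 _] := Lv.
have I j : leb2.-integrable [set: mR * mR] (EFin \o (fun z => cpart j (u z) * cpart j (v z))).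
  by apply: integrable_mul_L2 => //; exact: L2plane_cpart.
have := integrable_addr measurableT (I false) (I true).
apply: eq_integrable => // z _ /=; congr EFin.
by case: (u z) (v z) => a1 a2 [b1 b2] /=; rewrite mulNr opprK.
Qed.

Definition square_energy (nu : R) (up um : R * R -> R[i]) : \bar R :=
  (\int[leb2]_z (normc (Dminus um z + nu%:C * up z) ^+ 2 +
                 normc (Dplus up z - nu%:C * um z) ^+ 2)%:E)%E.

(** Expanding the squares produces the coupling with factor 2 nu, a quarter of which is nu/2, and
    nu^2 times the mass. All the quadratic integrals are finite, so the identity can be checked on
    real numbers; the quartic term is carried along untouched. *)
Lemma energy_square (nu lp lm l0 : R) (up um : R * R -> R[i]) : H1 up -> H1 um ->
  energy nu lp lm l0 up um =
  ((4^-1)%:E * square_energy nu up um - (nu ^+ 2 / 4)%:E * mass up um -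
   nonlin lp lm l0 up um)%E.
Proof.
move=> Hp Hm; have [Lp _] := Hp; have [Lm _] := Hm.
have Dp := L2plane_Dplus Hp; have Dm := L2plane_Dminus Hm.
have ia := integrable_addr measurableT (integrable_normc Dp) (integrable_normc Dm).
have ib := integrable_subr measurableT (integrable_cprod Lp Dm) (integrable_cprod Lm Dp).
have ip := integrable_normc Lp; have im := integrable_normc Lm.
have fin (F : R * R -> R) : leb2.-integrable [set: mR * mR] (EFin \o F) ->
    (\int[leb2]_z (F z)%:E = (Rintegral leb2 [set: mR * mR] F)%:E)%E.
  by move=> iF; rewrite EFin_Rintegral.
rewrite /energy; congr (_ - _)%E.
have -> : (\int[leb2]_z (complex.Re ((up z)^*%C * Dminus um z - (um z)^*%C * Dplus up z))%:E)%E =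
    (Rintegral leb2 [set: mR * mR] (fun z => complex.Re ((up z)^*%C * Dminus um z) -
      complex.Re ((um z)^*%C * Dplus up z)))%:E.
  rewrite -(fin _ ib); apply: eq_integral => z _.
  by case: (_ * _) (_ * _) => ? ? [].
set b := Rintegral _ _ _.
rewrite (fin _ ia); set a := Rintegral _ _ _.
rewrite /mass (fin _ ip) (fin _ im); set p := Rintegral _ _ _; set q := Rintegral _ _ _.
have -> : square_energy nu up um = (a + (2 * nu) * b + nu ^+ 2 * (p + q))%:E.
  have ib' := integrable_mulr (2 * nu) measurableT ib.
  have ipq := integrable_mulr (nu ^+ 2) measurableT (integrable_addr measurableT ip im).
  have iab := integrable_addr measurableT ia ib'.
  have iall := integrable_addr measurableT iab ipq.
  transitivity (Rintegral leb2 [set: mR * mR] (fun z =>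
    normc (Dplus up z) ^+ 2 + normc (Dminus um z) ^+ 2 +
    2 * nu * (complex.Re ((up z)^*%C * Dminus um z) - complex.Re ((um z)^*%C * Dplus up z)) +
    nu ^+ 2 * (normc (up z) ^+ 2 + normc (um z) ^+ 2)))%:E.
    rewrite -fin//; apply: eq_integral => z _; congr EFin.
    rewrite !normc_cpart; case: (Dplus up z) (Dminus um z) (up z) (um z) => a1 a2 [b1 b2] [c1 c2] [d1 d2] /=.
    by ring.
  have hpq : Rintegral leb2 [set: mR * mR] (fun z => normc (up z) ^+ 2 + normc (um z) ^+ 2) = p + q.
    by rewrite RintegralD.
  congr EFin; rewrite RintegralD// RintegralD// RintegralZl// RintegralZl//.
    by rewrite hpq.
  exact: integrable_addr.
rewrite -!EFinM -!EFinD -?EFinN -?EFinD; congr EFin; by field.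
Qed.

Definition ang (m : int) (s : bool) : R := (if s then m else m + 1)%:~R.

(** The radial profiles of D^+ u_+ - nu u_- for [s = true], carried by e^{i(m+1) theta}, and of D^-
    u_- + nu u_+ for [s = false], carried by e^{im theta}. *)
Definition square_form m (nu : R) (f g : bool -> bool -> R -> R) (s j : bool) (r : R) : R :=
  if s then g true j r - ang m true / r * f true j r - nu * f false j r
  else g false j r + ang m false / r * f false j r + nu * f true j r.

Definition radial_int (h : R -> R) : \bar R :=
  ((2 * kappa R)%:E * \int[mu]_(r in `]0%R, +oo[) (h r * r)%:E)%E.

(* In f s j the Boolean s selects the component u_+ (true) or u_- (false), and j the
   imaginary (true) or real (false) part. *)
Definition state m (f g : bool -> bool -> R -> R) : Prop :=
  forall s, radial_pairs (ang m s) (f s) (g s).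

Definition sq2 (h : bool -> bool -> R -> R) (r : R) : R := \sum_(i : bool * bool) h i.1 i.2 r ^+ 2.

Definition quad (lp lm l0 a b : R) : R := lp * a ^+ 2 + lm * b ^+ 2 + 2 * l0 * a * b.

Definition dens (f : bool -> bool -> R -> R) s r : R := f s false r ^+ 2 + f s true r ^+ 2.

Definition quartic (lp lm l0 : R) (f : bool -> bool -> R -> R) (r : R) : R :=
  quad lp lm l0 (dens f true r) (dens f false r).

Lemma quad_ge0 (lp lm l0 a b : R) : 0 < lp -> 0 < lm -> 0 < l0 -> 0 <= a -> 0 <= b ->
  0 <= quad lp lm l0 a b.
Proof.
move=> /ltW p /ltW q /ltW r a0 b0; rewrite /quad.
by rewrite !addr_ge0 ?mulr_ge0 ?exprn_ge0.
Qed.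

Lemma measurable_quad d (T : measurableType d) (D : set T) (lp lm l0 : R) (A B : T -> R) :
  measurable_fun D A -> measurable_fun D B ->
  measurable_fun D (fun t => quad lp lm l0 (A t) (B t)).
Proof.
move=> mA mB; rewrite /quad; apply: measurable_funD; last first.
  by apply: measurable_funM => //; apply: measurable_funM.
by apply: measurable_funD; apply: measurable_funM => //; exact: measurable_funX.
Qed.

Lemma dens_ge0 f s r : 0 <= dens f s r.
Proof. by rewrite addr_ge0// sqr_ge0. Qed.

Lemma L2wZ (c : R) (f : R -> R) : L2w f -> L2w (fun r => c * f r).
Proof.
move=> [mf f2]; split; first by apply: measurable_funM.
under eq_integral do rewrite exprMn -mulrA EFinM.
rewrite ge0_integralZl//.
- by apply: lte_mul_pinfty => //; rewrite lee_fin sqr_ge0.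
- by apply/measurable_EFinP; apply: measurable_funM => //; exact: measurable_funX.
- by move=> x; rewrite /= in_itv/= andbT lee_fin => x0; rewrite mulr_ge0 ?sqr_ge0// ltW.
- by rewrite lee_fin sqr_ge0.
Qed.

Lemma L2wD (f g : R -> R) : L2w f -> L2w g -> L2w (fun r => f r + g r).
Proof.
move=> Lf Lg; have [mf _] := Lf; have [mg _] := Lg.
split; first exact: measurable_funD.
have [_ f2] := L2wZ 2 Lf; have [_ g2] := L2wZ 2 Lg.
have mm (h : R -> R) : measurable_fun Rpos h -> measurable_fun Rpos (fun r => (h r ^+ 2 * r)%:E).
  move=> mh; apply/measurable_EFinP; apply: measurable_funM => //; exact: measurable_funX.
have p0 (h : R -> R) r : Rpos r -> (0 <= (h r ^+ 2 * r)%:E)%E.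
  by rewrite /= in_itv/= andbT lee_fin => x0; rewrite mulr_ge0 ?sqr_ge0// ltW.
apply: (@le_lt_trans _ _ (\int[mu]_(r in `]0%R, +oo[) (((2 * f r) ^+ 2 * r)%:E + ((2 * g r) ^+ 2 * r)%:E))%E).
  apply: ge0_le_integral => //.
  - by move=> r; exact: (p0 (fun r => f r + g r)).
  - by apply: mm; exact: measurable_funD.
  - by apply: emeasurable_funD; apply: mm; exact: measurable_funM.
  - move=> r; rewrite /= in_itv/= andbT lee_fin => x0; rewrite -mulrDl.
    apply: ler_wpM2r; first exact: ltW.
    rewrite -subr_ge0 (_ : _ - _ = (f r - g r) ^+ 2 + 2 * f r ^+ 2 + 2 * g r ^+ 2); last by ring.
    by have := sqr_ge0 (f r - g r); have := sqr_ge0 (f r); have := sqr_ge0 (g r); lra.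
rewrite ge0_integralD//.
- exact: lte_add_pinfty.
- by move=> r; exact: (p0 (fun r => 2 * f r)).
- by apply: mm; exact: measurable_funM.
- by move=> r; exact: (p0 (fun r => 2 * g r)).
- by apply: mm; exact: measurable_funM.
Qed.

Lemma L2w_square_form m nu f g s j : state m f g -> L2w (square_form m nu f g s j).
Proof.
move=> st; have [Lf Lf' Lg _] := st s j; have [Lf2 _ _ _] := st (~~ s) j.
case: s Lf Lf' Lg Lf2 => /= Lf Lf' Lg Lf2.
  rewrite (_ : square_form _ _ _ _ _ _ =
    fun r => (g true j r + -1 * (ang m true / r * f true j r)) + - nu * f false j r).
    by apply: L2wD; [apply: L2wD => //; exact: L2wZ|exact: L2wZ].
  by apply/funext => r; rewrite /square_form mulN1r mulNr.
by apply: L2wD; [exact: L2wD|exact: L2wZ].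
Qed.

Lemma radial_integral_ae (F : R * R -> R) (h : R -> R) :
  measurable_fun [set: mR * mR] F -> measurable_fun Rpos h ->
  (forall z, 0 <= F z) -> (forall r, 0 < r -> 0 <= h r) ->
  {ae leb2, forall z, 0 < radius z -> F z = h (radius z)} ->
  (\int[leb2]_z (F z)%:E = radial_int h)%E.
Proof.
move=> mF mh F0 h0 e.
have ma : measurable_fun Rpos (fun r => `|h r|) by exact: measurableT_comp.
have mr := measurable_radial ma.
transitivity (\int[leb2]_z (`|h (radius z)|)%:E)%E.
  apply: ge0_ae_eq_integral => //.
  - exact/measurable_EFinP.
  - exact/measurable_EFinP.
  - by move=> z _; rewrite lee_fin.
  - move: e (plane_pos R); apply: ae_imp2 => z hz r0 _.
    by rewrite hz// ger0_norm// h0.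
rewrite (radial_integral (f := fun r => `|h r|))//.
congr (_ * _)%E; apply: eq_integral => r; rewrite inE/= in_itv/= andbT => r0.
by rewrite ger0_norm// h0.
Qed.

Lemma sq2E h r : sq2 h r = h true false r ^+ 2 + h true true r ^+ 2 +
  (h false false r ^+ 2 + h false true r ^+ 2).
Proof.
rewrite /sq2 -(pair_bigA _ (fun s j => h s j r ^+ 2)) /= !big_bool /=; ring.
Qed.

Lemma sq2_ge0 h r : 0 <= sq2 h r.
Proof. by apply: sumr_ge0 => i _; exact: sqr_ge0. Qed.

(** The profiles are arbitrary representatives; [f] holds the absolutely continuous functions that
    agree with them almost everywhere, to which all integrals are transferred. *)
Definition represents m (f g : bool -> bool -> R -> R) (vp vm : R -> R[i]) : Prop :=
  [/\ state m f g, Hpair m vp vm,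
      {ae mu, forall r, 0 < r -> vp r = cpair (f true) r} &
      {ae mu, forall r, 0 < r -> vm r = cpair (f false) r}].

Lemma Hpair_represents m vp vm : Hpair m vp vm -> exists f g, represents m f g vp vm.
Proof.
move=> H; have [Hp Hm] := H.
have [f1 [g1 [f2 [g2 [p1 p2 e1]]]]] := Hrad_radial_pair Hp.
have [f3 [g3 [f4 [g4 [p3 p4 e2]]]]] := Hrad_radial_pair Hm.
exists (fun s j => if s then (if j then f2 else f1) else (if j then f4 else f3)).
exists (fun s j => if s then (if j then g2 else g1) else (if j then g4 else g3)).
by split => //; case; case.
Qed.

Lemma state_represents m f g : state m f g ->
  represents m f g (cpair (f true)) (cpair (f false)).
Proof.
move=> st; split => //; try by apply: aeW.
by split; [exact: (radial_pair_Hrad (st true false) (st true true))|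
  exact: (radial_pair_Hrad (st false false) (st false true))].
Qed.

(** The bridge from the plane to the half-line: the unimodular angular factors drop out of every
    squared modulus, and the weak derivatives are replaced by their polar form almost everywhere. *)
Lemma represents_values m f g vp vm : represents m f g vp vm ->
  [/\ H1 (angular_lift m vp), H1 (angular_lift (m + 1) vm) &
  [/\ mass_m m vp vm = radial_int (sq2 f),
    (grad2 (angular_lift m vp) + grad2 (angular_lift (m + 1) vm))%E =
      radial_int (fun r => sq2 g r + sq2 (fun s j r => ang m s / r * f s j r) r),
    forall nu, square_energy nu (angular_lift m vp) (angular_lift (m + 1) vm) =
      radial_int (sq2 (square_form m nu f g)) &
    forall lp lm l0 : R, 0 < lp -> 0 < lm -> 0 < l0 ->
      nonlin lp lm l0 (angular_lift m vp) (angular_lift (m + 1) vm) =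
      ((4^-1)%:E * radial_int (quartic lp lm l0 f))%E]].
Proof.
move=> [st [Hp Hm] ap am].
set fp := f true in ap; set fm := f false in am; pose gp := g true; pose gm := g false.
have [Hup ep wp] := lift_representative (st true) Hp ap.
have [Hum em wm] := lift_representative (st false) Hm am.
rewrite -/gp -/fp in wp; rewrite -/gm -/fm in wm.
split => //.
set up := angular_lift m vp; set um := angular_lift (m + 1) vm.
have wp' : {ae leb2, forall z, forall b, wD b up z = lift_partial b m fp gp z}.
  by move: (wp false) (wp true); apply: ae_imp2 => z h1 h2 [].
have wm' : {ae leb2, forall z, forall b, wD b um z = lift_partial b (m + 1) fm gm z}.
  by move: (wm false) (wm true); apply: ae_imp2 => z h1 h2 [].
have e0 : {ae leb2, forall z, vp (radius z) = cpair fp (radius z) /\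
    vm (radius z) = cpair fm (radius z)}.
  by move: ep em; apply: ae_imp2 => z [_ h1] [_ h2].
have Lf s j : L2w (f s j) by have [] := st s j.
have Lfr s j : L2w (fun r => ang m s / r * f s j r) by have [] := st s j.
have Lg s j : L2w (g s j) by have [] := st s j.
have msq h : (forall s j, L2w (h s j)) -> measurable_fun Rpos (sq2 h).
  by move=> Lh; exact: (L2w_sum (fun i : bool * bool => Lh i.1 i.2)).2.
have [/cmeas_cmeasurable mp _] : L2plane up by case: Hup.
have [/cmeas_cmeasurable mm _] : L2plane um by case: Hum.
have [/cmeas_cmeasurable mDp _] := L2plane_Dplus Hup.
have [/cmeas_cmeasurable mDm _] := L2plane_Dminus Hum.
have nzl l (w : bool -> R -> R) z : 0 < radius z ->
    normc (dir z ^ l * cpair w (radius z)) ^+ 2 = w false (radius z) ^+ 2 + w true (radius z) ^+ 2.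
  by move=> r0; rewrite normc_dirX// normc_sqrC.
have mn (u : R * R -> R[i]) : cmeas u -> measurable_fun [set: mR * mR] (EFin \o (fun z => normc (u z) ^+ 2)).
  by move=> mu_; apply/measurable_EFinP; exact: measurable_normc.
split.
- rewrite /mass_m /mass -ge0_integralD//; [|by move=> z _; rewrite lee_fin sqr_ge0|exact: mn
    |by move=> z _; rewrite lee_fin sqr_ge0|exact: mn].
  under eq_integral do rewrite -EFinD.
  apply: radial_integral_ae.
  + by apply: measurable_funD; exact: measurable_normc.
  + exact: msq.
  + by move=> z; rewrite addr_ge0// sqr_ge0.
  + by move=> r _; exact: sq2_ge0.
  + move: ep em; apply: ae_imp2 => z [_ ep] [_ em] r0.
    by rewrite !angular_liftE ep em !nzl// sq2E.
- have mw b (u : R * R -> R[i]) : H1 u -> cmeas (wD b u).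
    by move=> Hu; have [/cmeas_cmeasurable] := L2plane_wD b Hu.
  have mg (u : R * R -> R[i]) : H1 u -> measurable_fun [set: mR * mR]
      (fun z => normc (wD false u z) ^+ 2 + normc (wD true u z) ^+ 2).
    by move=> Hu; apply: measurable_funD; apply: measurable_normc; exact: mw.
  rewrite /grad2 -ge0_integralD//; first last.
  + by apply/measurable_EFinP; exact: mg.
  + by move=> z _; rewrite lee_fin addr_ge0// sqr_ge0.
  + by apply/measurable_EFinP; exact: mg.
  + by move=> z _; rewrite lee_fin addr_ge0// sqr_ge0.
  under eq_integral do rewrite -EFinD.
  apply: radial_integral_ae.
  + by apply: measurable_funD; exact: mg.
  + by apply: measurable_funD; exact: msq.
  + by move=> z; rewrite !addr_ge0// sqr_ge0.
  + by move=> r _; rewrite addr_ge0// sq2_ge0.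
  + move: wp' wm'; apply: ae_imp2 => z w1 w2 r0.
    rewrite !w1 !w2 !lift_partial_sqr// !big_bool/= !sq2E /= /fp /fm /gp /gm /ang; ring.
- move=> nu; apply: radial_integral_ae.
  + apply: measurable_funD; apply: measurable_normc.
      move=> j; rewrite (_ : (fun z => _) = (fun z => cpart j (Dminus um z) + nu * cpart j (up z))).
        by apply: measurable_funD; [exact: mDm|apply: measurable_funM => //; exact: mp].
      by apply/funext => z; case: (Dminus um z) (up z) j => ? ? [? ?] [] /=; ring.
    move=> j; rewrite (_ : (fun z => _) = (fun z => cpart j (Dplus up z) - nu * cpart j (um z))).
      by apply: measurable_funB; [exact: mDp|apply: measurable_funM => //; exact: mm].
    by apply/funext => z; case: (Dplus up z) (um z) j => ? ? [? ?] [] /=; ring.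
  + by apply: msq => s j; exact: L2w_square_form.
  + by move=> z; rewrite addr_ge0// sqr_ge0.
  + by move=> r _; exact: sq2_ge0.
  + have w : {ae leb2, forall z b, wD b up z = lift_partial b m fp gp z /\
        wD b um z = lift_partial b (m + 1) fm gm z}.
      by move: wp' wm'; apply: ae_imp2 => z h1 h2 b; split.
    move: e0 w; apply: ae_imp2 => z [e e'] w r0.
    have w1 b := (w b).1; have w2 b := (w b).2.
    rewrite /Dminus /Dplus !w1 !w2 Dminus_lift// Dplus_lift// [up z]angular_liftE [um z]angular_liftE e e'.
    rewrite (mulrCA nu%:C (dir z ^ m)) -mulrDr (mulrCA nu%:C (dir z ^ (m + 1))) -mulrBr.
    rewrite !normc_dirX// /cpair !normc_cpart /= sq2E /square_form /fp /fm /gp /gm /ang /=; ring.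
- move=> lp lm l0 lp0 lm0 l00; rewrite /nonlin; congr (_ * _)%E.
  have n4 (u : R * R -> R[i]) (z : R * R) : normc (u z) ^+ 4 = (normc (u z) ^+ 2) ^+ 2 by rewrite -exprM.
  apply: radial_integral_ae.
  + rewrite (_ : (fun z => _) = (fun z => quad lp lm l0 (normc (up z) ^+ 2) (normc (um z) ^+ 2))).
      by apply: measurable_quad; exact: measurable_normc.
    by apply/funext => z; rewrite !n4.
  + have m1 s j : measurable_fun Rpos (f s j) by have [] := Lf s j.
    by apply: measurable_quad; apply: measurable_funD; exact: measurable_funX.
  + by move=> z; rewrite !n4; apply: quad_ge0 => //; exact: sqr_ge0.
  + by move=> r _; apply: quad_ge0 => //; exact: dens_ge0.
  + move: ep em; apply: ae_imp2 => z [_ ep] [_ em] r0.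
    by rewrite !n4 [up z]angular_liftE [um z]angular_liftE ep em !nzl.
Qed.

End energy_identity.

(** * Integrals against r dr and coercivity of Q *)

Section radial_integrals.
Variable R : realType.
Local Notation mu := (@lebesgue_measure R).
Local Notation mR := (measurableTypeR R).
Local Notation Rpos := (`]0, +oo[%classic : set R).
Implicit Types (h k f g : R -> R).

Definition rintegrable h : Prop := mu.-integrable Rpos (EFin \o (fun r => h r * r)).

Definition rint h : R := 2 * kappa R * \int[mu]_(r in Rpos) (h r * r).

Lemma kappa2_gt0 : 0 < 2 * kappa R.
Proof. by rewrite mulr_gt0// kappa_gt0. Qed.

Lemma radial_intE h : rintegrable h -> radial_int h = (rint h)%:E.
Proof. by move=> ih; rewrite /radial_int EFin_Rintegral//; exact: measurable_Rpos. Qed.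

Lemma rintegrableD h k : rintegrable h -> rintegrable k -> rintegrable (fun r => h r + k r).
Proof.
move=> ih ik; have := integrable_addr (@measurable_Rpos R) ih ik.
by apply: eq_integrable => [|r _]; [exact: measurable_Rpos|rewrite /= mulrDl].
Qed.

Lemma rintegrableZ c h : rintegrable h -> rintegrable (fun r => c * h r).
Proof.
move=> ih; have := integrable_mulr c (@measurable_Rpos R) ih.
by apply: eq_integrable => [|r _]; [exact: measurable_Rpos|rewrite /= mulrA].
Qed.

Lemma rintD h k : rintegrable h -> rintegrable k ->
  rint (fun r => h r + k r) = rint h + rint k.
Proof.
move=> ih ik; rewrite /rint -mulrDr; congr (_ * _).
under eq_Rintegral do rewrite mulrDl.
by rewrite RintegralD//; exact: measurable_Rpos.
Qed.

Lemma rintZ c h : rintegrable h -> rint (fun r => c * h r) = c * rint h.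
Proof.
move=> ih; rewrite /rint mulrCA; congr (_ * _).
under eq_Rintegral do rewrite -mulrA.
by rewrite RintegralZl//; exact: measurable_Rpos.
Qed.

Lemma eq_rint h k : (forall r, 0 < r -> h r = k r) -> rint h = rint k.
Proof.
move=> e; congr (_ * _); apply: eq_Rintegral => r; rewrite inE/= in_itv/= andbT => r0.
by rewrite e.
Qed.

Lemma le_rint h k : rintegrable h -> rintegrable k -> (forall r, 0 < r -> h r <= k r) ->
  rint h <= rint k.
Proof.
move=> ih ik hk; rewrite /rint ler_pM2l ?kappa2_gt0//; apply: le_Rintegral => //.
by move=> r; rewrite /= in_itv/= andbT => r0; rewrite ler_wpM2r ?hk// ltW.
Qed.

Lemma rint_ge0 h : (forall r, 0 < r -> 0 <= h r) -> 0 <= rint h.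
Proof.
move=> h0; apply: mulr_ge0; first by rewrite ltW ?kappa2_gt0.
apply: Rintegral_ge0 => r; rewrite /= in_itv/= andbT => r0.
by rewrite mulr_ge0 ?h0// ltW.
Qed.

Lemma measurable_weight h : measurable_fun Rpos h -> measurable_fun Rpos (fun r => h r * r).
Proof. by move=> mh; apply: measurable_funM. Qed.

Lemma ge0_rintegrable h : measurable_fun Rpos h -> (forall r, 0 < r -> 0 <= h r) ->
  (radial_int h < +oo)%E -> rintegrable h.
Proof.
move=> mh h0 fin; apply/integrableP; split; first by apply/measurable_EFinP; exact: measurable_weight.
have e : (\int[mu]_(r in `]0%R, +oo[) `|(EFin \o (fun r => h r * r)%R) r| =
    \int[mu]_(r in `]0%R, +oo[) (h r * r)%:E)%E.
  apply: eq_integral => r; rewrite inE/= in_itv/= andbT => r0.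
  by rewrite /= ger0_norm// mulr_ge0 ?h0// ltW.
rewrite e; move: fin; rewrite /radial_int => fin.
rewrite -[X in (X < _)%E]mul1e -(@mulVf _ (2 * kappa R)) ?gt_eqF ?kappa2_gt0// EFinM -muleA.
by apply: lte_mul_pinfty => //; rewrite lee_fin invr_ge0 ltW ?kappa2_gt0.
Qed.

Lemma L2w_rintegrable f : L2w f -> rintegrable (fun r => f r ^+ 2).
Proof.
move=> Lf; apply: ge0_rintegrable.
- exact: (L2w_sqr Lf).1.
- by move=> r _; exact: sqr_ge0.
- by apply: lte_mul_pinfty; [rewrite lee_fin ltW ?kappa2_gt0|exact|exact: Lf.2].
Qed.

Lemma le_rintegrable h k : measurable_fun Rpos h -> (forall r, 0 < r -> `|h r| <= k r) ->
  rintegrable k -> rintegrable h.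
Proof.
move=> mh hk; apply: le_integrable.
- exact: measurable_Rpos.
- by apply/measurable_EFinP; exact: measurable_weight.
- move=> r; rewrite /= in_itv/= andbT => r0; rewrite lee_fin !normrM (gtr0_norm r0).
  by rewrite ler_wpM2r ?(ltW r0)// (le_trans (hk r r0)) ?ler_norm.
Qed.

Lemma L2w_rintegrableM f g : L2w f -> L2w g -> rintegrable (fun r => f r * g r).
Proof.
move=> Lf Lg; apply: (@le_rintegrable _ (fun r => f r ^+ 2 + g r ^+ 2)).
- by apply: measurable_funM; [case: Lf|case: Lg].
- move=> r _; rewrite ler_norml.
  have := sqr_ge0 (f r - g r); have := sqr_ge0 (f r + g r).
  by have := sqr_ge0 (f r); have := sqr_ge0 (g r) => *; apply/andP; split; nra.
- by apply: rintegrableD; exact: L2w_rintegrable.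
Qed.

Lemma sq2_rintegrable (h : bool -> bool -> R -> R) : (forall s j, L2w (h s j)) ->
  rintegrable (sq2 h).
Proof.
move=> Lh; have [fin m] := L2w_sum (fun i : bool * bool => Lh i.1 i.2).
apply: ge0_rintegrable => //; first by move=> r _; exact: sq2_ge0.
by apply: lte_mul_pinfty => //; rewrite lee_fin ltW ?kappa2_gt0.
Qed.

(** Otherwise [F r > e / r] on all of [[c, d]], and the integral of e / r, a difference of
    logarithms, already exceeds [S]. *)
Lemma integral_inv_ge (F : R -> R) (e c d S : R) : 0 < c -> c <= d -> 0 < e ->
  measurable_fun Rpos F ->
  (forall r, 0 < r -> 0 <= F r) ->
  (\int[mu]_(r in `]0%R, +oo[) (F r)%:E <= S%:E)%E ->
  (S + 1) / e <= ln d - ln c -> exists2 r, c <= r <= d & F r * r <= e.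
Proof.
move=> c0 cd e0 mF F0 FS ln_ge.
have [//|nex] := pselect (exists2 r, c <= r <= d & F r * r <= e); exfalso.
have big r : c <= r <= d -> e < F r * r.
  by move=> h; rewrite ltNge; apply/negP => ?; apply: nex; exists r.
have sub : `[c, d] `<=` Rpos.
  by move=> x /=; rewrite !in_itv/= andbT => /andP[/(lt_le_trans c0)].
have pos r : c <= r <= d -> 0 < r by move=> /andP[/(lt_le_trans c0)].
have I : (\int[mu]_(r in `[c, d]) (e * r^-1)%:E = (e * ln d - e * ln c)%:E)%E.
  apply: (FTC2 (F := fun r => e * ln r)) => // x xcd.
    have x0 := pos _ xcd.
    have D := is_deriveZ e (is_derive1_ln x0).
    by apply: is_derive_eq D _.
  apply: cvgM; first exact: cvg_cst.
  by apply: cvgV; [rewrite gt_eqF// pos|exact: cvg_id].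
have : (\int[mu]_(r in `[c, d]) (e * r^-1)%:E <= S%:E)%E.
  apply: le_trans FS.
  apply: (@le_trans _ _ (\int[mu]_(r in `[c, d]) (F r)%:E)%E).
    apply: ge0_le_integral => //.
    - move=> r; rewrite /= in_itv/= => h.
      by rewrite lee_fin mulr_ge0 ?invr_ge0 ?(ltW e0)// ltW// pos.
    - apply/measurable_EFinP; apply: measurable_funM => //.
      apply: subspace_continuous_measurable_fun => //.
      apply: continuous_in_subspaceT => x; rewrite inE/= in_itv/= => h.
      by apply: cvgV; [rewrite gt_eqF// pos|exact: cvg_id].
    - by apply/measurable_EFinP; exact: measurable_funS mF.
    - move=> r; rewrite /= in_itv/= => h; rewrite lee_fin ler_pdivrMr ?pos//.
      exact/ltW/big.
  apply: ge0_subset_integral => //.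
  - exact/measurable_EFinP.
  - by move=> r; rewrite /= in_itv/= andbT => /F0; rewrite lee_fin.
rewrite I lee_fin -mulrBr leNgt => /negP; apply.
rewrite (@lt_le_trans _ _ (S + 1))// ?ltrDl//.
by move: ln_ge; rewrite ler_pdivrMr// mulrC.
Qed.

(** f g is the derivative of f^2 / 2, so only boundary values matter. For l != 0 the function f^2 /
    r is integrable in dr, which forces f to be small along radii tending to 0 and to infinity. *)
Lemma radial_pair_cross l f g : l != 0 -> radial_pair l f g ->
  mu.-integrable Rpos (EFin \o (fun r => f r * g r)) /\ \int[mu]_(r in Rpos) (f r * g r) = 0.
Proof.
move=> l0 [Lf Ll Lg pf].
have mf := Lf.1; have mg := Lg.1.
have ik : mu.-integrable Rpos (EFin \o (fun r => f r * g r)).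
  have := rintegrableZ l^-1 (L2w_rintegrableM Ll Lg).
  apply: eq_integrable => [|r]; first exact: measurable_Rpos.
  rewrite inE/= in_itv/= andbT => r0; congr EFin.
  have rn : r != 0 by rewrite gt_eqF.
  by field; rewrite l0 rn.
split => //.
(* This is [f r ^+ 2 / r], written so that finiteness of its integral follows from the bound on
   [l / r * f r]. *)
pose F r := (l^-1 * (l / r * f r)) ^+ 2 * r.
have mF : measurable_fun Rpos F.
  apply: measurable_weight; apply: measurable_funX; apply: measurable_funM => //.
  exact: Ll.1.
have F0 r : 0 < r -> 0 <= F r by move=> r0; rewrite /F mulr_ge0 ?sqr_ge0// ltW.
have FE r : 0 < r -> F r * r = f r ^+ 2.
  move=> r0; rewrite /F; have rn : r != 0 by rewrite gt_eqF.
  by field; rewrite l0 rn.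
have [_ fin] := L2wZ l^-1 Ll.
have [S FS] : exists S : R, (\int[mu]_(r in `]0%R, +oo[) (F r)%:E <= S%:E)%E.
  exists (fine (\int[mu]_(r in `]0%R, +oo[) (F r)%:E)).
  rewrite fineK// ge0_fin_numE//; apply: integral_ge0 => r.
  by rewrite /= in_itv/= andbT => /F0; rewrite lee_fin.
have pt n : exists ab : R * R, [/\ 0 < ab.1, ab.1 <= n.+1%:R^-1, n.+1%:R <= ab.2,
    f ab.1 ^+ 2 <= n.+1%:R^-1 & f ab.2 ^+ 2 <= n.+1%:R^-1].
  have n0 : (0 : R) < n.+1%:R by [].
  have i0 : (0 : R) < n.+1%:R^-1 by rewrite invr_gt0.
  (* With tolerance 1/(n+1), this [T] makes [[1/((n+1) T), 1/(n+1)]] and [[n+1, (n+1) T]]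
     logarithmically long enough for [integral_inv_ge]; the absolute value of [S] ensures
     [T >= 1]. *)
  pose T := expR ((`|S| + 1) / n.+1%:R^-1).
  have T0 : 0 < T by exact: expR_gt0.
  have T1 : 1 <= T by rewrite -expR0 ler_expR divr_ge0 ?ltW// addr_ge0.
  have lnT : (S + 1) / n.+1%:R^-1 <= ln T.
    rewrite /T expRK; apply: ler_wpM2r; first by rewrite invr_ge0 ltW.
    by rewrite lerD2r ler_norm.
  have c0 : 0 < n.+1%:R^-1 / T by rewrite divr_gt0.
  have h1 : n.+1%:R^-1 / T <= n.+1%:R^-1 by rewrite ler_pdivrMr// ler_peMr// ltW.
  have h2 : (S + 1) / n.+1%:R^-1 <= ln n.+1%:R^-1 - ln (n.+1%:R^-1 / T).
    by move: lnT; rewrite ln_div ?posrE//; lra.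
  have h3 : n.+1%:R <= n.+1%:R * T by rewrite ler_peMr// ltW.
  have h4 : (S + 1) / n.+1%:R^-1 <= ln (n.+1%:R * T) - ln n.+1%:R.
    by move: lnT; rewrite lnM ?posrE//; lra.
  have [a /andP[a1 a2] +] := integral_inv_ge c0 h1 i0 mF F0 FS h2.
  have [b /andP[b1 b2] +] := integral_inv_ge n0 h3 i0 mF F0 FS h4.
  have a0 : 0 < a by exact: lt_le_trans c0 a1.
  have b0 : 0 < b by exact: lt_le_trans n0 b1.
  by rewrite !FE// => fb fa; exists (a, b).
pose ab n := sval (cid (pt n)).
have abP n := svalP (cid (pt n)); rewrite -/(ab _) in abP.
pose kn n r := f r * g r * \1_(`[(ab n).1, (ab n).2]%classic : set R) r.
have mI n : measurable (`[(ab n).1, (ab n).2]%classic : set mR) by exact: measurable_itv.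
have subI n : `[(ab n).1, (ab n).2] `<=` Rpos.
  have [a0 _ _ _ _] := abP n.
  by move=> x /=; rewrite !in_itv/= andbT => /andP[/(lt_le_trans a0)].
have le_ab n : (ab n).1 <= (ab n).2.
  have [_ h1 h2 _ _] := abP n; apply: le_trans h1 (le_trans _ h2).
  by rewrite (@le_trans _ _ 1)// ?ler1n// invf_le1// ler1n.
have IE n : (\int[mu]_(r in Rpos) (kn n r)%:E)%E = (\int[mu]_(r in `[(ab n).1, (ab n).2]) (f r * g r))%:E.
  rewrite -EFin_Rintegral//; last exact: integrableS ik.
  rewrite (@integral_support _ _ _ mu `[(ab n).1, (ab n).2]%classic Rpos (kn n) (subI n)).
    by apply: eq_integral => r rI; rewrite /kn indicE rI mulr1.
  by move=> r _ nr; rewrite /kn indicE memNset// mulr0.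
have ibound n : `|\int[mu]_(r in `[(ab n).1, (ab n).2]) (f r * g r)| <= n.+1%:R^-1.
  have [a0 _ _ fa fb] := abP n.
  have pab := pf _ _ a0 (le_ab n).
  have ifg : mu.-integrable `[(ab n).1, (ab n).2] (EFin \o (fun r => f r * g r)).
    exact: integrableS ik.
  have igf : mu.-integrable `[(ab n).1, (ab n).2] (EFin \o (fun r => g r * f r)).
    by apply: eq_integrable ifg => // r _; rewrite /= mulrC.
  have := primitive_on_mul (le_ab n) pab pab; rewrite RintegralD//.
  have -> : \int[mu]_(t in `[(ab n).1, (ab n).2]) (g t * f t) =
    \int[mu]_(t in `[(ab n).1, (ab n).2]) (f t * g t).
    by apply: eq_Rintegral => r _; rewrite mulrC.
  rewrite -!expr2 => e; rewrite ler_norml.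
  have := sqr_ge0 (f (ab n).1); have := sqr_ge0 (f (ab n).2).
  move: fa fb e; set A := f (ab n).1 ^+ 2; set B := f (ab n).2 ^+ 2.
  move: A B (\int[mu]_(r in _) _) => A B I.
  by move: n.+1%:R^-1 => e hA hB hI B0 A0; apply/andP; split; lra.
have H := @dominated_cvg _ _ _ mu Rpos (@measurable_Rpos R) (fun n r => (kn n r)%:E)
  (fun r => (f r * g r)%:E) (fun r => (`|f r * g r|)%:E) _ _ _ (integrable_norm ik) _.
have {}H : (\int[mu]_(r in Rpos) (kn n r)%:E)%E @[n --> \oo] -->
    (\int[mu]_(r in Rpos) (f r * g r)%:E)%E.
  apply: H => //.
  - move=> n; apply/measurable_EFinP; apply: measurable_funM; first exact: measurable_funM.
    exact: measurable_indic.
  - move=> r; rewrite /= in_itv/= andbT => r0.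
    apply: cvg_near_cst.
    have ri0 : 0 < r^-1 by rewrite invr_gt0.
    have h1 := nbhs_infty_ger r; have h2 := nbhs_infty_ger r^-1.
    near=> n; rewrite /kn indicE mem_set ?mulr1//= in_itv/=.
    have [_ a1 b1 _ _] := abP n.
    have n1 : n%:R <= n.+1%:R :> R by rewrite ler_nat.
    apply/andP; split.
      apply: le_trans a1 _; rewrite -[r]invrK lef_pV2 ?posrE//.
      by apply: le_trans n1; near: n.
    by apply: le_trans b1; apply: le_trans n1; near: n.
  - move=> n r _; rewrite lee_fin /kn indicE normrM ler_piMr//.
    by case: (_ \in _); rewrite ?normr1 ?normr0.
have H0 : (\int[mu]_(r in Rpos) (kn n r)%:E)%E @[n --> \oo] --> 0%:E.
  under eq_fun do rewrite IE.
  apply: cvg_EFin; first exact: nearW.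
  apply/cvgr0Pnorm_le => e e0.
  near=> n; apply: le_trans (ibound n) _.
  by apply/ltW; near: n; exact: (near_infty_natSinv_lt (PosNum e0)).
have : (\int[mu]_(r in Rpos) (f r * g r)%:E)%E = 0%:E.
  exact: (cvg_unique (@ereal_hausdorff R) H H0).
by rewrite EFin_Rintegral; [case|exact: measurable_Rpos|exact: ik].
Unshelve. all: by end_near. Qed.

Definition grad_form (m : int) (f g : bool -> bool -> R -> R) (r : R) : R :=
  sq2 g r + sq2 (fun s j r => ang R m s / r * f s j r) r.

Lemma state_rintegrable (m : int) (f g : bool -> bool -> R -> R) : state m f g ->
  [/\ rintegrable (sq2 f), rintegrable (grad_form m f g) &
      forall nu, rintegrable (sq2 (square_form m nu f g))].
Proof.
move=> st; split.
- by apply: sq2_rintegrable => s j; have [] := st s j.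
- by apply: rintegrableD; apply: sq2_rintegrable => s j; have [] := st s j.
- by move=> nu; apply: sq2_rintegrable => s j; exact: L2w_square_form.
Qed.

(* Young's inequality; the cross terms [f g / r] integrate to zero because they
   are the derivative of [f^2 / 2] with respect to [dr]. *)
Lemma square_form_coercive (m : int) (nu e : R) (f g : bool -> bool -> R -> R) :
  state m f g -> 0 < e -> e < 1 ->
  (1 - e) * rint (grad_form m f g) - nu ^+ 2 / e * rint (sq2 f) <=
  rint (sq2 (square_form m nu f g)).
Proof.
move=> st e0 e1; have [i1 i2 i3] := state_rintegrable st.
(* Adding the cross terms [c] turns the gradient density into the sum of the squares (g - l f / r)^2
   and (g + l f / r)^2 of [square_form] with nu = 0. *)
pose sg s : R := if s then -1 else 1.
pose c s j r := 2 * sg s * (ang R m s / r * f s j r * g s j r).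
have ic s j : rintegrable (c s j).
  apply: rintegrableZ; apply: L2w_rintegrableM; by have [] := st s j.
have c0 s j : rint (c s j) = 0.
  rewrite /c rintZ; last by apply: L2w_rintegrableM; have [] := st s j.
  have [l0|l0] := eqVneq (ang R m s) 0.
    rewrite (@eq_rint _ (fun=> 0)); last by move=> r _; rewrite l0 !mul0r.
    rewrite /rint; under eq_Rintegral do rewrite mul0r.
    by rewrite Rintegral_cst ?mul0r ?mulr0//; exact: measurable_Rpos.
  have [ifg fg0] := radial_pair_cross l0 (st s j).
  rewrite /rint (_ : \int[mu]_(r in Rpos) _ = ang R m s * \int[mu]_(r in Rpos) (f s j r * g s j r)).
    by rewrite fg0 !mulr0.
  rewrite -RintegralZl//; apply: eq_Rintegral => r; rewrite inE/= in_itv/= andbT => r0.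
  by have rn : r != 0 by [rewrite gt_eqF]; field.
pose C r := c true false r + c true true r + (c false false r + c false true r).
have iC : rintegrable C by rewrite /C; do !apply: rintegrableD.
have C0 : rint C = 0.
  rewrite /C rintD; [|exact: rintegrableD|exact: rintegrableD].
  by rewrite !rintD// !c0 !addr0.
have iL : rintegrable (fun r => (1 - e) * (grad_form m f g r + C r) + - (nu ^+ 2 / e) * sq2 f r).
  by apply: rintegrableD; apply: rintegrableZ => //; exact: rintegrableD.
have <- : rint (fun r => (1 - e) * (grad_form m f g r + C r) + - (nu ^+ 2 / e) * sq2 f r) =
    (1 - e) * rint (grad_form m f g) - nu ^+ 2 / e * rint (sq2 f).
  rewrite rintD; [|by apply: rintegrableZ; exact: rintegrableD|exact: rintegrableZ].
  by rewrite !rintZ//; [rewrite rintD// C0 addr0 mulNr|exact: rintegrableD].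
apply: le_rint => // r r0.
have young (a b : R) : (1 - e) * a ^+ 2 - nu ^+ 2 / e * b ^+ 2 <= (a + nu * b) ^+ 2.
  rewrite -subr_ge0 (_ : _ - _ = e * (a + nu * b / e) ^+ 2 + nu ^+ 2 * b ^+ 2); last first.
    by have en : e != 0 by [rewrite gt_eqF]; field.
  by apply: addr_ge0; apply: mulr_ge0; rewrite ?sqr_ge0 ?ltW.
rewrite /grad_form /C /c !sq2E /square_form /sg /=.
have y1 := young (g true false r - ang R m true / r * f true false r) (- f false false r).
have y2 := young (g true true r - ang R m true / r * f true true r) (- f false true r).
have y3 := young (g false false r + ang R m false / r * f false false r) (f true false r).
have y4 := young (g false true r + ang R m false / r * f false true r) (f true true r).
move: y1 y2 y3 y4; rewrite !mulrN !sqrrN => y1 y2 y3 y4.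
apply: le_trans (lerD (lerD y1 y2) (lerD y3 y4)).
rewrite le_eqVlt; apply/orP; left; apply/eqP.
move: (nu ^+ 2 / e) (ang R m true / r) (ang R m false / r) => q l1 l2; ring.
Qed.

End radial_integrals.

(** * Compactness *)

Section pointwise_bounds.
Variable R : realType.
Local Notation mu := (@lebesgue_measure R).
Local Notation mR := (measurableTypeR R).
Local Notation Rpos := (`]0, +oo[%classic : set R).
Implicit Types (f g : R -> R).

Definition n2 g : R := \int[mu]_(r in Rpos) (g r ^+ 2 * r).

Lemma n2_ge0 g : 0 <= n2 g.
Proof.
apply: Rintegral_ge0 => r; rewrite /= in_itv/= andbT => r0.
by rewrite mulr_ge0 ?sqr_ge0// ltW.
Qed.

Lemma itv_Rpos (a b : R) : 0 < a -> `[a, b] `<=` Rpos.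
Proof. by move=> a0 x /=; rewrite !in_itv/= andbT => /andP[/(lt_le_trans a0)]. Qed.

Lemma L2w_itv g (a b : R) : L2w g -> 0 < a ->
  mu.-integrable `[a, b] (EFin \o (fun r => g r ^+ 2 * r)) /\
  \int[mu]_(r in `[a, b]) (g r ^+ 2 * r) <= n2 g.
Proof.
move=> Lg a0; have ig := L2w_rintegrable Lg.
have iab : mu.-integrable `[a, b] (EFin \o (fun r => g r ^+ 2 * r)).
  by apply: integrableS ig => //; exact: itv_Rpos.
split => //; rewrite -lee_fin -!EFin_Rintegral//.
apply: ge0_subset_integral => //.
- by apply/measurable_EFinP; exact: (L2w_sqr Lg).2.
- move=> r; rewrite /= in_itv/= andbT lee_fin => r0.
  by rewrite mulr_ge0 ?sqr_ge0// ltW.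
- exact: itv_Rpos.
Qed.

Lemma Rintegral_inv (a b : R) : 0 < a -> a <= b ->
  mu.-integrable `[a, b] (EFin \o (fun r : R => r^-1)) /\
  \int[mu]_(r in `[a, b]) r^-1 = ln b - ln a.
Proof.
move=> a0 ab.
have pos r : a <= r <= b -> 0 < r by move=> /andP[/(lt_le_trans a0)].
have [i p] : primitive_on a b (@ln R) (fun r => r^-1).
  apply: C1_primitive_on => // x h; first exact/is_derive1_ln/pos.
  by apply: cvgV; [rewrite gt_eqF// pos|exact: cvg_id].
by split => //; rewrite p.
Qed.

(** Cauchy-Schwarz with the weights r and 1/r, from nonnegativity of the integral of r (g - t/r)^2
    for every t. It makes profiles Hoelder continuous of exponent 1/2 in ln r. *)
Lemma cauchy_schwarz_log g (a b : R) : L2w g -> 0 < a -> a <= b ->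
  (\int[mu]_(r in `[a, b]) g r) ^+ 2 <= (ln b - ln a) * n2 g.
Proof.
move=> Lg a0 ab.
have [i2 le2] := L2w_itv b Lg a0; have [ig _] := L2w_integrable b Lg a0.
have [ii Ii] := Rintegral_inv a0 ab.
have L0 : 0 <= ln b - ln a by rewrite subr_ge0 ler_ln ?posrE// (lt_le_trans a0).
set I := \int[mu]_(r in _) _.
have key t : 0 <= n2 g - 2 * t * I + t ^+ 2 * (ln b - ln a).
  apply: (@le_trans _ _ (\int[mu]_(r in `[a, b]) (g r ^+ 2 * r + (- (2 * t)) * g r + t ^+ 2 * r^-1))).
    apply: Rintegral_ge0 => r; rewrite /= in_itv/= => /andP[ar _].
    have r0 : 0 < r by exact: lt_le_trans ar.
    rewrite (_ : _ + _ = r * (g r - t / r) ^+ 2); first by rewrite mulr_ge0 ?sqr_ge0// ltW.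
    by have rn : r != 0 by [rewrite gt_eqF]; field.
  have mI : measurable (`[a, b]%classic : set mR) by exact: measurable_itv.
  have i2g := integrable_mulr (- (2 * t)) mI ig.
  have i3 := integrable_mulr (t ^+ 2) mI ii.
  rewrite RintegralD//; last exact: integrable_addr.
  rewrite RintegralD// RintegralZl// RintegralZl// Ii -/I mulNr.
  by rewrite !lerD2r.
have [L1|L1] := ltP 0 (ln b - ln a).
  have := key (I / (ln b - ln a)).
  move: (ln b - ln a) L1 L0 => L L1 L0.
  rewrite (_ : _ + _ = n2 g - I ^+ 2 / L); last by have Ln : L != 0 by [rewrite gt_eqF]; field.
  by rewrite subr_ge0 ler_pdivrMr// mulrC.
have Lz : ln b - ln a = 0 by apply/eqP; rewrite eq_le L1 L0.
rewrite Lz mul0r.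
have [->|I0] := eqVneq I 0; first by rewrite expr0n.
(* When the logarithms coincide the quadratic in [t] is affine, and this [t] gives it the value
   -1. *)
have := key ((n2 g + 1) / (2 * I)); rewrite Lz mulr0 addr0.
rewrite (_ : _ - _ = -1); last by field.
by rewrite oppr_ge0 ler10.
Qed.

Lemma primitive0_oscillation f g (a b : R) : L2w g -> primitive0 f g -> 0 < a -> a <= b ->
  (f b - f a) ^+ 2 <= (ln b - ln a) * n2 g.
Proof.
move=> Lg pf a0 ab; have [_ p] := pf a b a0 ab.
by rewrite p//; exact: cauchy_schwarz_log.
Qed.

Lemma Rintegral_id (a b : R) : a <= b ->
  mu.-integrable `[a, b] (EFin \o (fun r : R => r)) /\
  \int[mu]_(r in `[a, b]) r = (b ^+ 2 - a ^+ 2) / 2.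
Proof.
move=> ab.
have [i p] : primitive_on a b (fun r : R => 2^-1 * r ^+ 2) (fun r => r).
  apply: C1_primitive_on => // x _; last exact: cvg_id.
  have D := is_deriveZ (2^-1 : R) (is_deriveX 2 (is_derive_id x (1 : R))).
  by apply: is_derive_eq D _; rewrite /GRing.scale/= expr1; field.
by split => //; rewrite -p//; field.
Qed.

(** On [[r, r + 1]] the squared oscillation of [f] is at most n2 g / r, so f(r)^2 is controlled by
    the average of f^2 against s ds there, which weighs about r. The 3 bounds 2 + 1/r for r >= 1. *)
Lemma radial_decay f g (r : R) : L2w f -> L2w g -> primitive0 f g -> 1 <= r ->
  r * f r ^+ 2 <= 2 * n2 f + 3 * n2 g.
Proof.
move=> Lf Lg pf r1; have r0 : 0 < r by exact: lt_le_trans r1.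
have rr : r <= r + 1 by rewrite lerDl.
have [i2 le2] := L2w_itv (r + 1) Lf r0.
have [ii Ii] := Rintegral_id rr.
have lnr s : r <= s <= r + 1 -> ln s - ln r <= r^-1.
  move=> /andP[rs sr]; have s0 : 0 < s by exact: lt_le_trans rs.
  rewrite -ln_div ?posrE//.
  rewrite (_ : s / r = 1 + (s - r) / r); last by have rn : r != 0 by [rewrite gt_eqF]; field.
  apply: le_trans (le_ln1Dx _) _.
    by rewrite (@lt_le_trans _ _ 0)// divr_ge0 ?subr_ge0// ltW.
  by rewrite ler_pdivrMr// mulVf ?gt_eqF// lerBlDr addrC.
have pt s : r <= s <= r + 1 -> f r ^+ 2 * s <= 2 * (f s ^+ 2 * s) + (2 * n2 g / r) * s.
  move=> h; have /andP[rs sr] := h; have s0 : 0 < s by exact: lt_le_trans rs.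
  rewrite mulrA -mulrDl; apply: ler_wpM2r; first exact: ltW.
  have o := primitive0_oscillation Lg pf r0 rs.
  have o2 : (f s - f r) ^+ 2 <= n2 g / r.
    by apply: le_trans o _; rewrite mulrC ler_wpM2l ?n2_ge0// lnr.
  have := sqr_ge0 (2 * f s - f r).
  by move: o2; rewrite -mulrA; move: (n2 g / r) => q; nra.
have le_int : \int[mu]_(s in `[r, r + 1]) (f r ^+ 2 * s) <=
    \int[mu]_(s in `[r, r + 1]) (2 * (f s ^+ 2 * s) + (2 * n2 g / r) * s).
  apply: le_Rintegral => //; first exact: integrable_mulr.
    by apply: integrable_addr => //; exact: integrable_mulr.
have mI : measurable (`[r, (r + 1)]%classic : set mR) by exact: measurable_itv.
have i1' := integrable_mulr 2 mI i2.
have i2' := integrable_mulr (2 * n2 g / r) mI ii.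
move: le_int; rewrite RintegralZl// RintegralD// !RintegralZl// Ii.
have -> : ((r + 1) ^+ 2 - r ^+ 2) / 2 = r + 2^-1 by field.
move=> h.
have h2 : 2 * n2 g / r * (r + 2^-1) <= 3 * n2 g.
  rewrite (_ : _ * _ = n2 g * (2 + r^-1)); last by have rn : r != 0 by [rewrite gt_eqF]; field.
  rewrite mulrC ler_wpM2r ?n2_ge0//.
  have : r^-1 <= 1 by rewrite invf_le1.
  by lra.
have h3 : r * f r ^+ 2 <= f r ^+ 2 * (r + 2^-1).
  by have := sqr_ge0 (f r); nra.
move: le2; set J := \int[mu]_(_ in _) _ in h *; move=> le2.
by lra.
Qed.

(** Compare with the value at 1: f(r)^2 is at most twice f(1)^2 plus twice the squared oscillation.
    The constants are twice those of [radial_decay]. *)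
Lemma radial_log_bound f g (r : R) : L2w f -> L2w g -> primitive0 f g -> 0 < r -> r <= 1 ->
  f r ^+ 2 <= (4 * n2 f + 6 * n2 g) * (1 - ln r).
Proof.
move=> Lf Lg pf r0 r1.
have o := primitive0_oscillation Lg pf r0 r1; rewrite ln1 sub0r in o.
have d := radial_decay Lf Lg pf (lexx 1); rewrite mul1r in d.
have lr : 0 <= - ln r by rewrite oppr_ge0 ln_le0.
have a0 := n2_ge0 f; have b0 := n2_ge0 g.
have := sqr_ge0 (2 * f 1 - f r).
have ab : 0 <= n2 f * - ln r by rewrite mulr_ge0.
have bb : 0 <= n2 g * - ln r by rewrite mulr_ge0.
by nra.
Qed.

(** Beyond 1 the decay suffices. Near 0 the logarithmic growth is absorbed by the weight: (1 - ln
    r)^2 <= 4 / r because 1 - ln r <= 2 exp(-(ln r) / 2). *)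
Lemma quartic_weight_bound f g (r K : R) : L2w f -> L2w g -> primitive0 f g -> 0 < r ->
  4 * n2 f + 6 * n2 g <= K -> f r ^+ 4 * r <= 4 * K ^+ 2.
Proof.
move=> Lf Lg pf r0 hK.
have a0 := n2_ge0 f; have b0 := n2_ge0 g.
have K0 : 0 <= K by lra.
have f2 := sqr_ge0 (f r).
rewrite (_ : f r ^+ 4 = (f r ^+ 2) ^+ 2); last by rewrite -exprM.
have [r1|/ltW r1] := leP 1 r.
  have d := radial_decay Lf Lg pf r1.
  have d1 : r * f r ^+ 2 <= K by lra.
  have d2 : f r ^+ 2 <= K by nra.
  by rewrite (_ : _ * r = f r ^+ 2 * (r * f r ^+ 2)); [nra|ring].
have d := radial_log_bound Lf Lg pf r0 r1.
have lr : 0 <= - ln r by rewrite oppr_ge0 ln_le0.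
have d1 : f r ^+ 2 <= K * (1 - ln r).
  by apply: le_trans d _; rewrite ler_wpM2r// addr_ge0.
have e : 1 - ln r <= 2 * expR (- ln r / 2).
  have := expR_ge1Dx (- ln r / 2); lra.
have e2 : (1 - ln r) ^+ 2 <= 4 / r.
  apply: (@le_trans _ _ ((2 * expR (- ln r / 2)) ^+ 2)).
    by rewrite ler_sqr ?nnegrE ?addr_ge0// mulr_ge0// expR_ge0.
  rewrite exprMn -expRM_natl (_ : 2%:R * _ = - ln r); last by field.
  by rewrite expRN lnK ?posrE// -natrX.
apply: (@le_trans _ _ ((K * (1 - ln r)) ^+ 2 * r)).
  by rewrite ler_wpM2r ?(ltW r0)// ler_sqr ?nnegrE// mulr_ge0// addr_ge0.
rewrite exprMn -mulrA mulrC ler_wpM2r ?sqr_ge0//.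
by rewrite -ler_pdivlMr.
Qed.

End pointwise_bounds.

(** Along an ultrafilter finer than the neighbourhoods of infinity all coordinates converge at once.
    The k-th index is then chosen at least k and within 1/(k+1) of the limits in the first k
    coordinates of the enumeration, which replaces a diagonal extraction. *)
Lemma bounded_subsequence (R : realType) (T : countType) (u : nat -> T -> R) (B : T -> R) :
  (forall n t, `|u n t| <= B t) ->
  exists (phi : T -> R) (s : nat -> nat), (forall k, (k <= s k)%N) /\
    forall t, u (s k) t @[k --> \oo] --> phi t.
Proof.
move=> uB.
have [U [UU subU]] := @ultraFilterLemma nat \oo _.
have lim_ t : exists p, forall e, 0 < e -> U [set n | `|u n t - p| < e].
  have cK := @segment_compact R (- B t) (B t).
  have FK : (u^~ t @ U) `[- B t, B t]%classic.
    have -> : (u^~ t @ U) `[- B t, B t]%classic = U [set n | - B t <= u n t <= B t].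
      by [].
    rewrite (_ : [set n | _] = setT); first exact: filterT.
    by apply/seteqP; split=> // n _ /=; rewrite -ler_norml.
  have [p [_ clp]] := cK (u^~ t @ U) _ FK.
  exists p => e e0.
  have [//|nU] := in_ultra_setVsetC [set n | `|u n t - p| < e] UU.
  have pn : nbhs p (ball p e) by exact: nbhsx_ballx.
  have nF : (u^~ t @ U) [set x | ~ `|x - p| < e] by [].
  have [x [/= h]] := clp _ _ nF pn.
  by rewrite /ball/= distrC.
pose phi t := sval (cid (lim_ t)).
have phiP t : forall e, 0 < e -> U [set n | `|u n t - phi t| < e] := svalP (cid (lim_ t)).
have ex k : exists n, (k <= n)%N /\ forall i : 'I_k, forall t, unpickle i = Some t ->
    `|u n t - phi t| < k.+1%:R^-1.
  have h1 : U [set n | (k <= n)%N] by apply: subU; exists k.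
  have h2 : U [set n | forall i : 'I_k, forall t, unpickle i = Some t ->
      `|u n t - phi t| < k.+1%:R^-1].
    apply: filter_forall => i; case: (unpickle i) => [t|]; last by apply: filterS filterT.
    have i0 : 0 < k.+1%:R^-1 :> R by rewrite invr_gt0.
    by move: (phiP t _ i0); apply: filterS => n h t' [<-].
  by have [n [? ?]] := filter_ex (filterI h1 h2); exists n.
pose s k := sval (cid (ex k)).
have sP k := svalP (cid (ex k)); rewrite -/(s _) in sP.
exists phi, s; split; first by move=> k; have [] := sP k.
move=> t; apply/cvgrPdist_lt => e e0.
have h := near_infty_natSinv_lt (PosNum e0).
have h2 : \forall k \near \oo, (pickle t < k)%N by exists (pickle t).+1.
near=> k; have [_ hk] := sP k.
have pk : (pickle t < k)%N by near: k.
rewrite distrC; apply: (lt_trans (hk (Ordinal pk) t _)); first by rewrite /= pickleK.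
by near: k.
Unshelve. all: by end_near. Qed.

(** * Pointwise limits of bounded states and the quartic term *)

Section compactness.
Variable R : realType.
Local Notation mu := (@lebesgue_measure R).
Local Notation mR := (measurableTypeR R).
Local Notation Rpos := (`]0, +oo[%classic : set R).

Definition comps := bool -> bool -> R -> R.

Lemma fatou_bound (h_ : nat -> R -> R) (h : R -> R) (c : \bar R) :
  (forall n, measurable_fun Rpos (h_ n)) -> measurable_fun Rpos h ->
  (forall n r, 0 < r -> 0 <= h_ n r) -> (forall r, 0 < r -> 0 <= h r) ->
  {ae mu, forall r, 0 < r -> h_ n r @[n --> \oo] --> h r} ->
  (forall n, (radial_int (h_ n) <= c)%E) -> (radial_int h <= c)%E.
Proof.
move=> mh_ mh h_0 h0 cv hc.
have k0 := kappa2_gt0 R.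
pose k_ n r := (2 * kappa R * (h_ n r * r))%:E.
have mk_ n : measurable_fun Rpos (k_ n).
  by apply/measurable_EFinP; apply: measurable_funM => //; exact: measurable_weight.
have k_0 n r : Rpos r -> (0 <= k_ n r)%E.
  rewrite /= in_itv/= andbT => r0; rewrite lee_fin.
  by apply: mulr_ge0; [exact: ltW|rewrite mulr_ge0 ?h_0// ltW].
have RE (g : R -> R) : measurable_fun Rpos g -> (forall r, 0 < r -> 0 <= g r) ->
    radial_int g = (\int[mu]_(r in Rpos) (2 * kappa R * (g r * r))%:E)%E.
  move=> mg g0; rewrite /radial_int -ge0_integralZl//.
  - by apply/measurable_EFinP; exact: measurable_weight.
  - by move=> r; rewrite /= in_itv/= andbT => r0; rewrite lee_fin mulr_ge0 ?g0// ltW.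
  - by rewrite lee_fin ltW.
have := @fatou _ _ _ mu Rpos (@measurable_Rpos R) k_ mk_ k_0.
have -> : (\int[mu]_(r in Rpos) limn_einf (k_^~ r) = radial_int h)%E.
  rewrite RE//; apply: ge0_ae_eq_integral => //.
  - rewrite (_ : (fun r => limn_einf _) = (fun r => - limn_esup (fun n => - k_ n r))%E); last first.
      by apply/funext => r; rewrite -[RHS]/(- limn_esup (-%E \o (k_^~ r)))%E limn_esupN oppeK.
    apply: measurableT_comp => //; apply: measurable_fun_limn_esup => n.
    rewrite (_ : (fun r => _) = (fun r => (- (2 * kappa R * (h_ n r * r)))%:E)); last exact/funext.
    apply/measurable_EFinP; apply: measurable_funN; apply: measurable_funM => //.
    exact: measurable_weight.
  - by apply/measurable_EFinP; apply: measurable_funM => //; exact: measurable_weight.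
  - move=> r Dr; rewrite limn_einf_lim; apply: lime_ge; first exact: is_cvg_einfs.
    by apply: nearW => n; apply: le_ereal_inf_tmp => _ [k _ <-]; exact: k_0.
  - move=> r; rewrite /= in_itv/= andbT => r0; rewrite lee_fin.
    by apply: mulr_ge0; [exact: ltW|rewrite mulr_ge0 ?h0// ltW].
  - move: cv; apply: ae_imp => r hr; rewrite /= in_itv/= andbT => r0.
    have c1 : k_ n r @[n --> \oo] --> (2 * kappa R * (h r * r))%:E.
      apply: cvg_EFin; first exact: nearW.
      by apply: cvgM; [exact: cvg_cst|apply: cvgM; [exact: hr|exact: cvg_cst]].
    have /cvg_limn_einf_sup[-> _] := c1.
    by [].
move=> le1; apply: le_trans le1 _.
rewrite limn_einf_lim; apply: lime_le; first exact: is_cvg_einfs.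
apply: nearW => n; apply: le_trans (hc n).
rewrite RE//; last exact: h_0.
by apply: ereal_inf_lbound; exists n => //=.
Qed.

(** Extraction takes place at rational radii, which are countable; equicontinuity in ln r upgrades
    convergence there to convergence at every positive radius. *)
Lemma state_subsequence (m : int) (F G : nat -> comps) (A : R) :
  (forall n, state m (F n) (G n)) ->
  (forall n s j, n2 (F n s j) <= A) -> (forall n s j, n2 (G n s j) <= A) ->
  exists (phi : comps) (u : nat -> nat), (forall k, (k <= u k)%N) /\
    forall s j r, 0 < r -> F (u k) s j r @[k --> \oo] --> phi s j r.
Proof.
move=> st FA GA.
have A0 : 0 <= A by apply: le_trans (FA 0%N true true); exact: n2_ge0.
have LF n s j : L2w (F n s j) by have [] := st n s j.
have LG n s j : L2w (G n s j) by have [] := st n s j.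
have pr n s j : primitive0 (F n s j) (G n s j) by have [] := st n s j.
pose v n (t : bool * bool * rat) : R :=
  if 0 < ratr t.2 :> R then F n t.1.1 t.1.2 (ratr t.2) else 0.
(* From |x| <= 1 + x^2; the factor 10 is the 4 + 6 of [radial_log_bound] and also covers the 2 + 3
   of [radial_decay]. *)
pose B (t : bool * bool * rat) : R := 1 + 10 * A * (1 + `|ln (ratr t.2 : R)|).
have vB n t : `|v n t| <= B t.
  case: t => [[s j] q]; rewrite /v /B /=; case: ifP => q0; last first.
    by rewrite normr0 addr_ge0// !mulr_ge0// addr_ge0.
  set r := ratr q in q0 *; set x := F n s j r.
  have x2 : x ^+ 2 <= 10 * A * (1 + `|ln r|).
    have hF := FA n s j; have hG := GA n s j.
    have f0 := n2_ge0 (F n s j); have g0 := n2_ge0 (G n s j).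
    have l0 := normr_ge0 (ln r).
    have [r1|/ltW r1] := leP 1 r.
      have d := radial_decay (LF n s j) (LG n s j) (pr n s j) r1.
      have := sqr_ge0 x; rewrite -/x in d => x0.
      have : x ^+ 2 <= r * x ^+ 2 by rewrite ler_peMl.
      have : 0 <= A * `|ln r| by rewrite mulr_ge0.
      by nra.
    have d := radial_log_bound (LF n s j) (LG n s j) (pr n s j) q0 r1; rewrite -/x in d.
    apply: le_trans d _; rewrite (ler0_norm (ln_le0 r1)).
    rewrite ler_wpM2r//; last by lra.
    by rewrite addr_ge0// oppr_ge0 ln_le0.
  apply: le_trans (_ : 1 + x ^+ 2 <= _); last by rewrite lerD2l.
  have := sqr_ge0 (1 - `|x|); rewrite -[x ^+ 2]real_normK ?num_real//.
  by have := normr_ge0 x; nra.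
have [psi [u [uk up]]] := bounded_subsequence vB.
have cv s j r : 0 < r -> cvg (F (u k) s j r @[k --> \oo]).
  move=> r0; apply/cauchy_cvgP; apply: cauchy_exP => e e0.
  have A1 : 0 < A + 1 by rewrite ltr_wpDl.
  have d0 : 0 < (e / 2) ^+ 2 / (A + 1) by rewrite divr_gt0// exprn_gt0// divr_gt0.
  (* A rational radius within this factor of [r] is so close in ln r that all the profiles of the
     sequence vary by less than [e / 2] between the two. *)
  have rd : r * expR (- ((e / 2) ^+ 2 / (A + 1))) < r.
    by rewrite gtr_pMr// -[X in _ < X]expR0 ltr_expR oppr_lt0.
  have [q] := rat_in_itvoo rd; rewrite in_itv/= => /andP[q1 q2].
  have rE0 : 0 < r * expR (- ((e / 2) ^+ 2 / (A + 1))) by rewrite mulr_gt0// expR_gt0.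
  have q0 : 0 < ratr q :> R by exact: lt_trans q1.
  exists (psi (s, j, q)).
  have osc n : `|F n s j r - F n s j (ratr q)| < e / 2.
    have o := primitive0_oscillation (LG n s j) (pr n s j) q0 (ltW q2).
    have l1 : ln r - ln (ratr q) < (e / 2) ^+ 2 / (A + 1).
      have := q1; rewrite -ltr_ln ?posrE// lnM ?posrE ?expR_gt0// expRK; lra.
    have l0 : 0 <= ln r - ln (ratr q) by rewrite subr_ge0 ler_ln ?posrE// ltW.
    have := GA n s j; have g0 := n2_ge0 (G n s j) => hG.
    have o2 : (F n s j r - F n s j (ratr q)) ^+ 2 < (e / 2) ^+ 2.
      apply: le_lt_trans o _.
      apply: (@le_lt_trans _ _ ((ln r - ln (ratr q)) * (A + 1))).
        by rewrite ler_wpM2l//; lra.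
      by rewrite -ltr_pdivlMr.
    rewrite -(@ltr_pXn2r _ 2)// ?nnegrE//; last by rewrite ltW// divr_gt0.
    by rewrite real_normK ?num_real.
  have /cvgrPdist_lt h := up (s, j, q).
  have e2 : 0 < e / 2 by rewrite divr_gt0.
  move: (h _ e2); apply: filterS => k; rewrite /v /= q0 => hk.
  rewrite /ball/= (_ : _ - _ = (psi (s, j, q) - F (u k) s j (ratr q)) -
    (F (u k) s j r - F (u k) s j (ratr q))); last by ring.
  apply: le_lt_trans (ler_normB _ _) _.
  by have := osc (u k); lra.
exists (fun s j r => lim (F (u k) s j r @[k --> \oo])), u; split => //; exact: cv.
Qed.

Section bounds.
Variables (m : int) (F G : comps) (A : R).
Hypothesis st : state m F G.
Hypothesis FA : forall s j, n2 (F s j) <= A.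
Hypothesis GA : forall s j, n2 (G s j) <= A.

Let A0 : 0 <= A.
Proof. by apply: le_trans (FA true true); exact: n2_ge0. Qed.

Lemma sq2_decay r : 1 <= r -> r * sq2 F r <= 20 * A.
Proof.
move=> r1; rewrite sq2E.
have b s j : r * F s j r ^+ 2 <= 5 * A.
  have [Lf _ Lg p] := st s j.
  by have := radial_decay Lf Lg p r1; have := FA s j; have := GA s j; lra.
by have := b true true; have := b true false; have := b false true; have := b false false; lra.
Qed.

(** Each component contributes at most 4 (10 A)^2 = (20 A)^2, and the square of a sum of four terms
    is at most 4 times the sum of squares: in all 16 (20 A)^2. *)
Lemma sq2_weight r : 0 < r -> sq2 F r ^+ 2 * r <= (80 * A) ^+ 2.
Proof.
move=> r0; rewrite sq2E.
have b s j : F s j r ^+ 4 * r <= (20 * A) ^+ 2.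
  have [Lf _ Lg p] := st s j.
  have h : 4 * n2 (F s j) + 6 * n2 (G s j) <= 10 * A by have := FA s j; have := GA s j; lra.
  by have := quartic_weight_bound Lf Lg p r0 h; lra.
have e s j : F s j r ^+ 4 = (F s j r ^+ 2) ^+ 2 by rewrite -exprM.
have := b true true; have := b true false; have := b false true; have := b false false.
rewrite !e; move: (F true false r ^+ 2) (F true true r ^+ 2) (F false false r ^+ 2)
  (F false true r ^+ 2) => a b' c d h1 h2 h3 h4.
apply: (@le_trans _ _ (4 * (a ^+ 2 * r + b' ^+ 2 * r + c ^+ 2 * r + d ^+ 2 * r))); last by lra.
rewrite -!mulrDl mulrA ler_wpM2r ?(ltW r0)//.
have := sqr_ge0 (a - b'); have := sqr_ge0 (a - c); have := sqr_ge0 (a - d).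
have := sqr_ge0 (b' - c); have := sqr_ge0 (b' - d); have := sqr_ge0 (c - d).
by lra.
Qed.

Variables (lp lm l0 : R).
Hypotheses (lp0 : 0 < lp) (lm0 : 0 < lm) (l00 : 0 < l0).

Lemma quartic_le r : 0 <= quartic lp lm l0 F r <= (lp + lm + l0) * sq2 F r ^+ 2.
Proof.
have d1 := dens_ge0 F true r; have d2 := dens_ge0 F false r.
apply/andP; split; first exact: quad_ge0.
have -> : sq2 F r = dens F true r + dens F false r by rewrite sq2E.
rewrite /quartic /quad; move: (dens F true r) (dens F false r) d1 d2 => a b a0 b0.
rewrite -subr_ge0 (_ : _ - _ = lp * (2 * a * b + b ^+ 2) +
  lm * (2 * a * b + a ^+ 2) + l0 * (a ^+ 2 + b ^+ 2)); last by ring.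
by rewrite !addr_ge0 ?mulr_ge0 ?addr_ge0 ?sqr_ge0 ?mulr_ge0 ?(ltW lp0) ?(ltW lm0) ?(ltW l00).
Qed.

Lemma measurable_quartic : measurable_fun Rpos (quartic lp lm l0 F).
Proof.
have mf s j : measurable_fun Rpos (F s j) by have [[]] := st s j.
by apply: measurable_quad; apply: measurable_funD; exact: measurable_funX.
Qed.

(** One factor [sq2 F] is traded for its decay [20 * A / r], while the other remains to be
    integrated as mass. *)
Lemma quartic_tail (L r : R) : 1 <= L -> L < r ->
  quartic lp lm l0 F r <= (lp + lm + l0) * (20 * A / L) * sq2 F r.
Proof.
move=> L1 Lr; have r1 : 1 <= r by rewrite (le_trans L1)// ltW.
have L0 : 0 < L by exact: lt_le_trans L1.
have /andP[_ q] := quartic_le r; apply: le_trans q _.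
rewrite expr2 mulrA -mulrA [X in _ <= X]mulrAC; rewrite -!mulrA; apply: ler_wpM2l; first by rewrite !addr_ge0 ?ltW.
rewrite ler_wpM2l ?sq2_ge0//.
rewrite mulrA ler_pdivlMr//; apply: le_trans (sq2_decay r1).
by rewrite mulrC ler_wpM2r ?sq2_ge0// ltW.
Qed.

End bounds.

Lemma quartic_rintegrable (m : int) (F G : comps) (lp lm l0 : R) : state m F G ->
  0 < lp -> 0 < lm -> 0 < l0 -> rintegrable (quartic lp lm l0 F).
Proof.
move=> st lp0 lm0 l00.
have [A FA GA] : exists2 A, forall s j, n2 (F s j) <= A & forall s j, n2 (G s j) <= A.
  pose a s := Num.max (n2 (F s true)) (n2 (F s false)).
  pose b s := Num.max (n2 (G s true)) (n2 (G s false)).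
  exists (Num.max (Num.max (a true) (a false)) (Num.max (b true) (b false)));
    by case=> -[]; rewrite !le_max lexx ?orbT.
set Lam := lp + lm + l0; have Lam0 : 0 <= Lam by rewrite !addr_ge0 ?ltW.
(* The majorant: a multiple of 1/r on [[0, 1]], harmless against r dr, plus beyond 1 a multiple of
   the mass density. *)
pose k r : R := Lam * ((80 * A) ^+ 2) * (\1_(`[0, 1]%classic : set R) r / r) + Lam * (20 * A / 1) * sq2 F r.
have i1 : rintegrable (fun r => \1_(`[0, 1]%classic : set R) r / r).
  have : mu.-integrable Rpos (EFin \o (\1_(`[0, 1]%classic : set R) : R -> R)).
    apply: (@integrableS _ _ _ _ setT) => //.
    apply/integrableP; split; first by apply/measurable_EFinP; exact: measurable_indic.
    under eq_integral do rewrite /= ger0_norm//.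
    rewrite integral_indic ?setIT//.
    by rewrite [X in (X < _)%E]lebesgue_measure_itv/= lte01 sube0 ltry.
  apply: eq_integrable => [|r]; first exact: measurable_Rpos.
  rewrite inE/= in_itv/= andbT => r0; congr EFin.
  by rewrite mulfVK// gt_eqF.
apply: (@le_rintegrable _ _ k).
- exact: measurable_quartic st _ _ _.
- move=> r r0; have /andP[q0 q1] := quartic_le F lp0 lm0 l00 r.
  rewrite ger0_norm// /k.
  have A0 : 0 <= A by apply: le_trans (FA true true); exact: n2_ge0.
  have [r1|r1] := leP r 1.
    rewrite indicE mem_set/=; last by rewrite in_itv/= (ltW r0).
    rewrite -[X in X <= _]addr0; apply: lerD; last by rewrite !mulr_ge0 ?sq2_ge0 ?invr_ge0.
    apply: le_trans q1 _; rewrite -/Lam -mulrA; apply: ler_wpM2l => //.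
    by rewrite mul1r ler_pdivlMr//; exact: (sq2_weight st FA GA).
  rewrite -[X in X <= _]add0r; apply: lerD; last exact: (quartic_tail st FA GA).
  apply: mulr_ge0; first by rewrite !mulr_ge0// sqr_ge0.
  by apply: divr_ge0; [rewrite indicE|exact: ltW].
- apply: rintegrableD; apply: rintegrableZ => //.
  by have [] := state_rintegrable st.
Qed.

(* Upper semicontinuity suffices for a minimization; the bound r |f|^2 <= C makes the
   tails uniformly small. *)
Lemma quartic_usc (m : int) (F G : nat -> comps) (phi gam : comps) (A lp lm l0 : R) :
  0 < lp -> 0 < lm -> 0 < l0 ->
  (forall n, state m (F n) (G n)) -> state m phi gam ->
  (forall n s j, n2 (F n s j) <= A) -> (forall n s j, n2 (G n s j) <= A) ->
  (forall s j r, 0 < r -> F n s j r @[n --> \oo] --> phi s j r) ->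
  forall e, 0 < e -> \forall n \near \oo,
    rint (quartic lp lm l0 (F n)) <= rint (quartic lp lm l0 phi) + e.
Proof.
move=> lp0 lm0 l00 st stp FA GA cv e e0.
have A0 : 0 <= A by apply: le_trans (FA 0%N true true); exact: n2_ge0.
set Lam := lp + lm + l0; have Lam0 : 0 <= Lam by rewrite !addr_ge0 ?ltW.
have k0 := kappa2_gt0 R.
pose T := Lam * (20 * A) * (2 * kappa R * (4 * A)).
have kA : 0 <= 2 * kappa R * (4 * A) by apply: mulr_ge0; [exact: ltW|rewrite mulr_ge0].
have T0 : 0 <= T by rewrite /T mulr_ge0// !mulr_ge0.
(* [T / L] bounds the quartic integral beyond [L] uniformly in n, and this [L] makes it at most
   [e / 2]. *)
pose L := 1 + 2 * T / e.
have L1 : 1 <= L by rewrite lerDl; apply: divr_ge0; [rewrite mulr_ge0|exact: ltW].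
have L0 : 0 < L by exact: lt_le_trans L1.
pose I : set R := `[0, L]%classic.
have mI : measurable (I : set mR) by exact: measurable_itv.
have iq n := quartic_rintegrable (st n) lp0 lm0 l00.
have iqp := quartic_rintegrable stp lp0 lm0 l00.
have mq n : measurable_fun Rpos (quartic lp lm l0 (F n)) by exact: measurable_quartic (st n) _ _ _.
have ihd (h : R -> R) : measurable_fun Rpos h -> rintegrable h -> rintegrable (fun r => h r * \1_I r).
  move=> mh ih; have ia : rintegrable (fun r => `|h r|).
    have := integrable_norm ih; apply: eq_integrable => [|r]; first exact: measurable_Rpos.
    by rewrite inE/= in_itv/= andbT => r0; rewrite /= normrM (gtr0_norm r0).
  apply: le_rintegrable ia; first by apply: measurable_funM => //; exact: measurable_indic.
  move=> r _; rewrite indicE normrM ler_piMr//.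
  by case: (_ \in _); rewrite ?normr1 ?normr0.
have mqp : measurable_fun Rpos (quartic lp lm l0 phi) by exact: measurable_quartic stp _ _ _.
(* On [[0, L]] the quartic density times r is bounded by a constant, which serves as majorant. *)
have head : rint (fun r => quartic lp lm l0 (F n) r * \1_I r) @[n --> \oo] -->
    rint (fun r => quartic lp lm l0 phi r * \1_I r).
  apply: cvgM; first exact: cvg_cst.
  pose h n r := quartic lp lm l0 (F n) r * \1_I r * r.
  pose h' r := quartic lp lm l0 phi r * \1_I r * r.
  have ig : mu.-integrable Rpos (EFin \o (fun r => Lam * ((80 * A) ^+ 2) * \1_I r)).
    apply: (@integrableS _ _ _ _ setT) => //.
    apply: integrable_mulr => //.
    apply/integrableP; split; first by apply/measurable_EFinP; exact: measurable_indic.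
    under eq_integral do rewrite /= ger0_norm//.
    rewrite integral_indic ?setIT//.
    by rewrite [X in (X < _)%E]lebesgue_measure_itv/= lte_fin L0 sube0 ltry.
  have := @dominated_cvg _ _ _ mu Rpos (@measurable_Rpos R) (fun n r => (h n r)%:E)
    (fun r => (h' r)%:E) _ _ _ _ ig _.
  move=> H; have {}H : (\int[mu]_(r in Rpos) (h n r)%:E)%E @[n --> \oo] -->
      (\int[mu]_(r in Rpos) (h' r)%:E)%E.
    apply: H => //.
    - move=> n; apply/measurable_EFinP; apply: measurable_weight.
      by apply: measurable_funM => //; exact: measurable_indic.
    - move=> r; rewrite /= in_itv/= andbT => r0.
      apply: cvg_EFin; first exact: nearW.
      apply: cvgM; last exact: cvg_cst; apply: cvgM; last exact: cvg_cst.
      have cd s : dens (F n) s r @[n --> \oo] --> dens phi s r.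
        by apply: cvgD; rewrite expr2; under eq_fun do rewrite expr2; apply: cvgM; exact: cv.
      rewrite /quartic /quad; apply: cvgD.
        by apply: cvgD; apply: cvgM; [exact: cvg_cst|rewrite expr2; under eq_fun do rewrite expr2;
          apply: cvgM; exact: cd|exact: cvg_cst|rewrite expr2; under eq_fun do rewrite expr2;
          apply: cvgM; exact: cd].
      by apply: cvgM => //; apply: cvgM => //; exact: cvg_cst.
    - move=> n r; rewrite /= in_itv/= andbT => r0.
      have /andP[q0 q1] := quartic_le (F n) lp0 lm0 l00 r.
      rewrite lee_fin /h ger0_norm; last by rewrite !mulr_ge0// ltW.
      rewrite mulrAC; apply: ler_wpM2r => //.
      apply: (@le_trans _ _ (Lam * sq2 (F n) r ^+ 2 * r)); first by rewrite ler_wpM2r// ltW.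
      rewrite -mulrA; apply: ler_wpM2l => //.
      exact: (sq2_weight (st n) (FA n) (GA n)).
  have ih n : mu.-integrable Rpos (EFin \o h n) by exact: (ihd _ (mq n) (iq n)).
  have ih' : mu.-integrable Rpos (EFin \o h') by exact: (ihd _ mqp iqp).
  have := fine_cvg; move=> fc.
  have E n : \int[mu]_(r in Rpos) h n r = fine (\int[mu]_(r in Rpos) (h n r)%:E)%E by [].
  under eq_fun do rewrite E.
  apply: fc; rewrite fineK//.
  by rewrite EFin_Rintegral//; exact: measurable_Rpos.
have head_le : rint (fun r => quartic lp lm l0 phi r * \1_I r) <= rint (quartic lp lm l0 phi).
  apply: le_rint => //; first exact: ihd.
  move=> r _; have /andP[q0 _] := quartic_le phi lp0 lm0 l00 r.
  by rewrite indicE ler_piMr//; case: (_ \in _).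
have e2 : 0 < e / 2 by rewrite divr_gt0.
have /cvgrPdist_lt hd := head.
move: (hd _ e2); apply: filterS => n; rewrite distrC ltr_norml => /andP[_ hn].
have i2 : rintegrable (sq2 (F n)) by have [] := state_rintegrable (st n).
have sqA : rint (sq2 (F n)) <= 2 * kappa R * (4 * A).
  rewrite (_ : rint (sq2 (F n)) = 2 * kappa R * (n2 (F n true false) + n2 (F n true true) +
      (n2 (F n false false) + n2 (F n false true)))).
    by rewrite ler_pM2l// (_ : 4 * A = A + A + (A + A)); [rewrite !lerD|ring].
  have i s j : rintegrable (fun r => F n s j r ^+ 2).
    by apply: L2w_rintegrable; have [] := st n s j.
  rewrite (@eq_rint _ _ (fun r => F n true false r ^+ 2 + F n true true r ^+ 2 +
      (F n false false r ^+ 2 + F n false true r ^+ 2))); last by move=> r _; rewrite sq2E.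
  by rewrite rintD; [rewrite !rintD// /rint -!mulrDr|exact: rintegrableD|exact: rintegrableD].
have split_ : rint (quartic lp lm l0 (F n)) <=
    rint (fun r => quartic lp lm l0 (F n) r * \1_I r + Lam * (20 * A / L) * sq2 (F n) r).
  apply: le_rint => //.
    by apply: rintegrableD; [exact: ihd|exact: rintegrableZ].
  move=> r r0; rewrite indicE.
  have [rL|rL] := leP r L.
    rewrite mem_set ?mulr1 ?lerDl; first by rewrite !mulr_ge0 ?sq2_ge0 ?invr_ge0 ?(ltW L0).
    by rewrite /I/= in_itv/= (ltW r0).
  rewrite memNset; last by rewrite /I/= in_itv/= (leNgt r L) rL andbF.
  by rewrite mulr0 add0r; exact: (quartic_tail (st n) (FA n) (GA n)).
rewrite (rintD (ihd _ (mq n) (iq n)) (rintegrableZ (Lam * (20 * A / L)) i2)) in split_.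
rewrite rintZ// in split_.
have tail : Lam * (20 * A / L) * rint (sq2 (F n)) <= e / 2.
  apply: (@le_trans _ _ (T / L)).
    have -> : T / L = Lam * (20 * A / L) * (2 * kappa R * (4 * A)).
      by rewrite /T; have Ln : L != 0 by [rewrite gt_eqF]; field.
    by rewrite ler_wpM2l// !mulr_ge0 ?invr_ge0 ?(ltW L0).
  rewrite ler_pdivrMr// /L mulrDr mulr1.
  rewrite (_ : e / 2 * (2 * T / e) = T); first by rewrite lerDr ltW.
  by have en : e != 0 by [rewrite gt_eqF]; field.
rewrite ltrBlDl in hn.
have h1 := le_trans (ltW hn) (lerD head_le (lexx (e / 2))).
apply: le_trans split_ _; apply: le_trans (lerD h1 tail) _.
by rewrite -addrA -splitr.
Qed.

End compactness.

(** * Weak limits by convex combinations *)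

Section weak_limits.
Variable R : realType.
Local Notation mu := (@lebesgue_measure R).
Local Notation mR := (measurableTypeR R).
Local Notation Rpos := (`]0, +oo[%classic : set R).

Lemma L2wB (f g : R -> R) : L2w f -> L2w g -> L2w (fun r => f r - g r).
Proof.
move=> Lf Lg; rewrite (_ : (fun r => _) = (fun r => f r + -1 * g r)).
  by apply: L2wD => //; exact: L2wZ.
by apply/funext => r; rewrite mulN1r.
Qed.

Lemma geometric_cauchy (h : nat -> R) (K : R) : 0 <= K ->
  (forall k, `|h k.+1 - h k| <= K * 2^-1 ^+ k) -> cvg (h k @[k --> \oo]).
Proof.
move=> K0 hK.
have tel k i : `|h (k + i)%N - h k| <= 2 * K * (2^-1 ^+ k - 2^-1 ^+ (k + i)).
  elim: i => [|i IH]; first by rewrite addn0 !subrr normr0 mulr0.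
  rewrite addnS (_ : _ - _ = (h (k + i).+1 - h (k + i)%N) + (h (k + i)%N - h k)); last by ring.
  apply: le_trans (ler_normD _ _) _; apply: le_trans (lerD (hK _) IH) _.
  by rewrite exprS; move: (2^-1 ^+ (k + i)) (2^-1 ^+ k) => a b; lra.
apply/cauchy_cvgP; apply: cauchy_exP => e e0.
have K1 : 0 < 2 * K + 1 by rewrite ltr_wpDl// mulr_ge0.
have eK : 0 < e / (2 * K + 1) by rewrite divr_gt0.
have [k ke] : exists k, 2^-1 ^+ k < e / (2 * K + 1).
  have : (2^-1 : R) ^+ k @[k --> \oo] --> (0 : R).
    by apply: cvg_expr; rewrite gtr0_norm ?invr_gt0// invf_lt1// ltr1n.
  by move=> /cvgrPdist_lt/(_ _ eK)[N _ /(_ N (leqnn _))]; rewrite sub0r normrN => hN;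
    exists N; apply: le_lt_trans hN; rewrite ler_norm.
exists (h k); exists k => // n /= kn; rewrite /ball/= distrC -(subnKC kn).
apply: le_lt_trans (tel _ _) _.
have p0 : 0 <= (2^-1 : R) ^+ (k + (n - k)) by rewrite exprn_ge0// invr_ge0.
have q0 : 0 <= (2^-1 : R) ^+ k by rewrite exprn_ge0// invr_ge0.
move: ke; rewrite ltr_pdivlMr//; move: p0 q0.
move: (2^-1 ^+ (k + (n - k))) (2^-1 ^+ k) => b a b0 a0 ke.
have h1 : 2 * K * (a - b) <= 2 * K * a by rewrite ler_wpM2l ?mulr_ge0// lerBlDr lerDl.
by lra.
Qed.

Lemma n2_radial (f : R -> R) : L2w f -> radial_int (fun r => f r ^+ 2) = (2 * kappa R * n2 f)%:E.
Proof. by move=> Lf; rewrite radial_intE//; exact: L2w_rintegrable. Qed.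

(** Riesz-Fischer for a sequence with a geometric rate, so fast that the sequence itself converges
    almost everywhere. *)
Lemma L2_cauchy_limit (h : nat -> R -> R) (C : R) : (forall k, L2w (h k)) ->
  (forall k l, (k <= l)%N -> n2 (fun r => h k r - h l r) <= C * 16^-1 ^+ k) ->
  exists gam : R -> R, [/\ L2w gam,
    {ae mu, forall r, 0 < r -> h k r @[k --> \oo] --> gam r} &
    forall k, n2 (fun r => h k r - gam r) <= C * 16^-1 ^+ k].
Proof.
move=> Lh hC.
have mh k : measurable_fun Rpos (h k) by case: (Lh k).
(* The rate 16^-k leaves room for the weight 4^k: the sum of the [t k] is integrable, and where it
   is finite consecutive differences are bounded by a multiple of 2^-k. *)
pose t k r : \bar R := (4 ^+ k * ((h k r - h k.+1 r) ^+ 2 * r))%:E.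
have mt k : measurable_fun Rpos (t k).
  apply/measurable_EFinP; apply: measurable_funM => //; apply: measurable_weight.
  by apply: measurable_funX; exact: measurable_funB.
have t0 k r : Rpos r -> (0 <= t k r)%E.
  rewrite /= in_itv/= andbT => r0; rewrite lee_fin mulr_ge0 ?exprn_ge0//.
  by rewrite mulr_ge0 ?sqr_ge0// ltW.
pose S r := (\sum_(0 <= k <oo) t k r)%E.
have LD k : L2w (fun r => h k r - h k.+1 r) by exact: L2wB.
have It k : (\int[mu]_(r in Rpos) t k r <= (C * 4^-1 ^+ k)%:E)%E.
  have -> : (\int[mu]_(r in Rpos) t k r = (4 ^+ k * n2 (fun r => h k r - h k.+1 r))%:E)%E.
    have i1 := L2w_rintegrable (LD k).
    have i2 := integrable_mulr (4 ^+ k) (@measurable_Rpos R) i1.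
    by rewrite /n2 -RintegralZl// -EFin_Rintegral.
  rewrite lee_fin; apply: le_trans (_ : 4 ^+ k * (C * 16^-1 ^+ k) <= _).
    by rewrite ler_wpM2l ?exprn_ge0//; exact: hC.
  rewrite mulrCA -exprMn (_ : 4 * 16^-1 = 4^-1 :> R)//; by field.
have C0 : 0 <= C by have := hC 0%N 0%N (leqnn _); rewrite mulr1; apply: le_trans; exact: n2_ge0.
have mS : measurable_fun Rpos S by apply: ge0_emeasurable_sum => // k x Dx _; exact: t0.
have IS : (\int[mu]_(r in Rpos) S r < +oo)%E.
  rewrite /S integral_nneseries//.
  apply: (@le_lt_trans _ _ (2 * C)%:E); last exact: ltry.
  apply: le_trans (@epsilon_trick0 R (2 * C) xpredT (mulr_ge0 _ C0)); last by [].
  apply: lee_nneseries => k _ //.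
    by move=> _; apply: integral_ge0 => r; exact: t0.
  apply: le_trans (It k) _; rewrite lee_fin expnS natrM invfM mulrA.
  rewrite (_ : 2 * C / 2 = C); last by field.
  have -> : 4^-1 ^+ k = ((2 ^ k)%:R)^-1 * ((2 ^ k)%:R)^-1 :> R.
    by rewrite natrX -exprVn -exprMn -invfM -natrM.
  rewrite mulrA ler_piMr//; first by rewrite divr_ge0.
  by rewrite invf_le1 ?ltr0n ?expn_gt0// ler1n expn_gt0.
have aeS : {ae mu, forall r, Rpos r -> S r \is a fin_num}.
  apply: integrable_ae; first exact: measurable_Rpos.
  apply/integrableP; split => //; apply: le_lt_trans IS; rewrite le_eqVlt.
  apply/orP; left; apply/eqP; apply: eq_integral => r; rewrite inE => Dr.
  by rewrite gee0_abs// nneseries_ge0// => k _ _; exact: t0.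
have cv : {ae mu, forall r, 0 < r -> cvg (h k r @[k --> \oo])}.
  move: aeS; apply: ae_imp => r fin r0.
  have Dr : Rpos r by rewrite /= in_itv/= r0.
  have {}fin := fin Dr; pose B := fine (S r) / r.
  have S0 : (0 <= S r)%E by apply: nneseries_ge0 => k _ _; exact: t0.
  have B0 : 0 <= B by rewrite divr_ge0 ?fine_ge0// ltW.
  have tB k : (h k r - h k.+1 r) ^+ 2 <= B * (2^-1 ^+ k) ^+ 2.
    have : (t k r <= S r)%E.
      apply: le_trans (nneseries_lim_ge k.+1 _); last by move=> n _ _; exact: t0.
      rewrite big_nat_recr//= leeDr// sume_ge0// => i _; exact: t0.
    rewrite -(fineK fin) lee_fin => h1.
    have -> : (2^-1 ^+ k) ^+ 2 = (4 ^+ k)^-1 :> R.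
      by rewrite -exprM mulnC exprM -exprVn; congr (_ ^+ k); field.
    rewrite /B mulrAC ler_pdivlMr// ler_pdivlMr ?exprn_gt0// mulrC.
    by rewrite mulrC [X in X <= _]mulrC.
  apply: (@geometric_cauchy _ (Num.sqrt B)); first exact: sqrtr_ge0.
  move=> k; rewrite distrC -(@ler_pXn2r _ 2)// ?nnegrE//.
  by rewrite real_normK ?num_real// exprMn sqr_sqrtr.
pose gam r := fine (limn_esup (fun k => (h k r)%:E)).
have mgam : measurable_fun Rpos gam.
  apply: measurableT_comp => //; apply: measurable_fun_limn_esup => k.
  exact/measurable_EFinP.
have cg : {ae mu, forall r, 0 < r -> h k r @[k --> \oo] --> gam r}.
  move: cv; apply: ae_imp => r hr r0; have {}hr := hr r0.
  have c1 : (h k r)%:E @[k --> \oo] --> (lim (h k r @[k --> \oo]))%:E.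
    by apply: cvg_EFin => //; exact: nearW.
  by rewrite /gam (cvg_limn_einf_sup c1).2.
have mD k : measurable_fun Rpos (fun r => (h k r - gam r) ^+ 2).
  by apply: measurable_funX; exact: measurable_funB.
have k0 := kappa2_gt0 R.
have FB k : (radial_int (fun r => (h k r - gam r) ^+ 2)%R <= (2 * kappa R * (C * 16^-1 ^+ k))%:E)%E.
  apply: (@fatou_bound _ (fun n r => (h k r - h (k + n)%N r) ^+ 2)) => //.
  - by move=> n; apply: measurable_funX; exact: measurable_funB.
  - by move=> *; exact: sqr_ge0.
  - by move=> *; exact: sqr_ge0.
  - move: cg; apply: ae_imp => r hr r0; rewrite expr2; under eq_fun do rewrite expr2.
    have c1 : h k r - h (k + n)%N r @[n --> \oo] --> h k r - gam r.
      apply: cvgB; first exact: cvg_cst.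
      have := hr r0; rewrite -(cvg_shiftn k); under eq_fun do rewrite addnC.
      by [].
    exact: cvgM.
  - move=> n; rewrite n2_radial; last exact: L2wB.
    by rewrite lee_fin ler_pM2l//; apply: hC; exact: leq_addr.
have LDg k : L2w (fun r => h k r - gam r).
  split; first exact: measurable_funB.
  have := le_lt_trans (FB k) (ltry _); rewrite /radial_int => fin.
  rewrite -[X in (X < _)%E]mul1e -(@mulVf _ (2 * kappa R)) ?gt_eqF// EFinM -muleA.
  by apply: lte_mul_pinfty => //; rewrite lee_fin invr_ge0 ltW.
exists gam; split => //.
  rewrite (_ : gam = fun r => h 0%N r - (h 0%N r - gam r)); first exact: L2wB.
  by apply/funext => r; ring.
by move=> k; have := FB k; rewrite n2_radial// lee_fin ler_pM2l.
Qed.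

Definition mid (c d : comps R * comps R) : comps R * comps R :=
  (fun s j r => 2^-1 * c.1 s j r + 2^-1 * d.1 s j r,
   fun s j r => 2^-1 * c.2 s j r + 2^-1 * d.2 s j r).

(* Midpoint closure replaces convexity: the parallelogram identity needs nothing
   more, and every midpoint-stable bound passes to the hull. *)
Definition hull (F G : nat -> comps R) n (c : comps R * comps R) : Prop :=
  forall S : comps R * comps R -> Prop, (forall k, (n <= k)%N -> S (F k, G k)) ->
    (forall a b, S a -> S b -> S (mid a b)) -> S c.

Lemma hull_gen F G n k : (n <= k)%N -> hull F G n (F k, G k).
Proof. by move=> nk S gen _; exact: gen. Qed.

Lemma hull_mid F G n a b : hull F G n a -> hull F G n b -> hull F G n (mid a b).
Proof. by move=> ha hb S gen cl; apply: (cl); [exact: ha|exact: hb]. Qed.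

Lemma hull_mono F G n k c : (n <= k)%N -> hull F G k c -> hull F G n c.
Proof. by move=> nk hc S gen cl; apply: hc => // i ki; apply: gen; exact: leq_trans ki. Qed.

Lemma state_mid m a b : state m a.1 a.2 -> state m b.1 b.2 -> state m (mid a b).1 (mid a b).2.
Proof.
move=> sa sb s j; have [L1 L2 L3 p1] := sa s j; have [M1 M2 M3 p2] := sb s j; split.
- by apply: L2wD; exact: L2wZ.
- rewrite (_ : (fun r => _) = (fun r => 2^-1 * (ang R m s / r * a.1 s j r) +
    2^-1 * (ang R m s / r * b.1 s j r))); first by apply: L2wD; exact: L2wZ.
  by apply/funext => r /=; ring.
- by apply: L2wD; exact: L2wZ.
- by move=> x y x0 xy; apply: primitive_onD => //; apply: primitive_onZ => //; [exact: p1|exact: p2].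
Qed.

Lemma sq2_mid (h k : comps R) r : sq2 (fun s j r => 2^-1 * h s j r + 2^-1 * k s j r) r +
  sq2 (fun s j r => 2^-1 * (h s j r - k s j r)) r = 2^-1 * sq2 h r + 2^-1 * sq2 k r.
Proof. by rewrite !sq2E; field. Qed.

Definition energy_form m nu (c : comps R * comps R) : R :=
  rint (sq2 (square_form m nu c.1 c.2)).

(** The parallelogram identity [sq2_mid] with the square of the difference dropped. *)
Lemma energy_form_mid m nu a b T : state m a.1 a.2 -> state m b.1 b.2 ->
  energy_form m nu a <= T -> energy_form m nu b <= T -> energy_form m nu (mid a b) <= T.
Proof.
move=> sa sb ha hb.
have [_ _ /(_ nu) ia] := state_rintegrable sa.
have [_ _ /(_ nu) ib] := state_rintegrable sb.
have [_ _ /(_ nu) im] := state_rintegrable (state_mid sa sb).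
apply: (@le_trans _ _ (2^-1 * energy_form m nu a + 2^-1 * energy_form m nu b)).
  rewrite /energy_form -!rintZ// -rintD; [|exact: rintegrableZ|exact: rintegrableZ].
  apply: le_rint => //; first by apply: rintegrableD; exact: rintegrableZ.
  move=> r _; rewrite -sq2_mid.
  rewrite (_ : square_form m nu (mid a b).1 (mid a b).2 = fun s j r =>
    2^-1 * square_form m nu a.1 a.2 s j r + 2^-1 * square_form m nu b.1 b.2 s j r).
    by rewrite lerDl sq2_ge0.
  by apply/funext => s; apply/funext => j; apply/funext => t; rewrite /square_form /mid; case: s => /=; ring.
move: ha hb; move: (energy_form m nu a) (energy_form m nu b) => x y hx hy; lra.
Qed.

(** * Strong convergence of midpoint combinations *)

Section mazur.
Variables (m : int) (F G : nat -> comps R) (phi : comps R) (A : R).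
Hypothesis st : forall n, state m (F n) (G n).
Hypothesis FA : forall n s j, n2 (F n s j) <= A.
Hypothesis LA : forall n s j, n2 (fun r => ang R m s / r * F n s j r) <= A.
Hypothesis GA : forall n s j, n2 (G n s j) <= A.
Hypothesis cv : forall s j r, 0 < r -> F n s j r @[n --> \oo] --> phi s j r.

Let P (c : comps R * comps R) : R := rint (sq2 c.2).

Lemma hull_state n c : hull F G n c -> state m c.1 c.2.
Proof.
move=> hc; apply: (hc (fun c => state m c.1 c.2)) => [k _|a b sa sb]; first exact: st.
exact: state_mid.
Qed.

Lemma state_P (c : comps R * comps R) : state m c.1 c.2 -> rintegrable (sq2 c.2).
Proof. by move=> sc; apply: sq2_rintegrable => s j; have [] := sc s j. Qed.

(** The infimum [d n] of the squared norm [P] of derivatives over the n-th hull increases to a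
    finite [D]. Near-minimizers from late hulls have midpoints whose [P] is nearly [D] too, so the
    parallelogram identity forces them together. *)
Lemma hull_cauchy : exists c : nat -> comps R * comps R,
  (forall k, hull F G k (c k)) /\
  forall k l s j, (k <= l)%N -> n2 (fun r => (c k).2 s j r - (c l).2 s j r) <=
    8 / (2 * kappa R) * 16^-1 ^+ k.
Proof.
have k0 := kappa2_gt0 R.
have P0 c : 0 <= P c by apply: rint_ge0 => r _; exact: sq2_ge0.
pose E n : set R := [set P c | c in hull F G n].
pose d n := inf (E n).
have En n : has_inf (E n).
  split; first by exists (P (F n, G n)); exists (F n, G n) => //; exact: hull_gen.
  by exists 0 => _ [c _ <-].
have d_le n c : hull F G n c -> d n <= P c.
  by move=> hc; apply: ge_inf; [exact: (En n).2|exists c].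
pose D := sup (range d).
have dub : has_ubound (range d).
  exists (2 * kappa R * (A + A + (A + A))) => _ [n _ <-].
  have hn : hull F G n (F n, G n) by exact: hull_gen.
  apply: le_trans (d_le n _ hn) _.
  have i s j : rintegrable (fun r => G n s j r ^+ 2) by apply: L2w_rintegrable; have [] := st n s j.
  rewrite /P (@eq_rint _ _ (fun r => G n true false r ^+ 2 + G n true true r ^+ 2 +
      (G n false false r ^+ 2 + G n false true r ^+ 2))); last by move=> r _; rewrite sq2E.
  rewrite rintD; [|exact: rintegrableD|exact: rintegrableD].
  by rewrite !rintD// /rint -!mulrDr ler_pM2l// !lerD//; exact: GA.
have hsD : has_sup (range d) by split => //; exists (d 0%N); exists 0%N.
have d_D n : d n <= D by apply: ub_le_sup => //; exists n.
have e0 k : 0 < (16^-1 : R) ^+ k by rewrite exprn_gt0// invr_gt0.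
have dmono n k : (n <= k)%N -> d n <= d k.
  move=> nk; apply: lb_le_inf; first exact: (En k).1.
  by move=> _ [c hc <-]; apply: d_le; exact: hull_mono hc.
have ex k : exists c n, [/\ (k <= n)%N, hull F G n c, P c < D + 16^-1 ^+ k & D - 16^-1 ^+ k < d n].
  have [_ [n0 _ <-] hn0] := sup_adherent (e0 k) hsD.
  pose n := maxn n0 k.
  have [_ [c hc <-] Pc] := inf_adherent (e0 k) (En n).
  exists c, n; split => //; first exact: leq_maxr.
    by apply: lt_le_trans Pc _; rewrite lerD2r; exact: d_D.
  by apply: lt_le_trans hn0 _; apply: dmono; exact: leq_maxl.
pose c k := sval (cid (ex k)).
have cP k : exists n, [/\ (k <= n)%N, hull F G n (c k), P (c k) < D + 16^-1 ^+ k &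
    D - 16^-1 ^+ k < d n] := svalP (cid (ex k)).
exists c; split.
  by move=> k; have [n [kn hc _ _]] := cP k; exact: hull_mono hc.
move=> k l s j kl.
have [n [kn hk Pk dk]] := cP k; have [p [lp hl Pl dl]] := cP l.
have e_le : (16^-1 : R) ^+ l <= 16^-1 ^+ k.
  by rewrite ler_wiXn2l// ?invr_ge0// invf_le1// ler1n.
(* Both elements belong to the earlier of the two hulls, where every [P] exceeds [D - 16^-1 ^+ k].
   The quarter of the squared difference is then at most twice [16^-1 ^+ k], hence the 8. *)
have hm : hull F G (minn n p) (mid (c k) (c l)).
  by apply: hull_mid; [apply: hull_mono hk; exact: geq_minl|apply: hull_mono hl; exact: geq_minr].
have Pm : D - 16^-1 ^+ k < P (mid (c k) (c l)).
  apply: lt_le_trans (d_le _ _ hm); rewrite /minn; case: ifP => _ //.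
  by apply: le_lt_trans dl; rewrite lerD2l lerN2.
have sk := hull_state hk; have sl := hull_state hl.
have ik := state_P sk; have il := state_P sl; have im := state_P (state_mid sk sl).
have Lkl s' j' : L2w (fun r => (c k).2 s' j' r - (c l).2 s' j' r).
  by apply: L2wB; [have [] := sk s' j'|have [] := sl s' j'].
pose df : comps R := fun s j r => 2^-1 * ((c k).2 s j r - (c l).2 s j r).
have idf : rintegrable (sq2 df) by apply: sq2_rintegrable => s' j'; exact: L2wZ.
have par : P (mid (c k) (c l)) + rint (sq2 df) = 2^-1 * P (c k) + 2^-1 * P (c l).
  rewrite /P -rintD// -!rintZ// -rintD; [|exact: rintegrableZ|exact: rintegrableZ].
  by apply: eq_rint => r _; rewrite -sq2_mid.
have small : rint (sq2 df) <= 2 * 16^-1 ^+ k.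
  move: par Pk Pl Pm e_le; move: (rint (sq2 df)) (P (mid _ _)) (P (c k)) (P (c l)) => x y z w.
  by move: (16^-1 ^+ k) (16^-1 ^+ l) => a b *; lra.
have := L2w_rintegrable (Lkl s j) => ikl.
have : rint (fun r => 4^-1 * ((c k).2 s j r - (c l).2 s j r) ^+ 2) <= rint (sq2 df).
  apply: le_rint => //; first exact: rintegrableZ.
  move=> r _; rewrite /sq2 (bigD1 (s, j))//= /df exprMn.
  rewrite (_ : 2^-1 ^+ 2 = 4^-1 :> R); last by field.
  by rewrite lerDl sumr_ge0// => i _; exact: sqr_ge0.
rewrite rintZ// => /le_trans/(_ small).
rewrite /rint -/(n2 _); move: (n2 _) => x h.
rewrite mulrAC ler_pdivlMr// mulrC.
by move: h; move: (2 * kappa R * x) (16^-1 ^+ k) => a b; lra.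
Qed.

(** Lying within [e] of [phi] at a given radius is stable under midpoints, so passing to hulls does
    not destroy pointwise convergence. *)
Lemma hull_cvg (c : nat -> comps R * comps R) : (forall k, hull F G k (c k)) ->
  forall s j r, 0 < r -> (c k).1 s j r @[k --> \oo] --> phi s j r.
Proof.
move=> hc s j r r0; apply/cvgrPdist_le => e e0.
have /cvgrPdist_le/(_ _ e0)[N _ hN] := @cv s j r r0.
exists N => // k /= Nk.
apply: (hull_mono Nk (hc k) (S := fun c => `|phi s j r - c.1 s j r| <= e)).
  by move=> i Ni; exact: hN.
move=> a b ha hb /=.
rewrite (_ : _ - _ = 2^-1 * (phi s j r - a.1 s j r) + 2^-1 * (phi s j r - b.1 s j r)); last by field.
apply: le_trans (ler_normD _ _) _; rewrite !normrM ger0_norm ?invr_ge0//.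
by move: ha hb; move: `|_| `|_| => x y; lra.
Qed.

(** The derivatives [G n] have no strong limit of their own, but hull elements do. Upper bounds on
    the energy form are stable under midpoints and pass to the limit by Fatou, which gives weak
    lower semicontinuity of Q. *)
Lemma mazur_limit : exists gam : comps R, state m phi gam /\
  forall nu T, (forall e, 0 < e -> \forall n \near \oo, energy_form m nu (F n, G n) <= T + e) ->
    energy_form m nu (phi, gam) <= T.
Proof.
have [c [hc cauchy]] := hull_cauchy.
have sc k := hull_state (hc k).
have cphi := hull_cvg hc.
have k0 := kappa2_gt0 R.
have ex s j : exists g : R -> R, [/\ L2w g,
    {ae mu, forall r, 0 < r -> (c k).2 s j r @[k --> \oo] --> g r} &
    forall k, n2 (fun r => (c k).2 s j r - g r) <= 8 / (2 * kappa R) * 16^-1 ^+ k].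
  apply: L2_cauchy_limit; first by move=> k; have [] := sc k s j.
  by move=> k l kl; exact: cauchy.
pose gam s j := sval (cid (ex s j)).
have gamP s j := svalP (cid (ex s j)); rewrite -/(gam _ _) in gamP.
have prim s j : primitive0 (phi s j) (gam s j).
  move=> a b a0 ab; have [Lg _ n2g] := gamP s j.
  have [ig _] := L2w_integrable b Lg a0; split => // x y ax xy yb.
  have x0 : 0 < x by exact: lt_le_trans ax.
  have y0 : 0 < y by exact: lt_le_trans xy.
  (* The same integrals are increments converging to those of [phi], and by [cauchy_schwarz_log]
     they converge to the integral of [gam]; equating the limits makes [gam] the derivative of
     [phi]. *)
  have c1 : \int[mu]_(t in `[x, y]) (c k).2 s j t @[k --> \oo] --> phi s j y - phi s j x.
    have E k : \int[mu]_(t in `[x, y]) (c k).2 s j t = (c k).1 s j y - (c k).1 s j x.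
      by have [_ _ _ p] := sc k s j; have [_ ->] := p a b a0 ab.
    by under eq_fun do rewrite E; apply: cvgB; exact: cphi.
  have [igx _] := L2w_integrable y Lg x0.
  have c2 : \int[mu]_(t in `[x, y]) (c k).2 s j t @[k --> \oo] --> \int[mu]_(t in `[x, y]) gam s j t.
    apply/cvgrPdist_le => e e0.
    pose K := (ln y - ln x) * (8 / (2 * kappa R)).
    have K0 : 0 <= K by rewrite mulr_ge0 ?subr_ge0 ?ler_ln ?posrE// divr_ge0// ltW.
    have c0 : K * 16^-1 ^+ k @[k --> \oo] --> (0 : R).
      rewrite -[X in _ --> X](mulr0 K); apply: cvgM; first exact: cvg_cst.
      by apply: cvg_expr; rewrite gtr0_norm ?invr_gt0// invf_lt1// ltr1n.
    have e2 : 0 < e ^+ 2 by rewrite exprn_gt0.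
    move/cvgrPdist_le/(_ _ e2): c0; apply: filterS => k; rewrite sub0r normrN => hk.
    have Lc : L2w ((c k).2 s j) by have [] := sc k s j.
    have [ic _] := L2w_integrable y Lc x0.
    rewrite distrC -RintegralB//.
    have := cauchy_schwarz_log (L2wB Lc Lg) x0 xy.
    have l0 : 0 <= ln y - ln x by rewrite subr_ge0 ler_ln ?posrE.
    move=> /le_trans/(_ (ler_wpM2l l0 (n2g k))); rewrite mulrA -/K.
    move=> /le_trans/(_ (ler_norm _))/le_trans/(_ hk) h.
    by rewrite -(@ler_pXn2r _ 2)// ?nnegrE ?(ltW e0)// real_normK ?num_real.
  exact: (cvg_unique _ c1 c2).
have mphi s j : measurable_fun Rpos (phi s j) by exact: primitive0_measurable (prim s j).
have minv : measurable_fun Rpos (fun r : R => r^-1).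
  apply: open_continuous_measurable_fun; first exact: interval_open.
  move=> x; rewrite inE/= in_itv/= andbT => x0.
  by apply: cvgV; [rewrite gt_eqF|exact: cvg_id].
have sqc (h_ : nat -> R -> R) (h : R -> R) : (forall n, L2w (h_ n)) -> measurable_fun Rpos h ->
    (forall r, 0 < r -> h_ n r @[n --> \oo] --> h r) -> (forall n, n2 (h_ n) <= A) -> L2w h.
  move=> Lh mh ch hA; split => //.
  have : (radial_int (fun r => h r ^+ 2)%R <= (2 * kappa R * A)%:E)%E.
    apply: (@fatou_bound _ (fun n r => h_ n r ^+ 2)) => //.
    - by move=> n; have [mn _] := Lh n; exact: measurable_funX.
    - exact: measurable_funX.
    - by move=> *; exact: sqr_ge0.
    - by move=> *; exact: sqr_ge0.
    - apply: aeW => r r0; rewrite expr2; under eq_fun do rewrite expr2.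
      by apply: cvgM; exact: ch.
    - by move=> n; rewrite n2_radial// lee_fin ler_pM2l.
  move=> /le_lt_trans/(_ (ltry _)); rewrite /radial_int => fin.
  rewrite -[X in (X < _)%E]mul1e -(@mulVf _ (2 * kappa R)) ?gt_eqF// EFinM -muleA.
  by apply: lte_mul_pinfty => //; rewrite lee_fin invr_ge0 ltW.
have stp : state m phi gam.
  move=> s j; have [Lg _ _] := gamP s j; split => //.
    apply: (sqc (fun n => F n s j)) => //; first by move=> n; have [] := st n s j.
    by move=> r; exact: cv.
  apply: (sqc (fun n r => ang R m s / r * F n s j r)) => //.
  - by move=> n; have [] := st n s j.
  - by apply: measurable_funM => //; apply: measurable_funM.
  - by move=> r r0; apply: cvgM; [exact: cvg_cst|exact: cv].
exists gam; split => // nu T hT.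
have [_ _ /(_ nu) ip] := state_rintegrable stp.
apply/ler_addgt0Pr => e e0.
have [N _ hN] := hT e e0.
rewrite -lee_fin -radial_intE//.
have msq (h : comps R) : (forall s j, L2w (h s j)) -> measurable_fun Rpos (sq2 h).
  by move=> Lh; exact: (L2w_sum (fun i : bool * bool => Lh i.1 i.2)).2.
(* The shift by [N] places every term in the [N]-th hull, all of whose generators satisfy the bound
   [T + e]. *)
apply: (@fatou_bound _ (fun n => sq2 (square_form m nu (c (n + N)%N).1 (c (n + N)%N).2))).
- by move=> n; apply: msq => s j; exact: L2w_square_form.
- by apply: msq => s j; exact: L2w_square_form.
- by move=> *; exact: sq2_ge0.
- by move=> *; exact: sq2_ge0.
- have aeg : {ae mu, forall r, 0 < r -> forall s j, (c k).2 s j r @[k --> \oo] --> gam s j r}.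
    have [_ g1 _] := gamP true true; have [_ g2 _] := gamP true false.
    have [_ g3 _] := gamP false true; have [_ g4 _] := gamP false false.
    have h1 : {ae mu, forall r, 0 < r -> forall j, (c k).2 true j r @[k --> \oo] --> gam true j r}.
      by move: g1 g2; apply: ae_imp2 => r h1 h2 r0 []; [exact: h1|exact: h2].
    have h2 : {ae mu, forall r, 0 < r -> forall j, (c k).2 false j r @[k --> \oo] --> gam false j r}.
      by move: g3 g4; apply: ae_imp2 => r h2 h3 r0 []; [exact: h2|exact: h3].
    by move: h1 h2; apply: ae_imp2 => r h1 h2 r0 []; [exact: h1|exact: h2].
  move: aeg; apply: ae_imp => r hg r0.
  have {}hg := hg r0.
  have cs s j : square_form m nu (c k).1 (c k).2 s j r @[k --> \oo] --> square_form m nu phi gam s j r.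
    rewrite /square_form; case: s.
      by apply: cvgB; [apply: cvgB; [exact: hg|apply: cvgM; [exact: cvg_cst|exact: cphi]]|
        apply: cvgM; [exact: cvg_cst|exact: cphi]].
    by apply: cvgD; [apply: cvgD; [exact: hg|apply: cvgM; [exact: cvg_cst|exact: cphi]]|
        apply: cvgM; [exact: cvg_cst|exact: cphi]].
  have := cvg_shiftn N (fun k => sq2 (square_form m nu (c k).1 (c k).2) r) => sh.
  rewrite sh; under eq_fun do rewrite sq2E; rewrite sq2E.
  have cs2 s j : square_form m nu (c k).1 (c k).2 s j r ^+ 2 @[k --> \oo] --> square_form m nu phi gam s j r ^+ 2.
    by rewrite expr2; under eq_fun do rewrite expr2; apply: cvgM; exact: cs.
  by apply: cvgD; apply: cvgD; exact: cs2.
- move=> n; have [_ _ /(_ nu) ic] := state_rintegrable (sc (n + N)%N).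
  rewrite radial_intE// lee_fin.
  have hNn : hull F G N (c (n + N)%N) by apply: hull_mono (hc _); exact: leq_addl.
  have : state m (c (n + N)%N).1 (c (n + N)%N).2 /\ energy_form m nu (c (n + N)%N) <= T + e.
    apply: (hNn (fun c => state m c.1 c.2 /\ energy_form m nu c <= T + e)).
      by move=> k Nk; split; [exact: st|exact: hN].
    by move=> a b [sa ha] [sb hb]; split; [exact: state_mid|exact: energy_form_mid].
  by case.
Qed.

End mazur.

End weak_limits.

(** * Bessel modes and negativity of the infimum *)

Section bessel.
Variable R : realType.
Local Notation mu := (@lebesgue_measure R).
Local Notation Rpos := (`]0, +oo[%classic : set R).

Lemma cvg_pseries_exp (d : nat -> R) (C q x : R) : 0 <= q ->
  (forall k, `|d k| <= C * (q ^+ k / k`!%:R)) -> cvgn (pseries d x).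
Proof.
move=> q0 dC.
have e0 k : 0 <= q ^+ k / k`!%:R by rewrite divr_ge0// exprn_ge0.
have C0 : 0 <= C by have := dC 0%N; rewrite expr0 divr1 mulr1; apply: le_trans.
apply: normed_cvg; rewrite /normed_series_of /=.
apply: (@series_le_cvg _ _ (fun k => C * exp_coeff (q * `|x|) k)).
- by move=> k.
- by move=> k; rewrite /exp_coeff /= mulr_ge0// divr_ge0// exprn_ge0// mulr_ge0.
- move=> k; rewrite /exp_coeff /= normrM normrX exprMn mulrAC mulrA mulrA.
  rewrite ler_wpM2r ?exprn_ge0// -mulrA; exact: dC.
- by apply: is_cvg_seriesZ; exact: is_cvg_series_exp_coeff.
Qed.

Variables (q : R) (m : nat).
Hypothesis q0 : 0 <= q.

(** Coefficients of the j-th derivative of the series with terms (-q)^k s^k / (k! (k+m)!), so that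
    differentiation just raises j. With q = nu^2 / 4 and s = r^2, the case j = 0 times r^m is J_m(nu
    r) up to a constant factor. *)
Definition bcoef j k : R := (- q) ^+ (k + j) / (k`! * (k + j + m)`!)%:R.

Definition bessel j (s : R) : R := limn (pseries (bcoef j) s).

Lemma bcoef_diffs j : pseries_diffs (bcoef j) = bcoef j.+1.
Proof.
apply/funext => k; rewrite /pseries_diffs /bcoef addnS !addSn factS -mulnA natrM.
by rewrite invfM mulrCA mulVKf// pnatr_eq0.
Qed.

Lemma cvg_bessel j s : cvgn (pseries (bcoef j) s).
Proof.
apply: (@cvg_pseries_exp _ (q ^+ j) q) => // k.
rewrite /bcoef normrM normrX normrN (ger0_norm q0).
rewrite [leRHS](_ : _ = q ^+ (k + j) / k`!%:R); last by rewrite exprD mulrAC mulrC.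
rewrite ler_wpM2l ?exprn_ge0//.
rewrite ger0_norm ?invr_ge0// lef_pV2 ?posrE ?ltr0n ?muln_gt0 ?fact_gt0//.
by rewrite ler_nat leq_pmulr// fact_gt0.
Qed.

Lemma is_derive_bessel j s : is_derive s (1 : R) (bessel j) (bessel j.+1 s).
Proof.
rewrite /bessel -bcoef_diffs; apply: (@pseries_snd_diffs _ _ (`|s| + 1)).
- exact: cvg_bessel.
- by rewrite bcoef_diffs; exact: cvg_bessel.
- by rewrite !bcoef_diffs; exact: cvg_bessel.
- by rewrite [ltRHS]ger0_norm ?ltrDl// addr_ge0.
Qed.

Lemma continuous_bessel j : continuous (bessel j).
Proof.
move=> s; have [d _] := is_derive_bessel j s.
exact/differentiable_continuous/derivable1_diffP.
Qed.

Lemma bessel0 : bessel 0 0 = m`!%:R^-1.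
Proof.
suff c : pseries (bcoef 0) 0 n @[n --> \oo] --> (m`!%:R^-1 : R) by exact: cvg_lim c.
rewrite -cvg_shiftS; apply: cvg_near_cst; apply: nearW => n.
rewrite /pseries /series /= big_nat_recl// big1 ?addr0.
  by rewrite /bcoef !addn0 add0n !expr0 mulr1 mul1n mul1r.
by move=> i _; rewrite expr0n mulr0.
Qed.

Lemma bessel_ode s : s * bessel 2 s + m.+1%:R * bessel 1 s + q * bessel 0 s = 0.
Proof.
have rec k : (k.+1)%:R * (k.+1 + m)%:R * bcoef 0 k.+1 + q * bcoef 0 k = 0.
  rewrite /bcoef !addn0 addSn !factS exprS !natrM.
  have n0 n : n.+1%:R != 0 :> R by rewrite pnatr_eq0.
  have f0 n : n`!%:R != 0 :> R by rewrite pnatr_eq0 -lt0n fact_gt0.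
  have := n0 k; have := n0 (k + m)%N; have := f0 k; have := f0 (k + m)%N.
  move: (k.+1%:R : R) ((k + m).+1%:R : R) (k`!%:R : R) ((k + m)`!%:R : R) => a b c d d0 c0 b0 a0.
  by field; rewrite a0 b0 c0 d0.
have b1 k : bcoef 1 k = k.+1%:R * bcoef 0 k.+1 by rewrite -bcoef_diffs.
have b2 k : bcoef 2 k = k.+1%:R * (k.+2%:R * bcoef 0 k.+2) by rewrite -!bcoef_diffs.
(* The partial sums satisfy the equation without remainder: the factor [s] raises the degree by one,
   so the second-derivative series is cut one term earlier. *)
have part n : s * pseries (bcoef 2) s n + m.+1%:R * pseries (bcoef 1) s n.+1 +
    q * pseries (bcoef 0) s n.+1 = 0.
  elim: n => [|n IH].
    rewrite /pseries /series /= !big_nat1 big_geq// expr0 !mulr1 mulr0 add0r.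
    by have := rec 0%N; rewrite b1 add1n mul1r mul1r.
  have S (u : nat -> R) k : series u k.+1 = series u k + u k by rewrite /series/= big_nat_recr.
  rewrite /pseries in IH *; rewrite [series _ n.+1]S [series _ n.+2]S [X in q * X]S.
  have := rec n.+1; rewrite /= b1 b2 exprS natrD -!natr1; move: IH; rewrite -!natr1.
  move: (series _ _) (series _ _) (series _ _) => x y z IH e.
  apply/eqP; rewrite -[X in _ == X]IH -subr_eq0; apply/eqP.
  rewrite -[RHS](mulr0 (s * s ^+ n)) -e; ring.
have c j : pseries (bcoef j) s n.+1 @[n --> \oo] --> bessel j s.
  by rewrite cvg_shiftS; exact: cvg_bessel.
have c1 : s * pseries (bcoef 2) s n + m.+1%:R * pseries (bcoef 1) s n.+1 +
    q * pseries (bcoef 0) s n.+1 @[n --> \oo] -->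
    s * bessel 2 s + m.+1%:R * bessel 1 s + q * bessel 0 s.
  apply: cvgD; first apply: cvgD.
  - by apply: cvgM; [exact: cvg_cst|exact: cvg_bessel].
  - by apply: cvgM; [exact: cvg_cst|exact: c].
  - by apply: cvgM; [exact: cvg_cst|exact: c].
have c2 : s * pseries (bcoef 2) s n + m.+1%:R * pseries (bcoef 1) s n.+1 +
    q * pseries (bcoef 0) s n.+1 @[n --> \oo] --> (0 : R).
  by under eq_fun do rewrite part; exact: cvg_cst.
exact: (cvg_unique _ c1 c2).
Qed.

End bessel.

(** * Zero modes of Q and their size at infinity *)

Section zero_modes.
Variable R : realType.

(* The first-order system expressing that square_form vanishes. *)
Definition zero_mode (m : int) (nu : R) (vp vm : R -> R) : Prop := forall r : R, 0 < r ->
  is_derive r (1 : R) vp (m%:~R / r * vp r + nu * vm r) /\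
  is_derive r (1 : R) vm (- ((m + 1)%:~R / r * vm r) - nu * vp r).

Lemma nondecreasing_Rpos (f df : R -> R) (a b : R) : 0 < a -> a <= b ->
  (forall x, a <= x -> is_derive x (1 : R) f (df x)) -> (forall x, a <= x -> 0 <= df x) ->
  f a <= f b.
Proof.
move=> a0 ab Df df0.
have [x|x|c cab E] := @MVT_segment _ f df a b ab.
- by rewrite in_itv/= => /andP[/ltW ax _]; exact: Df.
- apply: continuous_in_subspaceT => y; rewrite inE/= in_itv/= => /andP[ay _].
  by have [d _] := Df _ ay; exact/differentiable_continuous/derivable1_diffP.
- move: cab; rewrite in_itv/= => /andP[ac _].
  by rewrite -subr_ge0 E mulr_ge0// ?subr_ge0// df0.
Qed.

(** The symmetry m -> -m - 1 exchanging the two components; it reduces negative m to natural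
    numbers. *)
Lemma zero_mode_swap m nu vp vm : zero_mode m nu vp vm ->
  zero_mode (- m - 1) nu vm (fun r => - vp r).
Proof.
move=> zm r r0; have [dp dm] := zm r r0; split.
  by apply: is_derive_eq dm _; rewrite !intrD !intrN; ring.
apply: is_derive_eq (is_deriveN dp) _.
by rewrite subrK intrN; ring.
Qed.

Section growth.
Variables (m : nat) (nu : R) (vp vm : R -> R).
Hypothesis nu0 : 0 < nu.
Hypothesis zm : zero_mode m nu vp vm.

Let k : R := (m.*2.+1)%:R.
Let P (r : R) : R := r * (vp r ^+ 2 + vm r ^+ 2).

Let k0 : 0 < k. Proof. by rewrite ltr0n. Qed.
Let kE : k = 2 * m%:R + 1. Proof. by rewrite /k -natr1 -mul2n natrM. Qed.

Lemma zero_mode_deriveP (r : R) : 0 < r -> is_derive r (1 : R) P (k * (vp r ^+ 2 - vm r ^+ 2)).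
Proof.
move=> r0; have [dp dm] := zm r0.
have D := is_deriveM (is_derive_id r (1 : R)) (is_deriveD (is_deriveX 2 dp) (is_deriveX 2 dm)).
apply: is_derive_eq D _; rewrite !fctE /GRing.scale /= kE intrD -pmulrn mulr1z.
by have rn : r != 0 by [rewrite gt_eqF]; field.
Qed.

(** Multiplying [P] by [r ^+ k] cancels the negative part of its derivative, so positivity
    propagates outwards from a radius near 0 where [vp] does not vanish. *)
Lemma zero_mode_P_gt0 : (forall e : R, 0 < e -> exists2 r, 0 < r < e & vp r != 0) ->
  forall r : R, 0 < r -> 0 < P r.
Proof.
move=> near0 r r0; have [e /andP[e0 er] ve] := near0 r r0.
have : e ^+ m.*2.+1 * P e <= r ^+ m.*2.+1 * P r.
  apply: (@nondecreasing_Rpos (fun x => x ^+ m.*2.+1 * P x)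
      (fun x => 2 * k * x ^+ m.*2.+1 * vp x ^+ 2)) => //; first exact: ltW.
    move=> x ex; have x0 : 0 < x by exact: lt_le_trans ex.
    have D := is_deriveM (is_deriveX m.*2.+1 (is_derive_id x (1 : R))) (zero_mode_deriveP x0).
    rewrite (_ : (fun y => _) = ((@id R) ^+ m.*2.+1 * P)); last first.
      by apply/funext => y; rewrite mulrfctE exprfctE.
    apply: is_derive_eq D _; rewrite exprfctE /GRing.scale /= -/k /P exprS.
    by ring.
  move=> x ex; have x0 : 0 < x by exact: lt_le_trans ex.
  by rewrite mulr_ge0 ?sqr_ge0// mulr_ge0 ?exprn_ge0 ?ltW// mulr_gt0.
have Pe : 0 < P e.
  by rewrite /P mulr_gt0// ltr_wpDr ?sqr_ge0// lt_def sqr_ge0 sqrf_eq0 ve.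
move=> h; have : 0 < r ^+ m.*2.+1 * P r by apply: lt_le_trans h; rewrite mulr_gt0// exprn_gt0.
by rewrite pmulr_rgt0// exprn_gt0.
Qed.

Let K : R := k / nu.
Let G (r : R) : R := P r + K * (vp r * vm r).
Let K0 : 0 < K. Proof. by rewrite divr_gt0. Qed.

(* P is conserved only to order 1 / r; adding K * (vp * vm) cancels the oscillating
   term of P' and leaves a derivative of size G / r ^+ 2, which is integrable. *)
Lemma zero_mode_deriveG (r : R) : 0 < r -> is_derive r (1 : R) G (- (K * (vp r * vm r) / r)).
Proof.
move=> r0; have [dp dm] := zm r0.
have D := is_deriveD (zero_mode_deriveP r0) (is_deriveZ K (is_deriveM dp dm)).
apply: is_derive_eq D _; rewrite /GRing.scale /= intrD -pmulrn mulr1z /K kE.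
have rn : r != 0 by rewrite gt_eqF.
by have nn : nu != 0 by [rewrite gt_eqF]; field; rewrite rn nn.
Qed.

(** By |a b| <= (a^2 + b^2) / 2 the correction in [G] is at most half of [P] as soon as r >= K, so
    that [G] and [P] are comparable and [G] controls its own derivative. *)
Lemma zero_mode_PG (r : R) : K <= r -> P r / 2 <= G r /\ G r <= 3 / 2 * P r /\
  `|K * (vp r * vm r) / r| <= K * G r / r ^+ 2.
Proof.
move=> Kr; have r0 : 0 < r by exact: lt_le_trans Kr.
have cross : `|K * (vp r * vm r)| <= K * ((vp r ^+ 2 + vm r ^+ 2) / 2).
  rewrite normrM (gtr0_norm K0) ler_pM2l// ler_norml.
  have := sqr_ge0 (vp r - vm r); have := sqr_ge0 (vp r + vm r).
  by rewrite !expr2 => h1 h2; apply/andP; split; nra.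
have s0 : 0 <= (vp r ^+ 2 + vm r ^+ 2) / 2 by rewrite divr_ge0// addr_ge0 ?sqr_ge0.
have hP : `|K * (vp r * vm r)| <= P r / 2.
  by apply: le_trans cross _; rewrite /P -mulrA ler_wpM2r.
have PG : P r / 2 <= G r.
  by move: hP; rewrite /G ler_norml => /andP[h1 h2]; lra.
split => //; split.
  by move: hP; rewrite /G ler_norml => /andP[h1 h2]; lra.
rewrite normrM normfV (gtr0_norm r0) ler_pdivrMr//; apply: le_trans cross _.
rewrite (_ : _ / _ * r = K * (G r / r)); last by have rn : r != 0 by [rewrite gt_eqF]; field.
rewrite ler_pM2l// ler_pdivlMr//; apply: le_trans PG.
by rewrite /P le_eqVlt; apply/orP; left; apply/eqP; ring.
Qed.

Lemma zero_mode_growth : (forall e : R, 0 < e -> exists2 r, 0 < r < e & vp r != 0) ->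
  exists c C r0 : R, [/\ 0 < c, 0 < r0 & forall r : R, r0 <= r ->
    c / r <= vp r ^+ 2 + vm r ^+ 2 <= C / r].
Proof.
move=> near0; have Pgt0 := zero_mode_P_gt0 near0.
have [PGK _] := zero_mode_PG (lexx K).
have GK : 0 < G K by apply: lt_le_trans PGK; rewrite divr_gt0// Pgt0.
(* Gronwall with the integrating factor exp(s K / r): the product is nondecreasing for s = -1 and
   nonincreasing for s = 1, which traps [G] between two positive constants. *)
pose W (s r : R) := G r * expR (s * K / r).
have DW (s r : R) : 0 < r -> is_derive r (1 : R) (W s)
    (expR (s * K / r) * (- (K * (vp r * vm r) / r) - s * (K * G r / r ^+ 2))).
  move=> r0; have rn : r != 0 by rewrite gt_eqF.
  have D1 := is_deriveZ (s * K) (is_deriveV rn (is_derive_id r (1 : R))).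
  have D2 := @is_derive1_comp _ expR (fun r => s * K / r) r _ _ (is_derive_expR _) D1.
  apply: is_derive_eq (is_deriveM (zero_mode_deriveG r0) D2) _.
  by rewrite /GRing.scale /=; field.
have lo (r : R) : K <= r -> G K * expR (- 1) <= G r.
  move=> Kr; have r0 : 0 < r by exact: lt_le_trans Kr.
  have : W (-1) K <= W (-1) r.
    apply: (nondecreasing_Rpos K0 Kr) => x Kx; first by apply: DW; exact: lt_le_trans Kx.
    rewrite mulr_ge0 ?expR_ge0//.
    have [_ [_]] := zero_mode_PG Kx; rewrite ler_norml => /andP[_ h].
    by rewrite mulN1r opprK; lra.
  rewrite /W -mulrA divff ?gt_eqF// mulr1 => h; apply: le_trans h _.
  have [h _] := zero_mode_PG Kr.
  have Gr : 0 < G r by apply: lt_le_trans h; rewrite divr_gt0// Pgt0.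
  rewrite ler_piMr ?(ltW Gr)// -[leRHS]expR0 ler_expR mulN1r mulNr oppr_le0.
  by rewrite divr_ge0// ltW.
have hi (r : R) : K <= r -> G r <= G K * expR 1.
  move=> Kr; have r0 : 0 < r by exact: lt_le_trans Kr.
  have : - W 1 K <= - W 1 r.
    apply: (@nondecreasing_Rpos (fun x => - W 1 x) (fun r => - (expR (1 * K / r) *
      (- (K * (vp r * vm r) / r) - 1 * (K * G r / r ^+ 2)))) _ _ K0 Kr) => x Kx.
      by apply: is_deriveN; apply: DW; exact: lt_le_trans Kx.
    rewrite -mulrN mulr_ge0 ?expR_ge0//.
    have [_ [_]] := zero_mode_PG Kx; rewrite ler_norml => /andP[h _].
    by rewrite mul1r; lra.
  rewrite lerN2 /W mul1r divff ?gt_eqF// => h; apply: le_trans h.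
  have [h _] := zero_mode_PG Kr.
  have Gr : 0 < G r by apply: lt_le_trans h; rewrite divr_gt0// Pgt0.
  rewrite ler_peMr ?(ltW Gr)// -[leLHS]expR0 ler_expR.
  by rewrite divr_ge0// ltW.
exists (2 / 3 * (G K * expR (-1))), (2 * (G K * expR 1)), K; split => //.
  by rewrite !mulr_gt0 ?expR_gt0.
move=> r Kr; have r0 : 0 < r by exact: lt_le_trans Kr.
have [h1 [h2 _]] := zero_mode_PG Kr.
rewrite ler_pdivrMr// ler_pdivlMr// [_ * r]mulrC -/(P r).
move: h1 h2 (lo _ Kr) (hi _ Kr); move: (P r) (G r) (_ * expR (-1)) (_ * expR 1) => x y z w.
by move=> *; apply/andP; split; lra.
Qed.

End growth.

Lemma continuous_bounded (h : R -> R) (a b : R) : a <= b -> continuous h ->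
  exists2 C, 0 <= C & forall r, a <= r <= b -> `|h r| <= C.
Proof.
move=> ab ch.
have ca : continuous (fun r => `|h r|).
  by move=> r; apply: (@continuous_comp _ _ _ h (fun y => `|y|)); [exact: ch|exact: norm_continuous].
have [c _ hc] := EVT_max ab (continuous_subspaceT ca).
by exists `|h c| => // r rab; apply: hc; rewrite in_itv.
Qed.

(* Up to a common factor the modes are J_m (nu r) and J_(m+1) (nu r). *)
Section bessel_mode.
Variables (m : nat) (nu : R).
Hypothesis nu0 : 0 < nu.
Let q : R := nu ^+ 2 / 4.
Let q0 : 0 <= q. Proof. by rewrite divr_ge0// sqr_ge0. Qed.
Let vp (r : R) : R := r ^+ m * bessel q m 0 (r ^+ 2).
Let vm (r : R) : R := 2 / nu * (r ^+ m.+1 * bessel q m 1 (r ^+ 2)).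

Lemma is_derive_pow_bessel (n j : nat) (r : R) : 0 < r ->
  is_derive r (1 : R) (fun r => r ^+ n * bessel q m j (r ^+ 2))
    (r ^+ n * (n%:R / r * bessel q m j (r ^+ 2) + 2 * r * bessel q m j.+1 (r ^+ 2))).
Proof.
move=> r0; have rn : r != 0 by rewrite gt_eqF.
have D1 := @is_derive1_comp _ (bessel q m j) (fun r => r ^+ 2) r _ _
  (is_derive_bessel m q0 j (r ^+ 2)) (is_deriveX 2 (is_derive_id r (1 : R))).
have D := is_deriveM (is_deriveX n (is_derive_id r (1 : R))) D1.
rewrite (_ : (fun r => _) = (@id R) ^+ n * (bessel q m j \o (fun r => r ^+ 2))); last first.
  by apply/funext => y; rewrite mulrfctE exprfctE.
apply: is_derive_eq D _; rewrite exprfctE /GRing.scale /=.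
by case: n => [|n]; rewrite ?exprS; field.
Qed.

Lemma bessel_zero_mode : zero_mode m nu vp vm.
Proof.
move=> r r0; have rn : r != 0 by rewrite gt_eqF.
have nn : nu != 0 by rewrite gt_eqF.
split; first by apply: is_derive_eq (is_derive_pow_bessel m 0 r0) _;
  rewrite /vp /vm -pmulrn [r ^+ m.+1]exprS; field; rewrite nn rn.
apply: is_derive_eq (is_deriveZ (2 / nu) (is_derive_pow_bessel m.+1 1 r0)) _.
have := bessel_ode m q0 (r ^+ 2); rewrite /vp /vm intrD -pmulrn mulr1z -natr1 /GRing.scale /= [r ^+ m.+1]exprS /q.
move: (bessel _ m 0 _) (bessel _ m 1 _) (bessel _ m 2 _) => x y z e.
have -> : z = - ((m%:R + 1) * y + nu ^+ 2 / 4 * x) / r ^+ 2.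
  apply: (mulfI (_ : r ^+ 2 != 0)); first by rewrite sqrf_eq0.
  by rewrite mulrCA divff ?sqrf_eq0// mulr1; apply/eqP; rewrite -addr_eq0 addrA e.
by field; rewrite nn rn.
Qed.

Lemma bessel_mode_neq0 e : 0 < e -> exists2 r, 0 < r < e & vp r != 0.
Proof.
move=> e0.
have c : (bessel q m 0 \o (fun r => r ^+ 2)) r @[r --> (0 : R)] --> (m`!%:R^-1 : R).
  have <- : bessel q m 0 (0 ^+ 2) = m`!%:R^-1 by rewrite expr0n bessel0.
  apply: (@continuous_comp _ _ _ (fun r : R => r ^+ 2) (bessel q m 0) 0); first exact: exprn_continuous.
  exact: continuous_bessel.
have m0 : 0 < (m`!%:R^-1 : R) by rewrite invr_gt0 ltr0n fact_gt0.
have /cvgrPdist_lt/(_ _ m0)/nbhs_ballP[d /= d0 hd] := c.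
pose r := Num.min d e / 2.
have r0 : 0 < r by rewrite divr_gt0// lt_min d0 e0.
have rmin : r < Num.min d e by rewrite /r ltr_pdivrMr// ltr_pMr ?ltr1n// lt_min d0 e0.
have [rd re] : r < d /\ r < e by move: rmin; rewrite lt_min => /andP[].
exists r; first by rewrite r0.
rewrite mulf_neq0 ?expf_neq0 ?gt_eqF//.
have := hd r; rewrite /ball /= sub0r normrN gtr0_norm// => /(_ rd).
by rewrite ltr_norml => /andP[_]; rewrite ltrBlDr ltrDl.
Qed.

End bessel_mode.

(** Continuity bounds the modes on []0, r0]] and [zero_mode_growth] bounds them beyond. The form
    [C / r] is used at all radii because it is integrable against r dr on bounded intervals. *)
Lemma zero_mode_exists (m : int) (nu : R) : 0 < nu ->
  exists vp vm (c C r0 : R), [/\ zero_mode m nu vp vm, 0 < c, 0 < C, 0 < r0 &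
    forall r, 0 < r -> [/\ vp r ^+ 2 + vm r ^+ 2 <= C / r,
      (m%:~R / r * vp r) ^+ 2 <= C / r, ((m + 1)%:~R / r * vm r) ^+ 2 <= C / r &
      r0 <= r -> c / r <= vp r ^+ 2 + vm r ^+ 2]].
Proof.
move=> nu0.
have nat_case (n : nat) : exists vp vm (c C r0 : R), [/\ zero_mode n nu vp vm, 0 < c, 0 < C, 0 < r0 &
    forall r, 0 < r -> [/\ vp r ^+ 2 + vm r ^+ 2 <= C / r,
      (n%:R / r * vp r) ^+ 2 <= C / r, (n.+1%:R / r * vm r) ^+ 2 <= C / r &
      r0 <= r -> c / r <= vp r ^+ 2 + vm r ^+ 2]].
  have zm := bessel_zero_mode n nu0.
  have [c [C [r0 [c0 r00 hcC]]]] := zero_mode_growth nu0 zm (bessel_mode_neq0 n nu).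
  have q0 : 0 <= nu ^+ 2 / 4 by rewrite divr_ge0// sqr_ge0.
  move: zm hcC; set vp := (fun r => _); set vm := (fun r => _) => zm hcC.
  have cB j : continuous (fun r : R => bessel (nu ^+ 2 / 4) n j (r ^+ 2)).
    move=> r; apply: (@continuous_comp _ _ _ (fun r : R => r ^+ 2)); first exact: exprn_continuous.
    exact: continuous_bessel.
  have cX i : continuous (fun r : R => r ^+ i) by move=> r; exact: exprn_continuous.
  have cW (f g : R -> R) : continuous f -> continuous g -> continuous (fun r => f r * g r).
    by move=> cf cg r; apply: cvgM; [exact: cf|exact: cg].
  have cc (x : R) : continuous (fun _ : R => x) by move=> r; exact: cvg_cst.
  have cvp : continuous vp by apply: cW => //; exact: cB.
  have cvm : continuous vm by apply: (cW _ _ (cc _)); apply: cW => //; exact: cB.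
  have r0' := ltW r00.
  have [C1 C10 h1] := continuous_bounded r0' (cW _ _ (cX 1%N) (cW _ _ cvp cvp)).
  have [C2 C20 h2] := continuous_bounded r0' (cW _ _ (cX 1%N) (cW _ _ cvm cvm)).
  (* The quotients by [r] extended continuously to 0; for [n = 0] the first one vanishes
     identically, whatever the exponent [n.-1]. *)
  pose wp r : R := n%:R * (r ^+ n.-1 * bessel (nu ^+ 2 / 4) n 0 (r ^+ 2)).
  pose wm r : R := n.+1%:R * (2 / nu * (r ^+ n * bessel (nu ^+ 2 / 4) n 1 (r ^+ 2))).
  have cwp : continuous wp by apply: (cW _ _ (cc _)); apply: cW => //; exact: cB.
  have cwm : continuous wm by apply: (cW _ _ (cc _)); apply: (cW _ _ (cc _)); apply: cW => //; exact: cB.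
  have [C3 C30 h3] := continuous_bounded r0' (cW _ _ (cX 1%N) (cW _ _ cwp cwp)).
  have [C4 C40 h4] := continuous_bounded r0' (cW _ _ (cX 1%N) (cW _ _ cwm cwm)).
  have C0 : 0 < C.
    have /andP[a b] := hcC _ (lexx r0).
    by have := lt_le_trans (divr_gt0 c0 r00) (le_trans a b); rewrite pmulr_lgt0// invr_gt0.
  pose D := C1 + C2 + C3 + C4 + C + (n%:R / r0) ^+ 2 * C + (n.+1%:R / r0) ^+ 2 * C.
  have D5 : 0 <= (n%:R / r0) ^+ 2 * C by rewrite mulr_ge0 ?sqr_ge0// ltW.
  have D6 : 0 <= (n.+1%:R / r0) ^+ 2 * C by rewrite mulr_ge0 ?sqr_ge0// ltW.
  exists vp, vm, c, D, r0; split => //.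
    by rewrite /D; lra.
  move=> r rpos; have rn : r != 0 by rewrite gt_eqF.
  have [rr|rr] := leP r r0.
    have rI : 0 <= r <= r0 by rewrite (ltW rpos).
    have wpE : n%:R / r * vp r = wp r.
      by rewrite /vp /wp; case: (n) => [|i]; rewrite /= ?mul0r// exprS; field.
    have wmE : n.+1%:R / r * vm r = wm r.
      by rewrite /vm /wm exprS; field; rewrite rn gt_eqF.
    rewrite wpE wmE; split.
    - rewrite ler_pdivlMr// mulrDl.
      have := h1 r rI; have := h2 r rI; rewrite !expr1 => /(le_trans (ler_norm _)) a /(le_trans (ler_norm _)) b.
      by rewrite /D !expr2; move: a b; lra.
    - rewrite ler_pdivlMr//.
      have := h3 r rI; rewrite !expr1 => /(le_trans (ler_norm _)) a.
      by rewrite /D expr2; lra.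
    - rewrite ler_pdivlMr//.
      have := h4 r rI; rewrite !expr1 => /(le_trans (ler_norm _)) a.
      by rewrite /D expr2; lra.
    - move=> rr'; have -> : r = r0 by apply/eqP; rewrite eq_le rr.
      by have /andP[] := hcC _ (lexx r0).
  have /andP[lo hi] := hcC _ (ltW rr).
  have CD : C / r <= D / r by rewrite ler_pM2r ?invr_gt0// /D; lra.
  have far (a : R) (v : R) : v ^+ 2 <= C / r -> 0 <= a -> (a / r0) ^+ 2 * C <= D ->
      (a / r * v) ^+ 2 <= D / r.
    move=> vC a0 aD; rewrite exprMn.
    apply: (@le_trans _ _ ((a / r0) ^+ 2 * (C / r))).
      apply: ler_pM => //; rewrite ?sqr_ge0//.
      rewrite lerXn2r ?nnegrE ?divr_ge0 ?(ltW rpos)//.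
      by rewrite ler_wpM2l// lef_pV2 ?posrE// ltW.
    by rewrite mulrA ler_pM2r ?invr_gt0.
  have vpC : vp r ^+ 2 <= C / r by apply: le_trans hi; rewrite lerDl sqr_ge0.
  have vmC : vm r ^+ 2 <= C / r by apply: le_trans hi; rewrite lerDr sqr_ge0.
  split => //; first exact: le_trans hi CD.
  - by apply: far => //; rewrite /D; lra.
  - by apply: far => //; rewrite /D; lra.
have [m0|m0] := leP 0 m.
  have [n mn] : exists n : nat, m = n by exists `|m|%N; rewrite gez0_abs.
  have [vp [vm [c [C [r0 [zm c0 C0 r00 h]]]]]] := nat_case n.
  exists vp, vm, c, C, r0; rewrite mn; split => // r rpos.
  by have [h1 h2 h3 h4] := h r rpos; split => //; rewrite intrD -pmulrn mulr1z natr1.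
have [n mn] : exists n : nat, m = - n%:Z - 1.
  by move: m0; case: (m) => // n _; exists n; rewrite NegzE -addn1 PoszD opprD.
have [vp [vm [c [C [r0 [zm c0 C0 r00 h]]]]]] := nat_case n.
exists vm, (fun r => - vp r), c, C, r0; rewrite mn; split => //; first exact: zero_mode_swap.
move=> r rpos; have [h1 h2 h3 h4] := h r rpos; split.
- by rewrite sqrrN addrC.
- rewrite (_ : _ * vm r = - (n.+1%:R / r * vm r)) ?sqrrN//.
  by rewrite intrB intrN -pmulrn mulr1z -natr1; ring.
- rewrite (_ : _ * - vp r = n%:R / r * vp r)//.
  by rewrite subrK intrN -pmulrn; ring.
- by rewrite sqrrN addrC.
Qed.

End zero_modes.

(** * Trial states of negative reduced energy *)

Section trial.
Variable R : realType.
Local Notation mu := (@lebesgue_measure R).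
Local Notation mR := (measurableTypeR R).
Local Notation Rpos := (`]0, +oo[%classic : set R).
Implicit Types (f g h k : R -> R).

Lemma rint_cut (A : set mR) h : measurable A -> A `<=` Rpos ->
  mu.-integrable A (EFin \o (fun r => h r * r)) ->
  rintegrable (h \_ A) /\ rint (h \_ A) = 2 * kappa R * \int[mu]_(r in A) (h r * r).
Proof.
move=> mA AR ih; split.
  have i1 : mu.-integrable Rpos ((EFin \o (fun r => h r * r)) \_ A).
    by apply: integrableS ((integrable_mkcond _ mA).1 ih).
  move: i1; congr (_.-integrable _ _); apply/funext => r /=; rewrite !patchE.
  by case: ifPn => //; rewrite mul0r.
congr (_ * _); rewrite /Rintegral; congr fine.
rewrite (@integral_support _ _ _ _ A)//.
  by apply: eq_integral => r rA; rewrite patchE rA.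
by move=> r _ rA; rewrite patchE memNset// mul0r.
Qed.

Lemma rint_cut_inv (D L : R) : 0 <= L ->
  rintegrable ((fun r => D / r) \_ (`]0, L]%classic : set R)) /\
  rint ((fun r => D / r) \_ (`]0, L]%classic : set R)) = 2 * kappa R * (D * L).
Proof.
move=> L0.
have E : {in (`]0, L]%classic : set R), (EFin \o (cst D)) =1 (EFin \o (fun r : R => D / r * r))}.
  by move=> r; rewrite inE/= in_itv/= => /andP[r0 _]; rewrite mulfVK// gt_eqF.
have fin : (mu `]0%R, L] < +oo)%E by rewrite lebesgue_measure_itv/=; case: ifP => _; rewrite ltry.
have [||i ->] := @rint_cut (`]0, L]%classic : set mR) (fun r => D / r) (measurable_itv _).
- by move=> r; rewrite /= !in_itv/= andbT => /andP[].
- have ic : mu.-integrable `]0, L] (EFin \o cst D).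
    apply: (@integrableS _ _ _ mu `[0, L]%classic) => //.
      by move=> r; rewrite /= !in_itv/= => /andP[/ltW -> ->].
    apply: continuous_compact_integrable; first exact: segment_compact.
    by apply: continuous_subspaceT => r; exact: cvg_cst.
  by apply: eq_integrable ic => // r; exact: E.
split => //; congr (_ * _).
rewrite (@eq_Rintegral _ _ _ _ _ (cst D)); last by move=> r /E[].
rewrite (_ : \int[mu]_(x in _) _ = D * fine (mu `]0, L])); last exact: Rintegral_cst.
congr (_ * _); rewrite lebesgue_measure_itv/= lte_fin.
by move: L0; rewrite le_eqVlt => /predU1P[<-|->]; rewrite ?ltxx//= oppr0 addr0.
Qed.

Lemma rint_cut_inv2 (d a b : R) : 0 < a -> a <= b ->
  rintegrable ((fun r => d / r ^+ 2) \_ (`[a, b]%classic : set R)) /\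
  rint ((fun r => d / r ^+ 2) \_ (`[a, b]%classic : set R)) = 2 * kappa R * (d * (ln b - ln a)).
Proof.
move=> a0 ab; have [ii Ii] := Rintegral_inv a0 ab.
have mI : measurable (`[a, b]%classic : set mR) by exact: measurable_itv.
have E (r : R) : r \in (`[a, b]%classic : set R) -> d * r^-1 = d / r ^+ 2 * r.
  rewrite inE/= in_itv/= => /andP[/(lt_le_trans a0) r0 _].
  by have rn : r != 0 by [rewrite gt_eqF]; field.
have [|i ->] := @rint_cut `[a, b] (fun r => d / r ^+ 2) mI (itv_Rpos a0).
  by apply: eq_integrable (integrable_mulr d mI ii) => // r /E /= ->.
split => //; congr (_ * _); rewrite -Ii -RintegralZl//.
by apply: eq_Rintegral => r /E ->.
Qed.

Lemma L2w_le f k : measurable_fun Rpos f -> (forall r, 0 < r -> f r ^+ 2 <= k r) ->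
  rintegrable k -> L2w f.
Proof.
move=> mf fk ik; split => //.
have i2 : rintegrable (fun r => f r ^+ 2).
  apply: le_rintegrable ik; first exact: measurable_funX.
  by move=> r r0; rewrite ger0_norm ?sqr_ge0// fk.
exact: integral_fune_lt_pinfty i2.
Qed.

Definition cutoff (L : R) h (r : R) : R := if r <= L then h r else 0.

Lemma L2w_cutoff (L C : R) h : 0 <= L -> measurable_fun Rpos h ->
  (forall r, 0 < r -> r <= L -> h r ^+ 2 <= C / r) -> L2w (cutoff L h).
Proof.
move=> L0 mh hC.
have [iC _] := rint_cut_inv C L0.
apply: L2w_le iC.
  rewrite (_ : cutoff L h = fun r => h r * \1_(`]-oo, L]%classic : set R) r).
    by apply: measurable_funM => //; apply: measurable_funTS; exact: measurable_indic.
  apply/funext => r; rewrite /cutoff indicE; case: ifPn => rL.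
    by rewrite mem_set ?mulr1//= in_itv.
  by rewrite memNset ?mulr0//= in_itv; exact/negP.
move=> r r0; rewrite /cutoff patchE; case: ifPn => rL.
  by rewrite mem_set ?hC//= in_itv/= r0.
by rewrite memNset ?expr0n//= in_itv/= r0; exact/negP.
Qed.

Lemma primitive_on_eq (a b : R) V h W k :
  (forall x, a <= x <= b -> V x = W x /\ h x = k x) -> primitive_on a b V h ->
  primitive_on a b W k.
Proof.
move=> E [ih Vh]; split.
  by apply: eq_integrable ih => // x; rewrite inE/= in_itv/= => /E[_ ->].
move=> x y ax xy yb.
have [<- _] := E y (introT andP (conj (le_trans ax xy) yb)).
have [<- _] := E x (introT andP (conj ax (le_trans xy yb))).
rewrite Vh//; apply: eq_Rintegral => t; rewrite inE/= in_itv/= => /andP[xt ty].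
by apply: (E t _).2; rewrite (le_trans ax xt) (le_trans ty yb).
Qed.

Lemma primitive0_cutoff (L : R) (f df : R -> R) : 0 < L ->
  (forall r : R, 0 < r -> is_derive r (1 : R) f (df r)) ->
  (forall r : R, 0 < r -> {for r, continuous df}) -> f L = 0 -> df L = 0 ->
  primitive0 (cutoff L f) (cutoff L df).
Proof.
move=> L0 Df cf fL dL.
have left a b : 0 < a -> a <= b -> b <= L -> primitive_on a b (cutoff L f) (cutoff L df).
  move=> a0 ab bL; apply: (@primitive_on_eq _ _ f df).
    by move=> x /andP[ax xb]; rewrite /cutoff (le_trans xb bL).
  by apply: C1_primitive_on => // x /andP[/(lt_le_trans a0) x0 _]; [exact: Df|exact: cf].
have right a b : L <= a -> a <= b -> primitive_on a b (cutoff L f) (cutoff L df).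
  move=> La ab; apply: (@primitive_on_eq _ _ (cst 0) (cst 0)).
    move=> x /andP[/(le_trans La) Lx _]; rewrite /cutoff /=.
    have [xL|//] := leP x L; have -> : x = L by apply/eqP; rewrite eq_le xL.
    by rewrite fL dL.
  by apply: C1_primitive_on => // x _; exact: cvg_cst.
move=> a b a0 ab.
have [bL|Lb] := leP b L; first exact: left.
have [La|aL] := leP L a; first exact: right.
apply: (primitive_on_cat (ltW aL) (ltW Lb)); first exact: left (ltW aL) _.
exact: right (ltW Lb).
Qed.

Lemma stateZ m (t : R) (F G : comps R) : state m F G ->
  state m (fun s j r => t * F s j r) (fun s j r => t * G s j r).
Proof.
move=> st s j; have [L1 L2 L3 p1] := st s j; split.
- exact: L2wZ.
- rewrite (_ : (fun r => _) = (fun r => t * (ang R m s / r * F s j r))); first exact: L2wZ.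
  by apply/funext => r; ring.
- exact: L2wZ.
- by move=> x y x0 xy; apply: primitive_onZ => //; exact: p1.
Qed.

Lemma rint_sq2Z (t : R) (F : comps R) : rintegrable (sq2 F) ->
  rint (sq2 (fun s j r => t * F s j r)) = t ^+ 2 * rint (sq2 F).
Proof. by move=> iF; rewrite -rintZ//; apply: eq_rint => r _; rewrite !sq2E; ring. Qed.

Lemma square_formZ m nu (t : R) (F G : comps R) :
  square_form m nu (fun s j r => t * F s j r) (fun s j r => t * G s j r) =
  fun s j r => t * square_form m nu F G s j r.
Proof.
by apply/funext => s; apply/funext => j; apply/funext => r; rewrite /square_form; case: s; ring.
Qed.

Lemma rint_quarticZ (lp lm l0 t : R) (F : comps R) : rintegrable (quartic lp lm l0 F) ->
  rint (quartic lp lm l0 (fun s j r => t * F s j r)) = t ^+ 4 * rint (quartic lp lm l0 F).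
Proof.
by move=> iF; rewrite -rintZ//; apply: eq_rint => r _; rewrite /quartic /quad /dens; ring.
Qed.

Lemma quad_ge (lp lm l0 d a b : R) : 0 <= d -> d <= lp -> d <= lm -> 0 <= l0 ->
  0 <= a -> 0 <= b -> d / 2 * (a + b) ^+ 2 <= quad lp lm l0 a b.
Proof.
move=> d0 dp dm l00 a0 b0; rewrite /quad.
have h1 : 0 <= (lp - d) * a ^+ 2 by rewrite mulr_ge0 ?sqr_ge0// subr_ge0.
have h2 : 0 <= (lm - d) * b ^+ 2 by rewrite mulr_ge0 ?sqr_ge0// subr_ge0.
have h3 : 0 <= 2 * l0 * a * b by rewrite !mulr_ge0.
have h4 : 0 <= d / 2 * (a - b) ^+ 2 by rewrite mulr_ge0 ?sqr_ge0// divr_ge0.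
rewrite -subr_ge0.
rewrite (_ : _ - _ = (lp - d) * a ^+ 2 + (lm - d) * b ^+ 2 + 2 * l0 * a * b + d / 2 * (a - b) ^+ 2).
  by rewrite !addr_ge0.
by field.
Qed.

(* A mode cut off at radius L has square energy of order 1 / L and mass of order L,
   while its quartic integral grows like ln L. *)
Lemma trial_state (m : int) (nu lp lm l0 rho : R) : 0 < nu -> 0 < lp -> 0 < lm -> 0 < l0 ->
  0 < rho -> exists F G : comps R, [/\ state m F G, rint (sq2 F) = rho &
    rint (sq2 (square_form m nu F G)) < rint (quartic lp lm l0 F)].
Proof.
move=> nu0 lp0 lm0 l00 rho0; have k0 := kappa2_gt0 R.
have [vp [vm [c [C [r0 [zm c0 C0 r00 hv]]]]]] := zero_mode_exists m nu0.
pose v (s : bool) := if s then vp else vm.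
pose w (s : bool) r : R := if s then m%:~R / r * vp r + nu * vm r
  else - ((m + 1)%:~R / r * vm r) - nu * vp r.
have Dv s (r : R) : 0 < r -> is_derive r (1 : R) (v s) (w s r).
  by move=> rpos; have [] := zm r rpos; case: s.
have cv s (r : R) : 0 < r -> {for r, continuous (v s)}.
  by move=> rpos; have [d _] := Dv s r rpos; exact/differentiable_continuous/derivable1_diffP.
have cinv (a r : R) : 0 < r -> {for r, continuous (fun y : R => a / y)}.
  by move=> rpos; apply: cvgM; [exact: cvg_cst|apply: cvgV; [rewrite gt_eqF|exact: cvg_id]].
have cw s (r : R) : 0 < r -> {for r, continuous (w s)}.
  move=> rpos; case: s.
    apply: cvgD; apply: cvgM; [exact: cinv|exact: (cv true)|exact: cvg_cst|exact: (cv false)].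
  apply: cvgB; first apply: cvgN; apply: cvgM; [exact: cinv|exact: (cv false)|exact: cvg_cst|exact: (cv true)].
pose d := Num.min lp lm.
have d0 : 0 < d by rewrite lt_min lp0.
(* On [[r0, L / 2]] the density is at least [c / (16 r)], so by [quad_ge] the quartic is at least
   [e / r ^+ 2], whose integral against r dr is [e * T]. *)
pose e := d / 2 * (c / 16) ^+ 2.
have e0 : 0 < e by rewrite mulr_gt0 ?exprn_gt0 ?divr_gt0.
(* Chosen so that [rho * e * T] exceeds [2 * kappa R * (4 * C * C)]: this is the final comparison of
   Q M with rho N, divided by [2 * kappa R]. *)
pose T := (2 * kappa R * (4 * C * C) + 1) / (rho * e) + 1.
have CC0 : 0 < 4 * C * C by rewrite !mulr_gt0.
have num0 := mulr_gt0 k0 CC0; have re0 := mulr_gt0 rho0 e0.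
have T0 : 0 < T by exact: addr_gt0 (divr_gt0 (addr_gt0 num0 ltr01) re0) ltr01.
pose L := 2 * (r0 * expR T).
have L0 : 0 < L by rewrite !mulr_gt0 ?expR_gt0.
have L2 : L / 2 = r0 * expR T by rewrite /L; field.
have r0L : r0 <= L / 2 by rewrite L2 ler_peMr ?(ltW r00)// -[leLHS]expR0 ler_expR ltW.
have lnL : ln (L / 2) - ln r0 = T by rewrite L2 lnM ?posrE ?expR_gt0// expRK addrC addKr.
have Ln : L != 0 by rewrite gt_eqF.
pose x r : R := 1 - r / L.
have x01 r : 0 < r -> r <= L -> 0 <= x r /\ x r <= 1.
  by move=> rpos rL; rewrite /x subr_ge0 ler_pdivrMr// mul1r rL gerBl divr_ge0 ?ltW.
have xL : x L = 0 by rewrite /x divff// subrr.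
(* The cutoff factor is squared so that the profile and its derivative both vanish at [L], and the
   extension by 0 stays absolutely continuous with continuous derivative. One real component per
   mode is enough. *)
pose F : comps R := fun s j => if j then (fun=> 0) else cutoff L (fun r => x r ^+ 2 * v s r).
pose G : comps R := fun s j => if j then (fun=> 0) else
  cutoff L (fun r => x r ^+ 2 * w s r - 2 / L * (x r * v s r)).
have Dx r : is_derive r (1 : R) x (- L^-1).
  have D := is_deriveB (is_derive_cst (1 : R) r (1 : R)) (is_deriveZ L^-1 (is_derive_id r (1 : R))).
  rewrite (_ : x = (cst 1 - L^-1 \*: id)); last by apply/funext => y; rewrite /x /= mulrC.
  by apply: is_derive_eq D _; rewrite sub0r /GRing.scale /= mulr1.
have cx r : {for r, continuous x}.
  by have [D _] := Dx r; exact/differentiable_continuous/derivable1_diffP.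
have mcont h : (forall r : R, 0 < r -> {for r, continuous h}) -> measurable_fun Rpos h.
  move=> ch; apply: open_continuous_measurable_fun; first exact: interval_open.
  by move=> r; rewrite inE/= in_itv/= andbT => /ch.
have mv s : measurable_fun Rpos (v s) by apply: mcont => r; exact: cv.
have mx : measurable_fun Rpos x by apply: mcont => r _; exact: cx.
have vC s r : 0 < r -> v s r ^+ 2 <= C / r.
  by move=> rpos; have [h _ _ _] := hv r rpos; apply: le_trans h; case: s => /=; rewrite ?lerDl ?lerDr sqr_ge0.
have x2 (a : R) r : 0 < r -> r <= L -> a ^+ 2 <= C / r -> (x r ^+ 2 * a) ^+ 2 <= C / r.
  move=> rpos rL aC; have [h1 h2] := x01 r rpos rL; apply: le_trans aC.
  by rewrite exprMn ler_piMl ?sqr_ge0// exprn_ile1 ?exprn_ge0// exprn_ile1.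
have x1 (a : R) r : 0 < r -> r <= L -> a ^+ 2 <= C / r -> (x r * a) ^+ 2 <= C / r.
  move=> rpos rL aC; have [h1 h2] := x01 r rpos rL; apply: le_trans aC.
  by rewrite exprMn ler_piMl ?sqr_ge0// exprn_ile1.
have L2w0 : L2w (fun=> 0 : R).
  split => //; rewrite (eq_integral (cst 0%E)) ?integral0 ?ltry//.
  by move=> r _; rewrite expr0n mul0r.
have vang s r : 0 < r -> (ang R m s / r * v s r) ^+ 2 <= C / r.
  by move=> rpos; have [_ h1 h2 _] := hv r rpos; case: s.
have LF s : L2w (cutoff L (fun r => x r ^+ 2 * v s r)).
  apply: (L2w_cutoff (C := C) (ltW L0)); first by apply: measurable_funM => //; exact: measurable_funX.
  by move=> r rpos rL; apply: x2 => //; exact: vC.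
have LA s : L2w (cutoff L (fun r => x r ^+ 2 * (ang R m s / r * v s r))).
  apply: (L2w_cutoff (C := C) (ltW L0)); last by move=> r rpos rL; apply: x2 => //; exact: vang.
  apply: measurable_funM; first exact: measurable_funX.
  by apply: measurable_funM => //; apply: mcont => r; exact: cinv.
have LX s : L2w (cutoff L (fun r => x r * v s r)).
  apply: (L2w_cutoff (C := C) (ltW L0)); first exact: measurable_funM.
  by move=> r rpos rL; apply: x1 => //; exact: vC.
have st : state m F G.
  move=> s j; case: j; rewrite /F /G /=.
    split => //; first by under eq_fun do rewrite mulr0.
    by move=> a b a0 ab; apply: C1_primitive_on => // y _; exact: cvg_cst.
  split; first exact: LF.
  - rewrite (_ : (fun r => _) = cutoff L (fun r => x r ^+ 2 * (ang R m s / r * v s r))) //.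
    by apply/funext => r; rewrite /cutoff; case: ifP => _; ring.
  - rewrite (_ : cutoff _ _ = fun r =>
        (if s then 1 else -1) * cutoff L (fun r => x r ^+ 2 * (ang R m s / r * v s r)) r +
        (if s then nu else - nu) * cutoff L (fun r => x r ^+ 2 * v (~~ s) r) r +
        - (2 / L) * cutoff L (fun r => x r * v s r) r).
      by apply: L2wD; [apply: L2wD; exact: L2wZ|exact: L2wZ].
    apply/funext => r; rewrite /cutoff; case: ifP => _; last by rewrite !mulr0 !addr0.
    by case: s; rewrite /w /v /ang /=; ring.
  - apply: primitive0_cutoff; first exact: L0.
    + move=> r rpos; have D := is_deriveM (is_deriveX 2 (Dx r)) (Dv s r rpos).
      by apply: is_derive_eq D _; rewrite -[(x ^+ 2) r]/(x r ^+ 2) /GRing.scale /= expr1; ring.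
    + move=> r rpos; apply: cvgB.
        apply: cvgM; last exact: cw.
        by rewrite /continuous_at expr2; under eq_fun do rewrite expr2; apply: cvgM; exact: cx.
      by apply: cvgM; [exact: cvg_cst|apply: cvgM; [exact: cx|exact: cv]].
    + by rewrite xL expr0n mul0r.
    + by rewrite xL expr0n !mul0r mulr0 subr0.
have [iF _ /(_ nu) iQ] := state_rintegrable st.
have iN := quartic_rintegrable st lp0 lm0 l00.
have vv r : 0 < r -> vp r ^+ 2 + vm r ^+ 2 <= C / r by move=> rpos; have [] := hv r rpos.
have sqF r : r <= L -> sq2 F r = (x r ^+ 2) ^+ 2 * (vp r ^+ 2 + vm r ^+ 2).
  by move=> rL; rewrite sq2E /F /cutoff rL /v; ring.
have sqF0 r : L < r -> sq2 F r = 0.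
  by move=> rL; rewrite sq2E /F /cutoff leNgt rL /= expr0n !addr0.
(* On a zero mode only the term with the derivative of the cutoff survives. *)
have QE r : 0 < r -> r <= L -> sq2 (square_form m nu F G) r = 4 / L ^+ 2 * (x r ^+ 2 * (vp r ^+ 2 + vm r ^+ 2)).
  move=> rpos rL; have rn : r != 0 by rewrite gt_eqF.
  by rewrite sq2E /square_form /F /G /cutoff rL /v /w /ang; field; rewrite Ln rn.
have Q0 r : L < r -> sq2 (square_form m nu F G) r = 0.
  by move=> rL; rewrite sq2E /square_form /F /G /cutoff leNgt rL /= !mulr0 !subr0 !addr0 !expr0n !addr0.
have [iC1 EC1] := rint_cut_inv C (ltW L0).
have Mle : rint (sq2 F) <= 2 * kappa R * (C * L).
  rewrite -EC1; apply: le_rint => // r rpos; rewrite patchE; have [rL|rL] := leP r L.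
    rewrite mem_set ?sqF//= ?in_itv/= ?rpos//; have [h1 h2] := x01 r rpos rL.
    apply: le_trans (vv r rpos); rewrite ler_piMl ?addr_ge0 ?sqr_ge0//.
    by rewrite exprn_ile1 ?exprn_ge0// exprn_ile1.
  by rewrite sqF0// memNset//= in_itv/= rpos leNgt rL.
have [iC2 EC2] := rint_cut_inv (4 / L ^+ 2 * C) (ltW L0).
have Qle : rint (sq2 (square_form m nu F G)) <= 2 * kappa R * (4 / L ^+ 2 * C * L).
  rewrite -EC2; apply: le_rint => // r rpos; rewrite patchE; have [rL|rL] := leP r L.
    rewrite mem_set ?QE//= ?in_itv/= ?rpos//; have [h1 h2] := x01 r rpos rL.
    rewrite -[leRHS]mulrA ler_wpM2l ?divr_ge0 ?sqr_ge0//.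
    apply: le_trans (vv r rpos); rewrite ler_piMl ?addr_ge0 ?sqr_ge0//.
    by rewrite exprn_ile1.
  by rewrite Q0// memNset//= in_itv/= rpos leNgt rL.
have low r : r0 <= r -> r <= L / 2 -> c / r / 16 <= sq2 F r.
  move=> r0r rL2; have rpos : 0 < r by exact: lt_le_trans r0r.
  have rL : r <= L by apply: le_trans rL2 _; rewrite ler_pdivrMr// ler_pMr// ler1n.
  have [_ _ _ /(_ r0r) lo] := hv r rpos.
  have cr : 0 <= c / r by rewrite divr_ge0 ?(ltW c0) ?(ltW rpos).
  rewrite sqF// mulrC ler_pM ?invr_ge0//.
  have hx : 2^-1 <= x r.
    rewrite /x lerBrDr -lerBrDl ler_pdivrMr//; apply: le_trans rL2 _.
    by rewrite le_eqVlt; apply/orP; left; apply/eqP; field.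
  rewrite -exprM (_ : 16^-1 = 2^-1 ^+ 4 :> R); last by field.
  by rewrite lerXn2r ?nnegrE ?invr_ge0// (le_trans _ hx).
have [iC3 EC3] := rint_cut_inv2 e r00 r0L.
have Nge : 2 * kappa R * (e * T) <= rint (quartic lp lm l0 F).
  rewrite -lnL -EC3; apply: le_rint => // r rpos; rewrite patchE; case: ifPn => [|_]; last first.
    by apply: quad_ge0 => //; rewrite /dens addr_ge0 ?sqr_ge0.
  rewrite inE/= in_itv/= => /andP[r0r rL2].
  have dF s : 0 <= dens F s r by rewrite /dens addr_ge0 ?sqr_ge0.
  apply: le_trans (quad_ge (ltW d0) _ _ (ltW l00) (dF true) (dF false)); last 2 first.
  - by rewrite ge_min lexx.
  - by rewrite ge_min lexx orbT.
  have -> : dens F true r + dens F false r = sq2 F r by rewrite sq2E.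
  rewrite (_ : e / r ^+ 2 = d / 2 * (c / r / 16) ^+ 2); last first.
    by have rn : r != 0 by [rewrite gt_eqF]; rewrite /e; field.
  rewrite ler_wpM2l ?divr_ge0 ?(ltW d0)// lerXn2r ?nnegrE ?sq2_ge0 ?low//.
  by rewrite !divr_ge0 ?(ltW c0) ?(ltW rpos).
have [iC4 EC4] := rint_cut_inv2 (c * r0 / 16) r00 r0L.
have M0 : 0 < rint (sq2 F).
  apply: (@lt_le_trans _ _ (2 * kappa R * (c * r0 / 16 * T))).
    by rewrite mulr_gt0// mulr_gt0// divr_gt0// mulr_gt0.
  rewrite -lnL -EC4; apply: le_rint => // r rpos; rewrite patchE; case: ifPn => [|_]; last exact: sq2_ge0.
  rewrite inE/= in_itv/= => /andP[r0r rL2]; apply: le_trans (low r r0r rL2).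
  have rn : r != 0 by rewrite gt_eqF.
  rewrite (_ : c * r0 / 16 / r ^+ 2 = c / r / 16 * (r0 / r)); last by field.
  by rewrite ler_piMr ?divr_ge0 ?(ltW c0) ?(ltW rpos)// ler_pdivrMr// mul1r.
have Npos : 0 < rint (quartic lp lm l0 F) by apply: lt_le_trans Nge; exact: mulr_gt0 k0 (mulr_gt0 e0 T0).
move: Mle Qle Nge Npos M0; set M := rint (sq2 F); set Q := rint (sq2 _); set N := rint _.
move=> Mle Qle Nge Npos M0.
(* This amplitude normalizes the mass. The square energy scales by A^2 and the quartic by A^4, so
   the claim becomes Q M < rho N. *)
pose A := Num.sqrt (rho / M).
have A2 : A ^+ 2 = rho / M by rewrite sqr_sqrtr// divr_ge0 ?ltW.
exists (fun s j r => A * F s j r), (fun s j r => A * G s j r); split.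
- exact: stateZ.
- by rewrite rint_sq2Z// A2 mulfVK// gt_eqF.
rewrite square_formZ rint_sq2Z// rint_quarticZ// -/Q -/N (_ : A ^+ 4 = A ^+ 2 * A ^+ 2); last by ring.
have A20 : 0 < A ^+ 2 by rewrite A2 divr_gt0.
rewrite -[ltRHS]mulrA ltr_pM2l// A2 mulrAC ltr_pdivlMr//.
apply: (@le_lt_trans _ _ (2 * kappa R * (4 / L ^+ 2 * C * L) * (2 * kappa R * (C * L)))).
  apply: ler_pM => //; last exact: ltW.
  by apply: rint_ge0 => r _; exact: sq2_ge0.
apply: (@lt_le_trans _ _ (rho * (2 * kappa R * (e * T)))); last by rewrite ler_pM2l.
rewrite (_ : _ * _ = 2 * kappa R * (2 * kappa R * (4 * C * C))); last by field.
rewrite (_ : rho * _ = 2 * kappa R * (rho * e * T)); last by ring.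
have -> : rho * e * T = 2 * kappa R * (4 * C * C) + 1 + rho * e.
  by rewrite /T mulrDr mulr1 mulrC mulfVK// gt_eqF.
by rewrite ltr_pM2l// -addrA ltrDl addr_gt0.
Qed.

End trial.

(** * Existence of a minimizer *)

Section minimization.
Variable R : realType.
Local Notation mu := (@lebesgue_measure R).
Local Notation Rpos := (`]0, +oo[%classic : set R).
Variables (nu lp lm l0 : R) (m : int).
Hypothesis nu_gt0 : 0 < nu.
Hypotheses (lp_gt0 : 0 < lp) (lm_gt0 : 0 < lm) (l0_gt0 : 0 < l0).
Implicit Types (F G : comps R).

Definition reduced_energy F G : R :=
  4^-1 * energy_form m nu (F, G) - 4^-1 * rint (quartic lp lm l0 F).

Local Notation J := reduced_energy.

Lemma represents_energy F G vp vm : represents m F G vp vm ->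
  mass_m m vp vm = (rint (sq2 F))%:E /\
  energy_m nu lp lm l0 m vp vm = (J F G - nu ^+ 2 / 4 * rint (sq2 F))%:E.
Proof.
move=> rep; have [st _ _ _] := rep.
have [i1 _ /(_ nu) i3] := state_rintegrable st.
have i4 := quartic_rintegrable st lp_gt0 lm_gt0 l0_gt0.
have [Hp Hm [eM _ /(_ nu) eQ eN]] := represents_values rep.
split; first by rewrite eM radial_intE.
rewrite /energy_m energy_square// eQ eN// -/(mass_m m vp vm) eM !radial_intE//.
by rewrite -!EFinM -!EFinB /J /energy_form /= addrAC.
Qed.

Lemma state_GN (C : R) F G : (forall up um : R * R -> R[i], H1 up -> H1 um ->
    (nonlin lp lm l0 up um <= C%:E * mass up um * (grad2 up + grad2 um))%E) ->
  state m F G ->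
  4^-1 * rint (quartic lp lm l0 F) <= C * rint (sq2 F) * rint (grad_form m F G).
Proof.
move=> hC st; have rep := state_represents st.
have [i1 i2 _] := state_rintegrable st.
have i4 := quartic_rintegrable st lp_gt0 lm_gt0 l0_gt0.
have [Hp Hm [eM eG _ eN]] := represents_values rep.
have := hC _ _ Hp Hm.
rewrite eN// -/(mass_m _ _ _) eM eG -/(grad_form m F G) !radial_intE//.
Qed.

(* C_GN is the infimum of a set of reals, which is 0 when the set is empty or
   unbounded below; the bound on rho excludes this, since (4 * 0)^-1 = 0. *)
Lemma C_GN_bound (rho : R) : 0 < rho -> rho < (4 * C_GN lp lm l0)^-1 ->
  exists C : R, [/\ 0 <= C, 4 * C * rho < 1 &
    forall up um : R * R -> R[i], H1 up -> H1 um ->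
    (nonlin lp lm l0 up um <= C%:E * mass up um * (grad2 up + grad2 um))%E].
Proof.
move=> rho0; rewrite /C_GN; set S := [set C | _] => rho_lt.
have S0 : 0 < inf S.
  have : 0 < (4 * inf S)^-1 by exact: lt_trans rho_lt.
  by rewrite invr_gt0 pmulr_rgt0.
have hS : has_inf S.
  by apply/not_notP => /inf_out h; rewrite h ltxx in S0.
have lt_inf : inf S < (4 * rho)^-1.
  move: rho_lt; rewrite -[X in X < _]invrK ltf_pV2 ?posrE ?invr_gt0 ?mulr_gt0//.
  by rewrite invfM => h; rewrite mulrC ltr_pdivlMr// mulrC.
have [C hC CS] := inf_lt hS.1 lt_inf.
exists C; split => //.
  by apply: le_trans (ltW S0) _; apply: ge_inf => //; exact: hS.2.
by rewrite mulrAC -ltr_pdivlMl ?mulr_gt0// mulr1.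
Qed.

Lemma n2_le F s j : (forall s j, L2w (F s j)) -> n2 (F s j) <= rint (sq2 F) / (2 * kappa R).
Proof.
move=> LF; rewrite ler_pdivlMr ?kappa2_gt0// mulrC.
apply: (@le_rint _ (fun r => F s j r ^+ 2)).
- exact: L2w_rintegrable.
- exact: sq2_rintegrable.
- by move=> r _; rewrite /sq2 (bigD1 (s, j))//= lerDl sumr_ge0// => i _; exact: sqr_ge0.
Qed.

Section minimizer.
Variables (rho C : R).
Hypotheses (rho0 : 0 < rho) (C0 : 0 <= C) (C_rho : 4 * C * rho < 1).
Hypothesis GN : forall up um : R * R -> R[i], H1 up -> H1 um ->
  (nonlin lp lm l0 up um <= C%:E * mass up um * (grad2 up + grad2 um))%E.

(** Half of the gap: Young's inequality costs [e] and Gagliardo-Nirenberg [4 * C * rho], so that of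
    the gradient coefficient 1/4 exactly [e / 4] remains. [K] collects the mass term of Young's
    inequality. *)
Let e : R := (1 - 4 * C * rho) / 2.
Let K : R := nu ^+ 2 * rho / (4 * e).
Let e0 : 0 < e. Proof. by rewrite divr_gt0// subr_gt0. Qed.
Let e1 : e < 1.
Proof.
have h : 0 <= 4 * C * rho by rewrite mulr_ge0 ?mulr_ge0// ltW.
by rewrite /e; lra.
Qed.

Lemma reduced_energy_coercive F G : state m F G -> rint (sq2 F) = rho ->
  e / 4 * rint (grad_form m F G) - K <= J F G.
Proof.
move=> st M; have := square_form_coercive nu st e0 e1; have := state_GN GN st.
rewrite M /J /energy_form /=.
move: (rint (grad_form _ _ _)) (rint (quartic _ _ _ _)) (rint (sq2 _)) => g q s h1 h2.
have -> : e / 4 * g - K = 4^-1 * ((1 - e) * g - nu ^+ 2 / e * rho) - C * rho * g.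
  by rewrite /K /e; field; rewrite gt_eqF// subr_gt0.
by rewrite lerB// ler_wpM2l// invr_ge0.
Qed.

Let S : set R := [set J p.1 p.2 | p in
  [set p : comps R * comps R | state m p.1 p.2 /\ rint (sq2 p.1) = rho]].

Lemma grad_form_ge0 F G : 0 <= rint (grad_form m F G).
Proof. by apply: rint_ge0 => r _; rewrite addr_ge0 ?sq2_ge0. Qed.

Lemma reduced_energy_lbound : lbound S (- K).
Proof.
move=> _ [[F G] /= [st M] <-]; apply: le_trans (reduced_energy_coercive st M).
by rewrite -[leLHS]add0r lerD2r mulr_ge0 ?grad_form_ge0// divr_ge0// ltW.
Qed.

Lemma reduced_energy_inf_lt0 : has_inf S /\ inf S < 0.
Proof.
have [F [G [st M lt]]] := trial_state m nu_gt0 lp_gt0 lm_gt0 l0_gt0 rho0.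
have SF : S (J F G) by exists (F, G).
have hS : has_inf S by split; [exists (J F G)|exists (- K); exact: reduced_energy_lbound].
split => //; apply: le_lt_trans (ge_inf hS.2 SF) _.
by rewrite /J -mulrBr pmulr_rlt0 ?invr_gt0// subr_lt0.
Qed.

Lemma reduced_energy_weak_limit : exists F G, [/\ state m F G, rint (sq2 F) <= rho &
  J F G <= inf S].
Proof.
have [hS I0] := reduced_energy_inf_lt0; set I := inf S in I0 *.
have k0 := kappa2_gt0 R.
have seq_ex n : exists p : comps R * comps R,
    [/\ state m p.1 p.2, rint (sq2 p.1) = rho & J p.1 p.2 < I + n.+1%:R^-1].
  have n0 : 0 < (n.+1%:R^-1 : R) by rewrite invr_gt0.
  have [_ [p [st M] <-] h] := inf_adherent n0 hS.
  by exists p.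
have [p pP] := choice seq_ex.
have st n : state m (p n).1 (p n).2 by have [] := pP n.
have M n : rint (sq2 (p n).1) = rho by have [] := pP n.
have Jn n : J (p n).1 (p n).2 < I + n.+1%:R^-1 by have [] := pP n.
pose B : R := (I + 1 + K) / (e / 4).
have e4 : 0 < e / 4 by rewrite divr_gt0.
have gB n : rint (grad_form m (p n).1 (p n).2) <= B.
  rewrite /B ler_pdivlMr// mulrC -lerBlDr; apply: le_trans (reduced_energy_coercive (st n) (M n)) _.
  by apply: le_trans (ltW (Jn n)) _; rewrite lerD2l invf_le1// ler1n.
have B0 : 0 <= B by apply: le_trans (gB 0%N); exact: grad_form_ge0.
pose A : R := (rho + B) / (2 * kappa R).
have A_ge (x : R) : x <= rho + B -> x / (2 * kappa R) <= A by move=> h; rewrite ler_pM2r ?invr_gt0.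
have FA n s j : n2 ((p n).1 s j) <= A.
  apply: le_trans (n2_le s j _) (A_ge _ _); last by rewrite M lerDl.
  by move=> s' j'; have [] := st n s' j'.
have gr n : rint (sq2 (p n).2) <= rho + B /\
    rint (sq2 (fun s j r => ang R m s / r * (p n).1 s j r)) <= rho + B.
  have i1 : rintegrable (sq2 (p n).2) by apply: sq2_rintegrable => s j; have [] := st n s j.
  have i2 : rintegrable (sq2 (fun s j r => ang R m s / r * (p n).1 s j r)).
    by apply: sq2_rintegrable => s j; have [] := st n s j.
  have := gB n; rewrite /grad_form (rintD i1 i2) => h.
  have s1 : 0 <= rint (sq2 (p n).2) by apply: rint_ge0 => r _; exact: sq2_ge0.
  have s2 : 0 <= rint (sq2 (fun s j r => ang R m s / r * (p n).1 s j r)).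
    by apply: rint_ge0 => r _; exact: sq2_ge0.
  have rB : B <= rho + B by rewrite lerDr ltW.
  split; apply: le_trans rB; apply: le_trans h; first by rewrite lerDl.
  by rewrite lerDr.
have GA n s j : n2 ((p n).2 s j) <= A.
  apply: le_trans (n2_le s j _) (A_ge _ (gr n).1).
  by move=> s' j'; have [] := st n s' j'.
have LA n s j : n2 (fun r => ang R m s / r * (p n).1 s j r) <= A.
  apply: le_trans (@n2_le (fun s j r => ang R m s / r * (p n).1 s j r) s j _) (A_ge _ (gr n).2).
  by move=> s' j'; have [] := st n s' j'.
have [phi [u [uk cv]]] := state_subsequence st FA GA.
pose Fu n := (p (u n)).1; pose Gu n := (p (u n)).2.
have [gam [stg hQ]] := @mazur_limit _ m Fu Gu phi A (fun n => st (u n))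
  (fun n => FA (u n)) (fun n => LA (u n)) (fun n => GA (u n)) cv.
exists phi, gam; split => //.
  have [iphi _ _] := state_rintegrable stg.
  have msq (h : comps R) : (forall s j, L2w (h s j)) -> measurable_fun Rpos (sq2 h).
    by move=> Lh; exact: (L2w_sum (fun i : bool * bool => Lh i.1 i.2)).2.
  rewrite -lee_fin -radial_intE//; apply: (@fatou_bound _ (fun n => sq2 (Fu n))).
  - by move=> n; apply: msq => s j; have [] := st (u n) s j.
  - by apply: msq => s j; have [] := stg s j.
  - by move=> *; exact: sq2_ge0.
  - by move=> *; exact: sq2_ge0.
  - apply: aeW => r r0; under eq_fun do rewrite sq2E; rewrite sq2E.
    have c2 s j : Fu k s j r ^+ 2 @[k --> \oo] --> phi s j r ^+ 2.
      by rewrite expr2; under eq_fun do rewrite expr2; apply: cvgM; exact: cv.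
    by apply: cvgD; apply: cvgD; exact: c2.
  - move=> n; have [i1 _ _] := state_rintegrable (st (u n)).
    by rewrite radial_intE// M.
have hT : energy_form m nu (phi, gam) <= 4 * I + rint (quartic lp lm l0 phi).
  (* The energy form is four times J plus the quartic integral: [d / 2] pays for the quartic, and
     four times [d / 8] for the distance of J to its infimum. *)
  apply: hQ => d d0; have d2 : 0 < d / 2 by rewrite divr_gt0.
  have N := quartic_usc lp_gt0 lm_gt0 l0_gt0 (fun n => st (u n)) stg (fun n => FA (u n)) (fun n => GA (u n)) cv d2.
  have d8 : 0 < d / 8 by rewrite divr_gt0.
  have V : \forall n \near \oo, n.+1%:R^-1 < d / 8.
    exact: near_infty_natSinv_lt (PosNum d8).
  move: N V; apply: filterS2 => n hN hV.
  have un : ((u n).+1%:R : R)^-1 <= n.+1%:R^-1 by rewrite lef_pV2 ?posrE// ler_nat ltnS uk.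
  have := Jn (u n); rewrite /J -/(Fu n) -/(Gu n).
  move: un hN hV; rewrite /Fu.
  move: (rint _) (rint _) (energy_form _ _ _) ((u n).+1%:R^-1) (n.+1%:R^-1) => a b c x y.
  by move=> *; lra.
rewrite /J; move: hT; move: (energy_form _ _ _) (rint _) => x y; lra.
Qed.

(* The weak limit may lose mass; since the reduced energy of the limit is negative,
   scaling it back up to mass rho does not increase the reduced energy. *)
Lemma reduced_energy_minimizer : exists F G, [/\ state m F G, rint (sq2 F) = rho &
  forall F' G', state m F' G' -> rint (sq2 F') = rho -> J F G <= J F' G'].
Proof.
have [F [G [st Mle Jle]]] := reduced_energy_weak_limit.
have [hS I0] := reduced_energy_inf_lt0.
have [iF _ /(_ nu) iQ] := state_rintegrable st.
have iN := quartic_rintegrable st lp_gt0 lm_gt0 l0_gt0.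
have Q0 : 0 <= energy_form m nu (F, G) by apply: rint_ge0 => r _; exact: sq2_ge0.
have J0 : J F G < 0 by exact: le_lt_trans Jle I0.
have N0 : 0 < rint (quartic lp lm l0 F).
  by move: J0 Q0; rewrite /J; move: (energy_form _ _ _) (rint _) => x y; lra.
(* Without mass, Gagliardo-Nirenberg would annihilate the quartic integral, which is positive
   because J is negative. *)
have M0 : 0 < rint (sq2 F).
  rewrite lt_def rint_ge0 ?andbT; last by move=> r _; exact: sq2_ge0.
  apply: contraTneq N0 => M0; have := state_GN GN st; rewrite M0 mulr0 mul0r.
  by rewrite pmulr_rle0 ?invr_gt0// leNgt.
pose t := Num.sqrt (rho / rint (sq2 F)).
have t2 : t ^+ 2 = rho / rint (sq2 F) by rewrite sqr_sqrtr// divr_ge0// ltW.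
have t1 : 1 <= t ^+ 2 by rewrite t2 ler_pdivlMr// mul1r.
exists (fun s j r => t * F s j r), (fun s j r => t * G s j r); split.
- exact: stateZ.
- by rewrite rint_sq2Z// t2 mulfVK// gt_eqF.
move=> F' G' st' M'.
have : inf S <= J F' G' by apply: ge_inf; [exact: hS.2|exists (F', G')].
apply: le_trans; apply: le_trans Jle.
rewrite {1}/J /energy_form /= square_formZ rint_sq2Z// rint_quarticZ//.
apply: (@le_trans _ _ (t ^+ 2 * J F G)).
  rewrite /J /energy_form /= mulrBr mulrCA lerD2l lerN2 mulrCA.
  rewrite ler_pM2l ?invr_gt0//.
  by rewrite ler_wpM2r ?(ltW N0)// (exprM t 2 2) expr2 ler_peMr// (le_trans ler01).
by rewrite -subr_ge0 -{1}[J F G]mul1r -mulrBl nmulr_lge0// subr_le0.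
Qed.

End minimizer.
End minimization.

Theorem theorem1p1 (R : realType) (nu lp lm l0 : R) (m : int)
    (nu_gt0 : 0 < nu) (lp_gt0 : 0 < lp) (lm_gt0 : 0 < lm) (l0_gt0 : 0 < l0)
    (rho : R) (rho_gt0 : 0 < rho)
    (rho_lt : rho < (4 * C_GN lp lm l0)^-1) :
  exists phip phim : R -> R[i],
    [/\ Hpair m phip phim,
        energy_m nu lp lm l0 m phip phim = min_energy_m nu lp lm l0 m rho &
        mass_m m phip phim = rho%:E].
Proof.
have [C [C0 C_rho GN]] := C_GN_bound rho_gt0 rho_lt.
have [F [G [st M minFG]]] :=
  reduced_energy_minimizer m nu_gt0 lp_gt0 lm_gt0 l0_gt0 rho_gt0 C0 C_rho GN.
have rep := state_represents st; have [_ H _ _] := rep.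
have [eM eE] := represents_energy nu lp_gt0 lm_gt0 l0_gt0 rep.
exists (cpair (F true)), (cpair (F false)); split => //; last by rewrite eM M.
apply/eqP; rewrite eq_le; apply/andP; split; last first.
  apply: ereal_inf_lbound; exists (cpair (F true), cpair (F false)) => //=.
  by split => //; rewrite eM M.
(* A competitor is any pair of representatives; it is compared through its absolutely continuous
   version, which has the same mass and energy. At fixed mass, comparing energies is comparing J. *)
apply: le_ereal_inf_tmp => _ [[vp vm] /= [Hv Mv] <-].
have [F' [G' rep']] := Hpair_represents Hv; have [st' _ _ _] := rep'.
have [eM' eE'] := represents_energy nu lp_gt0 lm_gt0 l0_gt0 rep'.
have M' : rint (sq2 F') = rho by move: eM'; rewrite Mv => -[].
by rewrite eE eE' lee_fin M M' lerD2r minFG.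
Qed.
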